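(* Let $L$ be a simply connected domain (Riemann surface) and let $\alpha=\alpha_2+\alpha_0+\alpha_{-1}+\alpha_1$ be a smooth $\mathfrak g$-valued one-form on $L$, decomposed according to $\mathfrak g^{\mathbb C}=\mathfrak g_2^{\mathbb C}\oplus\mathfrak g_0^{\mathbb C}\oplus\mathfrak g_{-1}^{\mathbb C}\oplus\mathfrak g_1^{\mathbb C}$. Then $\alpha$ is the Maurer-Cartan form $F^{-1}dF$ of a Lagrangian lift $F:L\to G$ of a weakly conformal Lagrangian immersion $f:L\to M=G/H$ if and only if it is flat, $d\alpha+\frac12[\alpha\wedge\alpha]=0$, and partially primitive, $\alpha''_{-1}=\alpha'_1=0$. Furthermore, in that case, the immersion $f$ is Hamiltonian stationary if and only if the extended Maurer-Cartan form $$\alpha_\lambda=\lambda^{-2}\alpha'_2+\lambda^{-1}\alpha'_{-1}+\alpha_0+\lambda\alpha''_1+\lambda^2\alpha''_2$$ is flat, $d\alpha_\lambda+\frac12[\alpha_\lambda\wedge\alpha_\lambda]=0$, for all $\lambda\in\mathbb C^*$ (equivalently, for all $\lambda\in S^1$); and the minimal subcase is characterized by $\alpha_2=0$.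
   Context: Symmetric space setting. $M=G/H$ is a Hermitian symmetric space of real dimension 4, namely one of $\mathbb C^2$, $\mathbb{CP}^2$, its dual the complex hyperbolic plane, $\mathbb{CP}^1\times\mathbb{CP}^1$ and its noncompact dual. $G$ is the (matrix Lie) group of unitary transformations of $M$, $H$ is the isotropy group of a point $p_0$, and $\sigma$ is the involution of $G$ with $(G^\sigma)_0\subset H\subset G^\sigma$. The Lie algebra splits as $\mathfrak g=\mathfrak h\oplus\mathfrak m$ ($+1$ and $-1$ eigenspaces of $\sigma$), and $\mathfrak m$ is identified with $T_{p_0}M$, from which it inherits a Hermitian structure with complex structure $J$. There is an order four automorphism $\tau$ of $G$ with $\tau^2=\sigma$; the same letter denotes the induced automorphism of $\mathfrak g$ and $\mathfrak g^{\mathbb C}$. For $a\in\{0,2,-1,1\}$, $\mathfrak g_a^{\mathbb C}\subset\mathfrak g^{\mathbb C}$ is the $i^a$-eigenspace of $\tau$, so $\mathfrak h^{\mathbb C}=\mathfrak g_0^{\mathbb C}\oplus\mathfrak g_2^{\mathbb C}$ and $\mathfrak m^{\mathbb C}=\mathfrak g_{-1}^{\mathbb C}\oplus\mathfrak g_1^{\mathbb C}$; $\mathfrak g_0=\mathfrak g\cap\mathfrak g_0^{\mathbb C}$, $\mathfrak g_2=\mathfrak g\cap\mathfrak g_2^{\mathbb C}$. Standing properties: there is $Y\in\mathfrak h$ with $\mathfrak g_2=\mathbb RY$ and $\exp(\frac{\pi}{2}\operatorname{ad}Y)|_{\mathfrak m}=J$; $[\mathfrak g_0,\mathfrak g_2]=0$;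 $G_0=G^\tau$ satisfies $\operatorname{Ad}G_0|_{\mathfrak m}\subset SU(\mathfrak m)$; $\tau|_{\mathfrak m}$ is an isometry. Fix a reference unitary frame $(\epsilon_1,\epsilon_2)$ of $\mathfrak m$ such that $\epsilon=\frac12(\epsilon_1-i\epsilon_2)\in\mathfrak m^{\mathbb C}$ belongs to $\mathfrak g_{-1}^{\mathbb C}$ (here $i$ is the imaginary unit of the complexification). Lagrangian means $f^*\omega=0$, with $\omega$ the Kähler form. For a 1-form $\eta$ with values in a complex vector space, $\eta'$ and $\eta''$ denote its $(1,0)$ and $(0,1)$ parts. Weakly conformal Lagrangian immersion: a smooth map $f:L\to M$ with $f^*\omega=0$ whose differential at each point is either zero or injective and conformal (points where $df=0$ are allowed). A lift of $f$ is a map $F:L\to G$ with $F\cdot p_0=f$. It is a Lagrangian lift if, at each point where $df\neq0$, the unitary frame of $T_{f(z)}M$ obtained by applying the differential of $F(z)$ to $(\epsilon_1,\epsilon_2)$ is equal, up to an element of $SU(2)$, to the frame obtained by normalizing $(\partial f/\partial x,\partial f/\partial y)$ to unit length, $z=x+iy$ being a local holomorphic coordinate. Equivalently, at each point the $\mathfrak m$-part of $F^{-1}dF$ has the form $r\,k(\epsilon_1dx+\epsilon_2dy)$ with $r\ge0$ and $k\in SU(\mathfrak m)$. Lagrangian angle: for Lagrangian $f$, the pull-back $f^*K$ of the canonical bundle of $M$ is flat; let $s_0$ be a parallel unit section. For a Lagrangian lift $F$ the Lagrangian angle $\beta:L\to\mathbb R/2\pi\mathbb Z$ is defined by $e^{i\beta}=s_0(F\epsilon_1,F\epsilon_2)$,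 where $F\epsilon_j$ is the image of $\epsilon_j\in T_{p_0}M$ under the differential of $F(z)$. Where $df\ne0$ it equals $s_0(e_1,e_2)$ for an oriented orthonormal basis $(e_1,e_2)$ of the tangent plane. It is defined up to an additive constant. $f$ is Hamiltonian stationary if $\beta$ is harmonic (for immersions this is equivalent to being a critical point of area under compactly supported Hamiltonian variations) and minimal if $\beta$ is constant (for immersions, equivalent to vanishing mean curvature). *)

(* Defs.v *)
From HB Require Import structures.
From mathcomp Require Import all_boot all_order all_algebra.
From mathcomp Require Import complex.
From mathcomp Require Import all_classical all_reals all_analysis.
Set Implicit Arguments.
Unset Strict Implicit.
Unset Printing Implicit Defensive.
Import Order.TTheory GRing.Theory Num.Theory.
Import numFieldNormedType.Exports.
Local Open Scope classical_set_scope.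
Local Open Scope ring_scope.

(** * Riemann surfaces

    Coordinates take values in [R * R], [z = x + iy] being the pair [(x, y)];
    the index [ix] (resp. [iy]) of ['I_2] stands for the x (resp. y)
    direction. *)

Definition ix : 'I_2 := ord0.
Definition iy : 'I_2 := ord_max.

Section Plane.
Variable R : realType.

Definition dvec (i : 'I_2) : R * R := ((i == ix)%:R, (i == iy)%:R).

Fixpoint Ck (k : nat) (D : set (R * R)) (f : R * R -> R) : Prop :=
  (forall z, D z -> {for z, continuous f}) /\
  (if k is k'.+1 then
     forall i, (forall z, D z -> derivable f z (dvec i)) /\
               Ck k' D (fun z => 'D_(dvec i) f z)
   else True).

Definition Cinfty (D : set (R * R)) (f : R * R -> R) := forall k, Ck k D f.

End Plane.

Record chart (R : realType) (T : topologicalType) := Chart {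
  cdom : set T;
  ccoord : T -> R * R;
  cinv : R * R -> T;
  cdom_open : open cdom;
  cimg_open : open (ccoord @` cdom);
  ccoordK : forall p, cdom p -> cinv (ccoord p) = p;
  ccoord_cont : forall p, cdom p -> {for p, continuous ccoord};
  cinv_cont : forall z, (ccoord @` cdom) z -> {for z, continuous cinv} }.

(* coordinate derivative of a real function in a chart *)
Definition pd (R : realType) (T : topologicalType) (c : chart R T) (i : 'I_2)
    (g : T -> R) (p : T) : R :=
  'D_(dvec R i) (g \o cinv c) (ccoord c p).

Definition smooth_in (R : realType) (T : topologicalType) (c : chart R T)
    (U : set T) (g : T -> R) : Prop :=
  Cinfty (ccoord c @` (U `&` cdom c)) (g \o cinv c).

(* The coordinate change from [c] to [c'] is smooth and satisfies the
   Cauchy-Riemann equations. *)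
Definition holomorphic_transition (R : realType) (T : topologicalType)
    (c c' : chart R T) : Prop :=
  let a := fun p => (ccoord c' p).1 in
  let b := fun p => (ccoord c' p).2 in
  [/\ smooth_in c (cdom c') a, smooth_in c (cdom c') b &
      forall p, cdom c p -> cdom c' p ->
        pd c ix a p = pd c iy b p /\ pd c iy a p = - pd c ix b p].

Record riemann_surface (R : realType) := RiemannSurface {
  rs_carrier :> topologicalType;
  atlas : set (chart R rs_carrier);
  rs_hausdorff : hausdorff_space rs_carrier;
  rs_connected : connected [set: rs_carrier];
  atlas_cover : forall p, exists2 c, atlas c & cdom c p;
  atlas_holo : forall c c', atlas c -> atlas c' ->
    holomorphic_transition c c' }.

Definition null_homotopic (R : realType) (T : topologicalType)
    (gamma : R -> T) : Prop :=
  exists h : R * R -> T,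
    [/\ {within `[0, 1]%classic `*` `[0, 1]%classic, continuous h},
        forall t, `[0, 1]%classic t -> h (0, t) = gamma t,
        forall t, `[0, 1]%classic t -> h (1, t) = gamma 0 &
        forall s, `[0, 1]%classic s -> h (s, 0) = gamma 0 /\ h (s, 1) = gamma 0].

Definition simply_connected (R : realType) (L : riemann_surface R) : Prop :=
  forall gamma : R -> L, {within `[0, 1], continuous gamma} ->
    gamma 0 = gamma 1 -> null_homotopic gamma.

(** * Matrix-valued functions and one-forms on a Riemann surface *)

Section Forms.
Variables (R : realType) (L : riemann_surface R) (N : nat).

Definition imu : R[i] := Complex 0 1.
Definition toC (X : 'M[R]_N) : 'M[R[i]]_N := map_mx (fun x => Complex x 0) X.
Definition mxRe (Z : 'M[R[i]]_N) : 'M[R]_N := map_mx (@complex.Re R) Z.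
Definition mxIm (Z : 'M[R[i]]_N) : 'M[R]_N := map_mx (@complex.Im R) Z.

Definition lbr (K : comNzRingType) (X Y : 'M[K]_N) : 'M[K]_N :=
  X *m Y - Y *m X.

Definition smooth_on (U : set L) (g : L -> R) : Prop :=
  forall c, atlas c -> smooth_in c U g.

Definition mx_smooth_on (U : set L) (F : L -> 'M[R]_N) : Prop :=
  forall a b, smooth_on U (fun p => F p a b).

Definition mx_pd (c : chart R L) (i : 'I_2) (F : L -> 'M[R]_N) (p : L) :
    'M[R]_N := \matrix_(a, b) pd c i (fun q => F q a b) p.

Definition C_pd (c : chart R L) (i : 'I_2) (u : L -> R[i]) (p : L) : R[i] :=
  Complex (pd c i (fun q => complex.Re (u q)) p) (pd c i (fun q => complex.Im (u q)) p).

Definition Cmx_pd (c : chart R L) (i : 'I_2) (Z : L -> 'M[R[i]]_N) (p : L) :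
    'M[R[i]]_N := \matrix_(a, b) C_pd c i (fun q => Z q a b) p.

(* [eta c i p] is the value at [p] of the one-form [eta] on the i-th
   coordinate vector field of the chart [c]; it is meaningful when [c] is in
   the atlas and [p] in its domain. *)
Definition oneform (V : Type) := chart R L -> 'I_2 -> L -> V.

(* smooth one-form with values in [g]: compatibility with the changes of
   coordinates, and smoothness of the components *)
Definition smooth_oneform (g : set 'M[R]_N) (alpha : oneform 'M[R]_N) : Prop :=
  [/\ forall c i p, atlas c -> cdom c p -> g (alpha c i p),
      forall c c' i p, atlas c -> atlas c' -> cdom c p -> cdom c' p ->
        alpha c i p = pd c i (fun q => (ccoord c' q).1) p *: alpha c' ix p
                    + pd c i (fun q => (ccoord c' q).2) p *: alpha c' iy p &
      forall c i a b, atlas c ->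
        smooth_in c (cdom c) (fun p => alpha c i p a b)].

Definition toC_form (alpha : oneform 'M[R]_N) : oneform 'M[R[i]]_N :=
  fun c i p => toC (alpha c i p).

(* [eta = P dx + Q dy] has (1,0) part [(P - iQ)/2 dz] and (0,1) part
   [(P + iQ)/2 dzbar]. *)
Definition part10 (eta : oneform 'M[R[i]]_N) : oneform 'M[R[i]]_N :=
  fun c i p =>
    let w := 2^-1 *: (eta c ix p - imu *: eta c iy p) in
    if i == ix then w else imu *: w.

Definition part01 (eta : oneform 'M[R[i]]_N) : oneform 'M[R[i]]_N :=
  fun c i p =>
    let w := 2^-1 *: (eta c ix p + imu *: eta c iy p) in
    if i == ix then w else - (imu *: w).

Definition zero_form (eta : oneform 'M[R[i]]_N) : Prop :=
  forall c i p, atlas c -> cdom c p -> eta c i p = 0.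

(* coefficients of [d eta] and of [[eta /\ xi]] on dx /\ dy *)
Definition ext_d (eta : oneform 'M[R[i]]_N) (c : chart R L) (p : L) :
    'M[R[i]]_N := Cmx_pd c ix (eta c iy) p - Cmx_pd c iy (eta c ix) p.

Definition wedge_br (eta xi : oneform 'M[R[i]]_N) (c : chart R L) (p : L) :
    'M[R[i]]_N :=
  lbr (eta c ix p) (xi c iy p) - lbr (eta c iy p) (xi c ix p).

Definition flat (eta : oneform 'M[R[i]]_N) : Prop :=
  forall c p, atlas c -> cdom c p ->
    ext_d eta c p + 2^-1 *: wedge_br eta eta c p = 0.

Definition extended_form (a2 a0 am1 a1 : oneform 'M[R[i]]_N) (lam : R[i]) :
    oneform 'M[R[i]]_N :=
  fun c i p =>
    lam ^- 2 *: part10 a2 c i p + lam^-1 *: part10 am1 c i p + a0 c i p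
    + lam *: part01 a1 c i p + lam ^+ 2 *: part01 a2 c i p.

Definition maurer_cartan (F : L -> 'M[R]_N) (alpha : oneform 'M[R]_N) : Prop :=
  forall c i p, atlas c -> cdom c p ->
    alpha c i p = invmx (F p) *m mx_pd c i F p.

End Forms.

(** * The symmetric space [M = G/H] with its order four automorphism

    [G] is a closed subgroup of some GL_N(R), complex matrix groups being
    viewed as real ones.  The record [hermitian_symmetric] holds for the flat
    space C^2, CP^2, CP^1 x CP^1 and the noncompact duals of the last two.
    For C^2, [tau] is conjugation by the linear map j : (z, w) |->
    (- conj w, conj z).  For CP^2 and its dual it is A |-> Q (conj A) Q^-1,
    with Q block diagonal made of the matrix of j and of 1.  For CP^1 x CP^1
    it exchanges the factors: (A, B) |-> (D (conj B) D^-1, conj A), with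
    D = diag(i, -i), and similarly for its dual. *)

Section Lie.
Variables (R : realType) (N : nat).
Implicit Types X Y g : 'M[R]_N.

Definition expm X : 'M[R]_N :=
  limn (fun n : nat => \sum_(k < n) (k`!%:R^-1 *: X ^+ k)).

Definition subgroup (A : set 'M[R]_N) : Prop :=
  [/\ A 1%:M, forall a b, A a -> A b -> A (a *m b) &
      forall a, A a -> a \in unitmx /\ A (invmx a)].

Definition matrix_lie_group (A : set 'M[R]_N) : Prop :=
  subgroup A /\ (forall a, a \in unitmx -> closure A a -> A a).

Definition lie_algebra (A : set 'M[R]_N) : set 'M[R]_N :=
  [set X | forall t : R, A (expm (t *: X))].

Definition Ad g X : 'M[R]_N := g *m X *m invmx g.

Definition linear_on (A : set 'M[R]_N) (f : 'M[R]_N -> 'M[R]_N) : Prop :=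
  forall a X Y, A X -> A Y -> f (a *: X + Y) = a *: f X + f Y.

(* left translate of a subset of the group; on cosets, the action of G on M *)
Definition trans g (S : set 'M[R]_N) : set 'M[R]_N := [set g *m x | x in S].

End Lie.

(* [sigma = tau^2]; [dtau] is the automorphism of the Lie algebra induced by
   [tau]; [ip] and [cJ] are the metric and the complex structure of m; [eps]
   is the reference unitary frame.  Only the values of these functions on G,
   on its Lie algebra and on m matter. *)
Record sym_data (R : realType) (N : nat) := SymData {
  sG : set 'M[R]_N;
  sH : set 'M[R]_N;
  tau : 'M[R]_N -> 'M[R]_N;
  dtau : 'M[R]_N -> 'M[R]_N;
  ip : 'M[R]_N -> 'M[R]_N -> R;
  cJ : 'M[R]_N -> 'M[R]_N;
  sY : 'M[R]_N;
  eps : 'I_2 -> 'M[R]_N }.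

Section SymmetricSpace.
Variables (R : realType) (N : nat) (S : sym_data R N).
Implicit Types X Y g : 'M[R]_N.

Definition sigma g := tau S (tau S g).
Definition dsigma X := dtau S (dtau S X).

Definition lg : set 'M[R]_N := lie_algebra (sG S).
Definition lh : set 'M[R]_N := [set X | lg X /\ dsigma X = X].
Definition lm : set 'M[R]_N := [set X | lg X /\ dsigma X = - X].

Definition hpart X : 'M[R]_N := 2^-1 *: (X + dsigma X).
Definition mpart X : 'M[R]_N := 2^-1 *: (X - dsigma X).

(* As the matrices of [G] are real, the complexification of [lg] is
   [lg + i lg] inside the complex matrices. *)
Definition lgC : set 'M[R[i]]_N := [set Z | lg (mxRe Z) /\ lg (mxIm Z)].
Definition dtauC (Z : 'M[R[i]]_N) : 'M[R[i]]_N :=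
  toC (dtau S (mxRe Z)) + imu R *: toC (dtau S (mxIm Z)).

Definition lgC_ (a : int) : set 'M[R[i]]_N :=
  [set Z | lgC Z /\ dtauC Z = imu R ^ a *: Z].
Definition lg_ (a : int) : set 'M[R]_N := [set X | lg X /\ lgC_ a (toC X)].

(* complex scalars acting on [m] through [J], Hermitian and Kaehler forms *)
Definition jscale (c : R[i]) X : 'M[R]_N := complex.Re c *: X + complex.Im c *: cJ S X.
Definition hform X Y : R[i] := Complex (ip S X Y) (ip S X (cJ S Y)).
Definition omega X Y : R := ip S (cJ S X) Y.

Definition unitary_m (k : 'M[R]_N -> 'M[R]_N) : Prop :=
  [/\ linear_on lm k,
      forall X, lm X -> lm (k X),
      forall X, lm X -> k (cJ S X) = cJ S (k X) &
      forall X Y, lm X -> lm Y -> ip S (k X) (k Y) = ip S X Y].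

Definition special_unitary_m (k : 'M[R]_N -> 'M[R]_N) : Prop :=
  unitary_m k /\ \det (\matrix_(a, b) hform (k (eps S b)) (eps S a)) = 1.

Record hermitian_symmetric : Prop := HermitianSymmetric {
  hs_G : matrix_lie_group (sG S);
  (* tau is an automorphism of G, of order four, and dtau its differential *)
  hs_tauG : forall g, sG S g -> sG S (tau S g);
  hs_tauM : forall g h, sG S g -> sG S h ->
    tau S (g *m h) = tau S g *m tau S h;
  hs_tau_cont : {within sG S, continuous (tau S)};
  hs_tau4 : forall g, sG S g -> iter 4 (tau S) g = g;
  hs_tau2 : exists2 g, sG S g & sigma g <> g;
  hs_dtaug : forall X, lg X -> lg (dtau S X);
  hs_dtauL : linear_on lg (dtau S);
  hs_dtau_exp : forall X, lg X ->
    forall t : R, tau S (expm (t *: X)) = expm (t *: dtau S X);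
  (* (G^sigma)_0 is contained in H, and H in G^sigma *)
  hs_H : subgroup (sH S);
  hs_H_fix : sH S `<=` [set g | sG S g /\ sigma g = g];
  hs_H_comp :
    connected_component [set g | sG S g /\ sigma g = g] 1%:M `<=` sH S;
  (* H-invariant Hermitian structure on m *)
  hs_ip_sym : forall X Y, lm X -> lm Y -> ip S X Y = ip S Y X;
  hs_ip_lin : forall a X Y Z, lm X -> lm Y -> lm Z ->
    ip S (a *: X + Y) Z = a * ip S X Z + ip S Y Z;
  hs_ip_pos : forall X, lm X -> X <> 0 -> 0 < ip S X X;
  hs_Jm : forall X, lm X -> lm (cJ S X);
  hs_J_lin : linear_on lm (cJ S);
  hs_JJ : forall X, lm X -> cJ S (cJ S X) = - X;
  hs_J_ip : forall X Y, lm X -> lm Y -> ip S (cJ S X) (cJ S Y) = ip S X Y;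
  hs_H_unitary : forall h, sH S h -> unitary_m (Ad h);
  (* (eps_1, eps_2) is a unitary frame of m, which has real dimension 4 *)
  hs_epsm : forall a, lm (eps S a);
  hs_eps_unitary : forall a b, hform (eps S a) (eps S b) = (a == b)%:R;
  hs_eps_span : forall X, lm X ->
    exists v : 'I_2 -> R[i], X = \sum_a jscale (v a) (eps S a);
  hs_epsilon :
    lgC_ (-1) (2^-1 *: (toC (eps S ix) - imu R *: toC (eps S iy)));
  hs_Yh : lh (sY S);
  hs_g2 : lg_ 2 = [set t *: sY S | t in [set: R]];
  hs_expY : forall X, lm X ->
    (fun n : nat => \sum_(k < n)
       ((pi / 2) ^+ k / k`!%:R) *: iter k (lbr (sY S)) X) @ \oo --> cJ S X;
  hs_g0g2 : forall X Y, lg_ 0 X -> lg_ 2 Y -> lbr X Y = 0;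
  hs_G0 : forall g, sG S g -> tau S g = g -> special_unitary_m (Ad g);
  hs_tau_isom : forall X Y, lm X -> lm Y ->
    ip S (dtau S X) (dtau S Y) = ip S X Y }.

(** * Maps into [M] and their lifts

    Points of [M] are cosets [gH]; [sH S] is the base point.  An element [g]
    of [G] identifies [m] unitarily with the tangent space of [M] at [gH].  If
    [F] is a lift of [f] near [p], then through [F p] the differential of [f]
    at [p] is the m-part of [F^-1 dF]; another lift changes it by the
    adjoint action of an element of [H] on [m], which is unitary. *)

Definition points : set (set 'M[R]_N) := [set trans g (sH S) | g in sG S].

Variable L : riemann_surface R.
Implicit Types (f : L -> set 'M[R]_N) (F : L -> 'M[R]_N).

Definition lift_on (U : set L) f F : Prop :=
  [/\ open U, mx_smooth_on U F &
      forall p, U p -> sG S (F p) /\ trans (F p) (sH S) = f p].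

(* [G -> G/H] has local sections, so smooth maps into [G/H] are those that
   lift locally to smooth maps into [G]. *)
Definition smooth_map f : Prop :=
  (forall p, points (f p)) /\
  (forall p, exists U F, U p /\ lift_on U f F).

Definition MC F (c : chart R L) (i : 'I_2) (p : L) : 'M[R]_N :=
  invmx (F p) *m mx_pd c i F p.

(* the i-th partial derivative of f, read in m through [F p] *)
Definition vel F (c : chart R L) (i : 'I_2) (p : L) : 'M[R]_N :=
  mpart (MC F c i p).

Definition lagrangian f : Prop :=
  forall U F, lift_on U f F -> forall c p, atlas c -> U p -> cdom c p ->
    omega (vel F c ix p) (vel F c iy p) = 0.

Definition weakly_conformal f : Prop :=
  forall U F, lift_on U f F -> forall c p, atlas c -> U p -> cdom c p ->
    (forall i, vel F c i p = 0) \/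
    (exists2 r : R, 0 < r &
       forall i j, ip S (vel F c i p) (vel F c j p) = r * (i == j)%:R).

Definition weakly_conformal_lagrangian f : Prop :=
  [/\ smooth_map f, lagrangian f & weakly_conformal f].

Definition SU2 : set 'M[R[i]]_2 :=
  [set U | U *m (map_mx conjc U)^T = 1%:M /\ \det U = 1].

Definition lagrangian_lift f F : Prop :=
  lift_on setT f F /\
  forall c p, atlas c -> cdom c p -> ~ (forall i, vel F c i p = 0) ->
    exists2 U, SU2 U & forall j,
      (Num.sqrt (ip S (vel F c j p) (vel F c j p)))^-1 *: vel F c j p
      = \sum_k jscale (U k j) (eps S k).

(** * Lagrangian angle

    A section [s] of the pull-back by [f] of the canonical bundle of [M] is
    given by the values [s p g X Y] of the 2-form [s p] on the images under
    [g] of [X] and [Y] in [m], for all [g] in the coset [f p].  The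
    Levi-Civita connection of a symmetric space is its canonical connection:
    if [F] is a lift of [f], the covariant derivative of the vector field
    [F X], for a constant [X] in [m], is [F [A, X]], with [A] the h-part of
    [F^-1 dF]. *)

Definition canonical_section f (s : L -> 'M[R]_N -> 'M[R]_N -> 'M[R]_N -> R[i])
    : Prop :=
  forall p g, f p g ->
  [/\ forall h X Y, sH S h -> lm X -> lm Y ->
        s p (g *m h) X Y = s p g (Ad h X) (Ad h Y),
      forall c X X' Y, lm X -> lm X' -> lm Y ->
        s p g (jscale c X + X') Y = c * s p g X Y + s p g X' Y &
      forall X Y, lm X -> lm Y -> s p g Y X = - s p g X Y].

Definition unit_section f (s : L -> 'M[R]_N -> 'M[R]_N -> 'M[R]_N -> R[i])
    : Prop :=
  forall p g, f p g -> `|s p g (eps S ix) (eps S iy)| = 1.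

Definition parallel_section f
    (s : L -> 'M[R]_N -> 'M[R]_N -> 'M[R]_N -> R[i]) : Prop :=
  forall U F, lift_on U f F -> forall X Y, lm X -> lm Y ->
    [/\ smooth_on U (fun q => complex.Re (s q (F q) X Y)),
        smooth_on U (fun q => complex.Im (s q (F q) X Y)) &
        forall c i p, atlas c -> U p -> cdom c p ->
          let A := hpart (MC F c i p) in
          C_pd c i (fun q => s q (F q) X Y) p
          = s p (F p) (lbr A X) Y + s p (F p) X (lbr A Y)].

Definition parallel_unit_section f
    (s : L -> 'M[R]_N -> 'M[R]_N -> 'M[R]_N -> R[i]) : Prop :=
  [/\ canonical_section f s, unit_section f s & parallel_section f s].

(* A function [beta] into R/2piZ is represented by [e^{i beta}]. *)
Definition expi (b : R) : R[i] := Complex (cos b) (sin b).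

Definition exp_i_angle (s : L -> 'M[R]_N -> 'M[R]_N -> 'M[R]_N -> R[i]) F
    (p : L) : R[i] := s p (F p) (eps S ix) (eps S iy).

(* Harmonicity of a real function on a Riemann surface only depends on the
   conformal structure. *)
Definition harmonic_on (U : set L) (b : L -> R) : Prop :=
  smooth_on U b /\
  forall c p, atlas c -> U p -> cdom c p ->
    pd c ix (pd c ix b) p + pd c iy (pd c iy b) p = 0.

Definition harmonic_angle (u : L -> R[i]) : Prop :=
  forall p, exists U b, [/\ open U, U p, harmonic_on U b &
    forall q, U q -> u q = expi (b q)].

Definition constant_angle (u : L -> R[i]) : Prop :=
  exists b, forall p, u p = expi b.

(* Both notions refer to the Lagrangian angle of the given Lagrangian lift
   [F] of [f]; where [df] vanishes, [f] alone does not determine it. *)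
Definition hamiltonian_stationary f F : Prop :=
  exists2 s, parallel_unit_section f s & harmonic_angle (exp_i_angle s F).

Definition minimal f F : Prop :=
  exists2 s, parallel_unit_section f s & constant_angle (exp_i_angle s F).

End SymmetricSpace.

(* Main.v *)
Require Import Defs.
From HB Require Import structures.
From mathcomp Require Import all_boot all_order all_algebra.
From mathcomp Require Import complex.
From mathcomp Require Import all_classical all_reals all_analysis.
From mathcomp Require Import ring lra.
Import Order.TTheory GRing.Theory Num.Theory.
Import numFieldNormedType.Exports.
Local Open Scope classical_set_scope.
Local Open Scope ring_scope.
Set Implicit Arguments.
Unset Strict Implicit.
Unset Printing Implicit Defensive.

(** Through a lift [F], the differential of the projection is the m-part of
    [F^-1 dF], and the theorem is a computation with this form, except for one
    global integration.

    Lifts and primitive forms.  On [m] the automorphism [T] is an isometry with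
    square [-1] that anticommutes with the complex structure ([dtau_J]): a
    quaternionic structure, centralized by [SU(2)].  A frame is therefore special
    unitary, up to normalization, if and only if its second vector is the image of
    the first by [- T] ([SU2_frame_primitive], [primitive_SU2_frame]); for the
    velocities this is partial primitivity ([partially_primitiveP]).  The form of a
    lift is flat because second derivatives commute ([sol_rflat]).  Conversely, a
    flat form on a simply connected surface is integrated: on small squares by
    ordinary differential equations ([local_frobenius]), along paths with a result
    that is invariant under homotopy ([hpath_unique]), hence globally
    ([global_solution]), with values in the group ([solution_in_group]).  Another
    lift changes the velocities by an isometry that commutes with the complex
    structure ([vel_change]), so that the projection is Lagrangian and weakly
    conformal.

    The angle.  A parallel section of the canonical bundle is differentiated by the
    trace on [m] of the h-part of the form, which is [i] times a real number.  This
    trace vanishes on [g_0], since the fixed group acts by special unitary maps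
    ([theta_fixed]), but not on [g_2], since [ad Y] exponentiates to the complex
    structure ([theta_sY]).  Hence the differential of the Lagrangian angle is the
    [g_2]-part of the form, up to a constant factor ([angle_derivative]): the angle
    is constant if and only if this part vanishes, and harmonic if and only if this
    part is coclosed.  As the part is closed, it has a primitive ([exists_angle]),
    which yields a parallel section ([rotated_parallel]).

    The extended form.  For [lam = exp (i t)] it rotates the m-part by [t] and the
    [g_2]-part by [2 t].  In its curvature all terms cancel by the flatness of the
    form itself, except the codifferential of the [g_2]-part, multiplied by
    [sin (2 t)] ([extended_curvature]).  So flatness for a single [lam] that is not a
    fourth root of unity means that the [g_2]-part is coclosed, and implies flatness
    for all [lam]. *)

(** * Calculus of matrix-valued functions *)

Section MatrixCalculus.
Variable R : realType.

Lemma is_derive_mxP (V : normedModType R) m n (F : V -> 'M[R]_(m, n)) (t v : V)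
    (D : 'M[R]_(m, n)) :
  is_derive t v F D <-> forall i j, is_derive t v (fun x => F x i j) (D i j).
Proof.
split=> [[dF eF] i j|H].
  have dFij := (derivable_mxP F t v).1 dF.
  by split; [exact: dFij|rewrite -eF derive_mx// mxE].
have dF : derivable F t v by apply/derivable_mxP => i j; case: (H i j).
split=> //; rewrite derive_mx//; apply/matrixP => i j; rewrite mxE.
by case: (H i j).
Qed.

Lemma is_derive_sumfun (V W : normedModType R) (I : Type) (r : seq I)
    (h : I -> V -> W) (t v : V) (dh : I -> W) :
  (forall i, is_derive t v (h i) (dh i)) ->
  is_derive t v (fun x => \sum_(i <- r) h i x) (\sum_(i <- r) dh i).
Proof.
move=> H; elim: r => [|i r IH].
  rewrite big_nil (_ : (fun _ => _) = cst 0); first exact: is_derive_cst.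
  by apply/funext => x; rewrite big_nil.
rewrite big_cons (_ : (fun _ => _) = h i + (fun x => \sum_(i <- r) h i x)).
  exact: is_deriveD.
by apply/funext => x; rewrite big_cons.
Qed.

Lemma is_derive_mulR (V : normedModType R) (f g : V -> R) (t v : V) (a b : R) :
  is_derive t v f a -> is_derive t v g b ->
  is_derive t v (fun x => f x * g x) (a * g t + f t * b).
Proof.
by move=> Hf Hg; apply: is_derive_eq; rewrite addrC [X in X + _]mulrC -mulrC.
Qed.

Lemma is_derive_mulmx (V : normedModType R) m n p (F : V -> 'M[R]_(m, n))
    (G : V -> 'M[R]_(n, p)) (t v : V) A B :
  is_derive t v F A -> is_derive t v G B ->
  is_derive t v (fun x => F x *m G x) (A *m G t + F t *m B).
Proof.
move=> /is_derive_mxP HF /is_derive_mxP HG; apply/is_derive_mxP => i j.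
rewrite !mxE -big_split /=.
rewrite (_ : (fun _ => _) = (fun x => \sum_k F x i k * G x k j)); last first.
  by apply/funext => x; rewrite mxE.
by apply: is_derive_sumfun => k; exact: is_derive_mulR.
Qed.

Lemma linear_mx_sum (W : normedModType R) m n (f : {linear 'M[R]_(m, n) -> W})
    (X : 'M[R]_(m, n)) : f X = \sum_i \sum_j X i j *: f (delta_mx i j).
Proof.
rewrite {1}(matrix_sum_delta X) linear_sum; apply: eq_bigr => i _.
by rewrite linear_sum; apply: eq_bigr => j _; rewrite linearZ.
Qed.

Lemma is_derive_scalev (V W : normedModType R) (f : V -> R) (w : W) (t v : V) a :
  is_derive t v f a -> is_derive t v (fun x => f x *: w) (a *: w).
Proof.
move=> [Hf <-].
have H : (fun h => h^-1 *: (((fun x => f x *: w) \o shift t) (h *: v) - f t *: w))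
    @ 0^' --> 'D_v f t *: w.
  rewrite [X in X @ _](_ : _ = (fun h => (h^-1 *: ((f \o shift t) (h *: v) - f t)) *: w)).
    by apply: cvgZr_tmp; exact: Hf.
  by apply/funext => h /=; rewrite -scalerBl scalerA.
split; last exact/cvg_lim.
by apply/cvg_ex; exists ('D_v f t *: w).
Qed.

Lemma is_derive_linear_mx (V W : normedModType R) m n
    (f : {linear 'M[R]_(m, n) -> W}) (F : V -> 'M[R]_(m, n)) (t v : V) D :
  is_derive t v F D -> is_derive t v (fun x => f (F x)) (f D).
Proof.
move=> /is_derive_mxP H; rewrite linear_mx_sum.
rewrite (_ : (fun _ => _) = (fun x => \sum_i \sum_j F x i j *: f (delta_mx i j))).
  by do 2!(apply: is_derive_sumfun => ?); exact: is_derive_scalev.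
by apply/funext => x; rewrite linear_mx_sum.
Qed.

(** Directional derivatives are derivatives along lines, which brings one-variable
    results to bear on functions on the plane. *)
Lemma is_derive_line (V W : normedModType R) (f : V -> W) (z v : V) (t : R) (D : W) :
  is_derive (t *: v + z) v f D <-> is_derive t 1 (fun s => f (s *: v + z)) D.
Proof.
suff E : (fun h : R => h^-1 *: ((f \o shift (t *: v + z)) (h *: v) - f (t *: v + z)))
    = (fun h => h^-1 *: (((fun s => f (s *: v + z)) \o shift t) (h *: 1) - f (t *: v + z))).
  by split=> -[d e]; split; move: d e; rewrite /derivable /derive E.
apply/funext => h /=; congr (_ *: (f _ - _)).
by rewrite scalerDl addrA [h *: 1]mulr1.
Qed.

Lemma is_derive_shift0 (W : normedModType R) (f : R -> W) (t : R) (D : W) :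
  is_derive t 1 f D -> is_derive (0 : R) 1 (fun h => f (h + t)) D.
Proof.
move=> df; have := (is_derive_line f t (1 : R) 0 D).1.
rewrite scale0r add0r => /(_ df); congr (is_derive _ _ _ _).
by apply/funext => s; rewrite [s *: 1]mulr1.
Qed.

Lemma mx_entry_le m n (A : 'M[R]_(m, n)) i j : `|A i j| <= `|A|.
Proof.
by rewrite [leRHS]/Num.norm/= mx_normrE (le_bigmax _ _ (i, j)).
Qed.

Lemma mx_norm_le m n (A : 'M[R]_(m, n)) c : 0 <= c ->
  (forall i j, `|A i j| <= c) -> `|A| <= c.
Proof.
by move=> c0 H; rewrite [leLHS]/Num.norm/= mx_normrE; apply/bigmax_leP; split.
Qed.

Lemma mx_norm_mulmx m n p (A : 'M[R]_(m, n)) (B : 'M[R]_(n, p)) :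
  `|A *m B| <= n%:R * (`|A| * `|B|).
Proof.
apply: mx_norm_le => [|i j]; first by rewrite !mulr_ge0.
rewrite mxE (le_trans (ler_norm_sum _ _ _))//.
have -> : n%:R * (`|A| * `|B|) = \sum_(k < n) (`|A| * `|B|).
  by rewrite sumr_const card_ord mulr_natl.
by apply: ler_sum => k _; rewrite normrM ler_pM// mx_entry_le.
Qed.

Lemma derive_continuous (f : R -> R) (t a : R) :
  is_derive t 1 f a -> {for t, continuous f}.
Proof. by case=> /derivable1_diffP/differentiable_continuous. Qed.

Lemma mvt_bound_ordered m n (f f' : R -> 'M[R]_(m, n)) (a b K : R) : a <= b -> 0 <= K ->
  (forall t, a <= t <= b -> is_derive t 1 f (f' t)) ->
  (forall t, a <= t <= b -> `|f' t| <= K) ->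
  `|f b - f a| <= K * (b - a).
Proof.
move=> ab K0 df bf; apply: mx_norm_le => [|i j].
  by rewrite mulr_ge0// subr_ge0.
have dfij t : a <= t <= b -> is_derive t 1 (fun t => f t i j) (f' t i j).
  by move=> /df/is_derive_mxP.
rewrite !mxE.
have [||c cab ->] := @MVT_segment _ (fun t => f t i j) (fun t => f' t i j) a b ab.
- move=> x; rewrite in_itv/= => /andP[ax xb].
  by apply: dfij; rewrite !ltW.
- apply/continuous_in_subspaceT => x; rewrite inE/= in_itv/= => xab.
  exact: derive_continuous (dfij _ xab).
- rewrite normrM (ger0_norm (_ : 0 <= b - a)) ?subr_ge0//.
  rewrite ler_wpM2r// ?subr_ge0//.
  by rewrite (le_trans _ (bf _ cab))// mx_entry_le.
Qed.

Lemma mvt_bound m n (f f' : R -> 'M[R]_(m, n)) (a b K : R) : 0 <= K ->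
  (forall t, Num.min a b <= t <= Num.max a b -> is_derive t 1 f (f' t)) ->
  (forall t, Num.min a b <= t <= Num.max a b -> `|f' t| <= K) ->
  `|f b - f a| <= K * `|b - a|.
Proof.
move=> K0; have [ab|/ltW ba] := leP a b => df bf.
  by rewrite ger0_norm ?subr_ge0//; exact: mvt_bound_ordered bf.
by rewrite distrC [`|b - a|]distrC ger0_norm ?subr_ge0//; exact: mvt_bound_ordered bf.
Qed.

Lemma derive0_const m n (f : R -> 'M[R]_(m, n)) (a b : R) :
  (forall t, Num.min a b <= t <= Num.max a b -> is_derive t 1 f 0) -> f b = f a.
Proof.
move=> df; apply/eqP; rewrite -subr_eq0 -normr_le0.
have := @mvt_bound _ _ f (fun=> 0) a b 0 (lexx _) df; rewrite mul0r; apply.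
by move=> t _; rewrite normr0.
Qed.

Lemma mx_norm_continuous m n (f : R -> 'M[R]_(m, n)) (t : R)
    (D : 'M[R]_(m, n)) :
  is_derive t 1 f D -> {for t, continuous (fun t => `|f t|)}.
Proof.
case=> /derivable1_diffP/differentiable_continuous fc _.
exact: (continuous_comp fc (@norm_continuous _ _ _)).
Qed.

(** Gronwall's inequality on an interval so short that the maximum of the norm
    can be absorbed. *)
Lemma small_gronwall m n (e e' : R -> 'M[R]_(m, n)) (d K rho : R) :
  0 <= d -> 0 <= K -> 0 <= rho -> K * d <= 2^-1 ->
  (forall t : R, `|t| <= d -> is_derive t 1 e (e' t)) ->
  (forall t : R, `|t| <= d -> `|e' t| <= K * `|e t| + rho) ->
  forall t : R, `|t| <= d -> `|e t| <= 2 * `|e 0| + 2 * rho * d.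
Proof.
move=> d0 K0 r0 Kd de be.
have [|c + cmax] := @EVT_max R (fun t => `|e t|) (- d) d (ge0_cp d0).2.
  apply/continuous_in_subspaceT => x; rewrite inE/= in_itv/= -ler_norml => xd.
  exact: mx_norm_continuous (de _ xd).
rewrite in_itv/= -ler_norml => cd.
have cE t : `|t| <= d -> `|e t| <= `|e c|.
  by move=> td; apply: cmax; rewrite in_itv/= -ler_norml.
move=> t td; apply: (le_trans (cE _ td)).
have seg s : Num.min 0 c <= s <= Num.max 0 c -> `|s| <= d.
  move: cd; rewrite !ler_norml ge_min le_max => /andP[? ?] /andP[] /orP[] ? /orP[] ?; lra.
have H : `|e c - e 0| <= (K * `|e c| + rho) * `|c - 0|.
  apply: (@mvt_bound _ _ e e').
  - by rewrite addr_ge0 ?mulr_ge0.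
  - by move=> s /seg/de.
  - by move=> s /seg sd; rewrite (le_trans (be _ sd))// lerD2r ler_wpM2l//; exact: cE.
rewrite subr0 in H.
have H1 : `|e c| <= `|e 0| + (K * `|e c| + rho) * d.
  have {1}-> : e c = e 0 + (e c - e 0) by rewrite addrC subrK.
  rewrite (le_trans (ler_normD _ _))// lerD2l (le_trans H)// ler_wpM2l//.
  by rewrite addr_ge0 ?mulr_ge0.
have H2 : K * d * `|e c| <= 2^-1 * `|e c| by rewrite ler_wpM2r.
rewrite mulrDl in H1.
have : K * `|e c| * d = K * d * `|e c| by rewrite mulrAC.
lra.
Qed.

End MatrixCalculus.

(** * Limits of matrices and the exponential *)

Section MatrixTopology.
Variable R : realType.

Lemma cvg_mxP (T : Type) (F : set_system T) (FF : Filter F) m n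
    (A : T -> 'M[R]_(m, n)) (a : 'M[R]_(m, n)) :
  A @ F --> a <-> forall i j, (fun t => A t i j) @ F --> a i j.
Proof.
split=> [Aa i j|H].
  apply/cvgrPdist_le => e e0; move/cvgrPdist_le: Aa => /(_ e e0).
  apply: filterS => t; apply: le_trans.
  by have := mx_entry_le (a - A t) i j; rewrite !mxE.
apply/cvgrPdist_le => e e0.
have : \forall t \near F, forall ij : 'I_m * 'I_n, `|a ij.1 ij.2 - A t ij.1 ij.2| <= e.
  apply: filter_forall => -[i j]; have /cvgrPdist_le := H i j; exact.
apply: filterS => t Ht; apply: mx_norm_le; first exact: ltW.
by move=> i j; rewrite !mxE; exact: (Ht (i, j)).
Qed.

Lemma cvg_sumfun (T : Type) (F : set_system T) (FF : Filter F) (W : normedModType R)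
    (I : Type) (r : seq I) (f : I -> T -> W) (a : I -> W) :
  (forall i, f i @ F --> a i) ->
  (fun t => \sum_(i <- r) f i t) @ F --> \sum_(i <- r) a i.
Proof.
move=> H; elim: r => [|i r IH].
  rewrite big_nil (_ : (fun _ => _) = fun=> 0); first exact: cvg_cst.
  by apply/funext => x; rewrite big_nil.
rewrite big_cons (_ : (fun _ => _) = f i + (fun x => \sum_(i <- r) f i x)).
  exact: cvgD.
by apply/funext => x; rewrite big_cons.
Qed.

Lemma cvg_mulmx (T : Type) (F : set_system T) (FF : Filter F) m n p
    (A : T -> 'M[R]_(m, n)) (B : T -> 'M[R]_(n, p)) (a : 'M[R]_(m, n)) (b : 'M[R]_(n, p)) :
  A @ F --> a -> B @ F --> b -> (fun t => A t *m B t) @ F --> a *m b.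
Proof.
move=> /cvg_mxP Aa /cvg_mxP Bb; apply/cvg_mxP => i j; rewrite mxE.
rewrite (_ : (fun _ => _) = (fun t => \sum_k A t i k * B t k j)); last first.
  by apply/funext => t; rewrite mxE.
by apply: cvg_sumfun => k; exact: cvgM.
Qed.

Lemma cvg_mulmxl (T : Type) (F : set_system T) {FF : Filter F} m n p
    (A : T -> 'M[R]_(m, n)) (B : 'M[R]_(n, p)) (a : 'M[R]_(m, n)) :
  A @ F --> a -> (fun t => A t *m B) @ F --> a *m B.
Proof. by move=> Aa; apply: cvg_mulmx => //; exact: cvg_cst. Qed.

Lemma cvg_mulmxr (T : Type) (F : set_system T) {FF : Filter F} m n p
    (A : 'M[R]_(m, n)) (B : T -> 'M[R]_(n, p)) (b : 'M[R]_(n, p)) :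
  B @ F --> b -> (fun t => A *m B t) @ F --> A *m b.
Proof. by move=> Bb; apply: cvg_mulmx => //; exact: cvg_cst. Qed.

Lemma cvg_linear_mx (T : Type) (F : set_system T) (FF : Filter F) m n
    (W : normedModType R) (f : {linear 'M[R]_(m, n) -> W}) (A : T -> 'M[R]_(m, n)) (a : 'M[R]_(m, n)) :
  A @ F --> a -> (fun t => f (A t)) @ F --> f a.
Proof.
move=> /cvg_mxP Aa; rewrite linear_mx_sum.
rewrite (_ : (fun _ => _) = (fun t => \sum_i \sum_j A t i j *: f (delta_mx i j))).
  by do 2!(apply: cvg_sumfun => ?); exact: cvgZr_tmp.
by apply/funext => t; rewrite linear_mx_sum.
Qed.

Lemma cvg_mx_unique (T : Type) (F : set_system T) (FF : ProperFilter F) m n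
    (A : T -> 'M[R]_(m, n)) (a b : 'M[R]_(m, n)) :
  A @ F --> a -> A @ F --> b -> a = b.
Proof.
move=> /cvg_mxP Aa /cvg_mxP Ab; apply/matrixP => i j.
by rewrite -(cvg_lim (@Rhausdorff R) (Aa i j)) (cvg_lim (@Rhausdorff R) (Ab i j)).
Qed.

Lemma invmxB n (A B : 'M[R]_n) : A \in unitmx -> B \in unitmx ->
  invmx A - invmx B = - (invmx A *m (A - B) *m invmx B).
Proof.
move=> uA uB; rewrite mulmxBr mulmxBl mulVmx// mul1mx -mulmxA mulmxV// mulmx1.
by rewrite opprB.
Qed.

(** The identity [A^-1 - B^-1 = - A^-1 (A - B) B^-1] bounds the inverse near [a]
    before it gives the limit. *)
Lemma cvg_invmx (T : Type) (F : set_system T) (FF : Filter F) n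
    (A : T -> 'M[R]_n) (a : 'M[R]_n) : a \in unitmx -> (\forall t \near F, A t \in unitmx) ->
  A @ F --> a -> (fun t => invmx (A t)) @ F --> invmx a.
Proof.
move=> ua uA Aa; pose b : 'M[R]_n := invmx a; rewrite -[invmx a]/b.
have Kb (X : 'M[R]_n) : `|X *m b| <= n%:R * `|b| * `|X|.
  by rewrite (le_trans (mx_norm_mulmx _ _))// mulrA mulrAC.
pose c : R := n%:R * n%:R * `|b| + 1.
have c0 : 0 < c by rewrite ltr_wpDl// !mulr_ge0.
have bound t : A t \in unitmx ->
    `|invmx (A t) - b| <= c * `|A t - a| * `|invmx (A t)|.
  move=> uAt; rewrite invmxB// normrN (le_trans (Kb _))//.
  rewrite (@le_trans _ _ (n%:R * `|b| * (n%:R * (`|invmx (A t)| * `|A t - a|))))//.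
    by rewrite ler_wpM2l ?mulr_ge0// mx_norm_mulmx.
  rewrite [leRHS](_ : _ = n%:R * `|b| * (n%:R * (`|invmx (A t)| * `|A t - a|)) + `|invmx (A t)| * `|A t - a|).
    by rewrite lerDl mulr_ge0.
  by rewrite /c; ring.
apply/cvgrPdist_le => e e0.
pose d := Num.min (2 * c)^-1 (e / (2 * c * (`|b| + 1))).
have b1 : 0 < `|b| + 1 by rewrite ltr_wpDl.
have d0 : 0 < d by rewrite lt_min invr_gt0 divr_gt0 ?mulr_gt0.
move/cvgrPdist_le: Aa => /(_ d d0) Aa.
apply: filterS2 uA Aa => t uAt; rewrite distrC le_min => /andP[h1 h2].
have := bound _ uAt; set x := `|A t - a| in h1 h2 *; set y := `|invmx (A t)|.
rewrite distrC; set z := `|b - _| => H.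
have y2 : y <= 2 * `|b|.
  have : y <= `|b| + z.
    rewrite /y /z -{1}[invmx (A t)](addrNK b) addrC distrC.
    by rewrite (le_trans (ler_normD _ _))// distrC.
  have h3 : c * x * y <= 2^-1 * y.
    rewrite ler_wpM2r ?normr_ge0//.
    move: h1; rewrite invfM => h1.
    by rewrite mulrC -ler_pdivlMr.
  have y0 : 0 <= y by rewrite /y.
  lra.
rewrite (le_trans H)//.
have h4 : c * x <= e / (2 * (`|b| + 1)).
  rewrite mulrC -ler_pdivlMr// (le_trans h2)//.
  rewrite le_eqVlt; apply/orP; left; apply/eqP; field.
  by rewrite !gt_eqF.
rewrite (@le_trans _ _ (e / (2 * (`|b| + 1)) * (2 * `|b|)))//.
  by apply: ler_pM; rewrite ?mulr_ge0 ?(ltW c0) ?normr_ge0.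
rewrite [leLHS](_ : _ = e * `|b| / (`|b| + 1)); last by field; rewrite gt_eqF.
by rewrite ler_pdivrMr// ler_wpM2l ?(ltW e0)// lerDl.
Qed.

Lemma cvg_line (V : normedModType R) (t v : V) :
  (fun h : R => h *: v + t) @ 0^' --> t.
Proof.
have : {for 0, continuous (fun h : R => h *: v + t)}.
  apply: cvgD; last exact: cvg_cst.
  by apply: cvgZr_tmp; exact: cvg_id.
by move=> /continuous_withinNx; rewrite scale0r add0r.
Qed.

Lemma is_derive_line_cvg (V W : normedModType R) (f : V -> W) (t v : V) (D : W) :
  is_derive t v f D -> (fun h : R => f (h *: v + t)) @ 0^' --> f t.
Proof.
case=> /derivable1P/derivable1_diffP/differentiable_continuous/= H _.
by move: H => /continuous_withinNx; rewrite scale0r add0r.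
Qed.

Lemma is_derive_invmx (V : normedModType R) n (A : V -> 'M[R]_n) (t v : V) (D : 'M[R]_n) :
  (\forall y \near t, A y \in unitmx) -> is_derive t v A D ->
  is_derive t v (fun y => invmx (A y)) (- (invmx (A t) *m D *m invmx (A t))).
Proof.
move=> uA dA.
have ut := nbhs_singleton uA.
have uh : \forall h \near 0^', A (h *: v + t) \in unitmx.
  by have := @cvg_line V t v _ uA.
suff H : (fun h : R => h^-1 *: (((fun y => invmx (A y)) \o shift t) (h *: v)
     - invmx (A t))) @ 0^' --> - (invmx (A t) *m D *m invmx (A t)).
  by split; [apply/cvg_ex; eexists; exact: H|exact/cvg_lim].
have : (fun h => - (invmx (A (h *: v + t)) *m (h^-1 *: ((A \o shift t) (h *: v) - A t))
      *m invmx (A t))) @ 0^' --> - (invmx (A t) *m D *m invmx (A t)).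
  apply: cvgN; apply: cvg_mulmx; last exact: cvg_cst.
  apply: cvg_mulmx.
    exact: cvg_invmx ut uh (is_derive_line_cvg dA).
  by case: dA => dA <-; exact: dA.
apply: cvg_trans; apply: near_eq_cvg.
apply: filterS uh => h uh /=.
by rewrite invmxB// scalerN -scalemxAr -scalemxAl.
Qed.

End MatrixTopology.

Section MatrixExponential.
Variables (R : realType) (N : nat).
Implicit Types X Y : 'M[R]_N.

Lemma expr_mxZ (t : R) X k : (t *: X) ^+ k = t ^+ k *: X ^+ k.
Proof.
elim: k => [|k IH]; first by rewrite !expr0 scale1r.
by rewrite !exprS IH -[LHS]scalemxAl -scalemxAr scalerA.
Qed.

Lemma norm_expr_mx X k : `|X ^+ k| <= (N%:R * `|X|) ^+ k.
Proof.
elim: k => [|k IH].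
  apply: mx_norm_le => [|i j]; first by rewrite exprn_ge0// mulr_ge0.
  by rewrite expr0 mxE; case: (i == j); rewrite ?normr1 ?normr0.
rewrite !exprS (le_trans (mx_norm_mulmx _ _))// mulrA.
by rewrite ler_wpM2l// mulr_ge0.
Qed.

(** The entries of [expm (t *: X)] are power series in [t].  Coefficients of this
    size give convergence on the whole line, and so do those of the derivative. *)
Definition exp_bounded (c : R^nat) :=
  exists M r, [/\ 0 <= M, 0 <= r & forall k, `|c k| <= M * (r ^+ k / k`!%:R)].

Lemma exp_bounded_cvg c x : exp_bounded c -> cvgn (pseries c x).
Proof.
move=> [M [r [M0 r0 cb]]]; apply: normed_cvg.
apply: (@series_le_cvg _ _ (fun k => M * exp_coeff (r * `|x|) k)).
- by move=> k; rewrite normr_ge0.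
- by move=> k; rewrite mulr_ge0// /exp_coeff/= divr_ge0// exprn_ge0// mulr_ge0.
- move=> k; rewrite /= normrM normrX /exp_coeff/= exprMn.
  by rewrite mulrAC mulrA ler_wpM2r// exprn_ge0.
- by apply: (@is_cvg_seriesZ _ _ M); exact: is_cvg_series_exp_coeff.
Qed.

Lemma exp_bounded_diffs c : exp_bounded c -> exp_bounded (pseries_diffs c).
Proof.
move=> [M [r [M0 r0 cb]]]; exists (M * r), r; split=> //; first exact: mulr_ge0.
move=> k; rewrite /pseries_diffs normrM ger0_norm// mulrC.
rewrite -ler_pdivlMr// (le_trans (cb _))// factS natrM invfM exprS.
by rewrite le_eqVlt; apply/orP; left; apply/eqP; ring.
Qed.

Let c X i j (k : nat) : R := k`!%:R^-1 * (X ^+ k) i j.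

Lemma exp_coef_bounded X i j : exp_bounded (c X i j).
Proof.
exists 1, (N%:R * `|X|); split=> // k.
rewrite mul1r /c normrM ger0_norm// mulrC ler_wpM2r//.
by rewrite (le_trans (mx_entry_le _ _ _))// norm_expr_mx.
Qed.

Lemma expm_cvg X :
  (fun n : nat => \sum_(k < n) (k`!%:R^-1 *: X ^+ k)) @ \oo --> expm X.
Proof.
suff H : cvgn (fun n : nat => \sum_(k < n) (k`!%:R^-1 *: X ^+ k)) by [].
apply/cvg_ex; exists (\matrix_(i, j) limn (pseries (c X i j) 1)).
apply/cvg_mxP => i j; rewrite mxE.
rewrite (_ : (fun _ => _) = pseries (c X i j) 1).
  exact: exp_bounded_cvg (exp_coef_bounded _ _ _).
apply/funext => n; rewrite summxE /pseries /series/= big_mkord.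
by apply: eq_bigr => k _; rewrite !mxE expr1n mulr1.
Qed.

Lemma expm_entry X (t : R) i j : expm (t *: X) i j = limn (pseries (c X i j) t).
Proof.
apply/esym/cvg_lim => //.
have /cvg_mxP/(_ i j) := expm_cvg (X:=t *: X).
rewrite (_ : (fun _ => _) = pseries (c X i j) t)//.
apply/funext => n; rewrite summxE /pseries /series/= big_mkord.
by apply: eq_bigr => k _; rewrite expr_mxZ !mxE /c mulrA mulrAC.
Qed.

Lemma is_derive_expm X (t : R) :
  is_derive t 1 (fun t => expm (t *: X)) (expm (t *: X) *m X).
Proof.
apply/is_derive_mxP => i j.
rewrite (_ : (fun _ => _) = (fun t => limn (pseries (c X i j) t))); last first.
  by apply/funext => s; rewrite expm_entry.
have cb := exp_coef_bounded X i j.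
apply: is_derive_eq.
  apply: (@pseries_snd_diffs _ (c X i j) (`|t| + 1)).
  - exact: exp_bounded_cvg.
  - exact/exp_bounded_cvg/exp_bounded_diffs.
  - exact/exp_bounded_cvg/exp_bounded_diffs/exp_bounded_diffs.
  - by rewrite [ltRHS]ger0_norm ?ltrDl// addr_ge0.
apply/cvg_lim => //; rewrite mxE.
rewrite (_ : pseries _ _ = fun n => \sum_l pseries (c X i l) t n * X l j).
  apply: cvg_sumfun => l; rewrite expm_entry; apply: cvgMr_tmp.
  exact: exp_bounded_cvg (exp_coef_bounded _ _ _).
apply/funext => n; rewrite /pseries /series/=.
under [RHS]eq_bigr do rewrite mulr_suml.
rewrite exchange_big/=; apply: eq_bigr => k _.
rewrite /pseries_diffs /c exprSr factS natrM invfM mxE.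
rewrite mulrA mulVKf ?pnatr_eq0//.
rewrite mulr_sumr mulr_suml; apply: eq_bigr => l _; ring.
Qed.

Lemma expm_unique X (E : 'M[R]_N) :
  (fun n : nat => \sum_(k < n) (k`!%:R^-1 *: X ^+ k)) @ \oo --> E -> expm X = E.
Proof. by move=> H; apply: cvg_lim H; exact: norm_hausdorff. Qed.

Lemma expm_comm X : expm X *m X = X *m expm X.
Proof.
pose S n : 'M[R]_N := \sum_(k < n) (k`!%:R^-1 *: X ^+ k).
have H1 : (fun n => S n *m X) @ \oo --> expm X *m X.
  by apply: cvg_mulmxl; exact: expm_cvg.
have H2 : (fun n => S n *m X) @ \oo --> X *m expm X.
  have -> : (fun n => S n *m X) = (fun n => X *m S n).
    apply/funext => n; rewrite mulmx_suml mulmx_sumr; apply: eq_bigr => k _.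
    rewrite -scalemxAl -scalemxAr; congr (_ *: _).
    by rewrite -[LHS]exprSr -[RHS]exprS.
  by apply: cvg_mulmxr; exact: expm_cvg.
exact: cvg_mx_unique H1 H2.
Qed.

Lemma expm0 : expm (0 : 'M[R]_N) = 1%:M.
Proof.
apply/matrixP => i j; rewrite -(scale0r 0) expm_entry.
apply: lim_near_cst => //; near=> n.
rewrite /pseries /series/= -[n]prednK; last by near: n.
rewrite big_nat_recl//= big1 ?addr0 /c ?expr0 ?mulr1 ?fact0 ?invr1 ?mul1r//.
by move=> k _; rewrite expr0n/= mulr0.
Unshelve. all: by end_near. Qed.

Lemma expmZ_comm X (t : R) : expm (t *: X) *m X = X *m expm (t *: X).
Proof.
have := expm_comm (t *: X); rewrite -scalemxAl -scalemxAr.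
have [->|t0] := eqVneq t 0; last by move/(scalerI t0).
by rewrite !scale0r expm0 mul1mx mulmx1.
Qed.

Lemma expm_mulN X (t : R) : expm (t *: X) *m expm (t *: - X) = 1%:M.
Proof.
pose f (s : R) := expm (s *: X) *m expm (s *: - X).
suff : f t = f 0 by rewrite /f !scale0r !expm0 mulmx1.
apply: derive0_const => s _; apply: is_derive_eq.
  by apply: is_derive_mulmx; exact: is_derive_expm.
by rewrite (expmZ_comm (- X)) mulNmx mulmxN -mulmxA subrr.
Qed.

Lemma expm_unit X : expm X \in unitmx.
Proof. by have := expm_mulN X 1; rewrite scale1r => /mulmx1_unit[]. Qed.

Lemma invmx_expm X (t : R) : invmx (expm (t *: X)) = expm (- t *: X).
Proof.
have := expm_mulN X t; rewrite scalerN -scaleNr => H.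
by rewrite -[RHS](mulKmx (expm_unit (t *: X))) H mulmx1.
Qed.

(** Conjugation maps the partial sums of one series to those of the other. *)
Lemma expm_conj (g : 'M[R]_N) X : g \in unitmx ->
  expm (Ad g X) = g *m expm X *m invmx g.
Proof.
move=> ug; apply: expm_unique.
rewrite (_ : (fun _ => _) =
    (fun n : nat => g *m (\sum_(k < n) (k`!%:R^-1 *: X ^+ k)) *m invmx g)).
  by apply: cvg_mulmxl; apply: cvg_mulmxr; exact: expm_cvg.
apply/funext => n; rewrite mulmx_sumr mulmx_suml; apply: eq_bigr => k _.
rewrite -scalemxAr -scalemxAl; congr (_ *: _); rewrite /Ad.
elim: (nat_of_ord k) => [|j IH]; first by rewrite !expr0 mulmx1 mulmxV.
rewrite !exprS IH.
by rewrite -[LHS]/(_ *m _) -[X * _]/(X *m _) !mulmxA mulmxKV.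
Qed.

End MatrixExponential.

(** * Curves in closed groups of matrices *)

Section Bisection.
Variable R : realType.

(** Compactness of an interval, as an induction principle: a property of intervals
    that is additive and holds locally holds globally, because the supremum of the
    points that can be reached from the left end is the right end. *)
Lemma interval_bisection (P : R -> R -> Prop) (a0 b0 : R) : a0 <= b0 ->
  (forall a b c, a0 <= a -> a <= b -> b <= c -> c <= b0 -> P a b -> P b c -> P a c) ->
  (forall t, a0 <= t <= b0 -> exists2 d, 0 < d &
     forall a b, a0 <= a -> a <= t -> t <= b -> b <= b0 -> b - a < d -> P a b) ->
  P a0 b0.
Proof.
move=> ab0 glue loc.
pose S := [set t | a0 <= t <= b0 /\ P a0 t].
have Sa0 : S a0.
  have [|d d0 H] := loc a0; first by rewrite lexx.
  by split; [rewrite lexx|apply: H; rewrite ?subrr].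
have Sub : has_ubound S by exists b0 => t [/andP[]].
have hS : has_sup S by split; [exists a0|].
have as_ : a0 <= sup S by apply: ub_le_sup.
have sb : sup S <= b0 by apply: ge_sup; [exists a0|move=> t [/andP[]]].
have [|d d0 H] := loc (sup S); first by rewrite as_.
have [t [/andP[at_ tb] Pt] ts] := sup_adherent (divr_gt0 d0 (ltr0n R 2)) hS.
have tls : t <= sup S by apply: ub_le_sup => //; split; rewrite ?at_.
pose u := Num.min b0 (sup S + d / 3).
have su : sup S <= u by rewrite le_min sb lerDl divr_ge0// ltW.
have ub : u <= b0 by rewrite ge_min lexx.
have ud : u <= sup S + d / 3 by rewrite ge_min lexx orbT.
have Pu : P a0 u.
  apply: (@glue a0 t u) => //; first by rewrite (le_trans tls).
  by apply: H => //; lra.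
have us : u <= sup S.
  by apply: ub_le_sup => //; split=> //; rewrite ub (le_trans as_).
move: us; rewrite /u ge_min => /orP[bs|]; last first.
  by rewrite gerDl => ?; lra.
suff -> : b0 = u by [].
by apply/eqP; rewrite eq_le ub andbT (le_trans bs).
Qed.

Lemma is_derive_remainder (W : normedModType R) (f : R -> W) (t : R) (D : W) (e : R) :
  is_derive t 1 f D -> 0 < e ->
  exists2 d, 0 < d & forall s, `|s - t| < d -> `|f s - f t - (s - t) *: D| <= e * `|s - t|.
Proof.
move=> [df <-] e0.
have /cvgrPdist_le/(_ _ e0) := df.
case=> d /= d0 H; exists d => // s sd.
have [->|st] := eqVneq s t; first by rewrite !subrr scale0r subr0 !normr0 mulr0.
have st0 : s - t != 0 by rewrite subr_eq0.
have := H (s - t); rewrite /= sub0r normrN => /(_ sd st0).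
rewrite -[(_ - _)%:A]/((_ - _) *: 1) [(_ - _) *: 1]mulr1 subrK => H1.
rewrite mulrC -ler_pdivrMl ?normr_gt0//.
rewrite -normfV -normrZ scalerBr scalerA mulVf// scale1r distrC.
exact: H1.
Qed.

Lemma derive_local_cvg (W : normedModType R) (f : R -> W) (t : R) (D : W) (e : R) :
  is_derive t 1 f D -> 0 < e ->
  exists2 d, 0 < d & forall s, `|s - t| < d -> `|f s - f t| <= e.
Proof.
move=> [/derivable1_diffP/differentiable_continuous df _] e0.
have /cvgrPdist_le/(_ _ e0) := df.
move=> /nbhs_ballP[d /= d0 H]; exists d => // s sd.
by rewrite distrC; apply: H; rewrite /ball/= distrC.
Qed.

Lemma is_derive_at_local (W : normedModType R) (f g : R -> W) (t : R) (D : W) (d : R) :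
  0 < d -> (forall s, `|s - t| < d -> f s = g s) ->
  is_derive t 1 f D -> is_derive t 1 g D.
Proof.
move=> d0 fg; apply: near_eq_is_derive; near=> s; apply: fg.
rewrite distrC; near: s.
exact: (@nbhsx_ballx _ R t d d0).
Unshelve. all: by end_near. Qed.

End Bisection.

Section ClosedGroup.
Variables (R : realType) (N : nat) (A : set 'M[R]_N).
Hypothesis hA : matrix_lie_group A.
Implicit Types (X Y g : 'M[R]_N) (V : R -> 'M[R]_N).

Lemma group1_mx : A 1%:M. Proof. by case: hA => -[]. Qed.
Lemma groupM_mx g h : A g -> A h -> A (g *m h).
Proof. by case: hA => -[_ H _] _; exact: H. Qed.
Lemma group_unit g : A g -> g \in unitmx.
Proof. by case: hA => -[_ _ H] _ /H[]. Qed.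
Lemma groupV_mx g : A g -> A (invmx g).
Proof. by case: hA => -[_ _ H] _ /H[]. Qed.

(** A velocity is realized by some curve in the group; no curve is required to be a
    one-parameter subgroup, which is what makes sums and brackets of velocities
    accessible. *)
Definition tangent_curve (gam : R -> 'M[R]_N) (D : 'M[R]_N) :=
  [/\ gam 0 = 1%:M, is_derive (0 : R) 1 gam D &
      exists2 d, 0 < d & forall h : R, `|h| < d -> A (gam h)].

(** This multiple of the entrywise maximum norm is submultiplicative. *)
Let nm (X : 'M[R]_N) : R := N%:R * `|X|.

Let nmM X Y : nm (X *m Y) <= nm X * nm Y.
Proof.
rewrite /nm mulrACA -mulrA ler_wpM2l//.
by have := mx_norm_mulmx X Y.
Qed.

Let nm_ge0 X : 0 <= nm X. Proof. by rewrite mulr_ge0. Qed.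

Let nmD X Y : nm (X + Y) <= nm X + nm Y.
Proof. by rewrite /nm -mulrDr ler_wpM2l// ler_normD. Qed.

Let norm_le_nm X : `|X| <= nm X.
Proof.
apply: mx_norm_le => // i j; rewrite (le_trans (mx_entry_le _ _ _))//.
by rewrite ler_peMl// ler1n (leq_ltn_trans _ (ltn_ord i)).
Qed.

Lemma nbhs_near (t d : R) (P : R -> Prop) : 0 < d ->
  (forall s, `|s - t| < d -> P s) -> \forall s \near t, P s.
Proof.
move=> d0 H; apply/nbhs_ballP; exists d => // s.
by rewrite /ball/= distrC; exact: H.
Qed.

(** On a short interval [[a, b]] around [t], the increment of [V] agrees with that of
    an element of the group up to an error that is small compared with [b - a]. *)
Lemma straddle_estimate V gam (t : R) (D : 'M[R]_N) (e : R) : 0 < e ->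
  (\forall s \near t, V s \in unitmx) ->
  is_derive t 1 V (V t *m D) -> tangent_curve gam D ->
  exists2 d, 0 < d & forall a b, a <= t -> t <= b -> b - a < d ->
    A (gam (b - a)) /\
    nm (V b *m invmx (gam (b - a)) *m invmx (V a) - 1%:M) <= e * (b - a).
Proof.
move=> e0 uV dV [g0 dg [d1 d10 Ag]].
pose B : R := `|V t| + `|invmx (V t)| + `|D| + 1.
have B1 : 1 <= B by rewrite /B lerDr !addr_ge0.
have VB : `|V t| + 1 <= B by rewrite /B lerD2r -addrA lerDl addr_ge0.
have ViB : `|invmx (V t)| + 1 <= B by rewrite /B lerD2r addrAC lerDr addr_ge0.
have DB : `|D| <= B by rewrite /B; have := normr_ge0 (V t); have := normr_ge0 (invmx (V t)); lra.
have B0 : 0 <= B by lra.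
pose C : R := N%:R * N%:R * (2 + 2 * N%:R * B) * B + 1.
have N0 : 0 <= N%:R :> R by [].
have NB0 : 0 <= N%:R * B by rewrite mulr_ge0.
have C1 : 0 <= N%:R * N%:R * (2 + 2 * N%:R * B) * B.
  by rewrite !mulr_ge0// addr_ge0// -mulrA mulr_ge0.
have C0 : 0 < C by rewrite /C; lra.
(* a relative accuracy [eta] of the linear approximations costs at most [C eta] *)
pose eta := Num.min 1 (e / C).
have eta0 : 0 < eta by rewrite lt_min ltr01 divr_gt0.
have eta1 : eta <= 1 by rewrite ge_min lexx.
have etae : eta * C <= e by rewrite -ler_pdivlMr// ge_min lexx orbT.
have ug : \forall s \near (0:R), gam s \in unitmx.
  by apply: (nbhs_near d10) => s; rewrite subr0 => /Ag/group_unit.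
have [d2 d20 H2] := derive_local_cvg dV eta0.
have [d3 d30 H3] := derive_local_cvg (is_derive_invmx uV dV) ltr01.
have [d4 d40 H4] := is_derive_remainder dV eta0.
have [d5 d50 H5] := is_derive_remainder (is_derive_invmx ug dg) eta0.
have [d6 d60 H6] : exists2 d, 0 < d & forall s, `|s - t| < d -> V s \in unitmx.
  move: uV => /nbhs_ballP[d /= d0 H]; exists d => // s sd.
  by apply: H; rewrite /ball/= distrC.
exists (Num.min d1 (Num.min d2 (Num.min d3 (Num.min d4 (Num.min d5 d6))))).
  by rewrite !lt_min d10 d20 d30 d40 d50.
move=> a b at_ tb; rewrite !lt_min => /and5P[h1 h2 h3 h4 /andP[h5 h6]].
set h := b - a in h1 h2 h3 h4 h5 h6 *.
have hE : h = b - a by [].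
have h0 : 0 <= h by rewrite subr_ge0 (le_trans at_).
have habs d : h < d -> `|h - 0| < d by rewrite subr0 ger0_norm.
have aabs d : h < d -> `|a - t| < d.
  by move=> hd; rewrite distrC ger0_norm ?subr_ge0// (le_lt_trans _ hd)// lerD2r.
have babs d : h < d -> `|b - t| < d.
  by move=> hd; rewrite ger0_norm ?subr_ge0// (le_lt_trans _ hd)// lerD2l lerN2.
split; first by apply: Ag; rewrite -(subr0 h); exact: habs.
have ua := H6 _ (aabs _ h6).
have := H2 _ (babs _ h2) => Vbt.
have Vb : `|V b| <= B.
  rewrite (le_trans _ VB)// -{1}[V b](subrK (V t)).
  by rewrite (le_trans (ler_normD _ _))// addrC lerD2l (le_trans Vbt).
have Va : `|invmx (V a)| <= B.
  rewrite (le_trans _ ViB)// -{1}[invmx (V a)](subrK (invmx (V t))).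
  by rewrite (le_trans (ler_normD _ _))// addrC lerD2l; exact: H3 (aabs _ h3).
have := H4 _ (babs _ h4); rewrite (ger0_norm (_ : 0 <= b - t)) ?subr_ge0//.
have := H4 _ (aabs _ h4); rewrite [`|a - t|]distrC (ger0_norm (_ : 0 <= t - a)) ?subr_ge0//.
have := H5 _ (habs _ h5).
rewrite subr0 g0 invmx1 mul1mx mulmx1 scalerN opprK (ger0_norm h0).
set R3 := _ + h *: D; set R2 := _ - (a - t) *: _; set R1 := _ - (b - t) *: _.
move=> R3h R2h R1h.
pose M := V b *m invmx (gam h) - V a.
have ME : M = R1 - R2 + V b *m R3 + h *: ((V t - V b) *m D).
  rewrite /R3 /R2 /R1 /M mulmxDr mulmxBr mulmx1 mulmxBl -scalemxAr.
  apply/matrixP => i j; rewrite !mxE /h; ring.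
have Mle : `|M| <= eta * h * (2 + 2 * N%:R * B).
  rewrite ME.
  have q1 : `|R1 - R2| <= 2 * eta * h.
    rewrite (le_trans (ler_normB _ _))//.
    have : eta * (b - t) + eta * (t - a) = eta * h by rewrite hE; ring.
    have : 0 <= eta * h by rewrite mulr_ge0// ltW.
    by move: R1h R2h; clear; lra.
  have q2 : `|V b *m R3| <= N%:R * B * (eta * h).
    by rewrite (le_trans (mx_norm_mulmx _ _))// -mulrA ler_wpM2l// ler_pM.
  have q3 : `|h *: ((V t - V b) *m D)| <= N%:R * B * (eta * h).
    rewrite normrZ (ger0_norm h0) mulrC mulrA ler_wpM2r//.
    rewrite (le_trans (mx_norm_mulmx _ _))// -mulrA ler_wpM2l// mulrC.
    by rewrite ler_pM// distrC.
  rewrite (le_trans (ler_normD _ _))//.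
  rewrite [leRHS](_ : _ = 2 * eta * h + N%:R * B * (eta * h) + N%:R * B * (eta * h)); last by ring.
  by rewrite lerD// (le_trans (ler_normD _ _))// lerD.
have -> : V b *m invmx (gam h) *m invmx (V a) - 1%:M = M *m invmx (V a).
  by rewrite mulmxBl mulmxV.
rewrite (le_trans (nmM _ _))// /nm mulrACA.
rewrite (@le_trans _ _ (N%:R * N%:R * (eta * h * (2 + 2 * N%:R * B) * B)))//.
  by rewrite ler_wpM2l ?mulr_ge0// ler_pM.
rewrite [leLHS](_ : _ = eta * (C - 1) * h); last by rewrite /C; ring.
by rewrite ler_wpM2r// (le_trans _ etae)// ler_wpM2l ?(ltW eta0)// gerBl.
Qed.

(** Chaining the local estimates along the interval approximates the increment of [V]
    by elements of the group.  The relative errors multiply, so that a rate [e]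
    accumulates to [expR (e * (b - a)) - 1]; letting [e] tend to zero, the group
    being closed, the increment itself belongs to the group. *)
Lemma closed_group_flow V (a b : R) : a <= b ->
  (forall t, a <= t <= b -> \forall s \near t, V s \in unitmx) ->
  (forall t, a <= t <= b -> exists gam D,
     tangent_curve gam D /\ is_derive t 1 V (V t *m D)) ->
  A (invmx (V a) *m V b).
Proof.
move=> ab uV dV.
have uV' t : a <= t <= b -> V t \in unitmx by move=> /uV/nbhs_singleton.
have ua : V a \in unitmx by apply: uV'; rewrite lexx.
have ub : V b \in unitmx by apply: uV'; rewrite lexx andbT.
pose W := invmx (V b) *m V a.
have uW : W \in unitmx by rewrite unitmx_mul unitmx_inv ub ua.
have -> : invmx (V a) *m V b = invmx W.
  apply: (can_inj (mulKmx uW)); rewrite mulmxV// /W -mulmxA mulKVmx//.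
  by rewrite mulVmx.
apply: groupV_mx; case: (hA) => _; apply=> //.
have key e : 0 < e -> exists2 g, A g &
    nm (V b *m invmx g *m invmx (V a) - 1%:M) <= expR (e * (b - a)) - 1.
  move=> e0; apply: (@interval_bisection R (fun a b => exists2 g, A g &
    nm (V b *m invmx g *m invmx (V a) - 1%:M) <= expR (e * (b - a)) - 1)) => //.
    move=> x y z ax xy yz zb [g Ag gE] [h Ah hE].
    exists (g *m h); first exact: groupM_mx.
    have uy : V y \in unitmx by apply: uV'; rewrite (le_trans ax)// (le_trans yz).
    have ug := group_unit Ag; have uh := group_unit Ah.
    have -> : V z *m invmx (g *m h) *m invmx (V x) =
        (V z *m invmx h *m invmx (V y)) *m (V y *m invmx g *m invmx (V x)).
      have -> : invmx (g *m h) = invmx h *m invmx g.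
        apply: (can_inj (mulKmx (_ : g *m h \in unitmx))).
          by rewrite unitmx_mul ug uh.
        by rewrite mulmxV ?unitmx_mul ?ug ?uh// -mulmxA mulKVmx// mulmxV.
      by rewrite !mulmxA mulmxKV.
    set E1 := V y *m _ *m _ - _ in gE; set E2 := V z *m _ *m _ - _ in hE.
    rewrite -[V y *m _ *m _](subrK 1%:M) -/E1 -[V z *m _ *m _](subrK 1%:M) -/E2.
    have -> : (E2 + 1%:M) *m (E1 + 1%:M) - 1%:M = E2 *m E1 + (E2 + E1).
      by rewrite mulmxDl mul1mx mulmxDr mulmx1 !addrA addrK.
    have -> : e * (z - x) = e * (z - y) + e * (y - x) by ring.
    rewrite expRD (le_trans (nmD _ _))//.
    have q1 : nm (E2 *m E1) <= (expR (e * (z - y)) - 1) * (expR (e * (y - x)) - 1).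
      by rewrite (le_trans (nmM _ _))// ler_pM.
    rewrite (le_trans (lerD q1 (le_trans (nmD _ _) (lerD hE gE))))//.
    by rewrite le_eqVlt; apply/orP; left; apply/eqP; ring.
  move=> t tab; have [gam [D [gD VD]]] := dV t tab.
  have [d d0 H] := straddle_estimate e0 (uV _ tab) VD gD.
  exists d => // x y ax xt ty yb xyd.
  have [Ag gE] := H x y xt ty xyd.
  exists (gam (y - x)) => //; rewrite (le_trans gE)//.
  by have := expR_ge1Dx (e * (y - x)); lra.
move=> B /nbhs_ballP[r /= r0 rB].
pose c : R := nm (invmx (V b)) * nm (V a) + 1.
have c0 : 0 < c by rewrite ltr_wpDl// mulr_ge0.
pose e1 := r / 2 / c.
have e10 : 0 < e1 by rewrite !divr_gt0.
have T0 : 0 < b - a + 1 by rewrite ltr_wpDl// subr_ge0.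
have l0 : 0 < ln (1 + e1) by rewrite ln_gt0// ltrDl.
(* the rate for which the accumulated error is at most [e1] *)
have [g Ag gE] := key (ln (1 + e1) / (b - a + 1)) (divr_gt0 l0 T0).
have gE1 : nm (V b *m invmx g *m invmx (V a) - 1%:M) <= e1.
  rewrite (le_trans gE)// lerBlDl -{2}(@lnK _ (1 + e1)) ?posrE ?addr_gt0//.
  rewrite ler_expR -mulrA ler_piMr ?(ltW l0)//.
  by rewrite mulrC ler_pdivrMr// mul1r lerDl.
exists (invmx g); split; first exact: groupV_mx.
apply: rB; rewrite -ball_normE /ball_/= distrC (le_lt_trans (norm_le_nm _))//.
have -> : invmx g - W = invmx (V b) *m ((V b *m invmx g *m invmx (V a) - 1%:M) *m V a).
  by rewrite mulmxBl mul1mx -!mulmxA mulVmx// mulmx1 mulmxBr mulKmx.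
rewrite (le_lt_trans (nmM _ _))//.
rewrite (@le_lt_trans _ _ (nm (invmx (V b)) * (e1 * nm (V a))))//.
  by rewrite ler_wpM2l// (le_trans (nmM _ _))// ler_wpM2r.
rewrite (@le_lt_trans _ _ (e1 * c))//.
  by rewrite mulrCA ler_wpM2l ?(ltW e10)// /c lerDl.
by rewrite /e1 mulfVK ?gt_eqF//; lra.
Qed.

End ClosedGroup.

(** * The Lie algebra of a closed group *)

Section Subspaces.
Variables (R : realType) (N : nat).

Definition is_subspace (A : set 'M[R]_N) :=
  A 0 /\ forall (a : R) X Y, A X -> A Y -> A (a *: X + Y).

(** A subspace of matrices, given as a mere set, is the range of a linear
    projection; in this way functions that are linear on it become restrictions of
    linear maps, hence continuous and differentiable. *)
Lemma subspace_projection (A : set 'M[R]_N) : is_subspace A ->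
  exists p : {linear 'M[R]_N -> 'M[R]_N},
    (forall X, A (p X)) /\ (forall X, A X -> p X = X).
Proof.
move=> [A0 AL].
pose P k := `[< exists U : {vspace 'M[R]_N}, \dim U = k /\ forall x, x \in U -> A x >].
have P0 : exists k, P k.
  exists 0%N; apply/asboolP; exists 0%VS; split; first exact: dimv0.
  by move=> x; rewrite memv0 => /eqP ->.
have Pm k : P k -> (k <= \dim (fullv : {vspace 'M[R]_N}))%N.
  by move=> /asboolP[U [<- _]]; rewrite dimvS// subvf.
have [k /asboolP[U [Uk UA]] kmax] := ex_maxnP P0 Pm.
have AU x : A x -> x \in U.
  move=> Ax; apply/negP => /negP xU.
  have /kmax : P (\dim (U + <[x]>)%VS).
    apply/asboolP; exists (U + <[x]>)%VS; split => // y.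
    move=> /memv_addP[u uU [v /vlineP[c ->] ->]].
    by rewrite addrC; apply: AL => //; exact: UA.
  apply/negP; rewrite -ltnNge -Uk.
  rewrite ltn_neqAle dimvS ?addvSl// andbT.
  rewrite (dimv_leqif_eq (addvSl U <[x]>%VS)); apply: contra xU => /eqP ->.
  by rewrite memvE addvSr.
exists (projv U : 'End(_)); split=> X.
  by apply: UA; exact: memv_proj.
by move=> /AU XU; exact: projv_id.
Qed.

Lemma subspace_derive (A : set 'M[R]_N) (V : normedModType R) (F : V -> 'M[R]_N)
    (t v : V) (D : 'M[R]_N) :
  is_subspace A -> (\forall s \near t, A (F s)) -> is_derive t v F D -> A D.
Proof.
move=> /subspace_projection[p [pA pid]] FA dF.
have : is_derive t v F (p D).
  apply: near_eq_is_derive (is_derive_linear_mx p dF).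
  by apply: filterS FA => s /pid.
by move=> [_ E]; case: dF => _ <-; rewrite E.
Qed.

End Subspaces.

Section ClosedGroupLie.
Variables (R : realType) (N : nat) (A : set 'M[R]_N).
Hypothesis hA : matrix_lie_group A.
Implicit Types (X Y g : 'M[R]_N) (V : R -> 'M[R]_N).
Local Notation lie := (lie_algebra A).

Lemma is_derive_expm0 X : is_derive (0 : R) 1 (fun t => expm (t *: X)) X.
Proof.
by apply: is_derive_eq; [exact: is_derive_expm|rewrite scale0r expm0 mul1mx].
Qed.

Lemma tangent_expm X : lie X -> tangent_curve A (fun t => expm (t *: X)) X.
Proof.
move=> AX; split; first by rewrite scale0r expm0.
  exact: is_derive_expm0.
by exists 1 => // h _; exact: AX.
Qed.

(** The one-parameter group generated by the velocity [X] has the constant logarithmic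
    derivative [X], realized at each time by the same curve. *)
Lemma tangent_lie gam X : tangent_curve A gam X -> lie X.
Proof.
move=> gX.
have H (T : R) : 0 <= T -> A (expm (T *: X)).
  move=> T0; have := @closed_group_flow R N A hA (fun t => expm (t *: X)) 0 T T0.
  rewrite scale0r expm0 invmx1 mul1mx; apply.
    by move=> t _; apply: filterE => s; exact: expm_unit.
  by move=> t _; exists gam, X; split=> //; exact: is_derive_expm.
move=> T; have [T0|/ltW T0] := leP 0 T; first exact: H.
by rewrite -(opprK T) -invmx_expm; apply: (groupV_mx hA); apply: H; rewrite oppr_ge0.
Qed.

Lemma lie0 : lie 0.
Proof. by move=> t; rewrite scaler0 expm0; exact: group1_mx. Qed.

Lemma lieZ (a : R) X : lie X -> lie (a *: X).
Proof. by move=> AX t; rewrite scalerA. Qed.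

Lemma lieD X Y : lie X -> lie Y -> lie (X + Y).
Proof.
move=> AX AY.
apply: (@tangent_lie (fun t => expm (t *: X) *m expm (t *: Y))); split.
- by rewrite !scale0r expm0 mulmx1.
- apply: is_derive_eq; first by apply: is_derive_mulmx; exact: is_derive_expm0.
  by rewrite /= !scale0r expm0 mulmx1 mul1mx.
- by exists 1 => // h _; exact: (groupM_mx hA).
Qed.

Lemma lie_subspace : is_subspace lie.
Proof. by split; [exact: lie0|move=> a X Y AX AY; apply: lieD => //; exact: lieZ]. Qed.

Lemma lie_Ad g X : A g -> lie X -> lie (Ad g X).
Proof.
move=> Ag AX t.
have -> : t *: Ad g X = Ad g (t *: X) by rewrite /Ad -scalemxAr -scalemxAl.
rewrite expm_conj; last exact: (group_unit hA).
by do !apply: (groupM_mx hA) => //; exact: (groupV_mx hA).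
Qed.

Lemma is_derive_Ad_expm X Y :
  is_derive (0 : R) 1 (fun t => Ad (expm (t *: X)) Y) (lbr X Y).
Proof.
have uX : \forall s \near (0 : R), expm (s *: X) \in unitmx.
  by apply: filterE => s; exact: expm_unit.
rewrite /Ad; apply: is_derive_eq.
  apply: is_derive_mulmx; last exact: is_derive_invmx uX (is_derive_expm0 X).
  by apply: is_derive_mulmx; exact: is_derive_expm0.
rewrite /= scale0r expm0 invmx1 !mulmx1 !mul1mx.
by rewrite addr0 mulmxN.
Qed.

(** The bracket is the derivative at [0] of a curve in the Lie algebra, which is a
    linear subspace. *)
Lemma lie_lbr X Y : lie X -> lie Y -> lie (lbr X Y).
Proof.
move=> AX AY; apply: subspace_derive lie_subspace _ (is_derive_Ad_expm X Y).
by apply: filterE => s; apply: lie_Ad.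
Qed.

Lemma group_curve_lie V (t : R) (D : 'M[R]_N) :
  (\forall s \near t, A (V s)) -> is_derive t 1 V D -> lie (invmx (V t) *m D).
Proof.
move=> AV dV; have At := nbhs_singleton AV.
apply: (@tangent_lie (fun h => invmx (V t) *m V (h + t))); split.
- by rewrite add0r mulVmx//; exact: (group_unit hA).
- apply: is_derive_eq.
    by apply: is_derive_mulmx; exact: is_derive_shift0.
  by rewrite mul0mx add0r.
- move: AV => /nbhs_ballP[d /= d0 H]; exists d => // h hd.
  apply: (groupM_mx hA); first exact: (groupV_mx hA).
  by apply: H; rewrite /ball/= opprD addrCA subrr addr0 normrN.
Qed.

(** Exponentials realize the logarithmic derivatives; time may run backwards. *)
Lemma group_curve_flow V (a b : R) (alpha : R -> 'M[R]_N) :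
  (forall t, Num.min a b <= t <= Num.max a b -> \forall s \near t, V s \in unitmx) ->
  (forall t, Num.min a b <= t <= Num.max a b ->
     is_derive t 1 V (V t *m alpha t) /\ lie (alpha t)) ->
  A (V a) -> A (V b).
Proof.
have [ab|/ltW ba] := leP a b => uV dV AV.
  have ua : V a \in unitmx by exact: (group_unit hA).
  rewrite -[V b](mulKVmx ua); apply: (groupM_mx hA) => //.
  apply: (closed_group_flow hA) => // t tab.
  exists (fun h => expm (h *: alpha t)), (alpha t).
  by have [? ?] := dV _ tab; split=> //; exact: tangent_expm.
have ua : V a \in unitmx by exact: (group_unit hA).
have ub : V b \in unitmx by apply: (nbhs_singleton (uV b _)); rewrite lexx.
have H : A (invmx (V b) *m V a).
  apply: (closed_group_flow hA) => // t tab.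
  exists (fun h => expm (h *: alpha t)), (alpha t).
  by have [? ?] := dV _ tab; split=> //; exact: tangent_expm.
have -> : V b = V a *m invmx (invmx (V b) *m V a).
  apply: (canRL (mulmxK _)); first by rewrite unitmx_mul unitmx_inv ub.
  by rewrite mulKVmx.
by apply: (groupM_mx hA) => //; exact: (groupV_mx hA).
Qed.

End ClosedGroupLie.

Lemma expm_inj (R : realType) N (X Y : 'M[R]_N) :
  (forall t : R, expm (t *: X) = expm (t *: Y)) -> X = Y.
Proof.
move=> XY; have [_ EX] := is_derive_expm0 X; have [_ EY] := is_derive_expm0 Y.
have E : (fun t : R => expm (t *: X)) = (fun t => expm (t *: Y)) by apply/funext.
by rewrite -EX E EY.
Qed.

(** * The Lie algebra of a symmetric space with an automorphism of order four *)

Section LinearOn.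
Variables (R : realType) (N : nat) (A : set 'M[R]_N).
Hypothesis hA : is_subspace A.

Definition lin_on (W : lmodType R) (f : 'M[R]_N -> W) :=
  forall (a : R) X Y, A X -> A Y -> f (a *: X + Y) = a *: f X + f Y.

Lemma subspace0 : A 0. Proof. by case: hA. Qed.
Lemma subspaceL (a : R) X Y : A X -> A Y -> A (a *: X + Y).
Proof. by case: hA => _; exact. Qed.
Lemma subspaceD X Y : A X -> A Y -> A (X + Y).
Proof. by move=> AX AY; rewrite -[X]scale1r; exact: subspaceL. Qed.
Lemma subspaceZ (a : R) X : A X -> A (a *: X).
Proof. by move=> AX; rewrite -[_ *: _]addr0; apply: subspaceL => //; exact: subspace0. Qed.
Lemma subspaceN X : A X -> A (- X).
Proof. by move=> AX; rewrite -scaleN1r; exact: subspaceZ. Qed.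
Lemma subspaceB X Y : A X -> A Y -> A (X - Y).
Proof. by move=> AX AY; apply: subspaceD => //; exact: subspaceN. Qed.

Lemma lin_on0 (W : lmodType R) (f : 'M[R]_N -> W) : lin_on f -> f 0 = 0.
Proof.
move=> fL; have := fL (-1) 0 0 subspace0 subspace0.
by rewrite scaleN1r addNr scaleN1r addNr.
Qed.
Lemma lin_onD (W : lmodType R) (f : 'M[R]_N -> W) X Y : lin_on f ->
  A X -> A Y -> f (X + Y) = f X + f Y.
Proof. by move=> fL AX AY; rewrite -[X in f (X + _)]scale1r fL// scale1r. Qed.
Lemma lin_onZ (W : lmodType R) (f : 'M[R]_N -> W) a X : lin_on f ->
  A X -> f (a *: X) = a *: f X.
Proof.
move=> fL AX; rewrite -[a *: X]addr0 fL//; last exact: subspace0.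
by rewrite lin_on0// addr0.
Qed.
Lemma lin_onN (W : lmodType R) (f : 'M[R]_N -> W) X : lin_on f ->
  A X -> f (- X) = - f X.
Proof. by move=> fL AX; rewrite -[- X]scaleN1r (lin_onZ _ fL)// scaleN1r. Qed.
Lemma lin_onB (W : lmodType R) (f : 'M[R]_N -> W) X Y : lin_on f ->
  A X -> A Y -> f (X - Y) = f X - f Y.
Proof.
by move=> fL AX AY; rewrite (lin_onD fL)// ?(lin_onN fL)//; exact: subspaceN.
Qed.

(** The structure maps are linear only on subspaces; extending them linearly makes
    calculus available. *)
Lemma lin_on_extend (W : lmodType R) (f : 'M[R]_N -> W) : lin_on f ->
  exists g : {linear 'M[R]_N -> W}, forall X, A X -> g X = f X.
Proof.
move=> fL; have [p [pA pid]] := subspace_projection hA.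
have gL : linear (f \o p) by move=> a X Y; rewrite /= linearP fL.
pose gM := GRing.isLinear.Build _ _ _ _ _ gL.
pose g : {linear _ -> _} := HB.pack (f \o p) gM.
by exists g => X AX; rewrite /g/= pid.
Qed.

Lemma is_derive_lin_on (V W : normedModType R) (f : 'M[R]_N -> W)
    (F : V -> 'M[R]_N) (t v : V) (D : 'M[R]_N) : lin_on f ->
  (\forall s \near t, A (F s)) -> is_derive t v F D -> is_derive t v (fun s => f (F s)) (f D).
Proof.
move=> /lin_on_extend[g gf] AF dF.
have AD := subspace_derive hA AF dF.
rewrite -gf//; apply: near_eq_is_derive (is_derive_linear_mx g dF).
by apply: filterS AF => s /gf.
Qed.

Lemma cvg_lin_on (T : Type) (F : set_system T) (FF : ProperFilter F)
    (W : normedModType R) (f : 'M[R]_N -> W) (X : T -> 'M[R]_N) (x : 'M[R]_N) :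
  lin_on f -> (forall t, A (X t)) -> X @ F --> x ->
  A x /\ (fun t => f (X t)) @ F --> f x.
Proof.
move=> /lin_on_extend[g gf] AX Xx.
have [p [pA pid]] := subspace_projection hA.
have Ax : A x.
  have H : (fun t => p (X t)) @ F --> p x by exact: cvg_linear_mx.
  have E : (fun t => p (X t)) = X by apply/funext => t; rewrite pid.
  by rewrite E in H; rewrite (cvg_mx_unique _ Xx H).
split => //; rewrite -gf//.
have H : (fun t => g (X t)) @ F --> g x by exact: cvg_linear_mx.
by move: H; have -> : (fun t => g (X t)) = (fun t => f (X t)) by apply/funext => t; rewrite gf.
Qed.

End LinearOn.

Section Bracket.
Variables (K : comNzRingType) (N : nat).
Implicit Types X Y Z : 'M[K]_N.

Lemma lbrDl X Y Z : lbr (X + Y) Z = lbr X Z + lbr Y Z.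
Proof. by rewrite /lbr mulmxDl mulmxDr opprD addrACA. Qed.
Lemma lbrDr X Y Z : lbr Z (X + Y) = lbr Z X + lbr Z Y.
Proof. by rewrite /lbr mulmxDl mulmxDr opprD addrACA. Qed.
Lemma lbrZl a X Z : lbr (a *: X) Z = a *: lbr X Z.
Proof. by rewrite /lbr -scalemxAl -scalemxAr scalerBr. Qed.
Lemma lbrZr a X Z : lbr Z (a *: X) = a *: lbr Z X.
Proof. by rewrite /lbr -scalemxAl -scalemxAr scalerBr. Qed.
Lemma lbrNl X Z : lbr (- X) Z = - lbr X Z.
Proof. by rewrite -scaleN1r lbrZl scaleN1r. Qed.
Lemma lbrNr X Z : lbr Z (- X) = - lbr Z X.
Proof. by rewrite -scaleN1r lbrZr scaleN1r. Qed.
Lemma lbrC X Y : lbr X Y = - lbr Y X.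
Proof. by rewrite /lbr opprB. Qed.
Lemma lbrxx X : lbr X X = 0.
Proof. by rewrite /lbr subrr. Qed.
End Bracket.

Lemma sum2E (V : nmodType) (F : 'I_2 -> V) : \sum_a F a = F ix + F iy.
Proof.
rewrite big_ord_recl big_ord1; congr (F _ + F _); exact: val_inj.
Qed.

Section SymmetricSpaceAlgebra.
Variables (R : realType) (N : nat) (S : sym_data R N).
Hypothesis hS : hermitian_symmetric S.
Implicit Types (X Y Z g : 'M[R]_N).
Local Notation T := (dtau S).
Local Notation J := (cJ S).
Let hG := hs_G hS.
Let tL := hs_dtauL hS.

Lemma lg_subspace : is_subspace (lg S). Proof. exact: lie_subspace hG. Qed.
Let lgS := lg_subspace.

Lemma lg_dtau X : lg S X -> lg S (T X). Proof. exact: hs_dtaug. Qed.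

Lemma lg_dsigma X : lg S X -> lg S (dsigma S X).
Proof. by move=> /lg_dtau/lg_dtau. Qed.

Lemma dsigma_lin : lin_on (lg S) (dsigma S).
Proof.
move=> a X Y HX HY; rewrite /dsigma (tL _ HX HY).
exact: tL (lg_dtau HX) (lg_dtau HY).
Qed.

Lemma dtau4 X : lg S X -> T (T (T (T X))) = X.
Proof.
move=> HX; apply: expm_inj => t.
have H Z : lg S Z -> expm (t *: T Z) = tau S (expm (t *: Z)).
  by move=> HZ; rewrite (hs_dtau_exp hS).
have H1 := lg_dtau HX; have H2 := lg_dtau H1; have H3 := lg_dtau H2.
by rewrite (H _ H3) (H _ H2) (H _ H1) (H _ HX); exact: (hs_tau4 hS (HX t)).
Qed.

Lemma dsigma2 X : lg S X -> dsigma S (dsigma S X) = X.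
Proof. exact: dtau4. Qed.

Lemma tau_invmx g : sG S g -> tau S (invmx g) = invmx (tau S g).
Proof.
move=> Gg; have ug := group_unit hG Gg.
have t1 : tau S 1%:M = 1%:M.
  have := hs_tauM hS (group1_mx hG) (group1_mx hG); rewrite mulmx1.
  have u1 := group_unit hG (hs_tauG hS (group1_mx hG)).
  by move/(congr1 (mulmx (invmx (tau S 1%:M)))); rewrite mulKmx// mulVmx.
have := hs_tauM hS Gg (groupV_mx hG Gg); rewrite mulmxV// t1 => E.
have ut := group_unit hG (hs_tauG hS Gg).
by rewrite -[LHS](mulKmx ut) -E mulmx1.
Qed.

Lemma dtau_Ad g X : sG S g -> lg S X -> T (Ad g X) = Ad (tau S g) (T X).
Proof.
move=> Gg HX; apply: expm_inj => t.
have AdZ (h : 'M[R]_N) Z : t *: Ad h Z = Ad h (t *: Z).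
  by rewrite /Ad -scalemxAr -scalemxAl.
have ug := group_unit hG Gg; have ut := group_unit hG (hs_tauG hS Gg).
rewrite -(hs_dtau_exp hS); last exact: lie_Ad.
rewrite !AdZ !expm_conj// (hs_tauM hS)//; last exact: (groupV_mx hG).
  by rewrite (hs_tauM hS)// tau_invmx// (hs_dtau_exp hS).
exact: (groupM_mx hG).
Qed.

Lemma dtau_lbr X Y : lg S X -> lg S Y -> T (lbr X Y) = lbr (T X) (T Y).
Proof.
move=> HX HY.
have d1 : is_derive (0 : R) 1 (fun t => T (Ad (expm (t *: X)) Y)) (T (lbr X Y)).
  apply: (is_derive_lin_on lgS (f := T)) (is_derive_Ad_expm X Y) => //.
  by apply: filterE => s; exact: lie_Ad.
have E : (fun t : R => T (Ad (expm (t *: X)) Y)) = (fun t => Ad (expm (t *: T X)) (T Y)).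
  by apply/funext => t; rewrite dtau_Ad// (hs_dtau_exp hS).
rewrite E in d1; have [_ E1] := d1.
by have [_ E2] := is_derive_Ad_expm (T X) (T Y); rewrite -E1 E2.
Qed.

Lemma dsigma_lbr X Y : lg S X -> lg S Y ->
  dsigma S (lbr X Y) = lbr (dsigma S X) (dsigma S Y).
Proof. by move=> HX HY; rewrite /dsigma !dtau_lbr//; exact: lg_dtau. Qed.

Lemma lm_subspace : is_subspace (lm S).
Proof.
split; first by split; [exact: (subspace0 lgS)|rewrite (lin_on0 lgS dsigma_lin) oppr0].
move=> a X Y [HX sX] [HY sY]; split; first exact: (subspaceL lgS).
by rewrite dsigma_lin// sX sY scalerN opprD.
Qed.

Lemma lh_subspace : is_subspace (lh S).
Proof.
split; first by split; [exact: (subspace0 lgS)|rewrite (lin_on0 lgS dsigma_lin)].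
move=> a X Y [HX sX] [HY sY]; split; first exact: (subspaceL lgS).
by rewrite dsigma_lin// sX sY.
Qed.

Lemma lm_lg X : lm S X -> lg S X. Proof. by case. Qed.
Lemma lh_lg X : lh S X -> lg S X. Proof. by case. Qed.

Lemma lbr_hm X Y : lh S X -> lm S Y -> lm S (lbr X Y).
Proof.
move=> [HX sX] [HY sY]; split; first exact: (lie_lbr hG).
by rewrite dsigma_lbr// sX sY lbrNr.
Qed.

Lemma mpart_lin : lin_on (lg S) (mpart S).
Proof.
move=> a X Y HX HY; rewrite /mpart dsigma_lin//.
by apply/matrixP => i j; rewrite !mxE; ring.
Qed.

Lemma hpart_lin : lin_on (lg S) (hpart S).
Proof.
move=> a X Y HX HY; rewrite /hpart dsigma_lin//.
by apply/matrixP => i j; rewrite !mxE; ring.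
Qed.

Lemma lm_mpart X : lg S X -> lm S (mpart S X).
Proof.
move=> HX; have sX := lg_dsigma HX; split.
  by apply: (subspaceZ lgS) => //; exact: (subspaceB lgS).
rewrite /mpart (lin_onZ lgS _ dsigma_lin); last exact: (subspaceB lgS).
by rewrite (lin_onB lgS dsigma_lin)// dsigma2// -scalerN opprB.
Qed.

Lemma lh_hpart X : lg S X -> lh S (hpart S X).
Proof.
move=> HX; have sX := lg_dsigma HX; split.
  by apply: (subspaceZ lgS) => //; exact: (subspaceD lgS).
rewrite /hpart (lin_onZ lgS _ dsigma_lin); last exact: (subspaceD lgS).
by rewrite (lin_onD dsigma_lin)// dsigma2// addrC.
Qed.

Lemma hpartDmpart X : hpart S X + mpart S X = X.
Proof. by apply/matrixP => i j; rewrite !mxE; field. Qed.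

Lemma mpart_lm X : lm S X -> mpart S X = X.
Proof. by move=> [_ sX]; rewrite /mpart sX; apply/matrixP => i j; rewrite !mxE; field. Qed.

Lemma mpart_lh X : lh S X -> mpart S X = 0.
Proof. by move=> [_ sX]; rewrite /mpart sX subrr scaler0. Qed.

Lemma hpart_lh X : lh S X -> hpart S X = X.
Proof. by move=> [_ sX]; rewrite /hpart sX; apply/matrixP => i j; rewrite !mxE; field. Qed.

Lemma lm_dtau X : lm S X -> lm S (T X).
Proof.
move=> [HX sX]; split; first exact: lg_dtau.
by rewrite /dsigma -/(dsigma S X) sX (lin_onN lgS tL).
Qed.

Lemma dtau2_lm X : lm S X -> T (T X) = - X. Proof. by case. Qed.

Lemma lh_dtau X : lh S X -> lh S (T X).
Proof.
move=> [HX sX]; split; first exact: lg_dtau.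
by rewrite /dsigma -/(dsigma S X) sX.
Qed.

Lemma sH_sG g : sH S g -> sG S g. Proof. by move=> /(hs_H_fix hS)[]. Qed.
Lemma sigma_sH g : sH S g -> sigma S g = g. Proof. by move=> /(hs_H_fix hS)[]. Qed.
Lemma sH_unit g : sH S g -> g \in unitmx.
Proof. by move=> /sH_sG; exact: (group_unit hG). Qed.
Lemma sH1 : sH S 1%:M. Proof. by case: (hs_H hS). Qed.
Lemma sHV g : sH S g -> sH S (invmx g).
Proof. by case: (hs_H hS) => _ _ H /H[]. Qed.

Lemma sigma_expm X (t : R) : lg S X -> sigma S (expm (t *: X)) = expm (t *: dsigma S X).
Proof. by move=> HX; rewrite /sigma !(hs_dtau_exp hS)//; exact: lg_dtau. Qed.

Lemma expm_lh_sH X (t : R) : lh S X -> sH S (expm (t *: X)).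
Proof.
move=> [HX sX]; apply: (hs_H_comp hS).
exists [set expm (s *: X) | s in [set: R]]; last by exists t.
split.
- by exists 0 => //; rewrite scale0r expm0.
- by move=> _ [s _ <-]; split; [exact: HX|rewrite sigma_expm// sX].
- apply: connected_continuous_connected; first exact/connected_intervalP.
  apply: continuous_subspaceT => s; apply/differentiable_continuous/derivable1_diffP.
  by case: (is_derive_expm X s).
Qed.

Lemma dsigma_Ad g X : sH S g -> lg S X -> dsigma S (Ad g X) = Ad g (dsigma S X).
Proof.
move=> Hg HX; rewrite /dsigma dtau_Ad//; last exact: sH_sG.
rewrite dtau_Ad//; first by rewrite -/(sigma S g) sigma_sH.
  exact/(hs_tauG hS)/sH_sG.
exact: lg_dtau.
Qed.

Lemma lm_Ad g X : sH S g -> lm S X -> lm S (Ad g X).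
Proof. by move=> /(hs_H_unitary hS)[_ + _ _]; exact. Qed.
Lemma J_Ad g X : sH S g -> lm S X -> Ad g (J X) = J (Ad g X).
Proof. by move=> /(hs_H_unitary hS)[_ _ + _]; exact. Qed.
Lemma ip_Ad g X Y : sH S g -> lm S X -> lm S Y -> ip S (Ad g X) (Ad g Y) = ip S X Y.
Proof. by move=> /(hs_H_unitary hS)[_ _ _ +]; exact. Qed.

Lemma lm_J X : lm S X -> lm S (J X). Proof. exact: (hs_Jm hS). Qed.

Lemma mpart_Ad g X : sH S g -> lg S X -> mpart S (Ad g X) = Ad g (mpart S X).
Proof.
move=> Hg HX; rewrite /mpart dsigma_Ad//.
by rewrite /Ad -scalemxAr -scalemxAl mulmxBr mulmxBl.
Qed.

Lemma hpart_Ad g X : sH S g -> lg S X -> hpart S (Ad g X) = Ad g (hpart S X).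
Proof.
move=> Hg HX; rewrite /hpart dsigma_Ad//.
by rewrite /Ad -scalemxAr -scalemxAl mulmxDr mulmxDl.
Qed.

Lemma Ad_lbr g X Y : g \in unitmx -> Ad g (lbr X Y) = lbr (Ad g X) (Ad g Y).
Proof.
by move=> ug; rewrite /lbr /Ad mulmxBr mulmxBl !mulmxA !mulmxKV.
Qed.

Lemma AdM g h X : g \in unitmx -> h \in unitmx -> Ad (g *m h) X = Ad g (Ad h X).
Proof.
move=> ug uh; rewrite /Ad; have -> : invmx (g *m h) = invmx h *m invmx g.
  apply: (can_inj (mulKmx (_ : g *m h \in unitmx))); rewrite ?unitmx_mul ?ug//.
  by rewrite mulmxV ?unitmx_mul ?ug ?uh// -mulmxA mulKVmx// mulmxV.
by rewrite !mulmxA.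
Qed.

Lemma Ad_invK g X : g \in unitmx -> Ad g (Ad (invmx g) X) = X.
Proof.
by move=> ug; rewrite -AdM ?unitmx_inv// mulmxV// /Ad invmx1 mulmx1 mul1mx.
Qed.

Lemma lbr_J X Z : lh S X -> lm S Z -> lbr X (J Z) = J (lbr X Z).
Proof.
move=> hX mZ.
have d1 : is_derive (0 : R) 1 (fun t => J (Ad (expm (t *: X)) Z)) (J (lbr X Z)).
  apply: (is_derive_lin_on lm_subspace (f := J)) (is_derive_Ad_expm X Z).
    exact: (hs_J_lin hS).
  by apply: filterE => s; apply: lm_Ad => //; exact: expm_lh_sH.
have E : (fun t : R => J (Ad (expm (t *: X)) Z)) = (fun t => Ad (expm (t *: X)) (J Z)).
  by apply/funext => t; rewrite J_Ad//; exact: expm_lh_sH.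
rewrite E in d1; have [_ E1] := d1.
by have [_ E2] := is_derive_Ad_expm X (J Z); rewrite -E1 E2.
Qed.

Lemma ip_lin Z : lm S Z -> lin_on (lm S) (fun X => ip S X Z : R).
Proof. by move=> mZ a X Y mX mY; rewrite (hs_ip_lin hS). Qed.

Lemma ip_skew X Z W : lh S X -> lm S Z -> lm S W ->
  ip S (lbr X Z) W = - ip S Z (lbr X W).
Proof.
move=> hX mZ mW.
have nX : lh S (- X) by exact: (subspaceN lh_subspace).
have d1 : is_derive (0 : R) 1 (fun t => ip S (Ad (expm (t *: X)) Z) W) (ip S (lbr X Z) W).
  apply: (is_derive_lin_on lm_subspace (f := fun X => ip S X W : R)) (is_derive_Ad_expm X Z).
    exact: ip_lin.
  by apply: filterE => s; apply: lm_Ad => //; exact: expm_lh_sH.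
have d2 : is_derive (0 : R) 1 (fun t => ip S (Ad (expm (t *: - X)) W) Z) (ip S (lbr (- X) W) Z).
  apply: (is_derive_lin_on lm_subspace (f := fun X => ip S X Z : R)) (is_derive_Ad_expm (- X) W).
    exact: ip_lin.
  by apply: filterE => s; apply: lm_Ad => //; exact: expm_lh_sH.
have E : (fun t : R => ip S (Ad (expm (t *: X)) Z) W) = (fun t => ip S (Ad (expm (t *: - X)) W) Z).
  apply/funext => t; have Hn : sH S (expm (t *: - X)) by exact: expm_lh_sH.
  have Hp : sH S (expm (t *: X)) by exact: expm_lh_sH.
  rewrite -(ip_Ad Hn (lm_Ad Hp mZ) mW).
  have -> : Ad (expm (t *: - X)) (Ad (expm (t *: X)) Z) = Z.
    by rewrite scalerN -scaleNr -invmx_expm -{2}[expm (t *: X)]invmxK Ad_invK ?unitmx_inv ?expm_unit.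
  by rewrite (hs_ip_sym hS)//; exact: lm_Ad.
rewrite E in d1; have [_ E1] := d1; have [_ E2] := d2.
rewrite -E1 E2 lbrNl (hs_ip_sym hS)//; last exact/(subspaceN lm_subspace)/lbr_hm.
rewrite (hs_ip_sym hS)//; last exact/(subspaceN lm_subspace)/lbr_hm.
rewrite (lin_onN lm_subspace (ip_lin mZ)); last exact: lbr_hm.
by rewrite (hs_ip_sym hS)//; exact: lbr_hm.
Qed.

End SymmetricSpaceAlgebra.

(** * Hermitian geometry of the tangent space *)

Ltac cplx := apply/eqP; rewrite eq_complex /=; apply/andP; split; apply/eqP.

Lemma ord2P (a : 'I_2) : a = ix \/ a = iy.
Proof.
by case: a => -[|[|//]] i; [left|right]; exact: val_inj.
Qed.

Lemma mx2P (K : nzRingType) (A B : 'M[K]_2) : A ix ix = B ix ix -> A ix iy = B ix iy ->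
  A iy ix = B iy ix -> A iy iy = B iy iy -> A = B.
Proof.
by move=> ? ? ? ?; apply/matrixP => i j; case: (ord2P i) => ->; case: (ord2P j) => ->.
Qed.

Lemma det_mx2 (K : comNzRingType) (A : 'M[K]_2) :
  \det A = A ix ix * A iy iy - A ix iy * A iy ix.
Proof.
rewrite (expand_det_row _ ix) sum2E /cofactor !det_mx11 !mxE/=.
rewrite expr0 mul1r addn1 expr1 mulN1r mulrN; congr (_ * A _ _ - _ * A _ _); exact: val_inj.
Qed.

Section Frame.
Variables (R : realType) (N : nat) (S : sym_data R N).
Hypothesis hS : hermitian_symmetric S.
Implicit Types (X Y Z : 'M[R]_N).
Local Notation T := (dtau S).
Local Notation J := (cJ S).
Let lmS := lm_subspace hS.
Let JL : lin_on (lm S) J := hs_J_lin hS.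
Local Notation e1 := (eps S ix).
Local Notation e2 := (eps S iy).

Lemma lm_eps a : lm S (eps S a). Proof. exact: (hs_epsm hS). Qed.

Lemma lm_jscale c X : lm S X -> lm S (jscale S c X).
Proof.
move=> mX; apply: (subspaceD lmS); apply: (subspaceZ lmS) => //.
exact: (lm_J hS).
Qed.

Lemma JJ X : lm S X -> J (J X) = - X. Proof. exact: (hs_JJ hS). Qed.

Lemma jscaleD c d X : jscale S (c + d) X = jscale S c X + jscale S d X.
Proof. by case: c d => [a b] [c d]; rewrite /jscale/= !scalerDl addrACA. Qed.

Lemma jscaleDr c X Y : lm S X -> lm S Y ->
  jscale S c (X + Y) = jscale S c X + jscale S c Y.
Proof. by move=> mX mY; rewrite /jscale (lin_onD JL)// !scalerDr addrACA. Qed.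

Lemma jscaleA c d X : lm S X -> jscale S c (jscale S d X) = jscale S (c * d) X.
Proof.
move=> mX; case: c d => [a b] [c d]; rewrite /jscale/=.
rewrite (lin_onD JL); try by apply: (subspaceZ lmS) => //; exact: (lm_J hS).
rewrite !(lin_onZ lmS _ JL)//; last exact: (lm_J hS).
by rewrite JJ//; apply/matrixP => i j; rewrite !mxE; ring.
Qed.

Lemma jscale_real (a : R) X : jscale S (Complex a 0) X = a *: X.
Proof. by rewrite /jscale/= scale0r addr0. Qed.

Lemma jscale1 X : jscale S 1 X = X.
Proof. by rewrite /jscale/= scale1r scale0r addr0. Qed.

Lemma jscale0 X : jscale S 0 X = 0.
Proof. by rewrite /jscale/= !scale0r addr0. Qed.

Lemma jscaleN c X : jscale S (- c) X = - jscale S c X.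
Proof. by case: c => a b; rewrite /jscale/= !scaleNr opprD. Qed.

Lemma jscale_J X : jscale S (imu R) X = J X.
Proof. by rewrite /jscale/= scale0r scale1r add0r. Qed.

Lemma ip_sym X Y : lm S X -> lm S Y -> ip S X Y = ip S Y X.
Proof. exact: (hs_ip_sym hS). Qed.

Lemma ip_linr Z : lm S Z -> lin_on (lm S) (fun X => ip S Z X : R).
Proof.
move=> mZ a X Y mX mY; rewrite ip_sym//; last exact: (subspaceL lmS).
by rewrite (hs_ip_lin hS)// ![ip S _ Z]ip_sym.
Qed.

Lemma ip_JN X Y : lm S X -> lm S Y -> ip S (J X) Y = - ip S X (J Y).
Proof.
move=> mX mY; have mJX := lm_J hS mX; have mJY := lm_J hS mY.
by rewrite -(hs_J_ip hS)// JJ// (lin_onN lmS (ip_lin hS mJY)).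
Qed.

(** The Hermitian coordinates of a vector in the reference frame. *)
Definition crd (a : 'I_2) X : R[i] := hform S X (eps S a).

Lemma crd_eps a b : crd a (eps S b) = (b == a)%:R.
Proof. exact: (hs_eps_unitary hS). Qed.

Lemma crdD a X Y : lm S X -> lm S Y -> crd a (X + Y) = crd a X + crd a Y.
Proof.
move=> mX mY; rewrite /crd /hform.
have me := lm_eps a; have mJe := lm_J hS me.
by rewrite (lin_onD (ip_lin hS me))// (lin_onD (ip_lin hS mJe)).
Qed.

Lemma crd_jscale a c X : lm S X -> crd a (jscale S c X) = c * crd a X.
Proof.
move=> mX; case: c => x y; rewrite /crd /hform /jscale/=.
have me := lm_eps a; have mJe := lm_J hS me; have mJX := lm_J hS mX.
rewrite !(ip_lin hS)//; try by apply: (subspaceZ lmS).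
rewrite !(lin_onZ lmS _ (ip_lin hS _))//.
rewrite (hs_J_ip hS)// (ip_JN mX me).
by cplx; rewrite /GRing.scale/=; ring.
Qed.

Lemma crd_frame X : lm S X -> X = jscale S (crd ix X) e1 + jscale S (crd iy X) e2.
Proof.
move=> mX; have [v] := hs_eps_span hS mX; rewrite sum2E => E.
have m1 := lm_eps ix; have m2 := lm_eps iy.
have H a : crd a X = v a.
  rewrite {1}E crdD ?crd_jscale ?crd_eps//; try exact: lm_jscale.
  by case: (ord2P a) => ->; rewrite /= ?mulr1 ?mulr0 ?addr0 ?add0r.
by rewrite !H -E.
Qed.

Lemma ip_jscaler c X Y : lm S X -> lm S Y ->
  ip S X (jscale S c Y) = complex.Re c * ip S X Y + complex.Im c * ip S X (J Y).
Proof.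
move=> mX mY; have mJY := lm_J hS mY; have L := ip_linr mX.
rewrite /jscale (lin_onD L (subspaceZ lmS _ mY) (subspaceZ lmS _ mJY)).
by rewrite (lin_onZ lmS _ L mY) (lin_onZ lmS _ L mJY).
Qed.

Lemma ip_crd X Y : lm S X -> lm S Y ->
  ip S X Y = complex.Re (crd ix X * conjc (crd ix Y) + crd iy X * conjc (crd iy Y)).
Proof.
move=> mX mY; rewrite {1}(crd_frame mY).
have m1 := lm_eps ix; have m2 := lm_eps iy.
rewrite (lin_onD (ip_linr mX) (lm_jscale _ m1) (lm_jscale _ m2)).
rewrite (ip_jscaler _ mX m1) (ip_jscaler _ mX m2).
by rewrite /crd /hform /=; ring.
Qed.

Lemma mxRe_toC X : mxRe (toC X) = X.
Proof. by apply/matrixP => i j; rewrite !mxE. Qed.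
Lemma mxIm_toC X : mxIm (toC X) = 0.
Proof. by apply/matrixP => i j; rewrite !mxE. Qed.
Lemma toC0 : toC (0 : 'M[R]_N) = 0.
Proof. by apply/matrixP => i j; rewrite !mxE. Qed.
Lemma toCN X : toC (- X) = - toC X.
Proof. by apply/matrixP => i j; rewrite !mxE; cplx; rewrite ?oppr0. Qed.
Lemma toC_inj : injective (@toC R N).
Proof. by move=> X Y /(congr1 (@mxRe R N)); rewrite !mxRe_toC. Qed.

Lemma dtauC_toC X : dtauC S (toC X) = toC (T X).
Proof.
rewrite /dtauC mxRe_toC mxIm_toC (lin_on0 (lg_subspace hS) (hs_dtauL hS)).
by rewrite toC0 scaler0 addr0.
Qed.

Lemma imu2 : imu R ^ (2 : int) = -1.
Proof. by rewrite -exprnP expr2; cplx; rewrite /=; ring. Qed.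

Lemma imuM : imu R * imu R = -1.
Proof. by cplx; rewrite /=; ring. Qed.

Lemma imuN1 : imu R ^ (-1 : int) = - imu R.
Proof.
rewrite exprN1.
apply: (@mulfI _ (imu R)); first by apply/eqP => -[] /eqP; rewrite oner_eq0.
rewrite mulrN imuM opprK mulfV//; apply/eqP => -[] /eqP; by rewrite oner_eq0.
Qed.

Lemma lg_0P X : lg_ S 0 X <-> lg S X /\ T X = X.
Proof.
split=> [[HX [_]]|[HX TX]].
  by rewrite dtauC_toC expr0z scale1r => /toC_inj.
split=> //; split; last by rewrite dtauC_toC expr0z scale1r TX.
by split; rewrite ?mxRe_toC ?mxIm_toC//; exact: (subspace0 (lg_subspace hS)).
Qed.

Lemma lg_2P X : lg_ S 2 X <-> lg S X /\ T X = - X.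
Proof.
split=> [[HX [_]]|[HX TX]].
  by rewrite dtauC_toC imu2 scaleN1r -toCN => /toC_inj.
split=> //; split; last by rewrite dtauC_toC imu2 scaleN1r -toCN TX.
by split; rewrite ?mxRe_toC ?mxIm_toC//; exact: (subspace0 (lg_subspace hS)).
Qed.

Lemma dtau_sY : T (sY S) = - sY S.
Proof.
have /lg_2P[] // : lg_ S 2 (sY S).
by rewrite (hs_g2 hS); exists 1 => //; rewrite scale1r.
Qed.

Let adY := lbr (sY S).

Lemma sY_lh : lh S (sY S). Proof. exact: (hs_Yh hS). Qed.

Lemma lm_iter_adY k X : lm S X -> lm S (iter k adY X).
Proof.
by move=> mX; elim: k => [//|k IH]; rewrite iterS; apply: (lbr_hm hS) => //; exact: sY_lh.
Qed.

Lemma dtau_iter_adY k X : lm S X -> T (iter k adY X) = (-1) ^+ k *: iter k adY (T X).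
Proof.
move=> mX; elim: k => [|k IH]; first by rewrite expr0 scale1r.
rewrite iterS {1}/adY (dtau_lbr hS); last exact/lm_lg/lm_iter_adY.
  by rewrite IH dtau_sY lbrNl lbrZr exprS mulN1r scaleNr.
by case: sY_lh.
Qed.

Let coef (k : nat) : R := (pi / 2) ^+ k / k`!%:R.

Lemma dtau_J_series X : lm S X ->
  (fun n : nat => \sum_(k < n) (coef k * (-1) ^+ k) *: iter k adY (T X)) @ \oo --> T (J X).
Proof.
move=> mX; have TL : lin_on (lm S) T.
  by move=> a U V mU mV; apply: (hs_dtauL hS); exact: lm_lg.
have mS n : lm S (\sum_(k < n) coef k *: iter k adY X).
  elim/big_ind: _; [exact: (subspace0 lmS)|exact: (subspaceD lmS)|].
  by move=> k _; apply: (subspaceZ lmS); exact: lm_iter_adY.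
have [_] := cvg_lin_on lmS _ TL mS (hs_expY hS mX).
have -> : (fun n : nat => \sum_(k < n) (coef k * (-1) ^+ k) *: iter k adY (T X))
  = (fun n : nat => T (\sum_(k < n) coef k *: iter k adY X)); last by [].
apply/funext => n; elim: n => [|n IH].
  by rewrite !big_ord0 (lin_on0 lmS TL).
rewrite !big_ord_recr/= IH (lin_onD TL)//; last exact/(subspaceZ lmS)/lm_iter_adY.
by rewrite (lin_onZ lmS _ TL) ?dtau_iter_adY ?scalerA//; exact: lm_iter_adY.
exact: mS.
Qed.

(** As a matrix on vectorized matrices, [ad Y] has an exponential to which the
    results on one-parameter groups apply. *)
Let L := lin_mx adY.
Let adY_linear : linear adY.
Proof. by move=> a U V; rewrite /adY lbrDr lbrZr. Qed.

Lemma mxvec_iter_adY k X : mxvec (iter k adY X) = mxvec X *m (lin_mx adY) ^+ k.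
Proof.
pose adM := GRing.isLinear.Build _ _ _ _ _ adY_linear.
pose ad : {linear 'M[R]_N -> 'M[R]_N} := HB.pack adY adM.
elim: k => [|k IH]; first by rewrite expr0 mulmx1.
have -> : lin_mx adY = lin_mx ad by [].
rewrite iterS exprSr -[_ ^+ k * _]/(_ *m _) mulmxA -IH.
by rewrite -[lin_mx adY]/(lin_mx ad) mul_vec_lin.
Qed.

Lemma mxvec_series (s : R) X Z :
  (fun n : nat => \sum_(k < n) (s ^+ k / k`!%:R) *: iter k adY X) @ \oo --> Z ->
  mxvec Z = mxvec X *m expm (s *: L).
Proof.
move=> H.
have H1 : (fun n : nat => mxvec (\sum_(k < n) (s ^+ k / k`!%:R) *: iter k adY X)) @ \oo --> mxvec Z.
  exact: cvg_linear_mx.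
have H2 : (fun n : nat => mxvec X *m \sum_(k < n) (k`!%:R^-1 *: (s *: L) ^+ k))
    @ \oo --> mxvec X *m expm (s *: L).
  by apply: cvg_mulmxr; exact: expm_cvg.
apply: (cvg_mx_unique _ H1).
have -> : (fun n : nat => mxvec (\sum_(k < n) (s ^+ k / k`!%:R) *: iter k adY X)) =
  (fun n : nat => mxvec X *m \sum_(k < n) (k`!%:R^-1 *: (s *: L) ^+ k)); last by [].
apply/funext => n; rewrite mulmx_sumr linear_sum; apply: eq_bigr => k _.
rewrite expr_mxZ linearZ/= mxvec_iter_adY -!scalemxAr scalerA.
by rewrite [_ * _ in RHS]mulrC.
Qed.

(** The automorphism changes the sign of [Y].  Hence it carries [exp (pi/2 ad Y)],
    which is [J], to the inverse, which is [- J]. *)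
Lemma dtau_J X : lm S X -> T (J X) = - J (T X).
Proof.
move=> mX; have mTX := lm_dtau hS mX.
apply: (can_inj mxvecK).
have E1 := mxvec_series (hs_expY hS mTX).
have E2 := mxvec_series (hs_expY hS (lm_J hS mTX)).
rewrite JJ// E1 -mulmxA in E2.
have E3 : mxvec (T (J X)) = mxvec (T X) *m expm (- (pi / 2) *: L).
  apply: mxvec_series.
  rewrite (_ : (fun _ => _) =
    (fun n : nat => \sum_(k < n) (coef k * (-1) ^+ k) *: iter k adY (T X))).
    exact: dtau_J_series.
  apply/funext => n; apply: eq_bigr => k _; congr (_ *: _).
  by rewrite /coef (exprNn (pi / 2)) [RHS]mulrC mulrA.
rewrite E3 linearN/= E1 -invmx_expm.
have uL := expm_unit ((pi / 2) *: L).
apply: (canLR (mulmxK uL)).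
by rewrite mulNmx -mulmxA -E2 linearN opprK.
Qed.

Lemma dtau_lm_lin : lin_on (lm S) T.
Proof. by move=> a U V mU mV; apply: (hs_dtauL hS); exact: lm_lg. Qed.

Lemma dtau_jscale c X : lm S X -> T (jscale S c X) = jscale S (conjc c) (T X).
Proof.
move=> mX; case: c => a b; rewrite /jscale/=.
have mJX := lm_J hS mX; have TL := dtau_lm_lin.
rewrite (lin_onD TL (subspaceZ lmS _ mX) (subspaceZ lmS _ mJX)).
by rewrite (lin_onZ lmS _ TL mX) (lin_onZ lmS _ TL mJX) dtau_J// scalerN scaleNr.
Qed.

Lemma mxRe_ReIm X Y : mxRe (toC X + imu R *: toC Y) = X.
Proof. by apply/matrixP => i j; rewrite !mxE/=; ring. Qed.
Lemma mxIm_ReIm X Y : mxIm (toC X + imu R *: toC Y) = Y.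
Proof. by apply/matrixP => i j; rewrite !mxE/=; ring. Qed.

Lemma dtauC_ReIm X Y :
  dtauC S (toC X + imu R *: toC Y) = toC (T X) + imu R *: toC (T Y).
Proof. by rewrite /dtauC mxRe_ReIm mxIm_ReIm. Qed.

Lemma toC_ReIm_inj X Y X' Y' :
  toC X + imu R *: toC Y = toC X' + imu R *: toC Y' -> X = X' /\ Y = Y'.
Proof.
move=> E; split; first by rewrite -(mxRe_ReIm X Y) E mxRe_ReIm.
by rewrite -(mxIm_ReIm X Y) E mxIm_ReIm.
Qed.

Lemma dtau_eps : T e1 = - e2 /\ T e2 = e1.
Proof.
have [_] := hs_epsilon hS.
have -> : 2^-1 *: (toC e1 - imu R *: toC e2) =
    toC (2^-1 *: e1) + imu R *: toC (- (2^-1 *: e2)).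
  apply/matrixP => i j; rewrite !mxE.
  have -> : (2^-1 : R[i]) = Complex 2^-1 0.
    apply: (@mulfI _ 2); first by rewrite pnatr_eq0.
    by rewrite mulfV ?pnatr_eq0//; cplx; rewrite /=; field.
  by cplx; rewrite /=; ring.
have m1 := lm_eps ix; have m2 := lm_eps iy; have TL := dtau_lm_lin.
rewrite dtauC_ReIm imuN1; set r := (X in _ = X).
have -> : r = toC (- (2^-1 *: e2)) + imu R *: toC (- (2^-1 *: e1)).
  by rewrite /r; apply/matrixP => i j; rewrite !mxE; cplx; rewrite /=; ring.
move=> /toC_ReIm_inj[]; rewrite (lin_onN lmS TL (subspaceZ lmS _ m2)).
rewrite (lin_onZ lmS _ TL m1) (lin_onZ lmS _ TL m2).
have h2 : (2^-1 : R) != 0 by rewrite invr_eq0 pnatr_eq0.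
by move=> H1 /oppr_inj H2; split; apply: (scalerI h2) => //; rewrite scalerN.
Qed.

Lemma ip_dtau X Y : lm S X -> lm S Y -> ip S (T X) (T Y) = ip S X Y.
Proof. exact: (hs_tau_isom hS). Qed.

(** On [m], the automorphism [T] is an isometry with [T^2 = -1] that anticommutes with
    [J]: a quaternionic structure.  So [X] and [- T X] are orthogonal, of the same
    length, and span a Lagrangian plane. *)
Lemma primitive_geometry X : lm S X ->
  [/\ omega S X (- T X) = 0, ip S X (- T X) = 0 & ip S (- T X) (- T X) = ip S X X].
Proof.
move=> mX; have mTX := lm_dtau hS mX; have mJX := lm_J hS mX.
have mJTX := lm_J hS mTX; have mNTX := subspaceN lmS mTX.
have nr Y : lm S Y -> lin_on (lm S) (fun X => ip S Y X : R) by exact: ip_linr.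
have nl Y : lm S Y -> lin_on (lm S) (fun X => ip S X Y : R) by exact: ip_lin.
split.
- rewrite /omega (lin_onN lmS (nr _ mJX) mTX).
  have := ip_dtau mJX mTX; rewrite dtau_J// dtau2_lm//.
  rewrite (lin_onN lmS (nr _ (subspaceN lmS mJTX)) mX) (lin_onN lmS (nl _ mX) mJTX) opprK.
  rewrite (ip_JN mTX mX) (ip_sym mTX mJX); lra.
- rewrite (lin_onN lmS (nr _ mX) mTX).
  have := ip_dtau mX mTX; rewrite dtau2_lm//.
  rewrite (lin_onN lmS (nr _ mTX) mX) (ip_sym mTX mX); lra.
- by rewrite (lin_onN lmS (nr _ mNTX) mTX) (lin_onN lmS (nl _ mTX) mTX) opprK ip_dtau.
Qed.

Lemma lbr_jscale X c Z : lh S X -> lm S Z ->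
  lbr X (jscale S c Z) = jscale S c (lbr X Z).
Proof. by move=> hX mZ; rewrite /jscale lbrDr !lbrZr (lbr_J hS). Qed.

(** As a skew-Hermitian map, [ad X] has a purely imaginary trace on [m]; this is
    its imaginary part. *)
Definition theta X : R := ip S (lbr X e1) (J e1) + ip S (lbr X e2) (J e2).

Lemma theta_lin : lin_on (lh S) (theta : 'M[R]_N -> R^o).
Proof.
move=> a X Y hX hY; rewrite /theta !lbrDl !lbrZl.
have m1 := lm_eps ix; have m2 := lm_eps iy.
have J1 := lm_J hS m1; have J2 := lm_J hS m2.
rewrite (ip_lin hS J1 _ (lbr_hm hS hX m1) (lbr_hm hS hY m1)).
rewrite (ip_lin hS J2 _ (lbr_hm hS hX m2) (lbr_hm hS hY m2)).
by rewrite /GRing.scale/=; ring.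
Qed.

Lemma ip_skew0 X Z : lh S X -> lm S Z -> ip S (lbr X Z) Z = 0.
Proof.
move=> hX mZ; have mXZ := lbr_hm hS hX mZ.
have := ip_skew hS hX mZ mZ; rewrite (ip_sym mZ mXZ); lra.
Qed.

Lemma trace_theta X : lh S X ->
  crd ix (lbr X e1) + crd iy (lbr X e2) = Complex 0 (theta X).
Proof.
move=> hX; rewrite /crd /hform; cplx; last by [].
by rewrite (ip_skew0 hX (lm_eps ix)) (ip_skew0 hX (lm_eps iy)) addr0.
Qed.

(** A complex alternating bilinear form on [m] is a multiple of the determinant in
    the reference frame. *)
Lemma alternating_det (w : 'M[R]_N -> 'M[R]_N -> R[i]) X Y :
  (forall c X X' Y, lm S X -> lm S X' -> lm S Y ->
     w (jscale S c X + X') Y = c * w X Y + w X' Y) ->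
  (forall X Y, lm S X -> lm S Y -> w Y X = - w X Y) ->
  lm S X -> lm S Y ->
  w X Y = (crd ix X * crd iy Y - crd iy X * crd ix Y) * w e1 e2.
Proof.
move=> wL wA mX mY.
have m1 := lm_eps ix; have m2 := lm_eps iy.
have w0 Z : lm S Z -> w 0 Z = 0.
  move=> mZ; have := wL 1 0 0 Z (subspace0 lmS) (subspace0 lmS) mZ.
  by rewrite jscale1 addr0 mul1r => /eqP; rewrite -[X in X == _]addr0 (inj_eq (addrI _)) eq_sym => /eqP.
have wl c d Z : lm S Z -> w (jscale S c e1 + jscale S d e2) Z = c * w e1 Z + d * w e2 Z.
  move=> mZ; rewrite wL//; last exact: lm_jscale.
  by rewrite -[jscale S d e2]addr0 wL// ?w0 ?addr0//; exact: (subspace0 lmS).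
have wxx Z : lm S Z -> w Z Z = 0.
  by move=> mZ; have /eqP := wA Z Z mZ mZ; rewrite -addr_eq0 -mulr2n mulrn_eq0/= => /eqP.
rewrite {1}(crd_frame mX) wl// (wA Y e1)// (wA Y e2)// {1 2}(crd_frame mY) !wl//.
by rewrite !wxx// (wA e1 e2)//; ring.
Qed.

(** The derivative of the determinant is the trace. *)
Lemma alternating_trace (w : 'M[R]_N -> 'M[R]_N -> R[i]) A X Y :
  (forall c X X' Y, lm S X -> lm S X' -> lm S Y ->
     w (jscale S c X + X') Y = c * w X Y + w X' Y) ->
  (forall X Y, lm S X -> lm S Y -> w Y X = - w X Y) ->
  lh S A -> lm S X -> lm S Y ->
  w (lbr A X) Y + w X (lbr A Y) = Complex 0 (theta A) * w X Y.
Proof.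
move=> wL wA hA mX mY.
have m1 := lm_eps ix; have m2 := lm_eps iy.
have mAX := lbr_hm hS hA mX; have mAY := lbr_hm hS hA mY.
have mA1 := lbr_hm hS hA m1; have mA2 := lbr_hm hS hA m2.
have E a Z : lm S Z -> crd a (lbr A Z) = crd ix Z * crd a (lbr A e1) + crd iy Z * crd a (lbr A e2).
  move=> mZ; rewrite {1}(crd_frame mZ) lbrDr !lbr_jscale//.
  by rewrite crdD ?crd_jscale//; exact: lm_jscale.
rewrite (alternating_det wL wA mAX mY) (alternating_det wL wA mX mAY) (alternating_det wL wA mX mY).
rewrite -(trace_theta hA) (E ix X mX) (E iy X mX) (E ix Y mY) (E iy Y mY).
move: (crd ix _) (crd iy _) (crd ix _) (crd iy _) => a b c d.
by move: (crd ix _) (crd iy _) (crd ix _) (crd iy _) => a' b' c' d'; ring.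
Qed.

End Frame.

(** * The trace of the isotropy group, and special unitary frames *)

Section Trace.
Variables (R : realType) (N : nat) (S : sym_data R N).
Hypothesis hS : hermitian_symmetric S.
Implicit Types (X Y Z : 'M[R]_N).
Local Notation T := (dtau S).
Local Notation J := (cJ S).
Let lmS := lm_subspace hS.
Local Notation e1 := (eps S ix).
Local Notation e2 := (eps S iy).
Let m1 : lm S e1 := lm_eps hS ix.
Let m2 : lm S e2 := lm_eps hS iy.
Let J1 : lm S (J e1) := lm_J hS m1.
Let J2 : lm S (J e2) := lm_J hS m2.

Lemma ip_eps : [/\ ip S e1 e1 = 1, ip S e2 e2 = 1, ip S e1 e2 = 0 &
  [/\ ip S e2 e1 = 0, ip S e1 (J e1) = 0, ip S e2 (J e2) = 0, ip S e1 (J e2) = 0 &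
      ip S e2 (J e1) = 0]].
Proof.
have H a b := hs_eps_unitary hS a b.
have H11 := H ix ix; have H12 := H ix iy; have H21 := H iy ix; have H22 := H iy iy.
by case: H11 H12 H21 H22; rewrite /= => -> -> [-> ->] [-> ->] [-> ->].
Qed.

(** The group fixed by the automorphism acts on [m] with determinant 1, so that its
    Lie algebra acts with trace 0. *)
Lemma theta_fixed X : lh S X -> T X = X -> theta S X = 0.
Proof.
move=> hX TX; have HX := lh_lg hX.
pose A t := Ad (expm (t *: X)).
pose x a b (t : R) := ip S (A t (eps S b)) (eps S a).
pose y a b (t : R) := ip S (A t (eps S b)) (J (eps S a)).
have me a : lm S (eps S a) by exact: lm_eps.
have mJe a : lm S (J (eps S a)) by exact: (lm_J hS).
have mA b (t : R) : lm S (A t (eps S b)) by apply: (lm_Ad hS) => //; exact: (expm_lh_sH hS).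
have dA b Z : lm S Z ->
    is_derive (0 : R) 1 (fun t => ip S (A t (eps S b)) Z) (ip S (lbr X (eps S b)) Z).
  move=> mZ; apply: (is_derive_lin_on lmS (f := fun X => ip S X Z : R)) (is_derive_Ad_expm X (eps S b)).
    exact: ip_lin.
  by apply: filterE => s; exact: mA.
(* the imaginary part of the determinant vanishes along the one-parameter group *)
have det1 t : x ix ix t * y iy iy t + y ix ix t * x iy iy t
    - (x ix iy t * y iy ix t + y ix iy t * x iy ix t) = 0.
  have Gt : sG S (expm (t *: X)) by exact: HX.
  have [|_] := hs_G0 hS Gt; first by rewrite (hs_dtau_exp hS)// TX.
  rewrite det_mx2 !mxE /hform -/(A t) => /(congr1 (@complex.Im R)) /= E.
  by rewrite -[RHS]E /x /y; ring.
have A0 b : A 0 (eps S b) = eps S b.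
  by rewrite /A /Ad scale0r expm0 invmx1 mul1mx mulmx1.
have dx a b := dA b _ (me a); have dy a b := dA b _ (mJe a).
have D1 := is_derive_mulR (dx ix ix) (dy iy iy).
have D2 := is_derive_mulR (dy ix ix) (dx iy iy).
have D3 := is_derive_mulR (dx ix iy) (dy iy ix).
have D4 := is_derive_mulR (dy ix iy) (dx iy ix).
have D := is_deriveB (is_deriveD D1 D2) (is_deriveD D3 D4).
have E0 : (fun t => x ix ix t * y iy iy t) + (fun t => y ix ix t * x iy iy t)
  - ((fun t => x ix iy t * y iy ix t) + (fun t => y ix iy t * x iy ix t)) = cst 0.
  by apply/funext => t; exact: det1.
have [_ D'] := D.
have := is_derive_cst (0 : R) (0 : R) 1 => -[_ D0].
have [q1 q2 q3 [q4 q5 q6 q7 q8]] := ip_eps.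
move: D'; rewrite [X in 'D__ X _]E0 D0 !A0 q1 q2 q3 q4 q5 q6 q7 q8 /theta => H.
by rewrite -[RHS]/(0 : R) [RHS]H; ring.
Qed.

Let adY := lbr (sY S).

Let skew_off X : lh S X ->
  crd S iy (lbr X e1) = - conjc (crd S ix (lbr X e2)).
Proof.
move=> hX; have mX1 := lbr_hm hS hX m1; have mX2 := lbr_hm hS hX m2.
rewrite /crd /hform; cplx.
  by rewrite (ip_skew hS hX m1 m2) (ip_sym hS m1 mX2).
rewrite (ip_skew hS hX m1 J2) (lbr_J hS hX m2).
by rewrite -(ip_JN hS m1 mX2) (ip_sym hS J1 mX2) opprK.
Qed.

(** Were this trace zero, [ad Y] would be a traceless skew-Hermitian matrix of size
    two, with a negative scalar as its square.  All its powers would then have traces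
    without imaginary part, and so would the sum [J] of the exponential series, whose
    trace is [2i]. *)
Lemma theta_sY : theta S (sY S) != 0.
Proof.
apply/eqP => th0; have hY := sY_lh hS.
pose p := crd S ix (adY e1); pose q := crd S ix (adY e2).
pose r := crd S iy (adY e1); pose s := crd S iy (adY e2).
have mY1 : lm S (adY e1) := lbr_hm hS hY m1.
have mY2 : lm S (adY e2) := lbr_hm hS hY m2.
have rE : r = - conjc q := skew_off hY.
have sE : s = - p.
  by apply/eqP; rewrite -addr_eq0 addrC /p /s (trace_theta hS hY) th0.
have pRe : complex.Re p = 0 by exact: (ip_skew0 hS hY m1).
(* the square of [ad Y] is the scalar [- d] *)
pose d := (complex.Im p) ^+ 2 + (complex.Re q) ^+ 2 + (complex.Im q) ^+ 2.
have dE : p * p + r * q = Complex (- d) 0.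
  have G (P Q : R[i]) : complex.Re P = 0 -> P * P + - conjc Q * Q =
      Complex (- (complex.Im P ^+ 2 + complex.Re Q ^+ 2 + complex.Im Q ^+ 2)) 0.
    by case: P Q => p1 p2 [q1 q2] /= ->; cplx; rewrite /=; ring.
  by rewrite rE G.
have adj c Z : lm S Z -> adY (jscale S c Z) = jscale S c (adY Z).
  by move=> mZ; exact: (lbr_jscale hS).
have F1 : adY e1 = jscale S p e1 + jscale S r e2 by exact: (crd_frame hS mY1).
have F2 : adY e2 = jscale S q e1 + jscale S s e2 by exact: (crd_frame hS mY2).
have adD Z Z' : adY (Z + Z') = adY Z + adY Z' by rewrite /adY lbrDr.
have lin2 c a b : jscale S c (jscale S a e1 + jscale S b e2) =
    jscale S (c * a) e1 + jscale S (c * b) e2.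
  rewrite (jscaleDr hS c (lm_jscale hS a m1) (lm_jscale hS b m2)).
  by rewrite (jscaleA hS c a m1) (jscaleA hS c b m2).
have E1 : adY (adY e1) = - d *: e1.
  rewrite F1 adD !adj// F1 F2 (lin2 p) (lin2 r).
  by rewrite addrACA -!jscaleD dE jscale_real sE mulrN [r * p]mulrC addrN jscale0 addr0.
have E2 : adY (adY e2) = - d *: e2.
  rewrite F2 adD !adj// F1 F2 (lin2 q) (lin2 s).
  rewrite addrACA -!jscaleD sE mulNr [q * p]mulrC addrN jscale0 add0r.
  by rewrite mulrNN addrC [q * r]mulrC dE jscale_real.
have iterZ k (c : R) Z : iter k adY (c *: Z) = c *: iter k adY Z.
  by elim: k => // k IH; rewrite !iterS IH /adY lbrZr.
have tr0 k : ip S (iter k adY e1) (J e1) + ip S (iter k adY e2) (J e2) = 0.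
  have [m] := ubnP k; elim: m k => // m IH [|[|k]] km.
  - by have [_ _ _ [_ q5 q6 _ _]] := ip_eps; rewrite /= q5 q6 addr0.
  - exact: th0.
  - rewrite !iterSr E1 E2 !iterZ.
    rewrite (lin_onZ lmS _ (ip_lin hS J1)); last exact: (lm_iter_adY hS).
    rewrite (lin_onZ lmS _ (ip_lin hS J2)); last exact: (lm_iter_adY hS).
    by rewrite -scalerDr IH ?scaler0//; rewrite ltnS in km; rewrite (leq_trans _ km).
pose sm (Z : 'M[R]_N) (n : nat) := \sum_(k < n) ((pi / 2) ^+ k / k`!%:R) *: iter k adY Z.
have msm Z n : lm S Z -> lm S (sm Z n).
  move=> mZ; rewrite /sm; elim/big_ind: _; [exact: (subspace0 lmS)|exact: (subspaceD lmS)|].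
  by move=> k _; apply: (subspaceZ lmS); exact: (lm_iter_adY hS).
have [_ c1] := cvg_lin_on lmS _ (ip_lin hS J1) (fun n => msm e1 n m1) (hs_expY hS m1).
have [_ c2] := cvg_lin_on lmS _ (ip_lin hS J2) (fun n => msm e2 n m2) (hs_expY hS m2).
have sm0 n : ip S (sm e1 n) (J e1) + ip S (sm e2 n) (J e2) = 0.
  rewrite /sm; elim: n => [|n IH].
    by rewrite !big_ord0 (lin_on0 lmS (ip_lin hS J1)) (lin_on0 lmS (ip_lin hS J2)) addr0.
  rewrite !big_ord_recr/=.
  rewrite (lin_onD (ip_lin hS J1)); [|exact: (msm e1 n m1)|exact/(subspaceZ lmS)/(lm_iter_adY hS)].
  rewrite (lin_onD (ip_lin hS J2)); [|exact: (msm e2 n m2)|exact/(subspaceZ lmS)/(lm_iter_adY hS)].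
  rewrite addrACA IH add0r.
  rewrite (lin_onZ lmS _ (ip_lin hS J1)); last exact: (lm_iter_adY hS).
  rewrite (lin_onZ lmS _ (ip_lin hS J2)); last exact: (lm_iter_adY hS).
  by rewrite -scalerDr tr0 scaler0.
have c3 : (fun n : nat => ip S (sm e1 n) (J e1) + ip S (sm e2 n) (J e2)) @ \oo
    --> ip S (J e1) (J e1) + ip S (J e2) (J e2) by exact: (cvgD c1 c2).
have E0 : (fun n : nat => ip S (sm e1 n) (J e1) + ip S (sm e2 n) (J e2)) = (fun=> 0).
  by apply/funext => n; exact: sm0.
rewrite E0 !(hs_J_ip hS)// in c3; have [q1 q2 _ _] := ip_eps; rewrite q1 q2 in c3.
have := cvg_lim (@Rhausdorff R) c3; rewrite (lim_cst (@Rhausdorff R)).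
by move=> /(_ _)/eqP; rewrite eq_sym -mulr2n pnatr_eq0.
Qed.

Lemma SU2_col (U : 'M[R[i]]_2) : SU2 U ->
  U ix iy = - conjc (U iy ix) /\ U iy iy = conjc (U ix ix).
Proof.
move=> [UU]; rewrite det_mx2.
have M a b : U a ix * conjc (U b ix) + U a iy * conjc (U b iy) = (a == b)%:R.
  by have /matrixP/(_ a b) := UU; rewrite !mxE sum2E !mxE.
have := M ix ix; have := M ix iy; have := M iy ix; have := M iy iy.
rewrite /=; set a := U ix ix; set b := U ix iy; set c := U iy ix; set d := U iy iy.
move=> h1 h2 h3 h4 D.
have H1 : conjc a = d.
  rewrite -[LHS]mulr1 -D.
  have -> : conjc a * (a * d - b * c) = d * (a * conjc a + b * conjc b)
    - b * (c * conjc a + d * conjc b) by ring.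
  by rewrite h2 h4 mulr1 mulr0 subr0.
have H2 : conjc c = - b.
  rewrite -[LHS]mulr1 -D.
  have -> : conjc c * (a * d - b * c) = d * (a * conjc c + b * conjc d)
    - b * (c * conjc c + d * conjc d) by ring.
  by rewrite h3 h1 mulr1 mulr0 sub0r.
by rewrite H1 H2 opprK.
Qed.

(** The matrices of [SU(2)] are those unitary matrices that commute with the quaternionic
    structure, which maps the first vector of the reference frame to the opposite of
    the second. *)
Lemma SU2_frame_primitive (U : 'M[R[i]]_2) X Y : SU2 U ->
  X = \sum_k jscale S (U k ix) (eps S k) -> Y = \sum_k jscale S (U k iy) (eps S k) ->
  Y = - T X.
Proof.
move=> /SU2_col[H1 H2] -> ->; rewrite !sum2E H1 H2.
rewrite (lin_onD (dtau_lm_lin hS)); try exact: (lm_jscale hS).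
have [t1 t2] := dtau_eps hS.
rewrite !(dtau_jscale hS)// t1 t2 jscaleN.
rewrite [RHS]opprD [RHS]addrC; congr (_ + _).
have -> : - e2 = jscale S (-1) e2 by rewrite jscaleN jscale1.
by rewrite (jscaleA hS)// mulrN1 jscaleN opprK.
Qed.

(** The coordinates of the normalized first vector are the first column of a matrix of
    [SU(2)], which determines the second. *)
Lemma primitive_SU2_frame X Y : lm S X -> Y = - T X -> X <> 0 ->
  exists2 U, SU2 U &
    (Num.sqrt (ip S X X))^-1 *: X = \sum_k jscale S (U k ix) (eps S k) /\
    (Num.sqrt (ip S X X))^-1 *: Y = \sum_k jscale S (U k iy) (eps S k).
Proof.
move=> mX -> X0; have r0 := hs_ip_pos hS mX X0.
set c := (Num.sqrt _)^-1.
have c2 : c * c * ip S X X = 1.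
  by rewrite /c -invfM -expr2 sqr_sqrtr ?(ltW r0)// mulVf// gt_eqF.
have mcX : lm S (c *: X) by exact: (subspaceZ lmS).
have [a Ea] : exists a, crd S ix (c *: X) = a by eexists.
have [b Eb] : exists b, crd S iy (c *: X) = b by eexists.
have [U [Uxx Uyx Uxy Uyy]] : exists U : 'M[R[i]]_2,
    [/\ U ix ix = a, U iy ix = b, U ix iy = - conjc b & U iy iy = conjc a].
  exists (\matrix_(k, j)
    if j == ix then (if k == ix then a else b) else (if k == ix then - conjc b else conjc a)).
  by split; rewrite mxE.
have ab : a * conjc a + b * conjc b = 1.
  have : ip S (c *: X) (c *: X) = 1.
    rewrite (lin_onZ lmS _ (ip_lin hS mcX) mX) (lin_onZ lmS _ (ip_linr hS mX) mX).
    by rewrite /GRing.scale/= mulrA c2.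
  rewrite (ip_crd hS mcX mcX) Ea Eb; case: (a) => a1 a2; case: (b) => b1 b2 /= H.
  by cplx; rewrite /= -?[RHS]H; ring.
have cN : lm S (c *: T X) by exact/(subspaceZ lmS)/(lm_dtau hS).
exists U.
  split; last first.
    by rewrite det_mx2 Uxx Uyx Uxy Uyy -ab; ring.
  have M i j : (U *m (map_mx conjc U)^T) i j = U i ix * conjc (U j ix) + U i iy * conjc (U j iy).
    by rewrite mxE sum2E !mxE.
  apply: mx2P; rewrite M mxE ?Uxx ?Uyx ?Uxy ?Uyy /= ?rmorphN/= ?conjcK.
  - by rewrite -ab; ring.
  - by ring.
  - by ring.
  - by rewrite -ab; ring.
rewrite !sum2E Uxx Uyx Uxy Uyy; split; first by rewrite {1}(crd_frame hS mcX) Ea Eb.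
have -> : c *: - T X = - T (c *: X).
  by rewrite (lin_onZ lmS _ (dtau_lm_lin hS) mX) scalerN.
have [t1 t2] := dtau_eps hS.
rewrite {1}(crd_frame hS mcX) Ea Eb.
rewrite (lin_onD (dtau_lm_lin hS)); try exact: (lm_jscale hS).
rewrite !(dtau_jscale hS)// t1 t2 jscaleN [LHS]opprD [LHS]addrC; congr (_ + _).
have -> : - e2 = jscale S (-1) e2 by rewrite jscaleN jscale1.
by rewrite (jscaleA hS)// mulrN1 jscaleN opprK.
Qed.

End Trace.

(** * Differential calculus in the plane *)

Section PlaneCalculus.
Variable R : realType.
Local Notation plane := (R * R)%type.

Lemma nbhs_planeP (z : plane) (P : set plane) :
  nbhs z P <-> exists2 d : R, 0 < d &
    forall w : plane, `|w.1 - z.1| < d -> `|w.2 - z.2| < d -> P w.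
Proof.
split=> [/nbhs_ballP[d /= d0 H]|[d d0 H]].
  exists d => // w w1 w2; apply: H; split; rewrite /ball/= distrC//.
apply/nbhs_ballP; exists d => //= w [w1 w2].
by apply: H; rewrite distrC.
Qed.

Lemma pair_ext (p q : plane) : p.1 = q.1 -> p.2 = q.2 -> p = q.
Proof. by case: p q => ? ? [? ?] /= -> ->. Qed.

Lemma is_derive_scale (t c : R) : is_derive t 1 (fun s : R => s * c) c.
Proof.
have H : is_derive t 1 (fun s : R => id s * cst c s) (1 * c + t * 0).
  by apply: is_derive_mulR.
by rewrite mul1r mulr0 addr0 in H.
Qed.

Lemma dvec_ix (t : R) (z : plane) : t *: dvec R ix + z = (t + z.1, z.2).
Proof.
by apply: pair_ext; rewrite /dvec /= /GRing.scale/= ?mulr1 ?mulr0 ?add0r.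
Qed.

Lemma dvec_iy (t : R) (z : plane) : t *: dvec R iy + z = (z.1, t + z.2).
Proof.
by apply: pair_ext; rewrite /dvec /= /GRing.scale/= ?mulr1 ?mulr0 ?add0r.
Qed.

Lemma is_derive_ix (W : normedModType R) (f : plane -> W) (x y : R) (D : W) :
  is_derive (x, y) (dvec R ix) f D <-> is_derive x 1 (fun s => f (s, y)) D.
Proof.
have := is_derive_line f (0, y) (dvec R ix) x D.
rewrite dvec_ix /= addr0 => ->.
have -> // : (fun s => f (s *: dvec R ix + (0, y))) = (fun s => f (s, y)).
by apply/funext => s; rewrite dvec_ix/= addr0.
Qed.

Lemma is_derive_iy (W : normedModType R) (f : plane -> W) (x y : R) (D : W) :
  is_derive (x, y) (dvec R iy) f D <-> is_derive y 1 (fun s => f (x, s)) D.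
Proof.
have := is_derive_line f (x, 0) (dvec R iy) y D.
rewrite dvec_iy /= addr0 => ->.
have -> // : (fun s => f (s *: dvec R iy + (x, 0))) = (fun s => f (x, s)).
by apply/funext => s; rewrite dvec_iy/= addr0.
Qed.

Lemma remainder_is_derive (W : normedModType R) (f : R -> W) (t : R) (D : W) :
  (forall e, 0 < e -> exists2 d, 0 < d & forall s, `|s - t| < d ->
     `|f s - f t - (s - t) *: D| <= e * `|s - t|) ->
  is_derive t 1 f D.
Proof.
move=> H.
suff L : (fun h : R => h^-1 *: ((f \o shift t) (h *: 1) - f t)) @ 0^' --> D.
  by split; [apply/cvg_ex; exists D|exact/cvg_lim].
apply/cvgrPdist_le => e e0; have [d d0 Hd] := H e e0.
exists d => //= h; rewrite /= sub0r normrN => hd h0.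
have := Hd (h + t); rewrite addrK => /(_ hd) Hh.
rewrite [h *: 1]mulr1 distrC.
have -> : h^-1 *: (f (h + t) - f t) - D = h^-1 *: (f (h + t) - f t - h *: D).
  by rewrite [in RHS]scalerBr scalerA mulVf// scale1r.
by rewrite normrZ normfV ler_pdivrMl ?normr_gt0// mulrC.
Qed.

Lemma mvt_boundR (f f' : R -> R) (a b K : R) : 0 <= K ->
  (forall t, Num.min a b <= t <= Num.max a b -> is_derive t 1 f (f' t)) ->
  (forall t, Num.min a b <= t <= Num.max a b -> `|f' t| <= K) ->
  `|f b - f a| <= K * `|b - a|.
Proof.
move=> K0 df bf; have := @mvt_bound R 1 1 (fun t => const_mx (f t)) (fun t => const_mx (f' t)) a b K K0.
move=> H; apply: le_trans (H _ _).
- have -> : f b - f a = (const_mx (f b) - const_mx (f a) : 'M[R]_1) 0 0 by rewrite !mxE.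
  exact: mx_entry_le.
- move=> t tab; apply/is_derive_mxP => i j; rewrite mxE.
  by rewrite (_ : (fun _ => _) = f); [exact: df|apply/funext => s; rewrite mxE].
- by move=> t tab; apply: mx_norm_le => // i j; rewrite mxE; exact: bf.
Qed.

(** The mean value theorem along a horizontal, then along a vertical segment. *)
Lemma C1_remainder (f fx fy : plane -> R) (z : plane) (e : R) : 0 < e ->
  (\forall w \near z, is_derive w (dvec R ix) f (fx w) /\ is_derive w (dvec R iy) f (fy w)) ->
  {for z, continuous fx} -> {for z, continuous fy} ->
  exists2 d, 0 < d & forall w : plane, `|w.1 - z.1| < d -> `|w.2 - z.2| < d ->
    `|f w - f z - (w.1 - z.1) * fx z - (w.2 - z.2) * fy z|
      <= e * (`|w.1 - z.1| + `|w.2 - z.2|).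
Proof.
move=> e0 df cx cy.
have [d1 d10 H1] := (nbhs_planeP _ _).1 df.
move/cvgrPdist_le: cx => /(_ _ e0)/nbhs_planeP[d2 d20 H2].
move/cvgrPdist_le: cy => /(_ _ e0)/nbhs_planeP[d3 d30 H3].
exists (Num.min d1 (Num.min d2 d3)); first by rewrite !lt_min d10 d20.
move=> w; rewrite !lt_min => /and3P[a1 a2 a3] /and3P[b1 b2 b3].
have seg (a b t d : R) : `|b - a| < d -> Num.min a b <= t <= Num.max a b -> `|t - a| < d.
  have [ab|/ltW ba] := leP a b; move=> bad /andP[t1 t2].
    by rewrite ger0_norm ?subr_ge0// (le_lt_trans _ bad)// ger0_norm ?subr_ge0// lerD2r.
  rewrite distrC ger0_norm ?subr_ge0// (le_lt_trans _ bad)// distrC.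
  by rewrite ger0_norm ?subr_ge0// lerD2l lerN2.
have -> : f w - f z - (w.1 - z.1) * fx z - (w.2 - z.2) * fy z =
   ((f (w.1, w.2) - w.1 * fx z) - (f (z.1, w.2) - z.1 * fx z))
   + ((f (z.1, w.2) - w.2 * fy z) - (f (z.1, z.2) - z.2 * fy z)).
  by rewrite -!surjective_pairing; ring.
rewrite (le_trans (ler_normD _ _))// mulrDr lerD//.
- apply: (@mvt_boundR (fun s => f (s, w.2) - s * fx z) (fun s => fx (s, w.2) - fx z)).
  + exact: ltW.
  + move=> t tab; apply: is_deriveB; last exact: is_derive_scale.
    by apply/is_derive_ix; apply: (H1 (t, w.2) _ _).1 => //=; exact: seg tab.
  + by move=> t tab; rewrite distrC; apply: (H2 (t, w.2)) => //=; exact: seg tab.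
- apply: (@mvt_boundR (fun s => f (z.1, s) - s * fy z) (fun s => fy (z.1, s) - fy z)).
  + exact: ltW.
  + move=> t tab; apply: is_deriveB; last exact: is_derive_scale.
    apply/is_derive_iy; apply: (H1 (z.1, t) _ _).2 => //=; last exact: seg tab.
    by rewrite subrr normr0.
  + move=> t tab; rewrite distrC; apply: (H3 (z.1, t)) => //=; last exact: seg tab.
    by rewrite subrr normr0.
Qed.

Lemma chain_rule_curve (f fx fy : plane -> R) (a b : R -> R) (t a' b' : R) :
  (\forall w \near (a t, b t),
     is_derive w (dvec R ix) f (fx w) /\ is_derive w (dvec R iy) f (fy w)) ->
  {for (a t, b t), continuous fx} -> {for (a t, b t), continuous fy} ->
  is_derive t 1 a a' -> is_derive t 1 b b' ->
  is_derive t 1 (fun s => f (a s, b s)) (a' * fx (a t, b t) + b' * fy (a t, b t)).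
Proof.
move=> df cx cy da db; apply: remainder_is_derive => e e0.
pose C : R := (`|a'| + 1) + (`|b'| + 1) + `|fx (a t, b t)| + `|fy (a t, b t)| + 1.
have C0 : 0 < C by rewrite /C ltr_wpDl// !addr_ge0.
have Ca : (`|a'| + 1) + (`|b'| + 1) <= C by rewrite /C -!addrA lerD2l !addrA !lerD2r; have := normr_ge0 (fx (a t, b t)); have := normr_ge0 (fy (a t, b t)); lra.
have Cx : `|fx (a t, b t)| + `|fy (a t, b t)| <= C.
  by rewrite /C; have := normr_ge0 a'; have := normr_ge0 b'; lra.
pose eta := e / (2 * C).
have eta0 : 0 < eta by rewrite divr_gt0// mulr_gt0.
have [d1 d10 H1] := C1_remainder eta0 df cx cy.
have [d2 d20 H2] := derive_local_cvg da (divr_gt0 d10 (ltr0n R 2)).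
have [d3 d30 H3] := derive_local_cvg db (divr_gt0 d10 (ltr0n R 2)).
have [d4 d40 H4] := is_derive_remainder da eta0.
have [d5 d50 H5] := is_derive_remainder db eta0.
have [d6 d60 H6] := is_derive_remainder da ltr01.
have [d7 d70 H7] := is_derive_remainder db ltr01.
exists (Num.min d2 (Num.min d3 (Num.min d4 (Num.min d5 (Num.min d6 d7))))).
  by rewrite !lt_min d20 d30 d40 d50 d60.
move=> s; rewrite !lt_min => /and5P[s2 s3 s4 s5 /andP[s6 s7]].
have half : d1 / 2 < d1 by rewrite ltr_pdivrMr// ltr_pMr// ltr1n.
have := H1 (a s, b s) (le_lt_trans (H2 _ s2) half) (le_lt_trans (H3 _ s3) half).
rewrite /=; set X := _ - _ * fy _ => HX.
have := H4 _ s4; set A := a s - a t - _ => HA.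
have := H5 _ s5; set B := b s - b t - _ => HB.
have lip (g : R -> R) (g' : R) : `|g s - g t - (s - t) *: g'| <= 1 * `|s - t| ->
    `|g s - g t| <= (`|g'| + 1) * `|s - t|.
  move=> H; rewrite -[g s - g t](subrK ((s - t) *: g')) (le_trans (ler_normD _ _))//.
  rewrite mulrDl [leRHS]addrC lerD// [_ *: _]/(_ * _) normrM mulrC//.
have La := lip a a' (H6 _ s6); have Lb := lip b b' (H7 _ s7).
have -> : f (a s, b s) - f (a t, b t) - (s - t) *: (a' * fx (a t, b t) + b' * fy (a t, b t))
    = X + (A * fx (a t, b t) + B * fy (a t, b t)).
  by rewrite /X /A /B /GRing.scale/=; ring.
rewrite (le_trans (ler_normD _ _))//.
have q1 : `|X| <= eta * (C * `|s - t|).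
  rewrite (le_trans HX)// ler_wpM2l ?(ltW eta0)// (le_trans (lerD La Lb))//.
  by rewrite -mulrDl ler_wpM2r.
have q2 : `|A * fx (a t, b t) + B * fy (a t, b t)| <= eta * (C * `|s - t|).
  rewrite (le_trans (ler_normD _ _))// !normrM.
  rewrite (le_trans (lerD (ler_wpM2r (normr_ge0 _) HA) (ler_wpM2r (normr_ge0 _) HB)))//.
  rewrite [leLHS](_ : _ = eta * ((`|fx (a t, b t)| + `|fy (a t, b t)|) * `|s - t|)); last by ring.
  by rewrite ler_wpM2l ?(ltW eta0)// ler_wpM2r.
rewrite (le_trans (lerD q1 q2))// /eta le_eqVlt; apply/orP; left; apply/eqP.
by field; rewrite gt_eqF.
Qed.

(** Both mixed derivatives are limits of the same second difference over a square,
    evaluated by the mean value theorem in the two possible orders. *)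
Lemma schwarz (f fx fy fxy fyx : plane -> R) (z : plane) :
  (\forall w \near z, is_derive w (dvec R ix) f (fx w) /\ is_derive w (dvec R iy) f (fy w)) ->
  (\forall w \near z, is_derive w (dvec R iy) fx (fxy w) /\ is_derive w (dvec R ix) fy (fyx w)) ->
  {for z, continuous fxy} -> {for z, continuous fyx} -> fxy z = fyx z.
Proof.
move=> df ddf cx cy; apply/eqP; rewrite -subr_eq0 -normr_le0.
apply/ler_addgt0Pr => e e0; rewrite add0r.
have e20 : 0 < e / 2 by rewrite divr_gt0.
have [d1 d10 H1] := (nbhs_planeP _ _).1 df.
have [d4 d40 H4] := (nbhs_planeP _ _).1 ddf.
move/cvgrPdist_le: cx => /(_ _ e20)/nbhs_planeP[d2 d20 H2].
move/cvgrPdist_le: cy => /(_ _ e20)/nbhs_planeP[d3 d30 H3].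
pose d := Num.min d1 (Num.min d2 (Num.min d3 d4)).
have d0 : 0 < d by rewrite !lt_min d10 d20 d30.
pose h := d / 2; have h0 : 0 < h by rewrite divr_gt0.
have hd : h < d by rewrite ltr_pdivrMr// ltr_pMr// ltr1n.
case: z @d @h d0 h0 hd H1 H2 H3 H4 {df ddf} => x y d h d0 h0 hd H1 H2 H3 H4.
have in_ (a t : R) : a <= t <= a + h -> `|t - a| < d.
  by move=> /andP[? ?]; rewrite ger0_norm ?subr_ge0// (le_lt_trans _ hd)// lerBlDl.
have dd1 r : r < d -> r < d1 by move/lt_le_trans; apply; rewrite ge_min lexx.
have dd2 r : r < d -> r < d2 by move/lt_le_trans; apply; rewrite !ge_min lexx orbT.
have dd3 r : r < d -> r < d3 by move/lt_le_trans; apply; rewrite !ge_min lexx !orbT.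
have dd4 r : r < d -> r < d4 by move/lt_le_trans; apply; rewrite !ge_min lexx !orbT.
have xh (a : R) : a < a + h by rewrite ltrDl.
have hh (a : R) : a + h - a = h by rewrite addrC addKr.
have cont (g g' : R -> R) a : (forall t, a <= t <= a + h -> is_derive t 1 g (g' t)) ->
    exists2 c, a <= c <= a + h & g (a + h) - g a = h * g' c.
  move=> dg; have [|||c cab E] := @MVT R g g' a (a + h).
  - exact: xh.
  - by move=> t; rewrite in_itv/= => /andP[t1 t2]; apply: dg; rewrite !ltW.
  - apply/continuous_in_subspaceT => t; rewrite inE/= in_itv/= => tab.
    exact: derive_continuous (dg _ tab).
  - move: cab; rewrite in_itv/= => /andP[c1 c2]; exists c; first by rewrite !ltW.
    by rewrite E hh mulrC.
have yin : y <= y <= y + h by rewrite lexx lerDl ltW.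
have yin' : y <= y + h <= y + h by rewrite lexx lerDl ltW.
have xin : x <= x <= x + h by rewrite lexx lerDl ltW.
have xin' : x <= x + h <= x + h by rewrite lexx lerDl ltW.
pose Del := f (x + h, y + h) - f (x + h, y) - (f (x, y + h) - f (x, y)).
have [c1 c1x [c1' c1y E1]] : exists2 c, x <= c <= x + h &
    exists2 c', y <= c' <= y + h & Del = h * (h * fxy (c, c')).
  have [|c cx E] := cont (fun s => f (s, y + h) - f (s, y)) (fun s => fx (s, y + h) - fx (s, y)) x.
    move=> t tx; apply: is_deriveB; apply/is_derive_ix; apply: (H1 _ _ _).1 => /=;
    apply: dd1; exact: in_.
  have [|c' cy E'] := cont (fun s => fx (c, s)) (fun s => fxy (c, s)) y.
    move=> t ty; apply/is_derive_iy; apply: (H4 _ _ _).1 => /=; apply: dd4; exact: in_.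
  by exists c => //; exists c' => //; rewrite /Del E E'.
have [c2 c2x [c2' c2y E2]] : exists2 c, x <= c <= x + h &
    exists2 c', y <= c' <= y + h & Del = h * (h * fyx (c, c')).
  have [|c' cy E] := cont (fun s => f (x + h, s) - f (x, s)) (fun s => fy (x + h, s) - fy (x, s)) y.
    move=> t ty; apply: is_deriveB; apply/is_derive_iy; apply: (H1 _ _ _).2 => /=;
    apply: dd1; exact: in_.
  have [|c cx E'] := cont (fun s => fy (s, c')) (fun s => fyx (s, c')) x.
    move=> t tx; apply/is_derive_ix; apply: (H4 _ _ _).2 => /=; apply: dd4; exact: in_.
  exists c => //; exists c' => //; rewrite -E' -E /Del; ring.
have EE : fxy (c1, c1') = fyx (c2, c2').
  have hn0 : h != 0 by rewrite gt_eqF.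
  by apply: (mulfI hn0); apply: (mulfI hn0); rewrite -E1 -E2.
have q1 := H2 (c1, c1') (dd2 _ (in_ _ _ c1x)) (dd2 _ (in_ _ _ c1y)).
have q2 := H3 (c2, c2') (dd3 _ (in_ _ _ c2x)) (dd3 _ (in_ _ _ c2y)).
rewrite (splitr e) -(subrKA (fxy (c1, c1'))) (le_trans (ler_normD _ _))// lerD//.
by rewrite EE distrC.
Qed.

End PlaneCalculus.

Section CkTheory.
Variable R : realType.
Local Notation plane := (R * R)%type.
Variable D : set plane.
Hypothesis oD : open D.
Implicit Types f g : plane -> R.

Let nearD z (P : plane -> Prop) : D z -> (forall w, D w -> P w) -> \forall w \near z, P w.
Proof.
move=> Dz H; have : nbhs z D by apply: open_nbhs_nbhs.
by apply: filterS.
Qed.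

Lemma Ck_ext k f g : (forall z, D z -> f z = g z) -> Ck k D f -> Ck k D g.
Proof.
elim: k f g => [|k IH] f g fg [cf Hf]; split.
- move=> z Dz; have fgz := nearD Dz fg.
  rewrite /prop_for /continuous_at -(fg _ Dz); apply: cvg_trans (cf _ Dz).
  exact: near_eq_cvg.
- by [].
- move=> z Dz; have fgz := nearD Dz fg.
  rewrite /prop_for /continuous_at -(fg _ Dz); apply: cvg_trans (cf _ Dz).
  exact: near_eq_cvg.
- move=> i; have [df Hi] := Hf i; split.
    by move=> z Dz; apply: near_eq_derivable (df _ Dz); exact: nearD.
  apply: IH Hi => z Dz; apply: near_eq_derive; exact: nearD.
Qed.

Lemma CkS k f : Ck k.+1 D f -> Ck k D f.
Proof.
elim: k f => [|k IH] f [cf Hf]; first by split.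
split=> // i; have [df Hi] := Hf i; split => //.
exact: IH.
Qed.

Lemma Ck_of_derive k f (f' : 'I_2 -> plane -> R) :
  (forall z, D z -> {for z, continuous f}) ->
  (forall i z, D z -> is_derive z (dvec R i) f (f' i z)) ->
  (forall i, Ck k D (f' i)) -> Ck k.+1 D f.
Proof.
move=> cf df Hf'; split=> // i; split; first by move=> z /(df i)[].
by apply: Ck_ext (Hf' i) => z Dz; case: (df i z Dz).
Qed.

Lemma Ck_is_derive k f i z : Ck k.+1 D f -> D z -> is_derive z (dvec R i) f ('D_(dvec R i) f z).
Proof. by move=> [_ /(_ i)[df _]] /df ?; apply: derivableP. Qed.

Lemma Ck_cst k (c : R) : Ck k D (fun=> c).
Proof.
elim: k c => [|k IH] c; first by split=> // z _; exact: cvg_cst.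
apply: (@Ck_of_derive _ _ (fun _ _ => 0)) => //.
by move=> z _; exact: cvg_cst.
Qed.

Lemma CkD k f g : Ck k D f -> Ck k D g -> Ck k D (fun z => f z + g z).
Proof.
elim: k f g => [|k IH] f g Hf Hg.
  by split=> // z Dz; apply: cvgD; [exact: Hf.1|exact: Hg.1].
apply: (@Ck_of_derive _ _ (fun i z => 'D_(dvec R i) f z + 'D_(dvec R i) g z)).
- by move=> z Dz; apply: cvgD; [exact: Hf.1|exact: Hg.1].
- by move=> i z Dz; exact: (is_deriveD (Ck_is_derive i Hf Dz) (Ck_is_derive i Hg Dz)).
- by move=> i; apply: IH; [case: (Hf.2 i)|case: (Hg.2 i)].
Qed.

Lemma CkM k f g : Ck k D f -> Ck k D g -> Ck k D (fun z => f z * g z).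
Proof.
elim: k f g => [|k IH] f g Hf Hg.
  by split=> // z Dz; apply: cvgM; [exact: Hf.1|exact: Hg.1].
apply: (@Ck_of_derive _ _ (fun i z => 'D_(dvec R i) f z * g z + f z * 'D_(dvec R i) g z)).
- by move=> z Dz; apply: cvgM; [exact: Hf.1|exact: Hg.1].
- by move=> i z Dz; exact: (is_derive_mulR (Ck_is_derive i Hf Dz) (Ck_is_derive i Hg Dz)).
- move=> i; apply: CkD; apply: IH.
  + by case: (Hf.2 i).
  + exact: CkS.
  + exact: CkS.
  + by case: (Hg.2 i).
Qed.

Lemma Ck_sum k (I : Type) (r : seq I) (f : I -> plane -> R) :
  (forall i, Ck k D (f i)) -> Ck k D (fun z => \sum_(i <- r) f i z).
Proof.
move=> H; elim: r => [|i r IH].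
  by apply: Ck_ext (Ck_cst k 0) => z _; rewrite big_nil.
by apply: Ck_ext (CkD (H i) IH) => z _; rewrite big_cons.
Qed.

Lemma Cinfty_ext f g : (forall z, D z -> f z = g z) -> Cinfty D f -> Cinfty D g.
Proof. by move=> fg Hf k; exact: Ck_ext fg (Hf k). Qed.

Lemma Cinfty_cst (c : R) : Cinfty D (fun=> c). Proof. by move=> k; exact: Ck_cst. Qed.

Lemma CinftyD f g : Cinfty D f -> Cinfty D g -> Cinfty D (fun z => f z + g z).
Proof. by move=> Hf Hg k; exact: CkD. Qed.

Lemma CinftyM f g : Cinfty D f -> Cinfty D g -> Cinfty D (fun z => f z * g z).
Proof. by move=> Hf Hg k; exact: CkM. Qed.

Lemma Cinfty_sum (I : Type) (r : seq I) (f : I -> plane -> R) :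
  (forall i, Cinfty D (f i)) -> Cinfty D (fun z => \sum_(i <- r) f i z).
Proof. by move=> H k; apply: Ck_sum => i; exact: H. Qed.

Lemma CinftyZ (c : R) f : Cinfty D f -> Cinfty D (fun z => c * f z).
Proof. by move=> Hf; apply: CinftyM => //; exact: Cinfty_cst. Qed.

Lemma Cinfty_continuous f z : Cinfty D f -> D z -> {for z, continuous f}.
Proof. by move=> /(_ 0%N)[cf _] /cf. Qed.

Lemma Cinfty_is_derive f i z : Cinfty D f -> D z ->
  is_derive z (dvec R i) f ('D_(dvec R i) f z).
Proof. by move=> /(_ 1%N)/Ck_is_derive H /H. Qed.

Lemma Cinfty_derive f i : Cinfty D f -> Cinfty D (fun z => 'D_(dvec R i) f z).
Proof. by move=> Hf k; case: (Hf k.+1) => _ /(_ i)[]. Qed.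

(** If the derivatives are as regular as the functions themselves, each degree of
    differentiability gives the next one. *)
Lemma Cinfty_bootstrap (I : Type) (f : I -> plane -> R) (f' : 'I_2 -> I -> plane -> R) :
  (forall j z, D z -> {for z, continuous (f j)}) ->
  (forall i j z, D z -> is_derive z (dvec R i) (f j) (f' i j z)) ->
  (forall k, (forall j, Ck k D (f j)) -> forall i j, Ck k D (f' i j)) ->
  forall j, Cinfty D (f j).
Proof.
move=> cf df Hf j k; elim: k j => [|k IH] j; first by split=> // z /cf.
by apply: (Ck_of_derive (cf j) (fun i => df i j)) => i; exact: Hf.
Qed.

End CkTheory.

Lemma CkW (R : realType) (D D' : set (R * R)) k f : D' `<=` D -> Ck k D f -> Ck k D' f.
Proof.
move=> DD'; elim: k f => [|k IH] f [cf Hf]; split=> //.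
- by move=> z /DD'/cf.
- by move=> z /DD'/cf.
- by move=> i; have [df Hi] := Hf i; split=> [z /DD'/df//|]; exact: IH.
Qed.

Lemma CinftyW (R : realType) (D D' : set (R * R)) f : D' `<=` D -> Cinfty D f -> Cinfty D' f.
Proof. by move=> DD' Hf k; exact: CkW (Hf k). Qed.

(** * Linear differential equations *)

Section LinearODE.
Variables (R : realType) (N : nat).
Local Notation mu := (@lebesgue_measure R).

Lemma seg0_norm (t s d : R) : `|t| <= d -> Num.min 0 t <= s <= Num.max 0 t -> `|s| <= d.
Proof.
rewrite !ler_norml ge_min le_max => /andP[q1 q2] /andP[/orP[] s1 /orP[] s2];
  apply/andP; split; lra.
Qed.

(** Truncating the variable turns functions on an interval into functions on the whole
    line, with the same bounds. *)
Definition clamp (d t : R) : R := Num.min (Num.max t (- d)) d.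

Lemma clamp_le d t : 0 <= d -> `|clamp d t| <= d.
Proof.
move=> d0; rewrite /clamp ler_norml ge_min lexx orbT andbT le_min le_max lexx orbT/=.
by rewrite ge0_cp.
Qed.

Lemma clamp_id d t : `|t| <= d -> clamp d t = t.
Proof.
by rewrite ler_norml /clamp => /andP[t1 t2]; rewrite max_l// min_l.
Qed.

Lemma clamp_continuous d : continuous (clamp d).
Proof.
move=> t; apply: (@continuous_min _ _ (fun t => Num.max t (- d) : R^o) (fun=> d : R^o)).
  apply: (@continuous_max _ _ (fun t => t : R^o) (fun=> - d : R^o)); first exact: cvg_id.
  exact: cvg_cst.
exact: cvg_cst.
Qed.

(** Integrals start at [-1] and not at [0], for [0] and small negative bounds to be
    interior points. *)
Definition primitiveR (f : R -> R) (t : R) : R :=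
  Rintegral mu `[(-1)%R, t]%classic f - Rintegral mu `[(-1)%R, 0%R]%classic f.

Lemma is_derive_primitiveR (f : R -> R) (t : R) : continuous f -> `|t| < 1 ->
  is_derive t 1 (primitiveR f) (f t).
Proof.
move=> cf; rewrite ltr_norml => /andP[t1 t2].
have fi : mu.-integrable `[(-1)%R, 1%R]%classic (EFin \o f).
  apply: continuous_compact_integrable; first exact: segment_compact.
  exact: continuous_subspaceT.
have [d e] := @continuous_FTC1_closed R f (-1) t 1 t2 fi t1 (cf t).
have H : is_derive t 1 (fun x => Rintegral mu `[(-1)%R, x]%classic f) (f t).
  by split; [exact: d|rewrite -derive1E; exact: e].
have := is_deriveB H (is_derive_cst (Rintegral mu `[(-1)%R, 0%R]%classic f) t 1).
by rewrite subr0.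
Qed.

Definition primitive (f : R -> 'M[R]_N) (t : R) : 'M[R]_N :=
  \matrix_(i, j) primitiveR (fun s => f s i j) t.

Lemma primitive0 f : primitive f 0 = 0.
Proof. by apply/matrixP => i j; rewrite !mxE /primitiveR subrr. Qed.

Lemma is_derive_primitive (f : R -> 'M[R]_N) (t : R) : continuous f -> `|t| < 1 ->
  is_derive t 1 (primitive f) (f t).
Proof.
move=> cf t1; apply/is_derive_mxP => i j.
rewrite (_ : (fun _ => _) = primitiveR (fun s => f s i j)).
  apply: is_derive_primitiveR => // s.
  by have /cvg_mxP := cf s; exact.
by apply/funext => s; rewrite mxE.
Qed.

Lemma geometric_small (C e : R) : 0 < e -> exists n : nat, C * (2^-1) ^+ n < e.
Proof.
move=> e0; have h1 : `|2^-1 : R| < 1.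
  by rewrite ger0_norm// invf_lt1// ltr1n.
have /cvgrPdist_lt/(_ _ e0) := cvg_geometric C h1.
move=> /filter_ex[n]; rewrite sub0r normrN => H; exists n.
by rewrite (le_lt_trans _ H)// ler_norm.
Qed.

Variables (A : R -> 'M[R]_N) (K d : R).
Hypotheses (cA : continuous A) (AK : forall t, `|A t| <= K).
Hypotheses (d0 : 0 < d) (d1 : d < 1) (NKd : N%:R * K * d <= 2^-1).

(** Picard's operator.  With the time truncated to [[-d, d]] it halves uniform
    distances on the whole line, by the bound on [N K d]. *)
Let Phi (u : R -> 'M[R]_N) (t : R) : 'M[R]_N :=
  1%:M + primitive (fun s => u s *m A s) (clamp d t).

Let K0 : 0 <= K. Proof. exact: le_trans (normr_ge0 (A 0)) (AK 0). Qed.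

Let clamp1 t : `|clamp d t| < 1.
Proof. by rewrite (le_lt_trans (clamp_le _ (ltW d0))). Qed.

Let cM (u : R -> 'M[R]_N) : continuous u -> continuous (fun s => u s *m A s).
Proof. by move=> cu s; apply: cvg_mulmx; [exact: cu|exact: cA]. Qed.

Let Phi_continuous (u : R -> 'M[R]_N) : continuous u -> continuous (Phi u).
Proof.
move=> cu t; apply: cvgD; first exact: cvg_cst.
suff H : {for clamp d t, continuous (primitive (fun s => u s *m A s))}.
  exact: (continuous_comp (@clamp_continuous d t) H).
have [+ _] := is_derive_primitive (cM cu) (clamp1 t).
by move=> /derivable1_diffP/differentiable_continuous.
Qed.

Let Phi_lip (u v : R -> 'M[R]_N) (c : R) : continuous u -> continuous v -> 0 <= c ->
  (forall t, `|u t - v t| <= c) -> forall t, `|Phi u t - Phi v t| <= c / 2.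
Proof.
move=> cu cv c0 uv t; rewrite /Phi opprD addrACA subrr add0r.
pose f s := primitive (fun s => u s *m A s) s - primitive (fun s => v s *m A s) s.
have seg s : Num.min 0 (clamp d t) <= s <= Num.max 0 (clamp d t) -> `|s| <= d.
  by apply: seg0_norm; rewrite clamp_le// ltW.
have Nc : 0 <= N%:R * (c * K) by rewrite !mulr_ge0.
have H : `|f (clamp d t) - f 0| <= (N%:R * (c * K)) * `|clamp d t - 0|.
  apply: (@mvt_bound _ _ _ f (fun s => (u s - v s) *m A s)) => //.
    move=> s /seg sd; rewrite mulmxBl; apply: is_deriveB;
      apply: is_derive_primitive; rewrite ?(le_lt_trans sd)//; exact: cM.
  move=> s _; rewrite (le_trans (mx_norm_mulmx _ _))// ler_wpM2l// ler_pM//.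
rewrite /f !primitive0 !subr0 in H.
rewrite (le_trans H)//.
rewrite (@le_trans _ _ (N%:R * (c * K) * d))//.
  by rewrite ler_wpM2l// clamp_le// ltW.
rewrite [leLHS](_ : _ = c * (N%:R * K * d)); last by ring.
by rewrite ler_wpM2l.
Qed.

Let u := fix u (n : nat) : R -> 'M[R]_N := if n is n'.+1 then Phi (u n') else fun=> 1%:M.

Let u_continuous n : continuous (u n).
Proof.
elim: n => [|n IH]; first exact: cst_continuous.
exact: Phi_continuous.
Qed.

Let norm1M : `|1%:M : 'M[R]_N| <= 1.
Proof.
by apply: mx_norm_le => // i j; rewrite mxE; case: (i == j); rewrite ?normr1 ?normr0.
Qed.

Let u_step n t : `|u n.+1 t - u n t| <= 2 * (2^-1) ^+ n.
Proof.
elim: n t => [|n IH] t.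
  have c2 : continuous (fun _ : R => 0 : 'M[R]_N) by move=> s; exact: cvg_cst.
  have H := @Phi_lip (u 0%N) (fun=> 0) 1 (@u_continuous 0) c2 ler01 _ t.
  have Phi0 : Phi (fun=> 0) t = 1%:M.
    rewrite /Phi (_ : (fun s => _) = (fun _ : R => 0 : 'M[R]_N)); last by apply/funext => s; rewrite mul0mx.
    have E : primitive (fun=> 0) (clamp d t) = primitive (fun=> 0) 0.
      apply: (@derive0_const _ _ _ (primitive (fun=> 0))) => s sc.
      have s1 : `|s| < 1 by rewrite (le_lt_trans (seg0_norm (clamp_le t (ltW d0)) sc)).
      exact: (is_derive_primitive c2 s1).
    by rewrite E primitive0 addr0.
  have {}H : `|Phi (u 0%N) t - Phi (fun=> 0) t| <= 1 / 2.
    by apply: H => s; rewrite subr0.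
  rewrite Phi0 in H; rewrite expr0 mulr1 (le_trans H)//; lra.
rewrite (le_trans (Phi_lip (@u_continuous n.+1) (@u_continuous n) _ IH t))//.
by rewrite exprSr mulrA.
Qed.

Let u_cauchy n m t : `|u (n + m)%N t - u n t| <= 4 * (2^-1) ^+ n.
Proof.
have p0 k : 0 <= (2^-1 : R) ^+ k by rewrite exprn_ge0.
suff H : `|u (n + m)%N t - u n t| <= 4 * (2^-1) ^+ n - 4 * (2^-1) ^+ (n + m).
  by rewrite (le_trans H)// gerBl mulr_ge0.
elim: m => [|m IH]; first by rewrite addn0 !subrr normr0.
rewrite addnS -(subrKA (u (n + m)%N t)) (le_trans (ler_normD _ _))//.
rewrite (le_trans (lerD (u_step _ _) IH))// exprS.
move: (2^-1 ^+ (n + m)) (2^-1 ^+ n) => x y; lra.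
Qed.

Let cauchy_entry t i j : cvgn (fun n => u n t i j).
Proof.
apply/cauchy_cvgP/cauchy_exP => e e0.
have [n nE] := geometric_small 4 e0.
exists (u n t i j); exists n => //= m nm.
rewrite /ball/= distrC (le_lt_trans _ nE)//.
rewrite -(subnKC nm) (le_trans _ (u_cauchy n (m - n) t))//.
by rewrite [leLHS](_ : _ = `|(u (n + (m - n))%N t - u n t) i j|) ?mx_entry_le// !mxE.
Qed.

Let V t : 'M[R]_N := \matrix_(i, j) limn (fun n => u n t i j).

Let V_cvg t : (fun n => u n t) @ \oo --> V t.
Proof. by apply/cvg_mxP => i j; rewrite mxE; exact: cauchy_entry. Qed.

Let V_dist n t : `|V t - u n t| <= 4 * (2^-1) ^+ n.
Proof.
apply/ler_addgt0Pr => e e0.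
have /cvgrPdist_le/(_ _ e0)[m _ H] := V_cvg (t:=t).
have := H (n + m)%N (leq_addl _ _) => H1.
rewrite -(subrKA (u (n + m)%N t)) (le_trans (ler_normD _ _))// addrC lerD//.
Qed.

Let V_continuous : continuous V.
Proof.
move=> t; apply/cvgrPdist_le => e e0.
have e3 : 0 < e / 3 by rewrite divr_gt0.
have [n nE] := geometric_small 4 e3.
have := @u_continuous n t => /cvgrPdist_le/(_ _ e3).
apply: filterS => s H.
have -> : V t - V s = (V t - u n t) + (u n t - u n s) - (V s - u n s).
  by rewrite opprB addrA; congr (_ + _); rewrite !addrA subrK addrK || rewrite subrKA subrK.
have := V_dist n t; have := V_dist n s; move: H.
move: (ler_normB (V t - u n t + (u n t - u n s)) (V s - u n s)).
move: (ler_normD (V t - u n t) (u n t - u n s)); lra.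
Qed.

Let V_fix t : V t = Phi V t.
Proof.
apply/eqP; rewrite eq_sym -subr_eq0 -normr_le0; apply/ler_addgt0Pr => e e0; rewrite add0r.
have [n nE] := geometric_small 4 e0.
rewrite -(subrKA (u n.+1 t)) (le_trans (ler_normD _ _))//.
have p0 : 0 <= (2^-1 : R) ^+ n by rewrite exprn_ge0.
have H1 : `|Phi V t - u n.+1 t| <= 4 * 2^-1 ^+ n / 2.
  by apply: (Phi_lip V_continuous (@u_continuous n)) => [|s]; [rewrite mulr_ge0|exact: V_dist].
have := V_dist n.+1 t; rewrite exprS distrC => H2.
by move: nE H1 H2; move: (2^-1 ^+ n) => x; lra.
Qed.

Lemma linear_ode_exists : exists V : R -> 'M[R]_N, V 0 = 1%:M /\
  forall t : R, `|t| < d -> is_derive t 1 V (V t *m A t).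
Proof.
exists V; split.
  by rewrite V_fix /Phi clamp_id ?normr0 ?(ltW d0)// primitive0 addr0.
move=> t td; have t1 : `|t| < 1 by exact: lt_trans d1.
have D : is_derive t 1 (fun s => 1%:M + primitive (fun s => V s *m A s) s) (0 + V t *m A t).
  apply: is_deriveD; exact: (is_derive_primitive (cM V_continuous) t1).
rewrite add0r in D; have r0 : 0 < d - `|t| by rewrite subr_gt0.
apply: (is_derive_at_local r0 _ D) => s sd.
rewrite V_fix /Phi clamp_id//.
have := ler_normD (s - t) t; rewrite subrK; lra.
Qed.

End LinearODE.

(** * Flat systems on a square *)

Lemma half_quarter (R : realFieldType) (a e : R) : a <= e / 4 -> 2 * a <= e / 2.
Proof. by move=> h; lra. Qed.

Lemma is_derive_val (R : realType) (V W : normedModType R) (f : V -> W) (t v : V) (D D' : W) :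
  is_derive t v f D -> D = D' -> is_derive t v f D'.
Proof. by move=> + <-. Qed.

Section Segments.
Variable R : realDomainType.
Implicit Types x s u v c r : R.

Lemma seg_ball x s u c r : `|x - c| < r -> `|s - c| < r ->
  Num.min x s <= u <= Num.max x s -> `|u - c| < r.
Proof.
have H a b : a <= u <= b -> `|a - c| < r -> `|b - c| < r -> `|u - c| < r.
  move=> /andP[au ub]; rewrite !ltr_norml => /andP[h1 _] /andP[_ h2].
  by rewrite (lt_le_trans h1) ?lerD2r// (le_lt_trans _ h2)// lerD2r.
by move=> hx hs; have [_|_] := leP x s => /H; exact.
Qed.

Lemma seg_dist x s u : Num.min x s <= u <= Num.max x s -> `|u - x| <= `|s - x|.
Proof.
have [xs|/ltW sx] := leP x s => /andP[u1 u2].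
  by rewrite !ger0_norm ?subr_ge0// lerD2r.
by rewrite distrC [leRHS]distrC !ger0_norm ?subr_ge0// lerD2l lerN2.
Qed.

Lemma seg_sub x s u v : Num.min x s <= u <= Num.max x s ->
  Num.min x u <= v <= Num.max x u -> Num.min x s <= v <= Num.max x s.
Proof.
move=> /andP[u1 u2] /andP[v1 v2].
rewrite (le_trans _ v1) ?le_min ?u1 ?ge_min ?lexx//=.
by rewrite (le_trans v2)// ge_max u2 le_max lexx.
Qed.

End Segments.

Section LocalFrobenius.
Variables (R : realType) (N : nat).
Local Notation plane := (R * R)%type.

Lemma norm_1mx : `|1%:M : 'M[R]_N| <= 1.
Proof.
by apply: mx_norm_le => // i j; rewrite mxE; case: (i == j); rewrite ?normr1 ?normr0.
Qed.

Lemma mx_norm_tr (X : 'M[R]_N) : `|X^T| <= `|X|.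
Proof. by apply: mx_norm_le => // i j; rewrite mxE mx_entry_le. Qed.

Lemma is_derive_trmx (V : normedModType R) (F : V -> 'M[R]_N) (t v : V) (D : 'M[R]_N) :
  is_derive t v F D -> is_derive t v (fun s => (F s)^T) D^T.
Proof.
move=> /is_derive_mxP H; apply/is_derive_mxP => i j; rewrite mxE.
by rewrite (_ : (fun _ => _) = fun s => F s j i)//; apply/funext => s; rewrite mxE.
Qed.

(** The inverse of a solution solves the system with [- A] on the other side, the
    transpose of the system with [- A^T].  The bound is Gronwall's inequality. *)
Lemma linear_ode (A : R -> 'M[R]_N) (K d : R) :
  continuous A -> (forall t, `|A t| <= K) -> 0 < d -> d < 1 -> N%:R * K * d <= 2^-1 ->
  exists V : R -> 'M[R]_N, V 0 = 1%:M /\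
    forall t : R, `|t| < d ->
      [/\ is_derive t 1 V (V t *m A t), V t \in unitmx & `|V t| <= 2].
Proof.
move=> cA AK d0 d1 NKd.
have K0 : 0 <= K by rewrite (le_trans _ (AK 0)).
have [V [V0 dV]] := linear_ode_exists cA AK d0 d1 NKd.
pose B t := - (A t)^T.
have cB : continuous B.
  move=> t; apply: cvgN; apply/cvg_mxP => i j; rewrite mxE.
  have /cvg_mxP/(_ j i) := cA t.
  by rewrite (_ : (fun t => (A t)^T i j) = (fun t => A t j i))//; apply/funext => s; rewrite mxE.
have BK t : `|B t| <= K by rewrite normrN (le_trans (mx_norm_tr _)).
have [Z [Z0 dZ]] := linear_ode_exists cB BK d0 d1 NKd.
exists V; split=> // t td.
have seg s : Num.min 0 t <= s <= Num.max 0 t -> `|s| < d.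
  by move=> /(seg0_norm (lexx `|t|))/le_lt_trans; exact.
split; first exact: dV.
  have H : V t *m (Z t)^T = V 0 *m (Z 0)^T.
    apply: (derive0_const (f := fun t => V t *m (Z t)^T)) => s /seg sd.
    have D := is_derive_mulmx (dV _ sd) (is_derive_trmx (dZ _ sd)).
    apply: (is_derive_val D).
    by rewrite trmx_mul /B linearN/= trmxK mulNmx mulmxN mulmxA addrN.
  by move: H; rewrite V0 Z0 trmx1 mulmx1 => /mulmx1_unit[].
have H := @small_gronwall R N N V (fun s => V s *m A s) `|t| (N%:R * K) 0.
rewrite (le_trans (H _ _ _ _ _ _ _ _))//.
- exact: mulr_ge0.
- by rewrite (le_trans _ NKd)// ler_wpM2l ?mulr_ge0// ltW.
- by move=> s st; apply: dV; rewrite (le_lt_trans st).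
- move=> s _; rewrite addr0 (le_trans (mx_norm_mulmx _ _))// -mulrA ler_wpM2l//.
  by rewrite mulrC ler_wpM2r.
- by rewrite mulr0 mul0r addr0 V0; have := norm_1mx; lra.
Qed.

Variables (x0 y0 r K : R).
Hypotheses (r0 : 0 < r) (r1 : r < 1) (K0 : 0 <= K) (NKr : N%:R * K * r <= 2^-1).
Local Notation sq z := (`|z.1 - x0| <= r /\ `|z.2 - y0| <= r).

Variables (P Q Py Qx Qxx : plane -> 'M[R]_N).
Hypotheses (cP : forall z : plane, sq z -> {for z, continuous P})
  (cQ : forall z : plane, sq z -> {for z, continuous Q})
  (dP : forall z : plane, sq z -> is_derive z (dvec R iy) P (Py z))
  (dQ : forall z : plane, sq z -> is_derive z (dvec R ix) Q (Qx z))
  (dQx : forall z : plane, sq z -> is_derive z (dvec R ix) Qx (Qxx z))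
  (bP : forall z : plane, sq z -> `|P z| <= K) (bQ : forall z : plane, sq z -> `|Q z| <= K)
  (bQx : forall z : plane, sq z -> `|Qx z| <= K) (bQxx : forall z : plane, sq z -> `|Qxx z| <= K)
  (flatPQ : forall z : plane, sq z -> Qx z - Py z + (P z *m Q z - Q z *m P z) = 0).

Let clampr t : `|clamp r t| <= r. Proof. by rewrite clamp_le// ltW. Qed.

Let cont_comp (F : plane -> 'M[R]_N) (g : R -> plane) :
  (forall t, {for g t, continuous F}) -> continuous g -> continuous (fun t => F (g t)).
Proof. by move=> cF cg t; exact: (@continuous_comp _ _ _ g F t (cg t) (cF t)). Qed.

Let cpair (a b : R -> R) : continuous a -> continuous b -> continuous (fun t => (a t, b t) : plane).
Proof. by move=> ca cb t; exact: (@cvg_pair _ _ _ _ _ _ _ _ _ a b (ca t) (cb t)). Qed.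

Let cshift a : continuous (fun t => a + clamp r t).
Proof. by move=> t; apply: cvgD; [exact: cvg_cst|exact: clamp_continuous]. Qed.

Let in_sq s t : `|s| <= r -> `|t| <= r -> sq (x0 + s, y0 + t).
Proof. by move=> sr tr; rewrite /= ![_ + _ - _]addrAC !subrr !add0r. Qed.

Let in_sq0 s : `|s| <= r -> sq (x0 + s, y0).
Proof. by move=> sr; rewrite /= addrAC !subrr add0r normr0; split => //; exact: ltW. Qed.

(** Solve first along the horizontal line through the centre, then along the vertical
    lines; only the horizontal derivative is at issue.  For an increment [h], the
    difference quotient minus [F P] solves, along vertical lines, a linear equation
    with an inhomogeneity of order [h], thanks to flatness; Gronwall's inequality
    brings the estimate from the central line, where it holds by construction, to
    every point. *)
Lemma local_frobenius_square : exists F : plane -> 'M[R]_N,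
  forall x y, `|x - x0| < r -> `|y - y0| < r ->
  [/\ F (x, y) \in unitmx, is_derive (x, y) (dvec R ix) F (F (x, y) *m P (x, y)),
      is_derive (x, y) (dvec R iy) F (F (x, y) *m Q (x, y)) &
      `|F (x, y)| <= 4 * N%:R].
Proof.
have cA : continuous (fun t => P (x0 + clamp r t, y0)).
  apply: (@cont_comp P (fun t => (x0 + clamp r t, y0))) => [t|].
    by apply: cP; exact: in_sq0.
  by apply: cpair => // t; exact: cvg_cst.
have AK t : `|P (x0 + clamp r t, y0)| <= K.
  by apply: bP; exact: in_sq0.
have [U [U0 HU]] := linear_ode cA AK r0 r1 NKr.
have HV s : exists V : R -> 'M[R]_N, V 0 = 1%:M /\ forall t : R, `|t| < r ->
   [/\ is_derive t 1 V (V t *m Q (x0 + clamp r s, y0 + clamp r t)), V t \in unitmx & `|V t| <= 2].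
  apply: (linear_ode (A := fun t => Q (x0 + clamp r s, y0 + clamp r t)) (K := K)) => //.
    apply: (@cont_comp Q (fun t => (x0 + clamp r s, y0 + clamp r t))) => [t|].
      by apply: cQ; exact: in_sq.
    by apply: cpair => // t; exact: cvg_cst.
  by move=> t; apply: bQ; exact: in_sq.
pose V s := projT1 (cid (HV s)).
have V0 s : V s 0 = 1%:M by rewrite /V; case: (cid (HV s)) => ? [].
have dV (s t : R) (tr : `|t| < r) :
    [/\ is_derive t 1 (V s) (V s t *m Q (x0 + clamp r s, y0 + clamp r t)), V s t \in unitmx & `|V s t| <= 2].
  by rewrite /V; case: (cid (HV s)) => V' /= [_]; exact.
pose F (z : plane) := U (z.1 - x0) *m V (z.1 - x0) (z.2 - y0).
have Fb x y : `|x - x0| < r -> `|y - y0| < r -> `|F (x, y)| <= 4 * N%:R.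
  move=> xr yr; rewrite /F (le_trans (mx_norm_mulmx _ _))//=.
  have [_ _ b1] := HU _ xr; have [_ _ b2] := dV (x - x0) _ yr.
  rewrite mulrC ler_wpM2r//; have -> : 4 = 2 * 2 :> R by ring.
  exact: ler_pM.
have subK (a b : R) : a + (b - a) = b by ring.
have Fy x y : `|x - x0| < r -> `|y - y0| < r ->
    is_derive y 1 (fun t => F (x, t)) (F (x, y) *m Q (x, y)).
  move=> xr yr; rewrite /F /=.
  have [d1 _ _] := dV (x - x0) _ yr.
  have d2 : is_derive y 1 (fun t => V (x - x0) (t - y0))
      (V (x - x0) (y - y0) *m Q (x, y)).
    have := (is_derive_line (V (x - x0)) (- y0) (1 : R) y _).1.
    rewrite [y *: 1]mulr1 => /(_ _ d1).
    rewrite !clamp_id ?(ltW xr) ?(ltW yr)// !subK.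
    by rewrite (_ : (fun s : R => V (x - x0) (s *: 1 - y0)) = (fun t => V (x - x0) (t - y0)))//; apply/funext => s; rewrite [s *: 1]mulr1.
  have := is_derive_mulmx (is_derive_cst (U (x - x0)) y 1) d2.
  by rewrite mul0mx add0r mulmxA.
have Fx0 x : `|x - x0| < r -> is_derive x 1 (fun s => F (s, y0)) (F (x, y0) *m P (x, y0)).
  move=> xr; have [d1 _ _] := HU _ xr.
  have E s : F (s, y0) = U (s - x0) by rewrite /F/= subrr V0 mulmx1.
  rewrite E (_ : (fun _ => _) = (fun s => U (s - x0))); last by apply/funext.
  have := (is_derive_line U (- x0) (1 : R) x _).1.
  rewrite [x *: 1]mulr1 => /(_ _ d1).
  rewrite !clamp_id ?(ltW xr)// !subK.
  by rewrite (_ : (fun s : R => U (s *: 1 - x0)) = (fun t => U (t - x0)))//; apply/funext => s; rewrite [s *: 1]mulr1.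
have Fx x y : `|x - x0| < r -> `|y - y0| < r ->
    is_derive x 1 (fun s => F (s, y)) (F (x, y) *m P (x, y)).
  move=> xr yr; apply: remainder_is_derive => e e0.
  pose E h t := h^-1 *: (F (x + h, y0 + t) - F (x, y0 + t)) - F (x, y0 + t) *m P (x, y0 + t).
  pose C : R := 8 * N%:R * N%:R * (N%:R * K + 1) * K.
  have Nge : 0 <= N%:R :> R by [].
  have C0 : 0 <= C by rewrite !mulr_ge0// addr_ge0// mulr_ge0.
  have e2 : 0 < e / 4 by rewrite divr_gt0.
  have [d1 d10 H1] := is_derive_remainder (Fx0 x xr) e2.
  pose d2 := Num.min d1 (Num.min (r - `|x - x0|) (e / (4 * (C + 1)))).
  have C10 : 0 < C + 1 by rewrite ltr_wpDl.
  have d20 : 0 < d2 by rewrite !lt_min d10 subr_gt0 xr divr_gt0// mulr_gt0.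
  exists d2 => // s sd.
  have [->|sx] := eqVneq s x; first by rewrite !subrr scale0r subr0 !normr0 mulr0.
  pose h := s - x; have hE : s = x + h by rewrite /h; ring.
  have h0 : h != 0 by rewrite subr_eq0.
  move: sd; rewrite -/h !lt_min => /and3P[hd1 hd2 hd3].
  have sr : `|s - x0| < r.
    have -> : s - x0 = h + (x - x0) by rewrite /h; ring.
    by rewrite (le_lt_trans (ler_normD _ _))// -ltrBrDr.
  pose S t := F (x, y0 + t) *m (P (x, y0 + t) *m (Q (x + h, y0 + t) - Q (x, y0 + t)))
     + F (x, y0 + t) *m (h^-1 *: (Q (x + h, y0 + t) - Q (x, y0 + t)) - Qx (x, y0 + t)).
  have tin (t : R) : `|t| <= `|y - y0| -> `|y0 + t - y0| < r.
    by move=> ty; rewrite addrAC subrr add0r (le_lt_trans ty).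
  have sqs u v : `|u - x0| < r -> `|v - y0| < r -> sq (u, v).
    by move=> ur vr; split; exact: ltW.
  have shift (G : R -> 'M[R]_N) t (D : 'M[R]_N) : is_derive (y0 + t) 1 G D ->
      is_derive t 1 (fun t => G (y0 + t)) D.
    rewrite addrC => dG; have := (is_derive_line G y0 (1 : R) t D).1.
    rewrite [t *: 1]mulr1 => /(_ dG).
    by rewrite (_ : (fun s : R => G (s *: 1 + y0)) = (fun t => G (y0 + t)))//; apply/funext => u; rewrite [u *: 1]mulr1 addrC.
  have dE (t : R) : `|t| <= `|y - y0| -> is_derive t 1 (E h) (E h t *m Q (x + h, y0 + t) + S t).
    move=> ty; have tr := tin _ ty.
    have a1 := shift (fun t => F (x + h, t)) t _ (Fy (x + h) _ _ tr).
    have a2 := shift (fun t => F (x, t)) t _ (Fy x _ xr tr).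
    have a3 : is_derive t 1 (fun t => P (x, y0 + t)) (Py (x, y0 + t)).
      by apply: (shift (fun t => P (x, t))); apply/is_derive_iy; apply: dP; exact: sqs.
    rewrite -hE in a1 *; have {}a1 := a1 sr.
    have D := is_deriveB (is_deriveZ h^-1 (is_deriveB a1 a2)) (is_derive_mulmx a2 a3).
    move: D; set D0 := (X in is_derive _ _ _ X) => D.
    apply: (@is_derive_val _ _ _ _ _ _ D0); first by rewrite /E -hE; exact: D.
    rewrite {D}/D0.
    have fl := flatPQ (sqs _ _ xr tr).
    have -> : Py (x, y0 + t) = Qx (x, y0 + t) + (P (x, y0 + t) *m Q (x, y0 + t) - Q (x, y0 + t) *m P (x, y0 + t)).
      by apply/eqP; rewrite eq_sym -subr_eq0 addrAC fl.
    rewrite /E /S -hE; move: (F (s, _)) (F (x, _)) (P (x, _)) (Q (s, _)) (Q (x, _)) (Qx _).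
    move=> f1 f p q1 q qx.
    rewrite !(mulmxDr, mulmxDl, mulmxBr, mulmxBl) -!scalemxAr -!scalemxAl !(mulmxBr, mulmxBl) !(mulmxN, mulNmx) !mulmxA.
    by apply/matrixP => i j; rewrite !mxE; ring.
  have qx_lip u : Num.min x s <= u <= Num.max x s -> `|u - x0| < r.
    exact: seg_ball.
  have dQ1 (t : R) : `|t| <= `|y - y0| -> `|Q (s, y0 + t) - Q (x, y0 + t)| <= K * `|h|.
    move=> ty; have tr := tin _ ty.
    apply: (@mvt_bound _ _ _ (fun u => Q (u, y0 + t)) (fun u => Qx (u, y0 + t))) => // u ux.
      by apply/is_derive_ix; apply: dQ; apply: sqs => //; exact: qx_lip ux.
    by apply: bQx; apply: sqs => //; exact: qx_lip ux.
  have dQ2 (t : R) : `|t| <= `|y - y0| ->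
      `|Q (s, y0 + t) - Q (x, y0 + t) - h *: Qx (x, y0 + t)| <= K * `|h| * `|h|.
    move=> ty; have tr := tin _ ty.
    have := @mvt_bound _ _ _ (fun u => Q (u, y0 + t) - u *: Qx (x, y0 + t))
      (fun u => Qx (u, y0 + t) - Qx (x, y0 + t)) x s (K * `|h|).
    rewrite -/h; have -> : Q (s, y0 + t) - s *: Qx (x, y0 + t) - (Q (x, y0 + t) - x *: Qx (x, y0 + t))
      = Q (s, y0 + t) - Q (x, y0 + t) - h *: Qx (x, y0 + t).
      by apply/matrixP => i j; rewrite !mxE /h; ring.
    apply; first exact: mulr_ge0.
      move=> u ux; apply: is_deriveB; last first.
        have := is_derive_scalev (Qx (x, y0 + t)) (is_derive_id u (1 : R)).
        by rewrite scale1r.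
      by apply/is_derive_ix; apply: dQ; apply: sqs => //; exact: qx_lip ux.
    move=> u ux.
    have sub v : Num.min x u <= v <= Num.max x u -> Num.min x s <= v <= Num.max x s.
      exact: seg_sub.
    have uh : `|u - x| <= `|h| by exact: seg_dist.
    rewrite (@le_trans _ _ (K * `|u - x|))//; last by rewrite ler_wpM2l.
    apply: (@mvt_bound _ _ _ (fun u => Qx (u, y0 + t)) (fun u => Qxx (u, y0 + t))) => // v /sub vx.
      by apply/is_derive_ix; apply: dQx; apply: sqs => //; exact: qx_lip vx.
    by apply: bQxx; apply: sqs => //; exact: qx_lip vx.
  have Sb (t : R) : `|t| <= `|y - y0| -> `|S t| <= C * `|h|.
    move=> ty; have tr := tin _ ty; have bF := Fb _ _ xr tr.
    have n0 : 0 <= `|h| by [].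
    rewrite /S -hE (le_trans (ler_normD _ _))//.
    have s1 : `|F (x, y0 + t) *m (P (x, y0 + t) *m (Q (s, y0 + t) - Q (x, y0 + t)))|
        <= N%:R * (4 * N%:R * (N%:R * (K * (K * `|h|)))).
      rewrite (le_trans (mx_norm_mulmx _ _))// ler_wpM2l// ler_pM//.
      rewrite (le_trans (mx_norm_mulmx _ _))// ler_wpM2l// ler_pM//.
        by apply: bP; exact: sqs.
      exact: dQ1.
    have s2 : `|F (x, y0 + t) *m (h^-1 *: (Q (s, y0 + t) - Q (x, y0 + t)) - Qx (x, y0 + t))|
        <= N%:R * (4 * N%:R * (K * `|h|)).
      rewrite (le_trans (mx_norm_mulmx _ _))// ler_wpM2l// ler_pM//.
      have -> : h^-1 *: (Q (s, y0 + t) - Q (x, y0 + t)) - Qx (x, y0 + t) =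
          h^-1 *: (Q (s, y0 + t) - Q (x, y0 + t) - h *: Qx (x, y0 + t)).
        by rewrite [in RHS]scalerBr scalerA mulVf// scale1r.
      by rewrite normrZ normfV ler_pdivrMl ?normr_gt0// mulrC; exact: dQ2.
    rewrite (le_trans (lerD s1 s2))// -subr_ge0.
    have -> : C * `|h| - (N%:R * (4 * N%:R * (N%:R * (K * (K * `|h|)))) + N%:R * (4 * N%:R * (K * `|h|)))
      = 4 * N%:R * N%:R * (N%:R * K + 1) * K * `|h| by rewrite /C; ring.
    by rewrite !mulr_ge0// addr_ge0// mulr_ge0.
  have yr1 : `|y - y0| <= r by exact: ltW.
  have Gr := @small_gronwall R N N (E h) (fun t => E h t *m Q (x + h, y0 + t) + S t)
    `|y - y0| (N%:R * K) (C * `|h|) (normr_ge0 _) (mulr_ge0 Nge K0)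
    (mulr_ge0 C0 (normr_ge0 _)) _ dE _ (y - y0) (lexx _).
  have NKy : N%:R * K * `|y - y0| <= 2^-1.
    by rewrite (le_trans _ NKr)// ler_wpM2l// mulr_ge0.
  have {}Gr := Gr NKy.
  have Ebound : `|E h (y - y0)| <= 2 * `|E h 0| + 2 * (C * `|h|) * `|y - y0|.
    apply: Gr => t ty; rewrite (le_trans (ler_normD _ _))// lerD// ?Sb//.
    rewrite (le_trans (mx_norm_mulmx _ _))// -mulrA ler_wpM2l// mulrC ler_wpM2r//.
    by rewrite -hE; apply: bQ; apply: sqs => //; exact: tin.
  have E0b : `|E h 0| <= e / 4.
    rewrite /E addr0 -hE.
    have -> : h^-1 *: (F (s, y0) - F (x, y0)) - F (x, y0) *m P (x, y0) =
       h^-1 *: (F (s, y0) - F (x, y0) - (s - x) *: (F (x, y0) *m P (x, y0))).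
      by rewrite [in RHS]scalerBr scalerA mulVf// scale1r.
    by rewrite normrZ normfV ler_pdivrMl ?normr_gt0// mulrC; exact: H1.
  have -> : F (s, y) - F (x, y) - (s - x) *: (F (x, y) *m P (x, y)) = h *: E h (y - y0).
    by rewrite /E (subK y0 y) -hE [in RHS]scalerBr scalerA mulfV// scale1r.
  rewrite normrZ mulrC ler_wpM2r// (le_trans Ebound)//.
  have q1 : 2 * (C * `|h|) * `|y - y0| <= 2 * ((C + 1) * `|h|).
    have ch0 := mulr_ge0 (ler0n R 2) (mulr_ge0 C0 (normr_ge0 h)).
    rewrite -[leRHS]mulr1 ler_pM//; last by rewrite ltW// (lt_trans yr).
    by rewrite ler_wpM2l// ler_wpM2r// lerDl.
  have q2 : 2 * ((C + 1) * `|h|) <= e / 2.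
    have q3 : (C + 1) * `|h| <= e / 4.
      rewrite mulrC -ler_pdivlMr// (le_trans (ltW hd3))//.
      by rewrite invfM mulrA.
    exact: half_quarter.
  by rewrite (splitr e) lerD ?half_quarter// (le_trans q1).
exists F => x y xr yr; split.
- rewrite /F unitmx_mul/=; have [_ -> _] := HU _ xr.
  by have [_ -> _] := dV (x - x0) _ yr.
- by apply/is_derive_ix; exact: Fx.
- by apply/is_derive_iy; exact: Fy.
- exact: Fb.
Qed.

End LocalFrobenius.

(** * Flat systems on a Riemann surface *)

Section LocalFrobenius2.
Variables (R : realType) (N : nat).
Local Notation plane := (R * R)%type.

Lemma is_derive_mx_Cinfty (D : set plane) (P : plane -> 'M[R]_N) i z :
  (forall a b, Cinfty D (fun w => P w a b)) -> D z ->
  is_derive z (dvec R i) P (\matrix_(a, b) 'D_(dvec R i) (fun w => P w a b) z).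
Proof.
move=> cP Dz; apply/is_derive_mxP => a b; rewrite mxE.
exact: Cinfty_is_derive Dz.
Qed.

Lemma mx_Cinfty_continuous (D : set plane) (P : plane -> 'M[R]_N) z :
  (forall a b, Cinfty D (fun w => P w a b)) -> D z -> {for z, continuous P}.
Proof. by move=> cP Dz; apply/cvg_mxP => a b; exact: Cinfty_continuous Dz. Qed.

Definition mxD i (P : plane -> 'M[R]_N) (z : plane) : 'M[R]_N :=
  \matrix_(a, b) 'D_(dvec R i) (fun w => P w a b) z.

Lemma mxD_Cinfty (D : set plane) i (P : plane -> 'M[R]_N) : open D ->
  (forall a b, Cinfty D (fun w => P w a b)) ->
  forall a b, Cinfty D (fun w => mxD i P w a b).
Proof.
move=> oD cP a b; have := Cinfty_derive i (cP a b).
by apply: Cinfty_ext => // z _; rewrite mxE.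
Qed.

Lemma local_bound (P : plane -> 'M[R]_N) (z : plane) : {for z, continuous P} ->
  \forall w \near z, `|P w| <= `|P z| + 1.
Proof.
move=> /cvgrPdist_le/(_ _ ltr01); apply: filterS => w H.
by rewrite -[P w](subrK (P z)) addrC (le_trans (ler_normD _ _))// lerD2l distrC.
Qed.

(** The bound of the coefficients on a neighbourhood decides how small the square
    has to be. *)
Lemma local_frobenius (D : set plane) (P Q : plane -> 'M[R]_N) (z0 : plane) :
  open D -> D z0 ->
  (forall a b, Cinfty D (fun w => P w a b)) -> (forall a b, Cinfty D (fun w => Q w a b)) ->
  (forall z, D z -> mxD ix Q z - mxD iy P z + lbr (P z) (Q z) = 0) ->
  exists2 r, 0 < r & exists F : plane -> 'M[R]_N, forall z : plane,
    `|z.1 - z0.1| < r -> `|z.2 - z0.2| < r ->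
    [/\ D z, F z \in unitmx, {for z, continuous F},
      is_derive z (dvec R ix) F (F z *m P z) & is_derive z (dvec R iy) F (F z *m Q z)].
Proof.
move=> oD Dz0 cP cQ fl.
have cQx := mxD_Cinfty ix oD cQ; have cQxx := mxD_Cinfty ix oD cQx.
have b1 := local_bound (mx_Cinfty_continuous cP Dz0).
have b2 := local_bound (mx_Cinfty_continuous cQ Dz0).
have b3 := local_bound (mx_Cinfty_continuous cQx Dz0).
have b4 := local_bound (mx_Cinfty_continuous cQxx Dz0).
have nD : nbhs z0 D by exact: open_nbhs_nbhs.
pose K := `|P z0| + `|Q z0| + `|mxD ix Q z0| + `|mxD ix (mxD ix Q) z0| + 1.
have K1 : 1 <= K by rewrite lerDr !addr_ge0.
have K0 : 0 <= K by exact: le_trans K1.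
have [d d0 H] := (nbhs_planeP _ _).1 (filterI nD (filterI (filterI b1 b2) (filterI b3 b4))).
(* a half-side [r <= C^-1] satisfies [r < 1] and [N K r <= 1/2] *)
pose C : R := 4 * (N%:R * K + 1).
have NK0 : 0 <= N%:R * K by rewrite mulr_ge0.
have C0 : 0 < C by rewrite mulr_gt0// ltr_wpDl.
pose r := Num.min (d / 2) C^-1.
have r0 : 0 < r by rewrite lt_min divr_gt0// invr_gt0.
have rd : r < d by rewrite gt_min ltr_pdivrMr// ltr_pMr// ltr1n.
have rC : r <= C^-1 by rewrite ge_min lexx orbT.
have Ci : C^-1 <= 2^-1 / (N%:R * K + 1).
  rewrite /C invfM ler_wpM2r//; first by rewrite invr_ge0 addr_ge0.
  by rewrite lef_pV2 ?posrE// ler_nat.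
have r1 : r < 1.
  rewrite (le_lt_trans rC)// (le_lt_trans Ci)// ltr_pdivrMr ?ltr_wpDl// mul1r.
  by rewrite (@lt_le_trans _ _ 1)// ?lerDr// invf_lt1// ltr1n.
have NKr : N%:R * K * r <= 2^-1.
  rewrite (@le_trans _ _ ((N%:R * K + 1) * (2^-1 / (N%:R * K + 1))))//.
    by rewrite ler_pM// ?(ltW r0)// ?lerDl// (le_trans rC).
  by rewrite mulrC mulfVK// gt_eqF// ltr_wpDl.
have HH (z : plane) : `|z.1 - z0.1| <= r /\ `|z.2 - z0.2| <= r ->
    [/\ D z, `|P z| <= K, `|Q z| <= K, `|mxD ix Q z| <= K & `|mxD ix (mxD ix Q) z| <= K].
  move=> [z1 z2]; have [Dz [[h1 h2] [h3 h4]]] := H z (le_lt_trans z1 rd) (le_lt_trans z2 rd).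
  have := normr_ge0 (P z0); have := normr_ge0 (Q z0); have := normr_ge0 (mxD ix Q z0).
  have := normr_ge0 (mxD ix (mxD ix Q) z0) => g1 g2 g3 g4.
  split=> //.
  - by rewrite (le_trans h1)// /K lerD2r -!addrA lerDl !addr_ge0.
  - by rewrite (le_trans h2)// /K lerD2r -[`|P z0| + _]addrC -!addrA lerDl !addr_ge0.
  - by rewrite (le_trans h3)// /K lerD2r -addrA addrCA lerDl !addr_ge0.
  - by rewrite (le_trans h4)// /K lerD2r lerDr !addr_ge0.
have [F HF] := @local_frobenius_square R N z0.1 z0.2 r K r0 r1 K0 NKr P Q (mxD iy P) (mxD ix Q)
  (mxD ix (mxD ix Q))
  (fun z zr => mx_Cinfty_continuous cP (let: And5 h _ _ _ _ := HH z zr in h))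
  (fun z zr => mx_Cinfty_continuous cQ (let: And5 h _ _ _ _ := HH z zr in h))
  (fun z zr => is_derive_mx_Cinfty iy cP (let: And5 h _ _ _ _ := HH z zr in h))
  (fun z zr => is_derive_mx_Cinfty ix cQ (let: And5 h _ _ _ _ := HH z zr in h))
  (fun z zr => is_derive_mx_Cinfty ix cQx (let: And5 h _ _ _ _ := HH z zr in h))
  (fun z zr => let: And5 _ h _ _ _ := HH z zr in h)
  (fun z zr => let: And5 _ _ h _ _ := HH z zr in h)
  (fun z zr => let: And5 _ _ _ h _ := HH z zr in h)
  (fun z zr => let: And5 _ _ _ _ h := HH z zr in h)
  (fun z zr => fl z (let: And5 h _ _ _ _ := HH z zr in h)).
exists r => //; exists F => -[x y] /= xr yr.
have [uF dx dy bF] := HF x y xr yr.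
have [Dz _ _ _ _] := HH (x, y) (conj (ltW xr) (ltW yr)).
split=> //; apply/cvgrPdist_le => e e0.
pose B : R := N%:R * (4 * N%:R * K) + 1.
have B0 : 0 < B by rewrite ltr_wpDl// !mulr_ge0.
have e2 : 0 < e / 2 by rewrite divr_gt0.
have [d1 d10 H1] := derive_local_cvg ((is_derive_ix _ _ _ _).1 dx) e2.
pose d2 := Num.min d1 (Num.min (r - `|x - z0.1|) (Num.min (r - `|y - z0.2|) (e / 2 / B))).
apply/nbhs_planeP; exists d2; first by rewrite !lt_min d10 !subr_gt0 xr yr divr_gt0.
move=> [x' y'] /=; rewrite !lt_min => /and4P[a1 a2 _ _] /and4P[_ _ c1 c2].
have x'r : `|x' - z0.1| < r.
  have -> : x' - z0.1 = (x' - x) + (x - z0.1) by ring.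
  by rewrite (le_lt_trans (ler_normD _ _))// -ltrBrDr.
have y'r : `|y' - z0.2| < r.
  have -> : y' - z0.2 = (y' - y) + (y - z0.2) by ring.
  by rewrite (le_lt_trans (ler_normD _ _))// -ltrBrDr.
have q1 := H1 _ a1.
have q2 : `|F (x', y') - F (x', y)| <= B * `|y' - y|.
  apply: (@mvt_bound _ _ _ (fun t => F (x', t)) (fun t => F (x', t) *m Q (x', t))).
  - exact: ltW.
  - move=> t ty; apply/is_derive_iy.
    by have [] := HF x' t x'r (seg_ball yr y'r ty).
  - move=> t ty; have tr := seg_ball yr y'r ty.
    have [_ _ _ bF'] := HF x' t x'r tr.
    have [_ _ bQ _ _] := HH (x', t) (conj (ltW x'r) (ltW tr)).
    rewrite (le_trans (mx_norm_mulmx _ _))// /B (@le_trans _ _ (N%:R * (4 * N%:R * K)))//.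
      by rewrite ler_wpM2l// ler_pM.
    by rewrite lerDl.
rewrite distrC -(subrKA (F (x', y))) (le_trans (ler_normD _ _))// (splitr e) lerD//.
rewrite (le_trans q2)// mulrC -ler_pdivlMr// ltW//.
Qed.

End LocalFrobenius2.

Section Surface.
Variables (R : realType) (L : riemann_surface R).
Local Notation plane := (R * R)%type.

Lemma chart_image_open (c : chart R L) (U : set L) : open U ->
  open (ccoord c @` (U `&` cdom c)).
Proof.
move=> oU; rewrite openE => _ [p [Up cp] <-].
have ni : nbhs (ccoord c p) (ccoord c @` cdom c).
  by apply: open_nbhs_nbhs; split; [exact: cimg_open|exists p].
have := @cinv_cont R L c (ccoord c p) (ex_intro2 _ _ p cp erefl).
rewrite /prop_for /continuous_at ccoordK// => cc.
have nU : nbhs (ccoord c p) (cinv c @^-1` U).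
  by apply: cc; exact: open_nbhs_nbhs.
apply: filterS (filterI ni nU) => _ [[q cq <-]] /=.
by rewrite ccoordK// => Uq; exists q.
Qed.

Lemma near_chart (c : chart R L) (p : L) (P : plane -> Prop) : cdom c p ->
  (\forall w \near ccoord c p, P w) -> \forall q \near p, cdom c q /\ P (ccoord c q).
Proof.
move=> cp HP; have nc : nbhs p (cdom c).
  by apply: open_nbhs_nbhs; split => //; exact: cdom_open.
have := ccoord_cont cp HP; rewrite nbhs_simpl/= => H.
by apply: filterS (filterI nc H).
Qed.

Lemma near_chart_inv (c : chart R L) (p : L) (P : L -> Prop) : cdom c p ->
  (\forall q \near p, P q) ->
  \forall w \near ccoord c p, exists2 q, cdom c q & ccoord c q = w /\ P q.
Proof.
move=> cp HP.
have ni : nbhs (ccoord c p) (ccoord c @` cdom c).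
  by apply: open_nbhs_nbhs; split; [exact: cimg_open|exists p].
have := @cinv_cont R L c (ccoord c p) (ex_intro2 _ _ p cp erefl).
rewrite /prop_for /continuous_at ccoordK// => /(_ _ HP); rewrite nbhs_simpl/= => H.
apply: filterS (filterI ni H) => _ [[q cq <-]] /=.
by rewrite ccoordK// => Pq; exists q.
Qed.

Variables (N : nat) (g : set 'M[R]_N) (alpha : oneform L 'M[R]_N).
Hypothesis hal : smooth_oneform g alpha.
Implicit Types (F : L -> 'M[R]_N) (p q : L).

(** The equation [dF = F alpha] at a point.  Invertibility is required near the point,
    where the derivative of the inverse is needed. *)
Definition sol_at F p :=
  [/\ \forall q \near p, F q \in unitmx, {for p, continuous F} &
      forall c i, atlas c -> cdom c p ->
        is_derive (ccoord c p) (dvec R i) (F \o cinv c) (F p *m alpha c i p)].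

(** Flatness of a real form, without the factor [1/2] of the bracket of forms. *)
Definition rflat :=
  forall c p, atlas c -> cdom c p ->
    mx_pd c ix (alpha c iy) p - mx_pd c iy (alpha c ix) p
      + lbr (alpha c ix p) (alpha c iy p) = 0.

Lemma alpha_Cinfty c i a b : atlas c ->
  Cinfty (ccoord c @` cdom c) (fun w => alpha c i (cinv c w) a b).
Proof.
by case: hal => _ _ H /(H c i a b); rewrite /smooth_in setIid.
Qed.

Lemma sol_at_local F G p : (\forall q \near p, F q = G q) -> sol_at F p -> sol_at G p.
Proof.
move=> FG [uF cF dF]; have FGp := nbhs_singleton FG.
split.
- by apply: filterS (filterI FG uF) => q [<-].
- rewrite /prop_for /continuous_at -FGp; apply: cvg_trans cF.
  exact: near_eq_cvg.
- move=> c i ac cp; rewrite -FGp.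
  apply: near_eq_is_derive (dF c i ac cp).
  by apply: filterS (near_chart_inv cp FG) => _ [q cq [<- E]] /=; rewrite ccoordK.
Qed.

Lemma sol_at_mull (C : 'M[R]_N) F p : C \in unitmx -> sol_at F p ->
  sol_at (fun q => C *m F q) p.
Proof.
move=> uC [uF cF dF]; split.
- by apply: filterS uF => q uFq; rewrite unitmx_mul uC.
- by apply: cvg_mulmxr.
- move=> c i ac cp; have := is_derive_mulmx (is_derive_cst C _ _) (dF c i ac cp).
  by rewrite mul0mx add0r mulmxA.
Qed.

(** A solution in one chart solves the equation in all charts, as both sides transform
    by the chain rule. *)
Lemma sol_local_exists p : rflat -> exists F, \forall q \near p, sol_at F q.
Proof.
move=> fl; have [c ac cp] := atlas_cover p.
pose D := ccoord c @` cdom c.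
pose P i (w : plane) := alpha c i (cinv c w).
have cP i a b : Cinfty D (fun w => P i w a b) by exact: alpha_Cinfty.
have flD z : D z -> mxD ix (P iy) z - mxD iy (P ix) z + lbr (P ix z) (P iy z) = 0.
  move=> [q cq <-]; have := fl c q ac cq.
  by rewrite /P ccoordK//; congr (_ - _ + _ = 0); apply/matrixP => a b; rewrite !mxE.
have Dp : D (ccoord c p) by exists p.
have [r r0 [G HG]] := local_frobenius (@cimg_open _ _ c) Dp (cP ix) (cP iy) flD.
pose F q := G (ccoord c q).
exists F.
have nsq : \forall w \near ccoord c p, `|w.1 - (ccoord c p).1| < r /\ `|w.2 - (ccoord c p).2| < r.
  by apply/nbhs_planeP; exists r.
have nsq2 : \forall w \near ccoord c p, \forall w' \near w,
    `|w'.1 - (ccoord c p).1| < r /\ `|w'.2 - (ccoord c p).2| < r.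
  exact: nbhs_interior nsq.
apply: filterS (near_chart cp nsq2) => q [cq nq].
have [q1 q2] := nbhs_singleton nq.
have [_ uG cG dGx dGy] := HG _ q1 q2.
have nq' := near_chart cq nq.
split.
- by apply: filterS nq' => q' [cq' [h1 h2]]; have [] := HG _ h1 h2.
- exact: (@continuous_comp _ _ _ (ccoord c) G q (ccoord_cont cq) cG).
move=> c' i ac' c'q.
have [_ compat _] := hal; rewrite (compat c' c i q ac' ac c'q cq).
have [sa sb _] := atlas_holo ac' ac.
have oD' : open (ccoord c' @` (cdom c `&` cdom c')) by apply: chart_image_open; exact: cdom_open.
have Dq : (ccoord c' @` (cdom c `&` cdom c')) (ccoord c' q) by exists q.
have da := Cinfty_is_derive i sa Dq; have db := Cinfty_is_derive i sb Dq.
set a' := 'D_(dvec R i) _ _ in da; set b' := 'D_(dvec R i) _ _ in db.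
have -> : pd c' i (fun q0 : L => (ccoord c q0).1) q = a' by [].
have -> : pd c' i (fun q0 : L => (ccoord c q0).2) q = b' by [].
apply/is_derive_mxP => m n.
set z' := ccoord c' q in da db *.
have la := (is_derive_line ((fun p0 : L => (ccoord c p0).1) \o cinv c') z' (dvec R i) 0 a').1.
have lb := (is_derive_line ((fun p0 : L => (ccoord c p0).2) \o cinv c') z' (dvec R i) 0 b').1.
rewrite scale0r add0r in la lb.
suff H : is_derive (0 : R) 1 (fun s => F (cinv c' (s *: dvec R i + z')) m n)
    ((F q *m (a' *: alpha c ix q + b' *: alpha c iy q)) m n).
  have := (is_derive_line (fun w => (F \o cinv c') w m n) z' (dvec R i) 0 _).2 H.
  by rewrite scale0r add0r.
have Pq j : P j (ccoord c q) = alpha c j q by rewrite /P ccoordK.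
have z0 : cinv c' (0 *: dvec R i + z') = q by rewrite scale0r add0r /z' ccoordK.
have ch := @chain_rule_curve R (fun w => G w m n) (fun w => (G w *m P ix w) m n)
  (fun w => (G w *m P iy w) m n)
  (fun s => (ccoord c (cinv c' (s *: dvec R i + z'))).1)
  (fun s => (ccoord c (cinv c' (s *: dvec R i + z'))).2) 0 a' b'.
rewrite z0 -surjective_pairing in ch.
have {}ch := ch _ _ _ (la da) (lb db).
rewrite !Pq in ch.
have -> : (F q *m (a' *: alpha c ix q + b' *: alpha c iy q)) m n =
   a' * (G (ccoord c q) *m alpha c ix q) m n + b' * (G (ccoord c q) *m alpha c iy q) m n.
  by rewrite mulmxDr -!scalemxAr !mxE.
have E : (fun s => F (cinv c' (s *: dvec R i + z')) m n) =
   (fun s => G ((ccoord c (cinv c' (s *: dvec R i + z'))).1,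
                (ccoord c (cinv c' (s *: dvec R i + z'))).2) m n).
  by apply/funext => s; rewrite -surjective_pairing.
rewrite E; apply: ch.
- apply: filterS nq => w [h1 h2]; have [_ _ _ hx hy] := HG w h1 h2.
  by split; [move/is_derive_mxP: hx|move/is_derive_mxP: hy]; apply.
- suff : {for ccoord c q, continuous (fun w => G w *m P ix w)} by move/cvg_mxP; exact.
  apply: cvg_mulmx => //; apply: (mx_Cinfty_continuous (cP ix)); by exists q.
- suff : {for ccoord c q, continuous (fun w => G w *m P iy w)} by move/cvg_mxP; exact.
  apply: cvg_mulmx => //; apply: (mx_Cinfty_continuous (cP iy)); by exists q.
Qed.

Lemma sol_smooth U F : open U -> (forall p, U p -> sol_at F p) -> mx_smooth_on U F.
Proof.
move=> oU sF a b c ac; rewrite /smooth_in.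
set D := _ @` _; have oD : open D by exact: chart_image_open.
have DD : D `<=` ccoord c @` cdom c by move=> _ [p [_ cp] <-]; exists p.
pose f (j : 'I_N * 'I_N) (w : plane) := F (cinv c w) j.1 j.2.
pose f' i (j : 'I_N * 'I_N) (w : plane) :=
  \sum_k F (cinv c w) j.1 k * alpha c i (cinv c w) k j.2.
apply: (@Cinfty_bootstrap R D oD _ f f' _ _ _ (a, b)).
- move=> j _ [p [Up cp] <-]; have [_ cF _] := sF p Up.
  have cc : {for ccoord c p, continuous (cinv c)} by apply: cinv_cont; exists p.
  have : {for ccoord c p, continuous (F \o cinv c)}.
    by apply: (continuous_comp cc); rewrite ccoordK.
  by move/cvg_mxP; exact.
- move=> i j _ [p [Up cp] <-]; have [_ _ dF] := sF p Up.
  have := dF c i ac cp => /is_derive_mxP/(_ j.1 j.2).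
  by rewrite mxE /f' ccoordK.
- move=> k Hk i j; apply: Ck_sum => // l; apply: CkM => //; first exact: (Hk (j.1, l)).
  by apply: CkW DD _; exact: alpha_Cinfty.
Qed.

(** The quotient of two solutions has zero derivative. *)
Lemma sol_local_unique F G p :
  (\forall q \near p, sol_at F q) -> (\forall q \near p, sol_at G q) -> F p = G p ->
  \forall q \near p, F q = G q.
Proof.
move=> sF sG FGp; have [c ac cp] := atlas_cover p.
have nn : \forall w \near ccoord c p,
    exists2 q, cdom c q & ccoord c q = w /\ (sol_at F q /\ sol_at G q).
  by apply: near_chart_inv => //; exact: filterI.
have [r r0 H] := (nbhs_planeP _ _).1 nn.
pose E w := (F \o cinv c) w *m invmx ((G \o cinv c) w).
have dE i (w : plane) : `|w.1 - (ccoord c p).1| < r -> `|w.2 - (ccoord c p).2| < r ->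
    is_derive w (dvec R i) E 0.
  move=> w1 w2; have [q cq [<- [[_ _ dF] [uG _ dG]]]] := H w w1 w2.
  have uGw : \forall y \near ccoord c q, (G \o cinv c) y \in unitmx.
    by apply: filterS (near_chart_inv cq uG) => _ [q' cq' [<- uq']]/=; rewrite ccoordK.
  have := is_derive_mulmx (dF c i ac cq) (is_derive_invmx uGw (dG c i ac cq)).
  move=> D; apply: is_derive_val D _.
  have uq := nbhs_singleton uG.
  by rewrite /= ccoordK// mulmxN !mulmxA mulmxKV// addrN.
have Ec (w : plane) : `|w.1 - (ccoord c p).1| < r -> `|w.2 - (ccoord c p).2| < r ->
    E w = E (ccoord c p).
  case: w => x y; case: (ccoord c p) (dE) => x0 y0 /= {}dE xr yr.
  have z0 (a : R) : `|a - a| < r by rewrite subrr normr0.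
  rewrite (_ : E (x, y) = E (x, y0)); last first.
    apply: (derive0_const (f := fun t => E (x, t))) => t ty.
    by apply/is_derive_iy; apply: dE => //=; exact: seg_ball ty.
  apply: (derive0_const (f := fun t => E (t, y0))) => t ty.
  by apply/is_derive_ix; apply: dE => //=; exact: seg_ball ty.
have nsq : \forall w \near ccoord c p, `|w.1 - (ccoord c p).1| < r /\ `|w.2 - (ccoord c p).2| < r.
  by apply/nbhs_planeP; exists r.
have uG : \forall q \near p, G q \in unitmx by have [] := nbhs_singleton sG.
apply: filterS (filterI uG (near_chart cp nsq)) => q [uq [cq [h1 h2]]].
have := Ec _ h1 h2; rewrite /E /= !ccoordK// FGp mulmxV ?(nbhs_singleton uG)// => E1.
by rewrite -[F q](mulmxKV uq) E1 mul1mx.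
Qed.

End Surface.

(** * Monodromy *)

Section Monodromy.
Variables (R : realType) (L : riemann_surface R) (N : nat) (gg : set 'M[R]_N).
Variable alpha : oneform L 'M[R]_N.
Hypotheses (hal : smooth_oneform gg alpha) (hfl : rflat alpha).
Local Notation sol := (sol_at alpha).
Local Notation plane := (R * R)%type.

(** Parallel transport over the part [B] of a map [g] into the surface: locally, [V] is
    the composition of [g] with a solution.  Nothing is assumed on [g] but continuity,
    as homotopies are only continuous. *)
Definition hor (K : topologicalType) (B : set K) (g : K -> L) (V : K -> 'M[R]_N) :=
  forall k, B k -> exists F, (\forall q \near g k, sol F q) /\
    \forall k' \near k, B k' -> V k' = F (g k').

Lemma hor_sub (K : topologicalType) (B B' : set K) g V :
  B' `<=` B -> hor B g V -> hor B' g V.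
Proof.
move=> BB H k /BB/H[F [sF FV]]; exists F; split=> //.
by apply: filterS FV => k' E /BB.
Qed.

Lemma hor_pull (K K' : topologicalType) (B : set K) (B' : set K') (e : K' -> K) g V :
  continuous e -> (forall k, B' k -> B (e k)) -> hor B g V -> hor B' (g \o e) (V \o e).
Proof.
move=> ce BB H k /BB/H[F [sF FV]]; exists F; split=> //.
have := ce k _ FV; rewrite nbhs_simpl/=; apply: filterS => k' E /BB.
exact: E.
Qed.

Lemma hor_eq (K : topologicalType) (B : set K) g g' V V' :
  (forall k, B k -> g k = g' k /\ V k = V' k) -> hor B g V -> hor B g' V'.
Proof.
move=> E H k Bk; have [F [sF FV]] := H k Bk; have [gE VE] := E k Bk.
exists F; split; first by rewrite -gE.
by apply: filterS FV => k' HV Bk'; have [<- <-] := E k' Bk'; exact: HV.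
Qed.

Lemma hor_mull (K : topologicalType) (B : set K) g V (C : 'M[R]_N) :
  C \in unitmx -> hor B g V -> hor B g (fun k => C *m V k).
Proof.
move=> uC H k Bk; have [F [sF FV]] := H k Bk.
exists (fun q => C *m F q); split.
  by apply: filterS sF => q; exact: sol_at_mull.
by apply: filterS FV => k' HV Bk'; rewrite HV.
Qed.

Lemma hor_unit (K : topologicalType) (B : set K) g V k : hor B g V -> B k -> V k \in unitmx.
Proof.
move=> H Bk; have [F [sF FV]] := H k Bk.
rewrite (nbhs_singleton FV)//; have [uF _ _] := nbhs_singleton sF.
exact: (nbhs_singleton uF).
Qed.

Lemma hor_const (K : topologicalType) (B : set K) (p : L) : hor B (fun=> p) (fun=> 1%:M).
Proof.
move=> k _; have [F sF] := sol_local_exists hal p hfl.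
have uF : F p \in unitmx by have [u _ _] := nbhs_singleton sF; exact: (nbhs_singleton u).
exists (fun q => invmx (F p) *m F q); split.
  by apply: filterS sF => q; apply: sol_at_mull; rewrite unitmx_inv.
by apply: filterE => k' _; rewrite mulVmx.
Qed.

Lemma hor_glue (K : topologicalType) (B1 B2 : set K) (g : K -> L) V1 V2 :
  continuous g -> closed B1 -> closed B2 ->
  (forall k, B1 k -> B2 k -> V1 k = V2 k) -> hor B1 g V1 -> hor B2 g V2 ->
  hor (B1 `|` B2) g (fun k => if `[< B1 k >] then V1 k else V2 k).
Proof.
move=> cg c1 c2 E H1 H2 k Bk.
have out (B : set K) : closed B -> ~ B k -> \forall k' \near k, ~ B k'.
  by move=> cB nB; apply: open_nbhs_nbhs; split=> //; exact: closed_openC.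
case: (pselect (B1 k)) => [B1k|nB1k].
- have [F1 [s1 E1]] := H1 k B1k; exists F1; split=> //.
  case: (pselect (B2 k)) => [B2k|nB2k].
    have [F2 [s2 E2]] := H2 k B2k.
    have F12 : F1 (g k) = F2 (g k).
      by rewrite -(nbhs_singleton E1)// -(nbhs_singleton E2)// E.
    have nF := cg k _ (sol_local_unique s1 s2 F12); rewrite nbhs_simpl/= in nF.
    apply: filterS (filterI nF (filterI E1 E2)) => k' [F12' [h1 h2]] Bk'.
    case: asboolP => [/h1//|nB1]; rewrite F12'; apply: h2.
    by case: Bk'.
  apply: filterS (filterI E1 (out _ c2 nB2k)) => k' [h1 n2] [B1k'|//].
  by case: asboolP => [/h1//|].
- have B2k : B2 k by case: Bk.
  have [F2 [s2 E2]] := H2 k B2k; exists F2; split=> //.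
  apply: filterS (filterI E2 (out _ c1 nB1k)) => k' [h2 n1] Bk'.
  by case: asboolP => [//|_]; apply: h2; case: Bk'.
Qed.

Definition seg (a b : R) : set R := [set t | a <= t <= b].

(** Locally both sections are multiples of the same solution. *)
Lemma hor_unique (g : R -> L) V1 V2 (a b : R) : a <= b -> continuous g ->
  hor (seg a b) g V1 -> hor (seg a b) g V2 ->
  V1 a *m invmx (V2 a) = V1 b *m invmx (V2 b).
Proof.
move=> ab cg H1 H2.
apply: (@interval_bisection R (fun a b => V1 a *m invmx (V2 a) = V1 b *m invmx (V2 b))) => //.
  by move=> x y z _ _ _ _ -> ->.
move=> t tab; have [F1 [s1 E1]] := H1 t tab; have [F2 [s2 E2]] := H2 t tab.
have u2 : F2 (g t) \in unitmx.
  by have [u _ _] := nbhs_singleton s2; exact: (nbhs_singleton u).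
have u1 : F1 (g t) \in unitmx.
  by have [u _ _] := nbhs_singleton s1; exact: (nbhs_singleton u).
pose C := F1 (g t) *m invmx (F2 (g t)).
have uC : C \in unitmx by rewrite unitmx_mul u1 unitmx_inv.
have s3 : \forall q \near g t, sol (fun q => C *m F2 q) q.
  by apply: filterS s2 => q; exact: sol_at_mull.
have E0 : F1 (g t) = C *m F2 (g t) by rewrite /C mulmxKV.
have nF := cg t _ (sol_local_unique s1 s3 E0); rewrite nbhs_simpl/= in nF.
have uu : \forall q \near g t, F2 q \in unitmx by have [u _ _] := nbhs_singleton s2.
have nu := cg t _ uu; rewrite nbhs_simpl/= in nu.
have HH : \forall s \near t, seg a b s -> V1 s *m invmx (V2 s) = C.
  apply: filterS (filterI (filterI nF nu) (filterI E1 E2)) => s [[h1 hu] [h3 h4]] sab.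
  by rewrite h3// h4// h1 mulmxK.
move: HH => /nbhs_ballP[d /= d0 Hd]; exists d => // x y ax xt ty yb xyd.
rewrite !Hd// /ball/= /seg/=.
- by rewrite distrC ger0_norm ?subr_ge0// (le_lt_trans _ xyd)// lerD2l lerN2.
- by rewrite (le_trans ax)// (le_trans xt).
- by rewrite ger0_norm ?subr_ge0// (le_lt_trans _ xyd)// lerD2r.
- by rewrite ax (le_trans xt)// (le_trans ty).
Qed.

Definition rect (a b c d : R) : set plane := [set z | a <= z.1 <= b /\ c <= z.2 <= d].

Lemma closed_seg a b : closed (seg a b).
Proof.
have -> : seg a b = `[a, b]%classic by apply/funext => t; rewrite /seg/= in_itv.
exact: itv_closed.
Qed.

Lemma closed_rect a b c d : closed (rect a b c d).
Proof.
have -> : rect a b c d = (fst @^-1` seg a b) `&` (snd @^-1` seg c d) by [].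
apply: closedI; apply: closed_comp; try exact: closed_seg.
  by move=> z _; exact: cvg_fst.
by move=> z _; exact: cvg_snd.
Qed.

Lemma pair_continuous_l (b : R) : continuous (fun t : R => (b, t) : plane).
Proof. by move=> t; exact: (@cvg_pair _ _ _ _ _ _ _ _ _ (fun=> b) id (cvg_cst _) cvg_id). Qed.

Lemma pair_continuous_r (b : R) : continuous (fun t : R => (t, b) : plane).
Proof. by move=> t; exact: (@cvg_pair _ _ _ _ _ _ _ _ _ id (fun=> b) cvg_id (cvg_cst _)). Qed.

(** Along the common curve the two sections differ by a constant factor on the left;
    multiplying one of them by it makes them agree. *)
Lemma hor_join (g : plane -> L) (B1 B2 : set plane) (e : R -> plane) (c d : R) V1 V2 :
  continuous g -> closed B1 -> closed B2 -> continuous e -> c <= d ->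
  (forall t, seg c d t -> B1 (e t) /\ B2 (e t)) ->
  (forall z, B1 z -> B2 z -> exists2 t, seg c d t & z = e t) ->
  hor B1 g V1 -> hor B2 g V2 -> exists V, hor (B1 `|` B2) g V.
Proof.
move=> cg c1 c2 ce cd eB Be H1 H2.
have cc : seg c d c by rewrite /seg/= lexx cd.
have cge : continuous (g \o e).
  by move=> t; apply: continuous_comp; [exact: ce|exact: cg].
have h1 : hor (seg c d) (g \o e) (V1 \o e).
  by apply: hor_pull H1 => // t /eB[].
have h2 : hor (seg c d) (g \o e) (V2 \o e).
  by apply: hor_pull H2 => // t /eB[].
pose C := V1 (e c) *m invmx (V2 (e c)).
have uC : C \in unitmx.
  by rewrite unitmx_mul unitmx_inv (hor_unit h1 cc) (hor_unit h2 cc).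
exists (fun k => if `[< B1 k >] then V1 k else C *m V2 k).
apply: hor_glue => //; last exact: hor_mull.
move=> z B1z B2z; have [t tcd ->] := Be z B1z B2z.
have /andP[ct td] := tcd.
have sb : seg c t `<=` seg c d by move=> s /andP[cs st]; rewrite /seg/= cs (le_trans st).
have := hor_unique ct cge (hor_sub sb h1) (hor_sub sb h2).
by rewrite /= -/C => ->; rewrite mulmxKV//; exact: (hor_unit h2 tcd).
Qed.

(** Two nested inductions over an interval: small squares lie in domains of solutions,
    they are joined to vertical strips, and these to the whole square. *)
Lemma hor_square (g : plane -> L) : continuous g -> exists V, hor (rect 0 1 0 1) g V.
Proof.
move=> cg; have H01 : (0 : R) <= 1 by [].
apply: (@interval_bisection R (fun a b => exists V, hor (rect a b 0 1) g V)) => //.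
  move=> a b c _ ab bc _ [V1 H1] [V2 H2].
  have [||V HV] := @hor_join g (rect a b 0 1) (rect b c 0 1) (fun t => (b, t)) 0 1 V1 V2 cg
    (closed_rect (a:=a) (b:=b) (c:=0) (d:=1)) (closed_rect (a:=b) (b:=c) (c:=0) (d:=1))
    (@pair_continuous_l b) H01 _ _ H1 H2.
  - by move=> t tcd; split; split => //=; rewrite lexx ?ab ?bc.
  - move=> [x y] [/= /andP[_ xb] ycd] [/= /andP[bx _] _]; exists y => //.
    by have -> : x = b by apply/eqP; rewrite eq_le xb.
  - exists V; apply: hor_sub HV => -[x y] [/= /andP[ax xc] ycd].
    by have [xb|/ltW bx] := leP x b; [left|right]; split; rewrite //= ?ax ?xc ?xb ?bx.
move=> t _.
have [d d0 [V HV]] : exists2 d, 0 < d & exists V, hor (rect (t - d) (t + d) 0 1) g V.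
  apply: (@interval_bisection R (fun a b => exists2 d, 0 < d &
    exists V, hor (rect (t - d) (t + d) a b) g V)) => //.
    move=> a b c _ ab bc _ [d1 d10 [V1 H1]] [d2 d20 [V2 H2]].
    pose d := Num.min d1 d2; have d0 : 0 < d by rewrite lt_min d10.
    have dd1 : d <= d1 by rewrite ge_min lexx.
    have dd2 : d <= d2 by rewrite ge_min lexx orbT.
    have {}H1 : hor (rect (t - d) (t + d) a b) g V1.
      apply: hor_sub H1 => z [/= /andP[z1 z2] z3]; split=> //=.
      by rewrite (le_trans _ z1) ?lerD2l ?lerN2// (le_trans z2)// lerD2l.
    have {}H2 : hor (rect (t - d) (t + d) b c) g V2.
      apply: hor_sub H2 => z [/= /andP[z1 z2] z3]; split=> //=.
      by rewrite (le_trans _ z1) ?lerD2l ?lerN2// (le_trans z2)// lerD2l.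
    exists d => //.
    have dd : t - d <= t + d by rewrite lerD2l ge0_cp// ltW.
    have [||V HV] := @hor_join g (rect (t - d) (t + d) a b) (rect (t - d) (t + d) b c)
      (fun s => (s, b)) (t - d) (t + d) V1 V2 cg
      (closed_rect (a:=t - d) (b:=t + d) (c:=a) (d:=b))
      (closed_rect (a:=t - d) (b:=t + d) (c:=b) (d:=c))
      (@pair_continuous_r b) dd _ _ H1 H2.
    - by move=> s scd; split; split => //=; rewrite lexx ?ab ?bc.
    - move=> [x y] [/= xcd /andP[_ yb]] [/= _ /andP[byy _]]; exists x => //.
      by have -> : y = b by apply/eqP; rewrite eq_le yb.
    - exists V; apply: hor_sub HV => -[x y] [/= xcd /andP[ay yc]].
      by have [yb|/ltW byy] := leP y b; [left|right]; split; rewrite //= ?ay ?yc ?yb ?byy.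
  move=> y _; have [F sF] := sol_local_exists hal (g (t, y)) hfl.
  have nF := cg (t, y) _ (nbhs_interior sF); rewrite nbhs_simpl/= in nF.
  have [d d0 Hd] := (nbhs_planeP _ _).1 nF.
  exists d => // a b _ ay yb _ abd; exists (d / 2); first by rewrite divr_gt0.
  have d2 : d / 2 < d by rewrite ltr_pdivrMr// ltr_pMr// ltr1n.
  exists (F \o g) => -[u v] [/= /andP[u1 u2] /andP[v1 v2]]; exists F; split; last exact: filterE.
  apply: (Hd (u, v)) => /=; rewrite ltr_norml; apply/andP; split; lra.
exists d => // a b a0 at_ tb b1 abd; exists V; apply: hor_sub HV => -[x y] [/= /andP[ax xb] ycd].
by split => //=; apply/andP; split; lra.
Qed.

(** [V1] is the result of parallel transport from [p0] to [p] along some path. *)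
Definition hpath (p0 p : L) (V1 : 'M[R]_N) := exists (gam : R -> L) (V : R -> 'M[R]_N),
  [/\ continuous gam, gam 0 = p0, gam 1 = p, V 0 = 1%:M & V 1 = V1 /\ hor (seg 0 1) gam V].

Lemma hpath_refl p0 : hpath p0 p0 1%:M.
Proof.
exists (fun=> p0), (fun=> 1%:M); split=> //; first by move=> t; exact: cvg_cst.
by split=> //; exact: hor_const.
Qed.

Lemma affine_continuous (a b : R) : continuous (fun t : R => a * t + b).
Proof.
move=> t; apply: cvgD; last exact: cvg_cst.
by apply: cvgMl_tmp; exact: cvg_id.
Qed.

Lemma concat_continuous (g1 g2 : R -> L) : continuous g1 -> continuous g2 -> g1 1 = g2 0 ->
  continuous (fun t : R => if t <= 2^-1 then g1 (2 * t + 0) else g2 (2 * t + -1)).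
Proof.
move=> c1 c2 E t.
have h1 : continuous (fun t : R => g1 (2 * t + 0)).
  by move=> s; apply: (@continuous_comp _ _ _ (fun t : R => 2 * t + 0) g1); [exact: affine_continuous|exact: c1].
have h2 : continuous (fun t : R => g2 (2 * t + -1)).
  by move=> s; apply: (@continuous_comp _ _ _ (fun t : R => 2 * t + -1) g2); [exact: affine_continuous|exact: c2].
have E2 : g1 (2 * 2^-1 + 0) = g2 (2 * 2^-1 + -1).
  by rewrite addr0 mulfV ?pnatr_eq0// subrr.
move=> U /= nU; rewrite nbhs_simpl/=.
have [tl|tr|te] := ltgtP t 2^-1.
- have n1 : \forall s \near t, s < 2^-1 by exact: lt_nbhsl.
  rewrite (ltW tl) in nU; have := h1 t U nU; rewrite nbhs_simpl/= => n2.
  by apply: filterS (filterI n1 n2) => s [/ltW sl Us]; rewrite /preimage/= sl.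
- have n1 : \forall s \near t, 2^-1 < s by exact: lt_nbhsr.
  rewrite leNgt tr/= in nU; have := h2 t U nU; rewrite nbhs_simpl/= => n2.
  by apply: filterS (filterI n1 n2) => s [st Us]; rewrite /preimage/= leNgt st.
- rewrite te lexx in nU; have n1 := h1 2^-1 U nU.
  rewrite E2 in nU; have n2 := h2 2^-1 U nU.
  rewrite te; move: n1 n2; rewrite !nbhs_simpl/= => n1 n2.
  by apply: filterS (filterI n1 n2) => s [u1 u2]; rewrite /preimage/=; case: ifP.
Qed.

Lemma hpath_extend p0 p q V1 F (e : R -> L) : hpath p0 p V1 -> continuous e ->
  e 0 = p -> e 1 = q -> (forall t, seg 0 1 t -> \forall r \near e t, sol F r) ->
  hpath p0 q (V1 *m invmx (F p) *m F q).
Proof.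
move=> [gam [V [cg g0 g1 V0 [VV1 HV]]]] ce e0 e1 sF.
have uFp : F p \in unitmx.
  have z01 : seg 0 1 0 by rewrite /seg/= lexx ler01.
  by have [u _ _] := nbhs_singleton (sF 0 z01); rewrite e0 in u; exact: (nbhs_singleton u).
have uV1 : V1 \in unitmx.
  by rewrite -VV1; apply: (hor_unit HV); rewrite /seg/= lexx ler01.
pose C := V1 *m invmx (F p).
have uC : C \in unitmx by rewrite unitmx_mul uV1 unitmx_inv.
have hE : hor (seg 0 1) e (fun t => C *m F (e t)).
  apply: hor_mull => // t t01; exists F; split; [exact: sF|exact: filterE].
pose cc (t : R) := if t <= 2^-1 then gam (2 * t + 0) else e (2 * t + -1).
have ccont : continuous cc by apply: concat_continuous => //; rewrite g1 e0.
have sub1 (t : R) : seg 0 2^-1 t -> seg 0 1 (2 * t + 0).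
  by rewrite /seg/= => /andP[? ?]; apply/andP; split; lra.
have sub2 (t : R) : seg 2^-1 1 t -> seg 0 1 (2 * t + -1).
  by rewrite /seg/= => /andP[? ?]; apply/andP; split; lra.
have H1 : hor (seg 0 2^-1) cc (fun t => V (2 * t + 0)).
  have := hor_pull (@affine_continuous 2 0) sub1 HV.
  by apply: hor_eq => t /andP[_ t2]; rewrite /cc t2.
have half : 2 * 2^-1 = 1 :> R by rewrite mulfV// pnatr_eq0.
have H2 : hor (seg 2^-1 1) cc (fun t => C *m F (e (2 * t + -1))).
  have := hor_pull (@affine_continuous 2 (-1)) sub2 hE.
  apply: hor_eq => t /andP[t1 _]; split=> //; rewrite /cc/=.
  case: ifP => // t2; have -> : t = 2^-1 by apply/eqP; rewrite eq_le t1 t2.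
  by rewrite half addr0 subrr g1 e0.
have HG := hor_glue ccont (closed_seg (a:=0) (b:=2^-1)) (closed_seg (a:=2^-1) (b:=1)) _ H1 H2.
exists cc, (fun k => if `[< seg 0 2^-1 k >] then V (2 * k + 0) else C *m F (e (2 * k + -1))).
have h0 : (0 : R) <= 2^-1 by rewrite invr_ge0.
have h1 : ((1 : R) <= 2^-1) = false by apply/negbTE; rewrite -ltNge invf_lt1// ltr1n.
split=> //.
- by rewrite /cc h0 mulr0 addr0.
- by rewrite /cc h1 mulr1 (_ : 2 + -1 = 1 :> R)//; ring.
- rewrite asboolT ?mulr0 ?addr0//; by rewrite /seg/= lexx h0.
- split.
    rewrite asboolF; last by rewrite /seg/= h1 andbF.
    by rewrite mulr1 (_ : 2 + -1 = 1 :> R) ?e1//; ring.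
  apply: hor_sub (HG _).
    by move=> t /andP[t0 t1]; rewrite /seg/=; have [th|/ltW th] := leP t 2^-1; [left|right]; apply/andP.
  move=> t /andP[_ t1] /andP[t2 _]; have -> : t = 2^-1 by apply/eqP; rewrite eq_le t1 t2.
  by rewrite half addr0 subrr VV1 e0 /C mulmxKV.
Qed.

Hypothesis hL : simply_connected L.

Definition clamp01 (t : R) : R := 2^-1 + clamp 2^-1 (t - 2^-1).

Lemma clamp01_continuous : continuous clamp01.
Proof.
move=> t; apply: cvgD; first exact: cvg_cst.
apply: (@continuous_comp _ _ _ (fun t : R => t - 2^-1) (clamp 2^-1)).
  by apply: cvgD; [exact: cvg_id|exact: cvg_cst].
exact: clamp_continuous.
Qed.

Lemma clamp01_in t : 0 <= clamp01 t <= 1.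
Proof.
have h0 : (0 : R) <= 2^-1 by rewrite invr_ge0.
have := clamp_le (t - 2^-1) h0; rewrite /clamp01 ler_norml => /andP[? ?].
by apply/andP; split; lra.
Qed.

Lemma clamp01_id t : seg 0 1 t -> clamp01 t = t.
Proof.
move=> /andP[t0 t1]; rewrite /clamp01 clamp_id; first by ring.
by rewrite ler_norml; apply/andP; split; lra.
Qed.

(** Two paths with the same ends form a loop.  Over the square of a homotopy that
    contracts it there is a flat section, constant on the three sides that are mapped
    to the base point; so transport along the loop is trivial. *)
Lemma hpath_unique p0 p V1 V2 : hpath p0 p V1 -> hpath p0 p V2 -> V1 = V2.
Proof.
move=> [g1 [U1 [c1 g10 g11 U10 [U11 H1]]]] [g2 [U2 [c2 g20 g21 U20 [U21 H2]]]].
pose r2 (t : R) := g2 (-1 * t + 1).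
have cr2 : continuous r2.
  move=> t; apply: (@continuous_comp _ _ _ (fun t : R => -1 * t + 1) g2).
    exact: affine_continuous.
  exact: c2.
pose cc (t : R) := if t <= 2^-1 then g1 (2 * t + 0) else r2 (2 * t + -1).
have r20 : r2 0 = p by rewrite /r2 mulr0 add0r g21.
have ccont : continuous cc by apply: concat_continuous => //; rewrite g11 r20.
have h0 : (0 : R) <= 2^-1 by rewrite invr_ge0.
have h1 : ((1 : R) <= 2^-1) = false by apply/negbTE; rewrite -ltNge invf_lt1// ltr1n.
have half : 2 * 2^-1 = 1 :> R by rewrite mulfV// pnatr_eq0.
have cc0 : cc 0 = p0 by rewrite /cc h0 mulr0 addr0.
have cc1 : cc 1 = p0.
  by rewrite /cc h1 /r2 mulr1 (_ : -1 * (2 + -1) + 1 = 0 :> R) ?g20//; ring.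
have [|h [ch hb ht hs]] := @hL cc (continuous_subspaceT ccont); first by rewrite cc0 cc1.
(* the homotopy is continuous on the unit square only *)
pose g (z : plane) := h (clamp01 z.1, clamp01 z.2).
have cg : continuous g.
  move=> z.
  have cq : continuous (fun z : plane => (clamp01 z.1, clamp01 z.2) : plane).
    have q1 : continuous (fun z : plane => clamp01 z.1).
      by move=> w; apply: (@continuous_comp _ _ _ fst clamp01); [exact: cvg_fst|exact: clamp01_continuous].
    have q2 : continuous (fun z : plane => clamp01 z.2).
      by move=> w; apply: (@continuous_comp _ _ _ snd clamp01); [exact: cvg_snd|exact: clamp01_continuous].
    move=> w; exact: (@cvg_pair _ _ _ _ _ _ _ _ _ (fun z : plane => clamp01 z.1)
      (fun z : plane => clamp01 z.2) (q1 w) (q2 w)).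
  have inQ (w : plane) : (`[0, 1]%classic `*` `[0, 1]%classic) (clamp01 w.1, clamp01 w.2).
    by split; rewrite /= in_itv/= clamp01_in.
  have := (subspace_continuousP _ _).1 ch _ (inQ z).
  move=> hc U nU; have := hc U nU; rewrite nbhs_simpl/= => nQ.
  have := cq z _ nQ; rewrite nbhs_simpl/=.
  by apply: filterS => w; apply; exact: inQ.
have [W HW] := hor_square cg.
have i0 : seg 0 1 (0 : R) by rewrite /seg/= lexx ler01.
have i1 : seg 0 1 (1 : R) by rewrite /seg/= lexx ler01.
have gE s t : seg 0 1 s -> seg 0 1 t -> g (s, t) = h (s, t).
  by move=> s1 t1; rewrite /g/= !clamp01_id.
have I t : seg 0 1 t -> `[0, 1]%classic t by rewrite /seg/= in_itv.
have hor_l (s : R) : seg 0 1 s -> hor (seg 0 1) (fun t => g (s, t)) (fun t => W (s, t)).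
  move=> s01; have := hor_pull (@pair_continuous_l s) (_ : forall t, seg 0 1 t -> rect 0 1 0 1 (s, t)) HW.
  by apply => t t01; split.
have hor_r (t : R) : seg 0 1 t -> hor (seg 0 1) (fun s => g (s, t)) (fun s => W (s, t)).
  move=> t01; have := hor_pull (@pair_continuous_r t) (_ : forall s, seg 0 1 s -> rect 0 1 0 1 (s, t)) HW.
  by apply => s s01; split.
have const (f : R -> L) (w : R -> 'M[R]_N) : (forall t, seg 0 1 t -> f t = p0) ->
    hor (seg 0 1) f w -> w 0 = w 1.
  move=> fp Hw; have Hw' : hor (seg 0 1) (fun=> p0) w by apply: hor_eq Hw => t /fp.
  have cp : continuous (fun _ : R => p0) by move=> t; exact: cvg_cst.
  have := hor_unique ler01 cp Hw' (@hor_const _ (seg 0 1) p0).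
  by rewrite invmx1 !mulmx1.
have W1 : W (0, 0) = W (1, 0).
  apply: (const (fun s => g (s, 0)) (fun s => W (s, 0)) _ (hor_r 0 i0)).
  by move=> t t01; rewrite gE// (hs t (I _ t01)).1 cc0.
have W2 : W (1, 0) = W (1, 1).
  apply: (const (fun s => g (1, s)) (fun s => W (1, s)) _ (hor_l 1 i1)).
  by move=> t t01; rewrite gE// (ht t (I _ t01)) cc0.
have W3 : W (0, 1) = W (1, 1).
  apply: (const (fun s => g (s, 1)) (fun s => W (s, 1)) _ (hor_r 1 i1)).
  by move=> t t01; rewrite gE// (hs t (I _ t01)).2 cc0.
have HB : hor (seg 0 1) cc (fun t => W (0, t)).
  by apply: hor_eq (hor_l 0 i0) => t t01; rewrite gE// (hb t (I _ t01)).
have sub1 (t : R) : seg 0 2^-1 t -> seg 0 1 (2 * t + 0).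
  by rewrite /seg/= => /andP[? ?]; apply/andP; split; lra.
have sub2 (t : R) : seg 2^-1 1 t -> seg 0 1 (-2 * t + 2).
  by rewrite /seg/= => /andP[? ?]; apply/andP; split; lra.
have hl1 : seg 0 2^-1 `<=` seg 0 1 by move=> t; rewrite /seg/= => /andP[? ?]; apply/andP; split; lra.
have hl2 : seg 2^-1 1 `<=` seg 0 1 by move=> t; rewrite /seg/= => /andP[? ?]; apply/andP; split; lra.
have K1 : hor (seg 0 2^-1) cc (fun t => U1 (2 * t + 0)).
  have := hor_pull (@affine_continuous 2 0) sub1 H1.
  by apply: hor_eq => t /andP[_ t2]; rewrite /cc t2.
have K2 : hor (seg 2^-1 1) cc (fun t => U2 (-2 * t + 2)).
  have := hor_pull (@affine_continuous (-2) 2) sub2 H2.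
  apply: hor_eq => t /andP[t1 _]; split=> //; rewrite /cc/=.
  case: ifP => t2.
    have -> : t = 2^-1 by apply/eqP; rewrite eq_le t1 t2.
    rewrite (_ : -2 * 2^-1 + 2 = 1 :> R); last by field.
    by rewrite half addr0 g21 g11.
  by rewrite /r2; congr g2; ring.
have h1' : (2^-1 : R) <= 1 by rewrite invf_le1// ler1n.
have := hor_unique h0 ccont (hor_sub hl1 HB) K1.
have := hor_unique h1' ccont (hor_sub hl2 HB) K2.
rewrite (_ : -2 * 2^-1 + 2 = 1 :> R); last by field.
rewrite (_ : -2 * 1 + 2 = 0 :> R); last by ring.
rewrite mulr0 addr0 half addr0 U10 U20 U11 U21 invmx1 !mulmx1 => E2 E1.
have uW : W (0, 2^-1) \in unitmx by apply: (hor_unit HB); rewrite /seg/= h0 h1'.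
have : invmx V1 = invmx V2.
  apply: (can_inj (mulKmx uW)); rewrite E2 -E1 W1 W2 W3//.
by move/(can_inj (@invmxK _ _)).
Qed.

End Monodromy.

(** * Global solutions *)

Section Global.
Variables (R : realType) (L : riemann_surface R).
Local Notation plane := (R * R)%type.

(** The points with the property and those without it are two open sets. *)
Lemma locally_constant_prop (P : L -> Prop) p0 :
  (forall p, \forall q \near p, P p <-> P q) -> P p0 -> forall p, P p.
Proof.
move=> loc P0 p; suff -> : P = [set: L] by [].
apply: (@rs_connected _ L); first by exists p0.
- exists P; last by rewrite setTI.
  rewrite openE => q Pq; apply: filterS (loc q) => r E; exact/E.
- exists P; last by rewrite setTI.
  rewrite -[P]setCK; apply: open_closedC; rewrite openE => q nPq.
  by apply: filterS (loc q) => r E /E.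
Qed.

Lemma chart_square (p : L) (P : L -> Prop) : (\forall q \near p, P q) ->
  exists c r, [/\ atlas c, cdom c p, 0 < r & forall w : plane,
    `|w.1 - (ccoord c p).1| < r -> `|w.2 - (ccoord c p).2| < r ->
    exists2 q, cdom c q & ccoord c q = w /\ P q].
Proof.
move=> HP; have [c ac cp] := atlas_cover p.
have [r r0 H] := (nbhs_planeP _ _).1 (near_chart_inv cp HP).
by exists c, r.
Qed.

Lemma near_square (c : chart R L) (p : L) (r : R) : cdom c p -> 0 < r ->
  \forall q \near p, [/\ cdom c q, `|(ccoord c q).1 - (ccoord c p).1| < r &
                         `|(ccoord c q).2 - (ccoord c p).2| < r].
Proof.
move=> cp r0.
have : \forall w \near ccoord c p, `|w.1 - (ccoord c p).1| < r /\ `|w.2 - (ccoord c p).2| < r.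
  by apply/nbhs_planeP; exists r.
by move/(near_chart cp); apply: filterS => q [? []].
Qed.

Lemma clamp01_seg (x0 r x y t : R) : `|x - x0| < r -> `|y - x0| < r -> 0 <= t <= 1 ->
  `|x + t * (y - x) - x0| < r.
Proof.
move=> hx hy /andP[t0 t1]; apply: (seg_ball hx hy).
have [xy|/ltW xy] := leP x y; rewrite -subr_ge0 in xy.
- have h1 := mulr_ge0 t0 xy; have t1' : 0 <= 1 - t by rewrite subr_ge0.
  by have h2 := mulr_ge0 t1' xy; apply/andP; split; lra.
- have h1 := mulr_ge0 t0 xy; have t1' : 0 <= 1 - t by rewrite subr_ge0.
  by have h2 := mulr_ge0 t1' xy; apply/andP; split; lra.
Qed.

Lemma locally_path_connected (p : L) (P : L -> Prop) : (\forall q \near p, P q) ->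
  \forall q \near p, exists e : R -> L,
    [/\ continuous e, e 0 = p, e 1 = q & forall t, P (e t)].
Proof.
move=> /chart_square[c [r [ac cp r0 H]]].
apply: filterS (near_square cp r0) => q [cq q1 q2].
set w := ccoord c p in H q1 q2; set w' := ccoord c q in q1 q2.
pose gam (t : R) : plane :=
  (w.1 + clamp01 t * (w'.1 - w.1), w.2 + clamp01 t * (w'.2 - w.2)).
have gin t : exists2 q, cdom c q & ccoord c q = gam t /\ P q.
  by apply: H => /=; apply: clamp01_seg => //; rewrite ?subrr ?normr0 ?clamp01_in.
have cl i0 i1 : continuous (fun t : R => i0 + clamp01 t * i1 : R).
  move=> t; apply: cvgD; first exact: cvg_cst.
  by apply: cvgMr_tmp; exact: clamp01_continuous.
have cgam : continuous gam.
  move=> t; exact: (@cvg_pair _ _ _ _ _ _ _ _ _ (fun t => w.1 + clamp01 t * (w'.1 - w.1))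
    (fun t => w.2 + clamp01 t * (w'.2 - w.2)) (cl _ _ t) (cl _ _ t)).
have s0 : seg 0 1 (0 : R) by rewrite /seg/= lexx ler01.
have s1 : seg 0 1 (1 : R) by rewrite /seg/= lexx ler01.
exists (fun t => cinv c (gam t)); split.
- move=> t; apply: (@continuous_comp _ _ _ gam (cinv c)); first exact: cgam.
  by have [q' cq' [E _]] := gin t; apply: cinv_cont; exists q'.
- by rewrite /gam clamp01_id// !mul0r !addr0 -surjective_pairing ccoordK.
- rewrite /gam clamp01_id// !mul1r ![_ + (_ - _)]addrC !subrK -surjective_pairing.
  by rewrite ccoordK.
- by move=> t; have [q' cq' [<- Pq']] := gin t; rewrite ccoordK.
Qed.

Variables (N : nat) (gg : set 'M[R]_N) (alpha : oneform L 'M[R]_N).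
Hypotheses (hal : smooth_oneform gg alpha) (hfl : rflat alpha).
Hypothesis hL : simply_connected L.
Local Notation sol := (sol_at alpha).

(** Transport along paths is independent of the path and, near each point, it is a
    constant multiple of a local solution. *)
Lemma global_solution p0 : exists F : L -> 'M[R]_N, F p0 = 1%:M /\ forall p, sol F p.
Proof.
pose hp := hpath alpha p0.
have ext p F : (\forall q \near p, sol F q) ->
    \forall q \near p, (forall V, hp p V -> hp q (V *m invmx (F p) *m F q)) /\
                       (forall V, hp q V -> hp p (V *m invmx (F q) *m F p)).
  move=> sF; have := locally_path_connected (nbhs_interior sF).
  apply: filterS => q [e [ce e0 e1 Pe]]; split=> V HV.
    by apply: (hpath_extend HV ce e0 e1) => t _; exact: Pe.
  apply: (@hpath_extend _ _ _ alpha p0 q p V F (fun t => e (-1 * t + 1)) HV).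
  - move=> t; apply: (@continuous_comp _ _ _ (fun t : R => -1 * t + 1) e).
      exact: affine_continuous.
    exact: ce.
  - by rewrite mulr0 add0r.
  - by rewrite mulr1 addNr.
  - by move=> t _; exact: Pe.
have reach : forall p, exists V, hp p V.
  apply: (@locally_constant_prop (fun p => exists V, hp p V) p0); last first.
    exists 1%:M; exact: (hpath_refl hal hfl).
  move=> p; have [F sF] := sol_local_exists hal p hfl.
  apply: filterS (ext p F sF) => q [h1 h2].
  by split=> -[V HV]; [exists (V *m invmx (F p) *m F q); exact: h1|
                       exists (V *m invmx (F q) *m F p); exact: h2].
pose F p := projT1 (cid (reach p)).
have HF p : hp p (F p) by exact: (projT2 (cid (reach p))).
have uniq p V1 V2 : hp p V1 -> hp p V2 -> V1 = V2 by exact: (hpath_unique hal hfl hL).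
exists F; split; first by apply: (uniq p0) => //; exact: (hpath_refl hal hfl).
move=> p; have [G sG] := sol_local_exists hal p hfl.
have uF : F p \in unitmx.
  have [gam [V [_ _ _ _ [<- HV]]]] := HF p; apply: (hor_unit HV).
  by rewrite /seg/= lexx ler01.
have uG : G p \in unitmx by have [u _ _] := nbhs_singleton sG; exact: (nbhs_singleton u).
apply: (@sol_at_local _ _ _ alpha (fun q => F p *m invmx (G p) *m G q)).
  by apply: filterS (ext p G sG) => q [h1 _]; apply: (uniq q) => //; exact: h1.
apply: sol_at_mull; last exact: (nbhs_singleton sG).
by rewrite unitmx_mul uF unitmx_inv.
Qed.

(** In a square chart any two points are joined by a horizontal and a vertical segment,
    on which the flow preserves the group. *)
Lemma solution_in_group (A : set 'M[R]_N) F p0 : matrix_lie_group A ->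
  (forall c i p, atlas c -> cdom c p -> lie_algebra A (alpha c i p)) ->
  (forall p, sol F p) -> A (F p0) -> forall p, A (F p).
Proof.
move=> hA Al sF A0; apply: locally_constant_prop A0 => p.
have triv : \forall q \near p, True by exact: filterE.
have [c [r [ac cp r0 H]]] := chart_square triv.
apply: filterS (near_square cp r0) => q [cq q1 q2].
set w := ccoord c p in H q1 q2; set w' := ccoord c q in q1 q2.
have flow i (a : R -> plane) (s t : R) :
   (forall u, Num.min s t <= u <= Num.max s t ->
     [/\ `|(a u).1 - w.1| < r, `|(a u).2 - w.2| < r, {for u, continuous a} &
      forall D, is_derive (a u) (dvec R i) (F \o cinv c) D ->
        is_derive u 1 (F \o cinv c \o a) D]) ->
   A (F (cinv c (a s))) -> A (F (cinv c (a t))).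
  move=> Ha.
  apply: (@group_curve_flow _ _ A hA (F \o cinv c \o a) s t
    (fun u => alpha c i (cinv c (a u)))) => u /Ha [h1 h2 ca da].
  - have [q' cq' [E _]] := H _ h1 h2; have [uF _ _] := sF q'.
    have := near_chart_inv cq' uF; rewrite E => nw.
    have := ca _ nw; rewrite nbhs_simpl/=; apply: filterS => v [q'' cq'' [/= <- Pq]].
    by rewrite ccoordK.
  - have [q' cq' [E _]] := H _ h1 h2; split; last by rewrite -E ccoordK//; exact: Al.
    apply: da; have [_ _ dF] := sF q'.
    by have := dF c i ac cq'; rewrite E /= -E ccoordK.
have hor_ (s t y : R) : `|s - w.1| < r -> `|t - w.1| < r -> `|y - w.2| < r ->
    A (F (cinv c (s, y))) -> A (F (cinv c (t, y))).
  move=> hs ht hy; apply: (flow ix (fun u => (u, y))) => u ust; split=> //=.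
  - exact: seg_ball ust.
  - exact: pair_continuous_r.
  - by move=> D /is_derive_ix.
have ver_ (s t x : R) : `|s - w.2| < r -> `|t - w.2| < r -> `|x - w.1| < r ->
    A (F (cinv c (x, s))) -> A (F (cinv c (x, t))).
  move=> hs ht hx; apply: (flow iy (fun u => (x, u))) => u ust; split=> //=.
  - exact: seg_ball ust.
  - exact: pair_continuous_l.
  - by move=> D /is_derive_iy.
have z0 (a : R) : `|a - a| < r by rewrite subrr normr0.
rewrite -(ccoordK cp) -(ccoordK cq) -/w -/w' (surjective_pairing w) (surjective_pairing w').
by split=> h; [apply: (ver_ w.2) => //; apply: (hor_ w.1)|
  apply: (hor_ w'.1) => //; apply: (ver_ w'.2)].
Qed.

End Global.

(** * Coordinate derivatives and flatness *)

Section CoordinateDerivatives.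
Variables (R : realType) (L : riemann_surface R).
Local Notation plane := (R * R)%type.
Implicit Types (c : chart R L) (p q : L).

(** Unlike the total function [pd], this predicate carries differentiability. *)
Definition pder (W : normedModType R) c i (F : L -> W) p (D : W) :=
  is_derive (ccoord c p) (dvec R i) (F \o cinv c) D.

Lemma pder_pd c i (g : L -> R) p d : pder c i g p d -> pd c i g p = d.
Proof. by move=> H; have := @derive_val _ _ _ _ _ _ _ H. Qed.

Lemma pder_near (W : normedModType R) c i (F G : L -> W) p D : cdom c p ->
  (\forall q \near p, F q = G q) -> pder c i F p D -> pder c i G p D.
Proof.
move=> cp FG H; apply: near_eq_is_derive H.
by apply: filterS (near_chart_inv cp FG) => _ [q cq [<- E]] /=; rewrite ccoordK.
Qed.

Lemma near_cdom c p : cdom c p -> \forall q \near p, cdom c q.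
Proof. by move=> cp; apply: open_nbhs_nbhs; split=> //; exact: cdom_open. Qed.

Lemma pder_cdom (W : normedModType R) c i (F G : L -> W) p D : cdom c p ->
  (forall q, cdom c q -> F q = G q) -> pder c i F p D -> pder c i G p D.
Proof. by move=> cp FG; apply: pder_near => //; apply: filterS (near_cdom cp). Qed.

Lemma pder_unique (W : normedModType R) c i (F : L -> W) p D D' :
  pder c i F p D -> pder c i F p D' -> D = D'.
Proof. by move=> H H'; have := @derive_val _ _ _ _ _ _ _ H; rewrite (@derive_val _ _ _ _ _ _ _ H'). Qed.

Lemma pderD (W : normedModType R) c i (F G : L -> W) p D E :
  pder c i F p D -> pder c i G p E -> pder c i (fun q => F q + G q) p (D + E).
Proof. exact: is_deriveD. Qed.

Lemma pderN (W : normedModType R) c i (F : L -> W) p D :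
  pder c i F p D -> pder c i (fun q => - F q) p (- D).
Proof. exact: is_deriveN. Qed.

Lemma pder_cst (W : normedModType R) c i p (w : W) : pder c i (fun=> w) p 0.
Proof. exact: is_derive_cst. Qed.

Lemma pderZ (W : normedModType R) c i (F : L -> W) p (a : R) D :
  pder c i F p D -> pder c i (fun q => a *: F q) p (a *: D).
Proof. exact: is_deriveZ. Qed.

Lemma pder_scalev (W : normedModType R) c i (f : L -> R) (w : W) p a :
  pder c i f p a -> pder c i (fun q => f q *: w) p (a *: w).
Proof. exact: is_derive_scalev. Qed.

Variable N : nat.

Lemma pder_mx_pd c i (F : L -> 'M[R]_N) p D : pder c i F p D -> mx_pd c i F p = D.
Proof.
move=> /is_derive_mxP H; apply/matrixP => a b; rewrite mxE.
exact: pder_pd (H a b).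
Qed.

Lemma pder_mulmx c i (F G : L -> 'M[R]_N) p D E : cdom c p ->
  pder c i F p D -> pder c i G p E ->
  pder c i (fun q => F q *m G q) p (D *m G p + F p *m E).
Proof.
move=> cp dF dG; have := is_derive_mulmx dF dG.
by rewrite /= ccoordK.
Qed.

Lemma pder_invmx c i (F : L -> 'M[R]_N) p D : cdom c p ->
  (\forall q \near p, F q \in unitmx) -> pder c i F p D ->
  pder c i (fun q => invmx (F q)) p (- (invmx (F p) *m D *m invmx (F p))).
Proof.
move=> cp uF dF.
have uF' : \forall y \near ccoord c p, (F \o cinv c) y \in unitmx.
  by apply: filterS (near_chart_inv cp uF) => _ [q cq [<- E]] /=; rewrite ccoordK.
by have := is_derive_invmx uF' dF; rewrite /= ccoordK.
Qed.

Lemma pder_lin_on (A : set 'M[R]_N) (W : normedModType R) (f : 'M[R]_N -> W) c i F p D :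
  is_subspace A -> lin_on A f -> cdom c p -> (\forall q \near p, A (F q)) ->
  pder c i F p D -> pder c i (fun q => f (F q)) p (f D).
Proof.
move=> sA fl cp AF dF; apply: (is_derive_lin_on sA fl) dF.
by apply: filterS (near_chart_inv cp AF) => _ [q cq [<- E]] /=; rewrite ccoordK.
Qed.

Lemma pder_subspace (A : set 'M[R]_N) c i F p D :
  is_subspace A -> cdom c p -> (\forall q \near p, A (F q)) -> pder c i F p D -> A D.
Proof.
move=> sA cp AF dF; apply: (subspace_derive sA) dF.
by apply: filterS (near_chart_inv cp AF) => _ [q cq [<- E]] /=; rewrite ccoordK.
Qed.

Lemma smooth_pder (U : set L) (F : L -> 'M[R]_N) c i p : mx_smooth_on U F ->
  atlas c -> U p -> cdom c p -> pder c i F p (mx_pd c i F p).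
Proof.
move=> sF ac Up cp; apply/is_derive_mxP => a b; rewrite mxE.
by apply: Cinfty_is_derive (sF a b c ac) _; exists p.
Qed.

Lemma smooth_continuous (U : set L) (F : L -> 'M[R]_N) p : mx_smooth_on U F ->
  U p -> {for p, continuous F}.
Proof.
move=> sF Up; have [c ac cp] := atlas_cover p.
apply/cvg_mxP => a b; have := sF a b c ac.
move=> /Cinfty_continuous/(_ (ex_intro2 _ _ p (conj Up cp) erefl)) cf.
have := continuous_comp (ccoord_cont cp) cf; rewrite /prop_for /continuous_at.
move=> cf'; have -> : F p a b = (((fun p0 => F p0 a b) \o cinv c) \o ccoord c) p.
  by rewrite /= ccoordK.
apply: cvg_trans cf'; apply: near_eq_cvg.
by apply: filterS (near_cdom cp) => q cq /=; rewrite ccoordK.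
Qed.

Lemma form_pder (g : set 'M[R]_N) (alpha : oneform L 'M[R]_N) c i j p :
  smooth_oneform g alpha -> atlas c -> cdom c p ->
  pder c i (alpha c j) p (mx_pd c i (alpha c j) p).
Proof.
move=> hal ac cp; apply/is_derive_mxP => a b; rewrite mxE.
by apply: Cinfty_is_derive (alpha_Cinfty hal j a b ac) _; exists p.
Qed.

(** Complex matrices are differentiated as pairs of real ones. *)
Definition Cpder c i (Z : L -> 'M[R[i]]_N) p (W : 'M[R[i]]_N) :=
  pder c i (fun q => mxRe (Z q)) p (mxRe W) /\ pder c i (fun q => mxIm (Z q)) p (mxIm W).

Lemma Cpder_pd c i Z p W : Cpder c i Z p W -> Cmx_pd c i Z p = W.
Proof.
move=> [/is_derive_mxP h1 /is_derive_mxP h2]; apply/matrixP => a b.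
have E1 : pd c i (fun q => mxRe (Z q) a b) p = mxRe W a b by exact: pder_pd (h1 a b).
have E2 : pd c i (fun q => mxIm (Z q) a b) p = mxIm W a b by exact: pder_pd (h2 a b).
rewrite !mxE /= in E1 E2; rewrite mxE /C_pd.
have fR : (fun q => mxRe (Z q) a b) = (fun q => complex.Re (Z q a b)).
  by apply/funext => q; rewrite mxE.
have fI : (fun q => mxIm (Z q) a b) = (fun q => complex.Im (Z q a b)).
  by apply/funext => q; rewrite mxE.
rewrite fR in E1; rewrite fI in E2.
by rewrite E1 E2; case: (W a b).
Qed.

Lemma Cpder_toC c i (P : L -> 'M[R]_N) p D : pder c i P p D ->
  Cpder c i (fun q => toC (P q)) p (toC D).
Proof.
move=> H; split; rewrite ?mxRe_toC ?mxIm_toC.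
- by under eq_fun do rewrite mxRe_toC.
- by under eq_fun do rewrite mxIm_toC; exact: pder_cst.
Qed.

Lemma mxReD (Z W : 'M[R[i]]_N) : mxRe (Z + W) = mxRe Z + mxRe W.
Proof. by apply/matrixP => a b; rewrite !mxE; case: (Z a b); case: (W a b). Qed.
Lemma mxImD (Z W : 'M[R[i]]_N) : mxIm (Z + W) = mxIm Z + mxIm W.
Proof. by apply/matrixP => a b; rewrite !mxE; case: (Z a b); case: (W a b). Qed.
Lemma mxReZ k (Z : 'M[R[i]]_N) : mxRe (k *: Z) = complex.Re k *: mxRe Z - complex.Im k *: mxIm Z.
Proof. by apply/matrixP => a b; rewrite !mxE; case: (Z a b); case: k. Qed.
Lemma mxImZ k (Z : 'M[R[i]]_N) : mxIm (k *: Z) = complex.Im k *: mxRe Z + complex.Re k *: mxIm Z.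
Proof. by apply/matrixP => a b; rewrite !mxE; case: (Z a b); case: k => ? ? ? ? /=; ring. Qed.

Lemma CpderD c i Z Z' p W W' : Cpder c i Z p W -> Cpder c i Z' p W' ->
  Cpder c i (fun q => Z q + Z' q) p (W + W').
Proof.
move=> [h1 h2] [h3 h4]; split; rewrite ?mxReD ?mxImD.
- by under eq_fun do rewrite mxReD; exact: pderD.
- by under eq_fun do rewrite mxImD; exact: pderD.
Qed.

Lemma CpderZ c i k Z p W : Cpder c i Z p W -> Cpder c i (fun q => k *: Z q) p (k *: W).
Proof.
move=> [h1 h2]; split; rewrite ?mxReZ ?mxImZ.
- by under eq_fun do rewrite mxReZ; apply: pderD; [exact: pderZ|apply: pderN; exact: pderZ].
- by under eq_fun do rewrite mxImZ; apply: pderD; exact: pderZ.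
Qed.

Lemma Cpder_cdom c i Z Z' p W : cdom c p -> (forall q, cdom c q -> Z q = Z' q) ->
  Cpder c i Z p W -> Cpder c i Z' p W.
Proof.
move=> cp E [h1 h2]; split.
- by apply: pder_cdom h1 => // q /E ->.
- by apply: pder_cdom h2 => // q /E ->.
Qed.

Lemma toCD (X Y : 'M[R]_N) : toC (X + Y) = toC X + toC Y.
Proof. by apply/matrixP => a b; rewrite !mxE; cplx; rewrite ?addr0. Qed.
Lemma toCB (X Y : 'M[R]_N) : toC (X - Y) = toC X - toC Y.
Proof. by rewrite toCD toCN. Qed.
Lemma toCZ (a : R) (X : 'M[R]_N) : toC (a *: X) = Complex a 0 *: toC X.
Proof. by apply/matrixP => i j; rewrite !mxE; cplx; ring. Qed.
Lemma toCM (X Y : 'M[R]_N) : toC (X *m Y) = toC X *m toC Y.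
Proof. exact: (@map_mxM _ _ (real_complex R)). Qed.
Lemma toC_lbr (X Y : 'M[R]_N) : toC (lbr X Y) = lbr (toC X) (toC Y).
Proof. by rewrite /lbr toCB !toCM. Qed.

Lemma wedge_brxx (eta : oneform L 'M[R[i]]_N) c p :
  2^-1 *: wedge_br eta eta c p = lbr (eta c ix p) (eta c iy p).
Proof.
rewrite /wedge_br (lbrC (eta c iy p)) opprK.
have -> (X : 'M[R[i]]_N) : X + X = (2 : R[i]) *: X by rewrite scaler_nat mulr2n.
by rewrite scalerA mulVf ?scale1r// pnatr_eq0.
Qed.

Lemma flat_toC (g : set 'M[R]_N) (alpha : oneform L 'M[R]_N) : smooth_oneform g alpha ->
  flat (toC_form alpha) <-> rflat alpha.
Proof.
move=> hal; have E c p : atlas c -> cdom c p ->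
    ext_d (toC_form alpha) c p + 2^-1 *: wedge_br (toC_form alpha) (toC_form alpha) c p =
    toC (mx_pd c ix (alpha c iy) p - mx_pd c iy (alpha c ix) p
      + lbr (alpha c ix p) (alpha c iy p)).
  move=> ac cp; rewrite wedge_brxx /ext_d toCD toCB toC_lbr.
  by rewrite !(Cpder_pd (Cpder_toC (form_pder _ _ hal ac cp))).
split=> H c p ac cp; have := H c p ac cp; rewrite E//; last by move->; rewrite toC0.
by rewrite -toC0 => /toC_inj.
Qed.

(** Mixed second derivatives of a solution commute, so its form is flat. *)
Lemma sol_rflat (g : set 'M[R]_N) (alpha : oneform L 'M[R]_N) F : smooth_oneform g alpha ->
  (forall p, sol_at alpha F p) -> rflat alpha.
Proof.
move=> hal sF c p ac cp.
have [uF cF _] := sF p; have up := nbhs_singleton uF.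
have cinvc w : (ccoord c @` cdom c) w -> {for w, continuous (F \o cinv c)}.
  move=> [q cq <-]; have [_ cq' _] := sF q.
  apply: continuous_comp; first by apply: cinv_cont; exists q.
  by rewrite ccoordK.
have nD : \forall w \near ccoord c p, (ccoord c @` cdom c) w.
  by apply: open_nbhs_nbhs; split; [exact: cimg_open|exists p].
pose f2 i j (w : plane) := (F \o cinv c) w *m alpha c i (cinv c w) *m alpha c j (cinv c w)
   + (F \o cinv c) w *m mxD i (fun w => alpha c j (cinv c w)) w.
have d1 i w : (ccoord c @` cdom c) w ->
    is_derive w (dvec R i) (F \o cinv c) ((F \o cinv c) w *m alpha c i (cinv c w)).
  by move=> [q cq <-]; have [_ _ dF] := sF q; rewrite /= ccoordK//; exact: dF.
have cal j a b := alpha_Cinfty hal j a b ac.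
have d2 i j w : (ccoord c @` cdom c) w ->
    is_derive w (dvec R i) (fun w => (F \o cinv c) w *m alpha c j (cinv c w)) (f2 i j w).
  move=> Dw; apply: is_derive_mulmx; first exact: d1.
  exact: (is_derive_mx_Cinfty i (cal j) Dw).
have D0 : (ccoord c @` cdom c) (ccoord c p) by exists p.
have cf2 i j : {for ccoord c p, continuous (f2 i j)}.
  have ca k : {for ccoord c p, continuous (fun w => alpha c k (cinv c w))}.
    exact: (mx_Cinfty_continuous (cal k) D0).
  apply: cvgD; first by apply: cvg_mulmx; [apply: cvg_mulmx; [exact: cinvc|exact: ca]|exact: ca].
  apply: cvg_mulmx; first exact: cinvc.
  exact: (mx_Cinfty_continuous (mxD_Cinfty i (@cimg_open _ _ c) (cal j)) D0).
have E : f2 iy ix (ccoord c p) = f2 ix iy (ccoord c p).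
  apply/matrixP => a b; apply: (@schwarz R (fun w => (F \o cinv c) w a b)
    (fun w => ((F \o cinv c) w *m alpha c ix (cinv c w)) a b)
    (fun w => ((F \o cinv c) w *m alpha c iy (cinv c w)) a b)
    (fun w => f2 iy ix w a b) (fun w => f2 ix iy w a b)).
  - by apply: filterS nD => w Dw; split; move: a b; apply/is_derive_mxP; exact: d1.
  - by apply: filterS nD => w Dw; split; move: a b; apply/is_derive_mxP; exact: d2.
  - by move: a b; apply/cvg_mxP; exact: cf2.
  - by move: a b; apply/cvg_mxP; exact: cf2.
move: E; rewrite /f2 /= !ccoordK// -!mulmxA -!mulmxDr => /(can_inj (mulKmx up)) E.
have mE i j : mxD i (fun w => alpha c j (cinv c w)) (ccoord c p) = mx_pd c i (alpha c j) p by [].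
rewrite !mE in E; rewrite /lbr.
move/eqP: E; rewrite -subr_eq0 => /eqP E; rewrite -oppr0 -E.
by rewrite !opprD !opprK; apply/matrixP => a b; rewrite !mxE; ring.
Qed.

End CoordinateDerivatives.

(** * Eigencomponents of a one-form *)

Section Decomposition.
Variables (R : realType) (N : nat) (S : sym_data R N).
Hypothesis hS : hermitian_symmetric S.
Implicit Types (X Y : 'M[R]_N) (Z W : 'M[R[i]]_N).
Local Notation T := (dtau S).
Let lgS := lg_subspace hS.
Let tL : lin_on (lg S) T := hs_dtauL hS.

Lemma halfC : Complex 2^-1 0 = 2^-1 :> R[i].
Proof. by rewrite -[Complex _ _]/(real_complex R 2^-1) fmorphV rmorph_nat. Qed.

Lemma dtauCD Z W : lgC S Z -> lgC S W -> dtauC S (Z + W) = dtauC S Z + dtauC S W.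
Proof.
move=> [z1 z2] [w1 w2]; rewrite /dtauC mxReD mxImD !(lin_onD tL)// !toCD scalerDr.
by rewrite addrACA.
Qed.

Lemma dtauCZ k Z : lgC S Z -> dtauC S (k *: Z) = k *: dtauC S Z.
Proof.
move=> [z1 z2]; rewrite /dtauC mxReZ mxImZ.
have zz a : lg S (a *: mxRe Z) /\ lg S (a *: mxIm Z) by split; exact: (subspaceZ lgS).
rewrite (lin_onB lgS tL (zz _).1 (zz _).2) (lin_onD tL (zz _).1 (zz _).2).
rewrite !(lin_onZ lgS _ tL)// toCB toCD !toCZ.
case: k {zz} => x y /=; set U := toC _; set V := toC (T (mxIm Z)).
have -> : Complex x y = Complex x 0 + imu R * Complex y 0 by rewrite /imu; cplx; ring.
have i2 : imu R * Complex y 0 * imu R = - Complex y 0 by rewrite mulrAC imuM mulN1r.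
rewrite !scalerDr !scalerDl !scalerA i2 scaleNr [Complex x 0 * imu R]mulrC.
move: (Complex x 0 *: U) (Complex y 0 *: V) (_ *: U) (_ *: V) => A B C D.
by rewrite addrACA; congr (_ + _); exact: addrC.
Qed.

Lemma lgCD Z W : lgC S Z -> lgC S W -> lgC S (Z + W).
Proof. by move=> [? ?] [? ?]; rewrite /lgC/= mxReD mxImD; split; exact: (subspaceD lgS). Qed.

Lemma lgCZ k Z : lgC S Z -> lgC S (k *: Z).
Proof.
move=> [z1 z2]; rewrite /lgC/= mxReZ mxImZ.
by split; [apply: (subspaceB lgS)|apply: (subspaceD lgS)]; exact: (subspaceZ lgS).
Qed.

Definition gpart2 X : 'M[R]_N := 2^-1 *: (hpart S X - T (hpart S X)).
Definition gpart0 X : 'M[R]_N := 2^-1 *: (hpart S X + T (hpart S X)).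

(** Applying the automorphism repeatedly to a real element multiplies its components
    by powers of [i]; the h-part and the m-part and their images determine them. *)
Lemma eigen_components X Z2 Z0 Zm Z1 : lg S X -> lgC_ S 2 Z2 -> lgC_ S 0 Z0 ->
  lgC_ S (-1) Zm -> lgC_ S 1 Z1 -> toC X = Z2 + Z0 + Zm + Z1 ->
  [/\ Z2 = toC (gpart2 X), Z0 = toC (gpart0 X),
      Zm = 2^-1 *: (toC (mpart S X) + imu R *: toC (T (mpart S X))) &
      Z1 = 2^-1 *: (toC (mpart S X) - imu R *: toC (T (mpart S X)))].
Proof.
move=> lX [g2 e2] [g0 e0] [gm em] [g1 e1] E.
rewrite imu2 in e2; rewrite expr0z scale1r in e0; rewrite imuN1 in em; rewrite expr1z in e1.
have step (k2 k0 km k1 : R[i]) Y : toC Y = k2 *: Z2 + k0 *: Z0 + km *: Zm + k1 *: Z1 ->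
    toC (T Y) = (- k2) *: Z2 + k0 *: Z0 + (- imu R * km) *: Zm + (imu R * k1) *: Z1.
  have l2 := lgCZ k2 g2; have l0 := lgCZ k0 g0; have lm_ := lgCZ km gm; have l1 := lgCZ k1 g1.
  move=> EY; rewrite -(dtauC_toC hS) EY (dtauCD (lgCD (lgCD l2 l0) lm_) l1).
  rewrite (dtauCD (lgCD l2 l0) lm_) (dtauCD l2 l0) (dtauCZ _ g2) (dtauCZ _ g0) (dtauCZ _ gm).
  rewrite (dtauCZ _ g1) e2 e0 em e1 !scalerA mulrN1.
  by rewrite [km * _]mulrC [k1 * _]mulrC.
have E0 : toC X = 1 *: Z2 + 1 *: Z0 + 1 *: Zm + 1 *: Z1 by rewrite !scale1r.
have E1 := step _ _ _ _ _ E0; have E2 := step _ _ _ _ _ E1; have E3 := step _ _ _ _ _ E2.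
have i2 : imu R * imu R = -1 := imuM R.
have Eh : toC (hpart S X) = Z2 + Z0.
  rewrite /hpart toCZ toCD E0 E2 halfC; apply/matrixP => a b; rewrite !mxE.
  rewrite !mulrA !mulrN !mulNr !opprK i2; by field.
have Em : toC (mpart S X) = Zm + Z1.
  rewrite /mpart toCZ toCB E0 E2 halfC; apply/matrixP => a b; rewrite !mxE.
  rewrite !mulrA !mulrN !mulNr !opprK i2; by field.
have Eh' : toC (hpart S X) = 1 *: Z2 + 1 *: Z0 + 0 *: Zm + 0 *: Z1.
  by rewrite Eh !scale1r !scale0r !addr0.
have Em' : toC (mpart S X) = 0 *: Z2 + 0 *: Z0 + 1 *: Zm + 1 *: Z1.
  by rewrite Em !scale1r !scale0r !add0r.
have Th := step _ _ _ _ _ Eh'; have Tm := step _ _ _ _ _ Em'.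
rewrite !mulr0 !scale0r !addr0 scale1r scaleN1r in Th.
rewrite oppr0 !mulr1 !scale0r !add0r in Tm.
have iTm : imu R *: toC (T (mpart S X)) = Zm - Z1.
  by rewrite Tm scalerDr !scalerA mulrN i2 opprK scale1r scaleN1r.
split.
- rewrite /gpart2 toCZ toCB Eh Th halfC; apply/matrixP => a b; rewrite !mxE; by field.
- rewrite /gpart0 toCZ toCD Eh Th halfC; apply/matrixP => a b; rewrite !mxE; by field.
- rewrite Em iTm; apply/matrixP => a b; rewrite !mxE; by field.
- rewrite Em iTm; apply/matrixP => a b; rewrite !mxE; by field.
Qed.

Lemma gpart_sum X : X = gpart2 X + gpart0 X + mpart S X.
Proof.
rewrite -{1}(hpartDmpart S X); congr (_ + _).
by apply/matrixP => a b; rewrite /gpart2 /gpart0 !mxE; by field.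
Qed.

Lemma gpart2_lin : lin_on (lg S) gpart2.
Proof.
move=> a X Y lX lY; have hl (Z : 'M[R]_N) (lZ : lg S Z) := lh_lg (lh_hpart hS lZ).
rewrite /gpart2 (hpart_lin hS)// tL; [|exact: hl|exact: hl].
by apply/matrixP => i j; rewrite !mxE; ring.
Qed.

Lemma gpart0_lin : lin_on (lg S) gpart0.
Proof.
move=> a X Y lX lY; have hl (Z : 'M[R]_N) (lZ : lg S Z) := lh_lg (lh_hpart hS lZ).
rewrite /gpart0 (hpart_lin hS)// tL; [|exact: hl|exact: hl].
by apply/matrixP => i j; rewrite !mxE; ring.
Qed.

Lemma gpart2_lh X : lg S X -> lh S (gpart2 X).
Proof.
move=> lX; have hl := lh_hpart hS lX.
by apply: subspaceZ; [exact: lh_subspace|]; apply: subspaceB; [exact: lh_subspace|done|exact: lh_dtau].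
Qed.

Lemma gpart0_lh X : lg S X -> lh S (gpart0 X).
Proof.
move=> lX; have hl := lh_hpart hS lX.
by apply: subspaceZ; [exact: lh_subspace|]; apply: subspaceD; [exact: lh_subspace|done|exact: lh_dtau].
Qed.

Lemma dtau_gpart2 X : lg S X -> T (gpart2 X) = - gpart2 X.
Proof.
move=> lX; have hl := lh_hpart hS lX; have lhl := lh_lg hl.
have lT := lg_dtau hS lhl.
rewrite /gpart2 (lin_onZ lgS _ tL) ?(lin_onB lgS tL)//; last exact: (subspaceB lgS).
have -> : T (T (hpart S X)) = hpart S X by case: hl.
by rewrite -[RHS]scalerN opprB.
Qed.

Lemma dtau_gpart0 X : lg S X -> T (gpart0 X) = gpart0 X.
Proof.
move=> lX; have hl := lh_hpart hS lX; have lhl := lh_lg hl.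
have lT := lg_dtau hS lhl.
rewrite /gpart0 (lin_onZ lgS _ tL) ?(lin_onD tL)//; last exact: (subspaceD lgS).
have -> : T (T (hpart S X)) = hpart S X by case: hl.
by rewrite addrC.
Qed.

Lemma gpart2_sY X : lg S X -> exists t, gpart2 X = t *: sY S.
Proof.
move=> lX; have : lg_ S 2 (gpart2 X).
  by apply/lg_2P => //; split; [apply: lh_lg; exact: gpart2_lh|exact: dtau_gpart2].
by rewrite (hs_g2 hS) => -[t _ <-]; exists t.
Qed.

Variables (L : riemann_surface R) (alpha : oneform L 'M[R]_N).
Hypothesis hal : smooth_oneform (lg S) alpha.
Variables a2 a0 am1 a1 : oneform L 'M[R[i]]_N.
Hypotheses (h2 : forall c i p, atlas c -> cdom c p -> lgC_ S 2 (a2 c i p))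
  (h0 : forall c i p, atlas c -> cdom c p -> lgC_ S 0 (a0 c i p))
  (hm1 : forall c i p, atlas c -> cdom c p -> lgC_ S (-1) (am1 c i p))
  (h1 : forall c i p, atlas c -> cdom c p -> lgC_ S 1 (a1 c i p))
  (hdec : forall c i p, atlas c -> cdom c p ->
     toC (alpha c i p) = a2 c i p + a0 c i p + am1 c i p + a1 c i p).

(** The velocities are related as the two vectors of a special unitary frame. *)
Definition primitive_form := forall c p, atlas c -> cdom c p ->
  mpart S (alpha c iy p) = - T (mpart S (alpha c ix p)).

Lemma alpha_lg c i p : atlas c -> cdom c p -> lg S (alpha c i p).
Proof. by case: hal => H _ _; exact: H. Qed.

Lemma form_components c i p : atlas c -> cdom c p ->
  let b := mpart S (alpha c i p) in
  [/\ a2 c i p = toC (gpart2 (alpha c i p)), a0 c i p = toC (gpart0 (alpha c i p)),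
      am1 c i p = 2^-1 *: (toC b + imu R *: toC (T b)) &
      a1 c i p = 2^-1 *: (toC b - imu R *: toC (T b))].
Proof.
move=> ac cp; apply: eigen_components; [exact: alpha_lg|exact: h2|exact: h0|
  exact: hm1|exact: h1|exact: hdec].
Qed.

(** Both conditions of partial primitivity are complex forms of the same real
    equation between the two m-parts. *)
Lemma partially_primitiveP :
  zero_form (part01 am1) /\ zero_form (part10 a1) <-> primitive_form.
Proof.
have i2 : imu R * imu R = -1 := imuM R.
have t2 c i p : atlas c -> cdom c p ->
    T (T (mpart S (alpha c i p))) = - mpart S (alpha c i p).
  by move=> ac cp; apply: dtau2_lm; apply: lm_mpart => //; exact: alpha_lg.
have E01 c p : atlas c -> cdom c p ->
    2^-1 *: (am1 c ix p + imu R *: am1 c iy p) =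
    (2^-1 * 2^-1) *: (toC (mpart S (alpha c ix p) - T (mpart S (alpha c iy p)))
      + imu R *: toC (mpart S (alpha c iy p) + T (mpart S (alpha c ix p)))).
  move=> ac cp; have [_ _ -> _] := form_components ix ac cp.
  have [_ _ -> _] := form_components iy ac cp.
  rewrite toCB toCD -scalerA; congr (_ *: _).
  rewrite [imu R *: (2^-1 *: _)]scalerA [imu R * _]mulrC -scalerA -scalerDr; congr (_ *: _).
  rewrite !scalerDr scalerA i2 scaleN1r.
  by apply/matrixP => a b; rewrite !mxE; ring.
have E10 c p : atlas c -> cdom c p ->
    2^-1 *: (a1 c ix p - imu R *: a1 c iy p) =
    (2^-1 * 2^-1) *: (toC (mpart S (alpha c ix p) - T (mpart S (alpha c iy p)))
      + imu R *: toC (- (mpart S (alpha c iy p) + T (mpart S (alpha c ix p))))).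
  move=> ac cp; have [_ _ _ ->] := form_components ix ac cp.
  have [_ _ _ ->] := form_components iy ac cp.
  rewrite toCB toCN toCD -scalerA; congr (_ *: _).
  rewrite [imu R *: (2^-1 *: _)]scalerA [imu R * _]mulrC -scalerA -scalerBr; congr (_ *: _).
  rewrite !scalerDr !scalerN scalerA i2 scaleN1r !scalerDr.
  by apply/matrixP => a b; rewrite !mxE; ring.
split=> [[H _]|prim].
  move=> c p ac cp; have := H c ix p ac cp; rewrite /part01 eqxx E01//.
  move/eqP; rewrite scaler_eq0 mulf_eq0 invr_eq0 pnatr_eq0/= => /eqP E.
  have [|_ /eqP] := @toC_ReIm_inj _ _ _ _ 0 0 (etrans E _).
    by rewrite toC0 scaler0 addr0.
  by rewrite addr_eq0 => /eqP.
have Ty c p : atlas c -> cdom c p -> mpart S (alpha c ix p) - T (mpart S (alpha c iy p)) = 0.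
  move=> ac cp; have lmx : lm S (mpart S (alpha c ix p)).
    by apply: lm_mpart => //; exact: alpha_lg.
  rewrite prim// (lin_onN lgS tL) ?t2 ?opprK ?subrr//; apply: lm_lg; exact: lm_dtau.
split=> c i p ac cp; rewrite /part01 /part10 ?E01 ?E10// Ty// prim// addNr ?oppr0 toC0;
  by rewrite scaler0 addr0 !scaler0; case: ifP; rewrite ?oppr0.
Qed.

End Decomposition.

(** * Lifts and their velocities *)

Lemma cvg_line0 (R : realType) (V : normedModType R) (v t : V) :
  (fun s : R => s *: v + t) @ 0 --> t.
Proof.
rewrite -[X in _ --> X]add0r -(scale0r v); apply: cvgD; last exact: cvg_cst.
by exact: (@scalel_continuous _ _ v 0).
Qed.

Section FixedGroup.
Variables (R : realType) (N : nat) (S : sym_data R N).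
Hypothesis hS : hermitian_symmetric S.
Implicit Types (X Y g : 'M[R]_N).

Definition fixed_group : set 'M[R]_N := [set g | sG S g /\ sigma S g = g].

Lemma cvg_tau_within (A : set 'M[R]_N) a : A `<=` sG S -> sG S a ->
  (forall x, A x -> A (tau S x)) ->
  tau S @ within A (nbhs a) --> within A (nbhs (tau S a)).
Proof.
move=> AG Ga At U HU.
have := (subspace_continuousP _ _).1 (hs_tau_cont hS) a Ga.
move=> /(_ _ HU) H.
have {}H : nbhs a (fun x => sG S x -> A (tau S x) -> U (tau S x)) by exact: H.
suff : nbhs a (fun x => A x -> U (tau S x)) by [].
by apply: filterS H => x Hx Ax; apply: Hx (AG _ Ax) (At _ Ax).
Qed.

(** Closedness uses the continuity of the automorphism on the group only, which is why
    limits are taken within it. *)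
Lemma fixed_group_closed : matrix_lie_group fixed_group.
Proof.
have hG := hs_G hS; have [[G1 GM GV] Gcl] := hG.
have tG := hs_tauG hS; have tM := hs_tauM hS.
have t1 : tau S 1%:M = 1%:M.
  have u1 : tau S 1%:M \in unitmx by have [] := GV _ (tG _ G1).
  by apply: (can_inj (mulKmx u1)); rewrite -tM// mulmx1 mulmx1.
split.
  split; first by split=> //; rewrite /sigma t1.
  - move=> a b [Ga sa] [Gb sb]; split; first exact: GM.
    rewrite /sigma tM// tM; [|exact: tG|exact: tG].
    by rewrite -/(sigma S a) -/(sigma S b) sa sb.
  - move=> a [Ga sa]; have [ua Gia] := GV _ Ga; split=> //; split=> //.
    rewrite /sigma (tau_invmx hS)// (tau_invmx hS); last exact: tG.
    by rewrite -/(sigma S a) sa.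
move=> a ua cla.
have Ga : sG S a by apply: Gcl => // B /cla [x [[Gx _] Bx]]; exists x.
split=> //.
have FF : ProperFilter (within fixed_group (nbhs a)).
  by apply: within_nbhs_proper; exact: cla.
have st x : fixed_group x -> fixed_group (tau S x).
  by move=> [Gx sx]; split; [exact: tG|rewrite /sigma; congr (tau S _)].
have sub : fixed_group `<=` sG S by move=> x [].
have c1 := cvg_tau_within sub Ga st.
have c2 := cvg_tau_within sub (tG _ Ga) st.
have c3 : sigma S @ within fixed_group (nbhs a) --> sigma S a.
  have c12 : sigma S @ within fixed_group (nbhs a) -->
      within fixed_group (nbhs (tau S (tau S a))).
    by move=> U HU; apply: (c1 (tau S @^-1` U)); exact: c2 HU.
  move=> V HV; apply: (c12 V); apply: cvg_within; exact: HV.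
apply: (cvg_mx_unique FF c3).
have c4 : id @ within fixed_group (nbhs a) --> a by exact: cvg_within.
apply: cvg_trans c4; apply: near_eq_cvg.
suff : nbhs a (fun x => fixed_group x -> x = sigma S x) by [].
by apply: filterE => x [_ ->].
Qed.

Lemma fixed_group_lie X : lie_algebra fixed_group X -> lh S X.
Proof.
move=> H; have lX : lg S X by move=> t; have [] := H t.
split=> //; apply: expm_inj => t; rewrite -(sigma_expm hS)//.
by have [] := H t.
Qed.

End FixedGroup.

Section PrimitiveFrames.
Variables (R : realType) (N : nat) (S : sym_data R N).
Hypothesis hS : hermitian_symmetric S.
Local Notation T := (dtau S).
Let lgS := lg_subspace hS.
Let lmS := lm_subspace hS.
Let tL : lin_on (lg S) T := hs_dtauL hS.
Variable X : 'I_2 -> 'M[R]_N.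

(** Conformality gives the two vectors the same length, hence the same normalization. *)
Lemma conformal_frame_primitive (r : R) U : (forall i, lm S (X i)) -> 0 < r ->
  (forall i j, ip S (X i) (X j) = r * (i == j)%:R) -> SU2 U ->
  (forall j, (Num.sqrt (ip S (X j) (X j)))^-1 *: X j = \sum_k jscale S (U k j) (eps S k)) ->
  X iy = - T (X ix).
Proof.
move=> lX r0 ipr hU E; have := E ix; have := E iy; rewrite !ipr !eqxx !mulr1 => Ey Ex.
have s0 : Num.sqrt r != 0 by rewrite sqrtr_eq0 -ltNge.
have := SU2_frame_primitive hS hU Ex Ey.
rewrite (lin_onZ lgS _ tL); last exact: lm_lg.
by rewrite -scalerN; apply: scalerI; rewrite invr_eq0.
Qed.

Hypotheses (lX : lm S (X ix)) (primX : X iy = - T (X ix)).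

Lemma primitive_eq0 : X ix = 0 -> forall i, X i = 0.
Proof.
by move=> X0 i; case: (ord2P i) => ->//; rewrite primX X0 (lin_on0 lgS tL) oppr0.
Qed.

Lemma primitive_conformal_frame : ~ (forall i, X i = 0) -> exists2 U, SU2 U &
  forall j, (Num.sqrt (ip S (X j) (X j)))^-1 *: X j = \sum_k jscale S (U k j) (eps S k).
Proof.
move=> nz; have nX : X ix <> 0 by move=> /primitive_eq0.
have [U hU [Ex Ey]] := primitive_SU2_frame hS lX primX nX.
have [_ _ nrm] := primitive_geometry hS lX.
by exists U => // j; case: (ord2P j) => ->//; rewrite -[RHS]Ey primX nrm.
Qed.

Lemma primitive_omega : omega S (X ix) (X iy) = 0.
Proof. by have [om _ _] := primitive_geometry hS lX; rewrite primX. Qed.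

Lemma primitive_conformal : (forall i, X i = 0) \/
  exists2 r : R, 0 < r & forall i j, ip S (X i) (X j) = r * (i == j)%:R.
Proof.
have [_ ipxy nrm] := primitive_geometry hS lX.
have [/primitive_eq0|X0] := eqVneq (X ix) 0; [by left|right].
exists (ip S (X ix) (X ix)); first by apply: (hs_ip_pos hS) => //; exact/eqP.
have lY : lm S (X iy) by rewrite primX; apply: (subspaceN lmS); exact: lm_dtau.
have symxy : ip S (X iy) (X ix) = 0 by rewrite (ip_sym hS)// primX.
move=> i j; case: (ord2P i) => ->; case: (ord2P j) => ->.
- by rewrite eqxx mulr1.
- by rewrite mulr0 primX.
- by rewrite mulr0.
- by rewrite eqxx mulr1 primX.
Qed.

End PrimitiveFrames.

Section Lifts.
Variables (R : realType) (N : nat) (S : sym_data R N).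
Hypothesis hS : hermitian_symmetric S.
Variable L : riemann_surface R.
Implicit Types (X Y g : 'M[R]_N) (c : chart R L) (p q : L) (U : set L).
Implicit Types (f : L -> set 'M[R]_N) (F : L -> 'M[R]_N).
Local Notation T := (dtau S).
Let lgS := lg_subspace hS.

Lemma sG_unit g : sG S g -> g \in unitmx.
Proof. by move=> Gg; have [[_ _ GV] _] := hs_G hS; have [] := GV _ Gg. Qed.

Lemma lift_unit f U F p : lift_on S U f F -> U p -> \forall q \near p, F q \in unitmx.
Proof.
move=> [oU _ H] Up; have nU : nbhs p U by exact: open_nbhs_nbhs.
by apply: filterS nU => q /H[Gq _]; exact: sG_unit.
Qed.

Lemma lift_ratio f U F F' q : lift_on S setT f F -> lift_on S U f F' -> U q ->
  sH S (invmx (F q) *m F' q).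
Proof.
move=> [_ _ H] [_ _ H'] Uq; have [Gq fq] := H q I; have [Gq' fq'] := H' q Uq.
have : trans (F' q) (sH S) (F' q) by exists 1%:M; [exact: sH1|rewrite mulmx1].
by rewrite fq' -fq => -[h Hh <-]; rewrite mulKmx// sG_unit.
Qed.

Lemma lift_pder f U F c i p : lift_on S U f F -> atlas c -> U p -> cdom c p ->
  pder c i F p (F p *m MC F c i p).
Proof.
move=> lF ac Up cp; have [_ sF H] := lF.
rewrite /MC mulKVmx; last by apply: sG_unit; have [] := H p Up.
exact: smooth_pder sF ac Up cp.
Qed.

(** Two lifts differ by a map into the isotropy group, whose logarithmic derivative
    lies in the Lie algebra of the group fixed by the involution. *)
Lemma lift_change f U F F' c i p : lift_on S setT f F -> lift_on S U f F' ->
  atlas c -> U p -> cdom c p ->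
  let h q := invmx (F q) *m F' q in
  exists2 B, lh S B & pder c i h p (h p *m B) /\
    MC F' c i p = Ad (invmx (h p)) (MC F c i p) + B.
Proof.
move=> lF lF' ac Up cp h.
have [oU _ _] := lF'; have nU : nbhs p U by exact: open_nbhs_nbhs.
have nF := lift_unit lF (I : setT p); have nF' := lift_unit lF' Up.
have uF := nbhs_singleton nF; have uF' := nbhs_singleton nF'.
have dF := lift_pder i lF ac I cp; have dF' := lift_pder i lF' ac Up cp.
have dh := pder_mulmx cp (pder_invmx cp nF dF) dF'.
set D := (X in pder _ _ _ _ X) in dh.
have uh : h p \in unitmx by rewrite unitmx_mul unitmx_inv uF.
have ED : D = h p *m MC F' c i p - MC F c i p *m h p.
  by rewrite /D mulKmx// mulNmx addrC -!mulmxA.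
pose B := invmx (h p) *m D.
have hB : lh S B.
  apply: (fixed_group_lie hS).
  have near_h : \forall q \near p, fixed_group S (h q).
    by apply: filterS nU => q Uq; apply: (hs_H_fix hS); exact: (lift_ratio lF lF' Uq).
  have dl := (is_derive_line (h \o cinv c) (ccoord c p) (dvec R i) 0 D).1.
  rewrite scale0r add0r in dl.
  have := @group_curve_lie R N _ (fixed_group_closed hS)
    (fun s => (h \o cinv c) (s *: dvec R i + ccoord c p)) 0 D _ (dl dh).
  rewrite /= scale0r add0r ccoordK//; apply.
  have nw : \forall w \near ccoord c p, fixed_group S (h (cinv c w)).
    by apply: filterS (near_chart_inv cp near_h) => _ [q cq [<- Hq]]; rewrite ccoordK.
  by have := cvg_line0 (dvec R i) nw; rewrite nbhs_simpl.
exists B => //; split; first by rewrite /B mulKVmx.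
rewrite /B ED mulmxBr mulKmx// /Ad invmxK.
by rewrite [invmx (h p) *m (_ *m h p)]mulmxA addrCA subrr addr0.
Qed.

Lemma MC_lg f U F c i p : lift_on S U f F -> atlas c -> U p -> cdom c p ->
  lg S (MC F c i p).
Proof.
move=> lF ac Up cp; have [oU _ H] := lF; have nU : nbhs p U by exact: open_nbhs_nbhs.
have dF := lift_pder i lF ac Up cp.
have dl := (is_derive_line (F \o cinv c) (ccoord c p) (dvec R i) 0 (F p *m MC F c i p)).1.
rewrite scale0r add0r in dl.
have uF := nbhs_singleton (lift_unit lF Up).
have := @group_curve_lie R N _ (hs_G hS)
  (fun s => (F \o cinv c) (s *: dvec R i + ccoord c p)) 0 _ _ (dl dF).
rewrite /= scale0r add0r ccoordK// mulKmx//; apply.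
have near_h : \forall q \near p, sG S (F q).
  by apply: filterS nU => q /H[].
have nw : \forall w \near ccoord c p, sG S (F (cinv c w)).
  by apply: filterS (near_chart_inv cp near_h) => _ [q cq [<- Hq]]; rewrite ccoordK.
by have := cvg_line0 (dvec R i) nw; rewrite nbhs_simpl.
Qed.

(** Hence changing the lift changes velocities by an isometry that commutes with [J],
    so that being Lagrangian or conformal can be checked with one lift. *)
Lemma vel_change f U F F' c p : lift_on S setT f F -> lift_on S U f F' ->
  atlas c -> U p -> cdom c p ->
  exists2 k, sH S k & forall i, vel S F' c i p = Ad k (vel S F c i p).
Proof.
move=> lF lF' ac Up cp; have hh := lift_ratio lF lF' Up.
exists (invmx (invmx (F p) *m F' p)); first exact: sHV.
move=> i; have [B hB [_ E]] := lift_change i lF lF' ac Up cp.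
have lM := MC_lg i lF ac I cp.
have lA : lg S (Ad (invmx (invmx (F p) *m F' p)) (MC F c i p)).
  by apply: (lie_Ad (hs_G hS)) => //; apply: (sH_sG hS); exact: sHV.
rewrite /vel E -[Ad _ _ + B]addrC -[B]scale1r (mpart_lin hS)//; last exact: lh_lg.
by rewrite (mpart_lh hB) scaler0 add0r (mpart_Ad hS)//; exact: sHV.
Qed.

Lemma vel_lm f U F c i p : lift_on S U f F -> atlas c -> U p -> cdom c p ->
  lm S (vel S F c i p).
Proof. by move=> lF ac Up cp; apply: (lm_mpart hS); exact: MC_lg lF ac Up cp. Qed.

Variable alpha : oneform L 'M[R]_N.

Lemma maurer_cartan_sol f F : lift_on S setT f F -> maurer_cartan F alpha ->
  forall p, sol_at alpha F p.
Proof.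
move=> lF mc p; have [_ sF _] := lF; split; first exact: lift_unit lF I.
- exact: smooth_continuous sF I.
- by move=> c i ac cp; rewrite mc//; exact: lift_pder lF ac I cp.
Qed.

Hypothesis hal : smooth_oneform (lg S) alpha.

Lemma vel_maurer_cartan F c i p : maurer_cartan F alpha -> atlas c -> cdom c p ->
  vel S F c i p = mpart S (alpha c i p).
Proof. by move=> mc ac cp; rewrite mc. Qed.

(** Where the differential vanishes there is nothing to prove; elsewhere the normalized
    velocities form a special unitary frame. *)
Lemma lagrangian_lift_primitive f F : weakly_conformal_lagrangian S f ->
  lagrangian_lift S f F -> maurer_cartan F alpha ->
  rflat alpha /\ primitive_form S alpha.
Proof.
move=> [_ _ wc] [lF fr] mc; split; first exact: sol_rflat hal (maurer_cartan_sol lF mc).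
move=> c p ac cp; rewrite -!(vel_maurer_cartan _ mc ac cp).
have lv i : lm S (vel S F c i p) by exact: vel_lm lF ac I cp.
have tL := hs_dtauL hS : lin_on (lg S) T.
pose X i := vel S F c i p.
have wcX : (forall i, X i = 0) \/
  exists2 r : R, 0 < r & forall i j, ip S (X i) (X j) = r * (i == j)%:R by exact: wc lF c p ac I cp.
have frX : ~ (forall i, X i = 0) -> exists2 U, SU2 U &
  forall j, (Num.sqrt (ip S (X j) (X j)))^-1 *: X j = \sum_k jscale S (U k j) (eps S k).
  exact: fr c p ac cp.
rewrite -/(X ix) -/(X iy); have {}lv : forall i, lm S (X i) by exact: lv.
move: (X) wcX frX lv => {}X wcX frX lv.
have [z|[r r0 ipr]] := wcX; first by rewrite !z (lin_on0 lgS tL) oppr0.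
have [z|U hU E] := frX; last exact: (conformal_frame_primitive hS lv r0 ipr hU E).
have := ipr ix ix; rewrite z eqxx mulr1.
rewrite (lin_on0 (lm_subspace hS) (ip_lin hS (subspace0 (lm_subspace hS)))) => E.
by rewrite -E ltxx in r0.
Qed.

Hypothesis hL : simply_connected L.

(** Integrating the form gives a map into the group, and primitivity is all that the
    geometry of its projection demands. *)
Lemma exists_lagrangian_lift : rflat alpha -> primitive_form S alpha ->
  exists f F, [/\ weakly_conformal_lagrangian S f, lagrangian_lift S f F
    & maurer_cartan F alpha].
Proof.
move=> fl prim.
have [F [sF GF]] : exists F, (forall p, sol_at alpha F p) /\ forall p, sG S (F p).
  have [[p0 _]|no] := pselect (exists p : L, True).
    have [F [F0 sF]] := global_solution hal fl hL p0.
    exists F; split=> //; apply: (solution_in_group (hs_G hS) _ sF (p0 := p0)).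
      by move=> c i p ac cp; exact: alpha_lg.
    by rewrite F0; have [[]] := hs_G hS.
  by exists (fun=> 0); split=> p; case: no; exists p.
pose f p := trans (F p) (sH S).
have smF : mx_smooth_on setT F by apply: (sol_smooth hal) => //; exact: openT.
have lF : lift_on S setT f F by split=> //; exact: openT.
have mc : maurer_cartan F alpha.
  move=> c i p ac cp; have [uF _ dF] := sF p.
  by rewrite (pder_mx_pd (dF c i ac cp)) mulKmx//; exact: (nbhs_singleton uF).
have lb c i p : atlas c -> cdom c p -> lm S (vel S F c i p).
  by move=> ac cp; exact: vel_lm lF ac I cp.
have primF c p : atlas c -> cdom c p -> vel S F c iy p = - T (vel S F c ix p).
  by move=> ac cp; rewrite !(vel_maurer_cartan _ mc ac cp) prim.
exists f, F; split=> //; last first.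
  split=> // c p ac cp; exact: (primitive_conformal_frame (X := fun i => vel S F c i p) hS (lb c ix p ac cp) (primF c p ac cp)).
split.
- split; first by move=> p; exists (F p).
  by move=> p; exists setT, F.
- move=> U F' lF' c p ac Up cp.
  have [k hk E] := vel_change lF lF' ac Up cp.
  have om := primitive_omega (X := fun i => vel S F c i p) hS (lb c ix p ac cp) (primF c p ac cp).
  rewrite /omega !E -(J_Ad hS)//; last exact: lb.
  by rewrite (ip_Ad hS)//; [apply: (lm_J hS); exact: lb|exact: lb].
- move=> U F' lF' c p ac Up cp.
  have [k hk E] := vel_change lF lF' ac Up cp.
  have [z|[r r0 ipr]] := primitive_conformal (X := fun i => vel S F c i p) hS (lb c ix p ac cp) (primF c p ac cp).
    by left=> i; rewrite E z /Ad mulmx0 mul0mx.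
  right; exists r; [exact: r0|move=> i j; rewrite (E i) (E j)].
  by rewrite (ip_Ad hS hk (lb c i p ac cp) (lb c j p ac cp)) ipr.
Qed.

End Lifts.

(** * Curvature of the extended form *)

(** With [cos t] and [sin t] for [c] and [e], the coefficients below are those of the
    rotations by [t] on the m-part and by [2 t] on the part in [g_2].  All terms
    combine to components of the flatness equation, up to multiples of
    [c ^+ 2 + e ^+ 2 - 1], except one. *)
Lemma curvature_identity (K : comNzRingType) (c e dQ dbxy dbyx dbxx dbyy dPxy dPyx dPxx dPyy
    QQ bb Qxby Qxbx bxQy byQy Pxby Pxbx bxPy byPy : K) :
  c * c + e * e = 1 ->
  dQ + (QQ + bb) = 0 -> dPxy - dPyx = 0 ->
  dbxy - dbyx + (Qxby + Pxby + bxQy + bxPy) = 0 ->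
  dbxx + dbyy + (Qxbx - Pxbx - byQy + byPy) = 0 ->
  dQ + (c * (dbxy - dbyx) + e * (dbxx + dbyy)) +
  ((c * c - e * e) * (dPxy - dPyx) + (2 * c * e) * (dPxx + dPyy)) +
  (QQ + (c * c + e * e) * bb + (c * Qxby + e * Qxbx) + (c * bxQy - e * byQy)
   + ((c * c - e * e) * (c * Pxby + e * Pxbx) + (2 * c * e) * (c * byPy + e * bxPy))
   + ((c * c - e * e) * (c * bxPy - e * byPy) + (2 * c * e) * (e * Pxby - c * Pxbx)))
  = (2 * c * e) * (dPxx + dPyy).
Proof.
move=> rel e0 e2 em eT.
have E : dQ + (c * (dbxy - dbyx) + e * (dbxx + dbyy)) +
  ((c * c - e * e) * (dPxy - dPyx) + (2 * c * e) * (dPxx + dPyy)) +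
  (QQ + (c * c + e * e) * bb + (c * Qxby + e * Qxbx) + (c * bxQy - e * byQy)
   + ((c * c - e * e) * (c * Pxby + e * Pxbx) + (2 * c * e) * (c * byPy + e * bxPy))
   + ((c * c - e * e) * (c * bxPy - e * byPy) + (2 * c * e) * (e * Pxby - c * Pxbx)))
  = (2 * c * e) * (dPxx + dPyy) + (dQ + (QQ + bb)) + (c * c - e * e) * (dPxy - dPyx)
    + c * (dbxy - dbyx + (Qxby + Pxby + bxQy + bxPy))
    + e * (dbxx + dbyy + (Qxbx - Pxbx - byQy + byPy))
    + (c * c + e * e - 1) * (bb + c * Pxby + c * bxPy - e * Pxbx + e * byPy) by ring.
by rewrite E rel e0 e2 em eT subrr !mulr0 mul0r !addr0.
Qed.

Section Entries.
Variables (K : nzRingType) (m n : nat).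
Implicit Types (A B : 'M[K]_(m, n)).
Lemma entD A B i j : (A + B) i j = A i j + B i j. Proof. by rewrite mxE. Qed.
Lemma entN A i j : (- A) i j = - A i j. Proof. by rewrite mxE. Qed.
Lemma entZ (a : K) A i j : (a *: A) i j = a * A i j. Proof. by rewrite mxE. Qed.
Lemma ent0 i j : (0 : 'M[K]_(m, n)) i j = 0. Proof. by rewrite mxE. Qed.
Definition entE := (entD, entN, entZ, ent0).
End Entries.

Lemma extended_algebra (K : numFieldType) (j lam : K) n (px py qx qy bx by_ : 'M[K]_n) :
  j * j = -1 -> lam != 0 ->
  let cc := 2^-1 * (lam^-1 + lam) in let ss := j * (2^-1 * (lam^-1 - lam)) in
  let am1x := 2^-1 *: (bx + j *: - by_) in let am1y := 2^-1 *: (by_ + j *: bx) in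
  let a1x := 2^-1 *: (bx - j *: - by_) in let a1y := 2^-1 *: (by_ - j *: bx) in
  lam ^- 2 *: (2^-1 *: (px - j *: py)) + lam^-1 *: (2^-1 *: (am1x - j *: am1y)) + qx
    + lam *: (2^-1 *: (a1x + j *: a1y)) + lam ^+ 2 *: (2^-1 *: (px + j *: py)) =
  qx + (cc *: bx + (- ss) *: by_)
      + ((cc * cc - ss * ss) *: px + (- (2 * cc * ss)) *: py) /\
  lam ^- 2 *: (j *: (2^-1 *: (px - j *: py))) + lam^-1 *: (j *: (2^-1 *: (am1x - j *: am1y)))
    + qy + lam *: (- (j *: (2^-1 *: (a1x + j *: a1y))))
    + lam ^+ 2 *: (- (j *: (2^-1 *: (px + j *: py)))) =
  qy + (cc *: by_ + ss *: bx)
      + ((cc * cc - ss * ss) *: py + (2 * cc * ss) *: px).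
Proof.
move=> j2 l0 cc ss am1x am1y a1x a1y.
have jZ (Z : 'M[K]_n) : j *: (j *: Z) = - Z by rewrite scalerA j2 scaleN1r.
have s2 : ss * ss = - (2^-1 * (lam^-1 - lam) * (2^-1 * (lam^-1 - lam))).
  by rewrite /ss mulrACA j2 mulN1r.
have EC : cc * cc - ss * ss = 2^-1 * (lam^-1 * lam^-1 + lam * lam).
  by rewrite s2 /cc; field.
have EE : 2 * cc * ss = j * (2^-1 * (lam^-1 * lam^-1 - lam * lam)).
  by rewrite /ss /cc; field.
have half_j (Z : 'M[K]_n) : j *: (2^-1 *: Z) = 2^-1 *: (j *: Z) by rewrite !scalerA mulrC.
have m10x : am1x - j *: am1y = bx - j *: by_.
  rewrite /am1x /am1y half_j [j *: (by_ + _)]scalerDr jZ scalerN.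
  by apply/matrixP => m l; rewrite !entE; field.
have p01x : a1x + j *: a1y = bx + j *: by_.
  rewrite /a1x /a1y half_j [j *: (by_ - _)]scalerBr jZ opprK scalerN opprK.
  by apply/matrixP => m l; rewrite !entE; field.
rewrite m10x p01x !half_j !scalerBr !scalerDr !jZ EC EE /ss /cc.
by split; apply/matrixP => m l; rewrite !entE; field.
Qed.

Lemma curvature_algebra (K : comNzRingType) n (c e : K) (dQxy dQyx dbxy dbyx dbxx dbyy
   dPxy dPyx dPxx dPyy u1 u2 u3 u4 u5 u6 u7 u8 u9 u10 : 'M[K]_n) :
  c * c + e * e = 1 ->
  dQxy - dQyx + (u1 + u2) = 0 -> dPxy - dPyx = 0 ->
  dbxy - dbyx + (u3 + u4 + u5 + u6) = 0 ->
  dbxx + dbyy + (u7 - u8 - u9 + u10) = 0 ->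
  dQxy + (c *: dbxy + e *: dbxx) + ((c * c - e * e) *: dPxy + (2 * c * e) *: dPxx) -
   (dQyx + (c *: dbyx + - e *: dbyy) + ((c * c - e * e) *: dPyx + - (2 * c * e) *: dPyy)) +
   (u1 + (c *: u3 + e *: u7) + ((c * c - e * e) *: 0 + (2 * c * e) *: 0) +
    (c *: u5 + (c *: (c *: u2) + c *: (e *: 0)) +
     (c *: ((c * c - e * e) *: u6) + c *: ((2 * c * e) *: - u8)) +
     (- e *: u9 + (- e *: (c *: 0) + - e *: (e *: - u2)) +
      (- e *: ((c * c - e * e) *: u10) + - e *: ((2 * c * e) *: - u4)))) +
    ((c * c - e * e) *: 0 + ((c * c - e * e) *: (c *: u4) + (c * c - e * e) *: (e *: u8)) +
     ((c * c - e * e) *: ((c * c - e * e) *: 0) + (c * c - e * e) *: ((2 * c * e) *: 0)) +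
     (- (2 * c * e) *: 0 + (- (2 * c * e) *: (c *: - u10) + - (2 * c * e) *: (e *: - u6)) +
      (- (2 * c * e) *: ((c * c - e * e) *: 0) + - (2 * c * e) *: ((2 * c * e) *: 0)))))
  = (2 * c * e) *: (dPxx + dPyy).
Proof.
move=> rel F0 F2 Fm Ft; apply/matrixP => i j.
move/matrixP/(_ i j): Ft; move/matrixP/(_ i j): Fm; move/matrixP/(_ i j): F2.
move/matrixP/(_ i j): F0; rewrite !entE => F0 F2 Fm Ft.
rewrite -(curvature_identity (dPxx i j) (dPyy i j) rel F0 F2 Fm Ft).
by ring.
Qed.

Lemma lbr_sum (K : comNzRingType) n (P Q b P' Q' b' : 'M[K]_n) :
  lbr P P' = 0 -> lbr Q P' = 0 -> lbr P Q' = 0 ->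
  lbr (P + Q + b) (P' + Q' + b') = (lbr Q Q' + lbr b b') +
    (lbr Q b' + lbr P b' + lbr b Q' + lbr b P').
Proof.
move=> PP QP PQ; rewrite !lbrDl !lbrDr PP QP PQ.
move: (lbr b P') (lbr b Q') (lbr b b') (lbr P b') (lbr Q Q') (lbr Q b') => *.
by apply/matrixP => m l; rewrite !entE; ring.
Qed.

Lemma curvature_expand (R : realType) n (c e : R[i]) (Px Py Qx Qy bx by_ dQxy dQyx
    dbxy dbyx dbxx dbyy dPxy dPyx dPxx dPyy : 'M[R]_n) :
  c * c + e * e = 1 ->
  lbr Px Py = 0 -> lbr Px Px = 0 -> lbr Py Py = 0 ->
  lbr Qx Py = 0 -> lbr Qx Px = 0 -> lbr Qy Py = 0 ->
  lbr Px Qy = 0 -> lbr Px Qx = 0 -> lbr Py Qy = 0 ->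
  dQxy - dQyx + (lbr Qx Qy + lbr bx by_) = 0 -> dPxy - dPyx = 0 ->
  dbxy - dbyx + (lbr Qx by_ + lbr Px by_ + lbr bx Qy + lbr bx Py) = 0 ->
  dbxx + dbyy + (lbr Qx bx - lbr Px bx - lbr by_ Qy + lbr by_ Py) = 0 ->
  (toC dQxy + (c *: toC dbxy + e *: toC dbxx)
     + ((c * c - e * e) *: toC dPxy + (2 * c * e) *: toC dPxx))
  - (toC dQyx + (c *: toC dbyx + (- e) *: toC dbyy)
     + ((c * c - e * e) *: toC dPyx + (- (2 * c * e)) *: toC dPyy))
  + lbr (toC Qx + (c *: toC bx + (- e) *: toC by_)
           + ((c * c - e * e) *: toC Px + (- (2 * c * e)) *: toC Py))
        (toC Qy + (c *: toC by_ + e *: toC bx)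
           + ((c * c - e * e) *: toC Py + (2 * c * e) *: toC Px))
  = (2 * c * e) *: toC (dPxx + dPyy).
Proof.
move=> rel PP PPx PPy QP QPx QPy PQ PQx PQy F0 F2 Fm Ft.
have PP' : lbr Py Px = 0 by rewrite lbrC PP oppr0.
have QPy' : lbr Py Qy = 0 by [].
have QyPx : lbr Px Qy = 0 by [].
rewrite !(lbrDl, lbrDr) !(lbrZl, lbrZr) -!toC_lbr PP PP' PPx PPy QP QPx PQ PQy.
rewrite !lbrxx (lbrC by_ bx) (lbrC bx Px) (lbrC by_ Px) (lbrC Py by_) (lbrC Py bx).
move: F0 F2 Fm Ft.
move: (lbr Qx Qy) (lbr bx by_) (lbr Qx by_) (lbr Px by_) (lbr bx Qy) (lbr bx Py) (lbr Qx bx)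
  (lbr Px bx) (lbr by_ Qy) (lbr by_ Py) => w1 w2 w3 w4 w5 w6 w7 w8 w9 w10 F0 F2 Fm Ft.
move/(congr1 (@toC R n)): F0; move/(congr1 (@toC R n)): F2.
move/(congr1 (@toC R n)): Fm; move/(congr1 (@toC R n)): Ft.
rewrite !(toCD, toCN, toC0) => Ft Fm F2 F0.
exact: curvature_algebra rel F0 F2 Fm Ft.
Qed.

Section ExtendedForm.
Variables (R : realType) (L : riemann_surface R) (N : nat).
Variables (a2 a0 am1 a1 : oneform L 'M[R[i]]_N) (lam : R[i]).

(** For [lam = exp (i t)] these are [cos t] and [sin t]; their squares sum to one for
    every nonzero [lam], so that complex [lam] needs no separate treatment. *)
Definition lcos : R[i] := 2^-1 * (lam^-1 + lam).
Definition lsin : R[i] := imu R * (2^-1 * (lam^-1 - lam)).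

Lemma lsin_sqr : lsin * lsin = - (2^-1 * (lam^-1 - lam) * (2^-1 * (lam^-1 - lam))).
Proof. by rewrite /lsin mulrACA imuM mulN1r. Qed.

Hypothesis l0 : lam != 0.

Lemma lcos_lsin : lcos * lcos + lsin * lsin = 1.
Proof. by rewrite lsin_sqr /lcos; field. Qed.

Lemma extended_form_expand c q (px py qx qy bx by_ : 'M[R[i]]_N) :
  a2 c ix q = px -> a2 c iy q = py -> a0 c ix q = qx -> a0 c iy q = qy ->
  am1 c ix q = 2^-1 *: (bx + imu R *: - by_) -> am1 c iy q = 2^-1 *: (by_ + imu R *: bx) ->
  a1 c ix q = 2^-1 *: (bx - imu R *: - by_) -> a1 c iy q = 2^-1 *: (by_ - imu R *: bx) ->
  extended_form a2 a0 am1 a1 lam c ix q =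
    qx + (lcos *: bx + (- lsin) *: by_)
      + ((lcos * lcos - lsin * lsin) *: px + (- (2 * lcos * lsin)) *: py) /\
  extended_form a2 a0 am1 a1 lam c iy q =
    qy + (lcos *: by_ + lsin *: bx)
      + ((lcos * lcos - lsin * lsin) *: py + (2 * lcos * lsin) *: px).
Proof.
move=> Ex2 Ey2 Ex0 Ey0 Exm Eym Ex1 Ey1.
rewrite /extended_form /part10 /part01 Ex2 Ey2 Ex0 Ey0 Exm Eym Ex1 Ey1.
exact: (extended_algebra px py qx qy bx by_ (imuM R) l0).
Qed.

End ExtendedForm.

Section Curvature.
Variables (R : realType) (N : nat) (S : sym_data R N).
Hypothesis hS : hermitian_symmetric S.
Variables (L : riemann_surface R) (alpha : oneform L 'M[R]_N).
Hypothesis hal : smooth_oneform (lg S) alpha.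
Variables a2 a0 am1 a1 : oneform L 'M[R[i]]_N.
Hypotheses (h2 : forall c i p, atlas c -> cdom c p -> lgC_ S 2 (a2 c i p))
  (h0 : forall c i p, atlas c -> cdom c p -> lgC_ S 0 (a0 c i p))
  (hm1 : forall c i p, atlas c -> cdom c p -> lgC_ S (-1) (am1 c i p))
  (h1 : forall c i p, atlas c -> cdom c p -> lgC_ S 1 (a1 c i p))
  (hdec : forall c i p, atlas c -> cdom c p ->
     toC (alpha c i p) = a2 c i p + a0 c i p + am1 c i p + a1 c i p).
Hypotheses (fl : rflat alpha) (prim : primitive_form S alpha).
Implicit Types (X Y : 'M[R]_N) (c : chart R L) (p q : L).
Local Notation T := (dtau S).
Local Notation P c i q := (gpart2 S (alpha c i q)).
Local Notation Q c i q := (gpart0 S (alpha c i q)).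
Local Notation b c i q := (mpart S (alpha c i q)).
Let lgS := lg_subspace hS.
Let lhS := lh_subspace hS.
Let lmS := lm_subspace hS.
Let tL : lin_on (lg S) T := hs_dtauL hS.
Let al c i p ac cp : lg S (alpha c i p) := alpha_lg hal i ac cp.

Lemma hpart_lm X : lm S X -> hpart S X = 0.
Proof. by move=> [_ sX]; rewrite /hpart sX subrr scaler0. Qed.

Lemma dtau_mpart c p : atlas c -> cdom c p ->
  T (b c ix p) = - b c iy p /\ T (b c iy p) = b c ix p.
Proof.
move=> ac cp; have lb i : lm S (b c i p) by apply: (lm_mpart hS); exact: al.
split; first by rewrite prim// opprK.
rewrite prim// (lin_onN lgS tL) ?dtau2_lm ?opprK//.
by apply: lm_lg; exact: lm_dtau.
Qed.

Lemma extended_formE lam c q : lam != 0 -> atlas c -> cdom c q ->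
  extended_form a2 a0 am1 a1 lam c ix q =
    toC (Q c ix q) + (lcos lam *: toC (b c ix q) + (- lsin lam) *: toC (b c iy q))
      + ((lcos lam * lcos lam - lsin lam * lsin lam) *: toC (P c ix q)
         + (- (2 * lcos lam * lsin lam)) *: toC (P c iy q)) /\
  extended_form a2 a0 am1 a1 lam c iy q =
    toC (Q c iy q) + (lcos lam *: toC (b c iy q) + lsin lam *: toC (b c ix q))
      + ((lcos lam * lcos lam - lsin lam * lsin lam) *: toC (P c iy q)
         + (2 * lcos lam * lsin lam) *: toC (P c ix q)).
Proof.
move=> l0 ac cq.
have [Ex2 Ex0 Exm Ex1] := form_components hS hal h2 h0 hm1 h1 hdec ix ac cq.
have [Ey2 Ey0 Eym Ey1] := form_components hS hal h2 h0 hm1 h1 hdec iy ac cq.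
have [Tx Ty] := dtau_mpart ac cq.
rewrite Tx toCN in Exm Ex1; rewrite Ty in Eym Ey1.
exact: (extended_form_expand l0 Ex2 Ey2 Ex0 Ey0 Exm Eym Ex1 Ey1).
Qed.

(** The space [g_2] is a line that commutes with [g_0]. *)
Lemma commute_g2 c i j p : atlas c -> cdom c p ->
  [/\ lbr (P c i p) (P c j p) = 0, lbr (Q c i p) (P c j p) = 0 &
      lbr (P c i p) (Q c j p) = 0].
Proof.
move=> ac cp; have a2l k : lg_ S 2 (P c k p).
  by apply/lg_2P => //; split; [apply: lh_lg; apply: (gpart2_lh hS)|apply: (dtau_gpart2 hS)]; exact: al.
have a0l k : lg_ S 0 (Q c k p).
  by apply/lg_0P => //; split; [apply: lh_lg; apply: (gpart0_lh hS)|apply: (dtau_gpart0 hS)]; exact: al.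
split.
- have [t ->] := gpart2_sY hS (al i ac cp); have [s ->] := gpart2_sY hS (al j ac cp).
  by rewrite lbrZl lbrZr lbrxx !scaler0.
- exact: (hs_g0g2 hS).
- by rewrite lbrC (hs_g0g2 hS)// oppr0.
Qed.

Lemma gparts_lh_fixed X : lh S X -> T X = X -> [/\ gpart2 S X = 0, gpart0 S X = X & mpart S X = 0].
Proof.
move=> hX tX; rewrite /gpart2 /gpart0 (hpart_lh hX) tX subrr scaler0 (mpart_lh hX); split=> //.
by apply/matrixP => m n; rewrite !entE; field.
Qed.

Lemma gparts_lm X : lm S X -> [/\ gpart2 S X = 0, gpart0 S X = 0 & mpart S X = X].
Proof.
move=> hX; rewrite /gpart2 /gpart0 (hpart_lm hX) (mpart_lm hX) (lin_on0 lgS tL).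
by rewrite subrr addr0 scaler0.
Qed.

(** The brackets of [g_2] with itself and with [g_0] vanish, and the bracket of the two
    m-parts, exchanged by the automorphism up to a sign, lies in [g_0].  Hence the
    [g_2]-part of the flatness equation contains derivatives only. *)
Lemma flat_components c p : atlas c -> cdom c p ->
  let D := mx_pd c ix (alpha c iy) p - mx_pd c iy (alpha c ix) p in
  [/\ lg S D, gpart2 S D = 0,
      gpart0 S D + (lbr (Q c ix p) (Q c iy p) + lbr (b c ix p) (b c iy p)) = 0 &
      mpart S D + (lbr (Q c ix p) (b c iy p) + lbr (P c ix p) (b c iy p)
        + lbr (b c ix p) (Q c iy p) + lbr (b c ix p) (P c iy p)) = 0].
Proof.
move=> ac cp D.
have lax := al ix ac cp; have lay := al iy ac cp.
have lPx := gpart2_lh hS lax; have lPy := gpart2_lh hS lay.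
have lQx := gpart0_lh hS lax; have lQy := gpart0_lh hS lay.
have lbx := lm_mpart hS lax; have lby := lm_mpart hS lay.
have [PP QP PQ] := commute_g2 ix iy ac cp.
have [Tbx Tby] := dtau_mpart ac cp.
have nal i : \forall q \near p, lg S (alpha c i q).
  by apply: filterS (near_cdom cp) => q cq; exact: al.
have lgD : lg S D.
  by apply: (subspaceB lgS); apply: (pder_subspace lgS cp (nal _) (form_pder _ _ hal ac cp)).
pose W0 := lbr (Q c ix p) (Q c iy p) + lbr (b c ix p) (b c iy p).
pose Wm := lbr (Q c ix p) (b c iy p) + lbr (P c ix p) (b c iy p)
        + lbr (b c ix p) (Q c iy p) + lbr (b c ix p) (P c iy p).
have lbm X Y : lh S X -> lm S Y -> lm S (lbr X Y) by exact: lbr_hm.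
have lbm' X Y : lm S X -> lh S Y -> lm S (lbr X Y).
  by move=> hX hY; rewrite lbrC; apply: (subspaceN lmS); exact: lbm.
have lWm : lm S Wm.
  exact: (subspaceD lmS (subspaceD lmS (subspaceD lmS (lbm _ _ lQx lby) (lbm _ _ lPx lby))
    (lbm' _ _ lbx lQy)) (lbm' _ _ lbx lPy)).
have lgl X Y : lg S X -> lg S Y -> lg S (lbr X Y) by exact: (lie_lbr (hs_G hS)).
have [gPx gPy gQx gQy] : [/\ lg S (P c ix p), lg S (P c iy p), lg S (Q c ix p) & lg S (Q c iy p)].
  by split; apply: lh_lg.
have [gbx gby] : lg S (b c ix p) /\ lg S (b c iy p) by split; apply: lm_lg.
have tW0 : T W0 = W0.
  rewrite /W0 (lin_onD tL (lgl _ _ gQx gQy) (lgl _ _ gbx gby)) (dtau_lbr hS gQx gQy).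
  rewrite (dtau_lbr hS gbx gby) (dtau_gpart0 hS lax) (dtau_gpart0 hS lay) Tbx Tby.
  by rewrite lbrNl -lbrC.
have lW0 : lh S W0.
  split; first by apply: (subspaceD lgS); exact: lgl.
  by rewrite /dsigma tW0.
have gW0 := lh_lg lW0; have gWm := lm_lg lWm.
have F : D + (W0 + Wm) = 0.
  have := fl ac cp; rewrite -/D => <-; congr (_ + _).
  have E := lbr_sum (b c ix p) (b c iy p) PP QP PQ.
  by rewrite -!(gpart_sum S) in E; rewrite E.
have lin_ (f : 'M[R]_N -> 'M[R]_N) : lin_on (lg S) f -> f D + (f W0 + f Wm) = 0.
  move=> fL; rewrite -(lin_onD fL gW0 gWm) -(lin_onD fL lgD (subspaceD lgS gW0 gWm)).
  by rewrite F (lin_on0 lgS fL).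
have [W02 W00 W0m] := gparts_lh_fixed lW0 tW0; have [Wm2 Wm0 Wmm] := gparts_lm lWm.
split=> //.
- by have := lin_ _ (gpart2_lin hS); rewrite W02 Wm2 !addr0.
- by have := lin_ _ (gpart0_lin hS); rewrite W00 Wm0 addr0.
- by have := lin_ _ (mpart_lin hS); rewrite W0m Wmm add0r.
Qed.

Lemma pder_part (f : 'M[R]_N -> 'M[R]_N) c k i p : lin_on (lg S) f -> atlas c -> cdom c p ->
  pder c k (fun q => f (alpha c i q)) p (f (mx_pd c k (alpha c i) p)).
Proof.
move=> fL ac cp; apply: (pder_lin_on lgS fL cp) (form_pder _ _ hal ac cp).
by apply: filterS (near_cdom cp) => q cq; exact: al.
Qed.

Lemma mx_pd_lg c k i p : atlas c -> cdom c p -> lg S (mx_pd c k (alpha c i) p).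
Proof.
move=> ac cp; apply: (pder_subspace lgS cp _ (form_pder _ _ hal ac cp)).
by apply: filterS (near_cdom cp) => q cq; exact: al.
Qed.

Lemma dtau_mpart_pd c k p : atlas c -> cdom c p ->
  T (mpart S (mx_pd c k (alpha c iy) p)) = mpart S (mx_pd c k (alpha c ix) p) /\
  T (mpart S (mx_pd c k (alpha c ix) p)) = - mpart S (mx_pd c k (alpha c iy) p).
Proof.
move=> ac cp; have dx := pder_part k ix (mpart_lin hS) ac cp.
have dy := pder_part k iy (mpart_lin hS) ac cp.
have nb i : \forall q \near p, lg S (b c i q).
  apply: filterS (near_cdom cp) => q cq; apply: lm_lg; apply: (lm_mpart hS); exact: al.
split.
- apply: (pder_unique (pder_lin_on lgS tL cp (nb iy) dy)).
  by apply: pder_cdom dx => // q cq; have [_ ->] := dtau_mpart ac cq.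
- apply: (pder_unique (pder_lin_on lgS tL cp (nb ix) dx)).
  by apply: pder_cdom (pderN dy) => // q cq; have [-> _] := dtau_mpart ac cq.
Qed.

(** Flatness makes the [g_2]-part closed.  The extended form rotates it by [2 t], and
    the differential of the rotated form is a multiple of its codifferential; all
    other terms cancel. *)
Lemma extended_curvature lam c p : lam != 0 -> atlas c -> cdom c p ->
  ext_d (extended_form a2 a0 am1 a1 lam) c p
    + 2^-1 *: wedge_br (extended_form a2 a0 am1 a1 lam) (extended_form a2 a0 am1 a1 lam) c p
  = (2 * lcos lam * lsin lam) *:
    toC (gpart2 S (mx_pd c ix (alpha c ix) p + mx_pd c iy (alpha c iy) p)).
Proof.
move=> l0 ac cp.
have dE k j : [/\ Cpder c k (fun q => toC (Q c j q)) p (toC (gpart0 S (mx_pd c k (alpha c j) p))),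
    Cpder c k (fun q => toC (b c j q)) p (toC (mpart S (mx_pd c k (alpha c j) p))) &
    Cpder c k (fun q => toC (P c j q)) p (toC (gpart2 S (mx_pd c k (alpha c j) p)))].
  by split; apply: Cpder_toC; apply: pder_part => //;
    [exact: gpart0_lin|exact: mpart_lin|exact: gpart2_lin].
have dx k (u v w t : R[i]) j j' : Cpder c k (fun q => toC (Q c j q)
    + (u *: toC (b c j q) + v *: toC (b c j' q)) + (w *: toC (P c j q) + t *: toC (P c j' q))) p
    (toC (gpart0 S (mx_pd c k (alpha c j) p)) + (u *: toC (mpart S (mx_pd c k (alpha c j) p))
     + v *: toC (mpart S (mx_pd c k (alpha c j') p))) + (w *: toC (gpart2 S (mx_pd c k (alpha c j) p))
     + t *: toC (gpart2 S (mx_pd c k (alpha c j') p)))).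
  have [d1 d2 d3] := dE k j; have [_ d4 d5] := dE k j'.
  apply: CpderD; [apply: CpderD; [exact: d1|]|].
    by apply: CpderD; apply: CpderZ.
  by apply: CpderD; apply: CpderZ.
rewrite wedge_brxx /ext_d.
have [Exx Eyy] := extended_formE l0 ac cp.
rewrite (Cpder_pd (Cpder_cdom cp (fun q cq => esym (extended_formE l0 ac cq).2) (dx ix _ _ _ _ iy ix))).
rewrite (Cpder_pd (Cpder_cdom cp (fun q cq => esym (extended_formE l0 ac cq).1) (dx iy _ _ _ _ ix iy))).
rewrite Exx Eyy.
have [gD F2 F0 Fm] := flat_components ac cp.
have [PP QP PQ] := commute_g2 ix iy ac cp.
have [PPxx QPxx PQxx] := commute_g2 ix ix ac cp.
have [PPyy QPyy PQyy] := commute_g2 iy iy ac cp.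
have [Txy Txx] := dtau_mpart_pd ix ac cp; have [Tyy Tyx] := dtau_mpart_pd iy ac cp.
have [Tbx Tby] := dtau_mpart ac cp.
have lgl X Y : lg S X -> lg S Y -> lg S (lbr X Y) by exact: (lie_lbr (hs_G hS)).
have lax := al ix ac cp; have lay := al iy ac cp.
have gb i : lg S (b c i p) by apply: lm_lg; apply: (lm_mpart hS); exact: al.
have gP i : lg S (P c i p) by apply: lh_lg; apply: (gpart2_lh hS); exact: al.
have gQ i : lg S (Q c i p) by apply: lh_lg; apply: (gpart0_lh hS); exact: al.
have gd k i : lg S (mx_pd c k (alpha c i) p) by exact: mx_pd_lg.
have gmd k i : lg S (mpart S (mx_pd c k (alpha c i) p)).
  by apply: lm_lg; apply: (lm_mpart hS).
have Tm : mpart S (mx_pd c ix (alpha c ix) p) + mpart S (mx_pd c iy (alpha c iy) p)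
   + (lbr (Q c ix p) (b c ix p) - lbr (P c ix p) (b c ix p)
      - lbr (b c iy p) (Q c iy p) + lbr (b c iy p) (P c iy p)) = 0.
  have l1 := lgl _ _ (gQ ix) (gb iy); have l2 := lgl _ _ (gP ix) (gb iy).
  have l3 := lgl _ _ (gb ix) (gQ iy); have l4 := lgl _ _ (gb ix) (gP iy).
  have := congr1 T Fm; rewrite (lin_on0 lgS tL).
  rewrite (lin_onD tL (lm_lg (lm_mpart hS gD)) (subspaceD lgS (subspaceD lgS (subspaceD lgS l1 l2) l3) l4)).
  rewrite (lin_onD tL (subspaceD lgS (subspaceD lgS l1 l2) l3) l4).
  rewrite (lin_onD tL (subspaceD lgS l1 l2) l3) (lin_onD tL l1 l2).
  rewrite (lin_onB lgS (mpart_lin hS) (gd _ _) (gd _ _)) (lin_onB lgS tL (gmd _ _) (gmd _ _)).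
  rewrite (dtau_lbr hS (gQ ix) (gb iy)) (dtau_lbr hS (gP ix) (gb iy)).
  rewrite (dtau_lbr hS (gb ix) (gQ iy)) (dtau_lbr hS (gb ix) (gP iy)).
  rewrite (dtau_gpart0 hS lax) (dtau_gpart0 hS lay) (dtau_gpart2 hS lax) (dtau_gpart2 hS lay).
  by rewrite Txy Tyx Tbx Tby opprK !lbrNl !lbrNr opprK.
rewrite (lin_onB lgS (gpart2_lin hS) (gd _ _) (gd _ _)) in F2.
rewrite (lin_onB lgS (gpart0_lin hS) (gd _ _) (gd _ _)) in F0.
rewrite (lin_onB lgS (mpart_lin hS) (gd _ _) (gd _ _)) in Fm.
rewrite (lin_onD (gpart2_lin hS) (gd _ _) (gd _ _)).
exact: (curvature_expand _ _ (lcos_lsin l0) PP PPxx PPyy QP QPxx QPyy PQ PQxx PQyy F0 F2 Fm Tm).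
Qed.

End Curvature.

(** * Smooth functions on a surface *)

Section SmoothFunctions.
Variables (R : realType) (L : riemann_surface R).
Implicit Types (c : chart R L) (p q : L) (U : set L) (f g : L -> R).

Lemma pder_val c i f p (d d' : R) : pder c i f p d -> d = d' -> pder c i f p d'.
Proof. by move=> + <-. Qed.

Lemma smooth_on_cst U (a : R) : open U -> smooth_on U (fun=> a).
Proof. by move=> oU c ac; apply: Cinfty_cst; exact: chart_image_open. Qed.

Lemma smooth_onD U f g : open U -> smooth_on U f -> smooth_on U g ->
  smooth_on U (fun q => f q + g q).
Proof.
by move=> oU sf sg c ac; apply: CinftyD (sf c ac) (sg c ac); exact: chart_image_open.
Qed.

Lemma smooth_onM U f g : open U -> smooth_on U f -> smooth_on U g ->
  smooth_on U (fun q => f q * g q).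
Proof.
by move=> oU sf sg c ac; apply: CinftyM (sf c ac) (sg c ac); exact: chart_image_open.
Qed.

Lemma smooth_onZ U (a : R) f : open U -> smooth_on U f -> smooth_on U (fun q => a * f q).
Proof. by move=> oU sf; apply: smooth_onM => //; exact: smooth_on_cst. Qed.

Lemma smooth_onN U f : open U -> smooth_on U f -> smooth_on U (fun q => - f q).
Proof.
move=> oU sf; have := smooth_onZ (-1) oU sf.
by under eq_fun do rewrite mulN1r.
Qed.

Lemma smooth_on_sum U (I : Type) (r : seq I) (f : I -> L -> R) : open U ->
  (forall i, smooth_on U (f i)) -> smooth_on U (fun q => \sum_(i <- r) f i q).
Proof.
move=> oU sf c ac.
by apply: (@Cinfty_sum R _ (chart_image_open oU) I r (fun i => f i \o cinv c)) => i; exact: sf.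
Qed.

Lemma smooth_on_ext U f g : open U -> (forall q, U q -> f q = g q) ->
  smooth_on U f -> smooth_on U g.
Proof.
move=> oU E sf c ac; apply: Cinfty_ext (sf c ac); first exact: chart_image_open.
by move=> _ [q [Uq cq] <-] /=; rewrite ccoordK//; exact: E.
Qed.

Lemma smooth_on_pder U f c i p : smooth_on U f -> atlas c -> U p -> cdom c p ->
  pder c i f p (pd c i f p).
Proof. by move=> sf ac Up cp; apply: Cinfty_is_derive (sf c ac) _; exists p. Qed.

Lemma pder_comp (phi : R -> R) (dphi : R) f c i p d : cdom c p ->
  is_derive (f p) 1 phi dphi -> pder c i f p d -> pder c i (fun q => phi (f q)) p (dphi * d).
Proof.
move=> cp dp df.
have l1 := (is_derive_line (f \o cinv c) (ccoord c p) (dvec R i) 0 d).1.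
have l2 := (is_derive_line (fun w => phi (f (cinv c w))) (ccoord c p) (dvec R i) 0 (dphi * d)).2.
rewrite scale0r add0r in l1 l2; apply: l2.
apply: (@is_derive1_comp R phi (fun s => f (cinv c (s *: dvec R i + ccoord c p))) 0 dphi d).
- by rewrite scale0r add0r ccoordK.
- exact: l1.
Qed.

Lemma pderM c i f g p d e : cdom c p -> pder c i f p d -> pder c i g p e ->
  pder c i (fun q => f q * g q) p (d * g p + f p * e).
Proof.
by move=> cp df dg; have := is_derive_mulR df dg; rewrite /= ccoordK.
Qed.

Lemma pder_cos f c i p d : cdom c p -> pder c i f p d ->
  pder c i (fun q => cos (f q)) p (- sin (f p) * d).
Proof. by move=> cp; apply: pder_comp => //; exact: is_derive_cos. Qed.

Lemma pder_sin f c i p d : cdom c p -> pder c i f p d ->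
  pder c i (fun q => sin (f q)) p (cos (f p) * d).
Proof. by move=> cp; apply: pder_comp => //; exact: is_derive_sin. Qed.

Lemma is_derive_continuous_comp (phi : R -> R) (h : R * R -> R) z :
  continuous phi -> {for z, continuous h} -> {for z, continuous (fun w => phi (h w))}.
Proof. by move=> cphi ch; apply: (@continuous_comp _ _ _ h phi z ch); exact: cphi. Qed.

(** Sine and cosine are differentiated into each other. *)
Lemma smooth_on_cos_sin U f : open U -> smooth_on U f ->
  smooth_on U (fun q => cos (f q)) /\ smooth_on U (fun q => sin (f q)).
Proof.
move=> oU sf.
suff H (bb : bool) : smooth_on U (fun q => if bb then cos (f q) else sin (f q)).
  by split; [exact: (H true)|exact: (H false)].
move=> c ac; have oD := chart_image_open (c := c) oU.
apply: (@Cinfty_bootstrap R _ oD bool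
  (fun bb w => if bb then cos (f (cinv c w)) else sin (f (cinv c w)))
  (fun i bb w => if bb then (-1 * sin (f (cinv c w))) * 'D_(dvec R i) (f \o cinv c) w
                 else cos (f (cinv c w)) * 'D_(dvec R i) (f \o cinv c) w)).
- move=> [] z Dz; apply: is_derive_continuous_comp (Cinfty_continuous (sf c ac) Dz).
    exact: continuous_cos.
  exact: continuous_sin.
- clear bb; move=> i bb _ [p [Up cp] <-]; have df := smooth_on_pder i sf ac Up cp.
  by case: bb; rewrite ccoordK// ?mulN1r; [exact: pder_cos|exact: pder_sin].
- clear bb; move=> k Hk i bb; have Df := Cinfty_derive i (sf c ac) k.
  case: bb; apply: CkM => //; last exact: (Hk true).
  by apply: (CkM oD); [exact: (Ck_cst oD)|exact: (Hk false)].
Qed.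

Variable N : nat.
Implicit Types (F G : L -> 'M[R]_N).

Lemma mx_smooth_mulmx U F G : open U -> mx_smooth_on U F -> mx_smooth_on U G ->
  mx_smooth_on U (fun q => F q *m G q).
Proof.
move=> oU sF sG a b.
apply: (smooth_on_ext (f := fun q => \sum_k F q a k * G q k b)) => //.
  by move=> q _; rewrite mxE.
by apply: smooth_on_sum => // k; exact: smooth_onM.
Qed.

Lemma mx_smooth_cst U (X : 'M[R]_N) : open U -> mx_smooth_on U (fun=> X).
Proof. by move=> oU a b; exact: smooth_on_cst. Qed.

(** The derivative of the inverse is a polynomial in the inverse and the derivatives
    of the matrix. *)
Lemma mx_smooth_invmx U F : open U -> (forall p, U p -> F p \in unitmx) ->
  mx_smooth_on U F -> mx_smooth_on U (fun q => invmx (F q)).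
Proof.
move=> oU uF sF a b c ac; have oD := chart_image_open (c := c) oU.
have nU p : U p -> \forall q \near p, F q \in unitmx.
  by move=> Up; apply: filterS (open_nbhs_nbhs (conj oU Up)) => q; exact: uF.
pose f (j : 'I_N * 'I_N) (w : R * R) := invmx (F (cinv c w)) j.1 j.2.
pose dF i k l (w : R * R) := 'D_(dvec R i) ((fun q => F q k l) \o cinv c) w.
apply: (@Cinfty_bootstrap R _ oD _ f (fun i j w => \sum_k \sum_l
   (-1 * f (j.1, k) w) * (dF i k l w * f (l, j.2) w)) _ _ _ (a, b)).
- move=> j _ [p [Up cp] <-].
  have cF : {for ccoord c p, continuous (fun w => invmx (F (cinv c w)))}.
    have cF : {for ccoord c p, continuous (F \o cinv c)}.
      apply: continuous_comp; first by apply: cinv_cont; exists p.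
      by rewrite ccoordK//; exact: (smooth_continuous sF Up).
    have := @cvg_invmx R _ _ _ N (F \o cinv c) (F (cinv c (ccoord c p))) _ _ cF; apply.
      by rewrite ccoordK// uF.
    by apply: filterS (near_chart_inv cp (nU p Up)) => _ [q cq [<- uq]] /=; rewrite ccoordK.
  by move/cvg_mxP: cF; exact.
- move=> i j _ [p [Up cp] <-].
  have := pder_invmx cp (nU p Up) (smooth_pder i sF ac Up cp) => /is_derive_mxP/(_ j.1 j.2) H.
  apply: (is_derive_val H); rewrite !mxE -sumrN.
  under eq_bigr do rewrite !mxE mulr_suml -sumrN.
  rewrite exchange_big; apply: eq_bigr => k _; apply: eq_bigr => l _.
  by rewrite /f /= ccoordK// !mxE /dF /pd; ring.
- move=> k Hk i j; apply: Ck_sum => // m; apply: Ck_sum => // l.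
  apply: (CkM oD); apply: (CkM oD).
  + exact: (Ck_cst oD).
  + exact: (Hk (j.1, m)).
  + exact: (Cinfty_derive i (sF m l c ac) k).
  + exact: (Hk (l, j.2)).
Qed.

Lemma smooth_on_linear U F (g : {linear 'M[R]_N -> R^o}) : open U -> mx_smooth_on U F ->
  smooth_on U (fun q => g (F q)).
Proof.
move=> oU sF; apply: (smooth_on_ext (f := fun q => \sum_i \sum_j g (delta_mx i j) * F q i j)) => //.
  move=> q _; rewrite (linear_mx_sum g); apply: eq_bigr => i _; apply: eq_bigr => j _.
  by rewrite mulrC.
by apply: smooth_on_sum => // i; apply: smooth_on_sum => // j; exact: smooth_onZ.
Qed.

Lemma smooth_on_lin_on (A : set 'M[R]_N) U F (f : 'M[R]_N -> R^o) : is_subspace A ->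
  lin_on A f -> open U -> mx_smooth_on U F -> (forall q, U q -> A (F q)) ->
  smooth_on U (fun q => f (F q)).
Proof.
move=> sA fl oU sF AF; have [g gE] := lin_on_extend sA fl.
apply: (smooth_on_ext (f := fun q => g (F q))) => //; last exact: smooth_on_linear.
by move=> q Uq; apply: gE; exact: AF.
Qed.

Lemma pder0_const F : (forall c i p, atlas c -> cdom c p -> pder c i F p 0) ->
  forall p q, F p = F q.
Proof.
move=> dF p q; apply/esym; move: q; apply: (@locally_constant_prop _ _ _ p) => // q.
have triv : \forall q' \near q, True by exact: filterE.
have [c [r [ac cq r0 H]]] := chart_square triv.
apply: filterS (near_square cq r0) => q' [cq' q1 q2].
set w := ccoord c q in H q1 q2; set w' := ccoord c q' in q1 q2.
have z0 (a : R) : `|a - a| < r by rewrite subrr normr0.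
have dFw i (v : R * R) : `|v.1 - w.1| < r -> `|v.2 - w.2| < r ->
    is_derive v (dvec R i) (F \o cinv c) 0.
  by move=> v1 v2; have [q'' cq'' [<- _]] := H v v1 v2; exact: dF.
suff -> : F q = F q' by [].
rewrite -(ccoordK cq) -(ccoordK cq') -/w -/w' (surjective_pairing w) (surjective_pairing w').
transitivity (F (cinv c (w'.1, w.2))).
  apply: (derive0_const (f := fun t => F (cinv c (t, w.2)))) => t tw.
  apply/(is_derive_ix (F \o cinv c)); apply: dFw => //=; apply: seg_ball tw => //.
apply: (derive0_const (f := fun t => F (cinv c (w'.1, t)))) => t tw.
apply/(is_derive_iy (F \o cinv c)); apply: dFw => //=; apply: seg_ball tw => //.
Qed.

End SmoothFunctions.

Section ComplexFunctions.
Variables (R : realType) (L : riemann_surface R).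
Implicit Types (c : chart R L) (p q : L) (u v : L -> R[i]).

(** Differentiability of a complex function together with its derivative. *)
Definition Cd c i u p (w : R[i]) :=
  pder c i (fun q => complex.Re (u q)) p (complex.Re w) /\
  pder c i (fun q => complex.Im (u q)) p (complex.Im w).

Lemma Cd_pd c i u p w : Cd c i u p w -> C_pd c i u p = w.
Proof. by move=> [h1 h2]; rewrite /C_pd (pder_pd h1) (pder_pd h2); case: w {h1 h2}. Qed.

Lemma CdM c i u v p w z : cdom c p -> Cd c i u p w -> Cd c i v p z ->
  Cd c i (fun q => u q * v q) p (w * v p + u p * z).
Proof.
move=> cp [h1 h2] [h3 h4].
have ReM (a b : R[i]) : complex.Re (a * b) = complex.Re a * complex.Re b - complex.Im a * complex.Im b.
  by case: a; case: b.
have ImM (a b : R[i]) : complex.Im (a * b) = complex.Re a * complex.Im b + complex.Im a * complex.Re b.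
  by case: a; case: b.
have ReD (a b : R[i]) : complex.Re (a + b) = complex.Re a + complex.Re b by case: a; case: b.
have ImD (a b : R[i]) : complex.Im (a + b) = complex.Im a + complex.Im b by case: a; case: b.
split.
- rewrite ReD !ReM; under eq_fun do rewrite ReM.
  by apply: (pder_val (pderD (pderM cp h1 h3) (pderN (pderM cp h2 h4)))); ring.
- rewrite ImD !ImM; under eq_fun do rewrite ImM.
  by apply: (pder_val (pderD (pderM cp h1 h4) (pderM cp h2 h3))); ring.
Qed.

Lemma CdB c i u v p w z : Cd c i u p w -> Cd c i v p z ->
  Cd c i (fun q => u q - v q) p (w - z).
Proof.
have ReB (a b : R[i]) : complex.Re (a - b) = complex.Re a - complex.Re b by case: a; case: b.
have ImB (a b : R[i]) : complex.Im (a - b) = complex.Im a - complex.Im b by case: a; case: b.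
move=> [h1 h2] [h3 h4]; split.
- by rewrite ReB; under eq_fun do rewrite ReB; exact: pderD h1 (pderN h3).
- by rewrite ImB; under eq_fun do rewrite ImB; exact: pderD h2 (pderN h4).
Qed.

Lemma Cd_near c i u v p w : cdom c p -> (\forall q \near p, u q = v q) ->
  Cd c i u p w -> Cd c i v p w.
Proof.
move=> cp E [h1 h2]; split.
- by apply: pder_near h1 => //; apply: filterS E => q ->.
- by apply: pder_near h2 => //; apply: filterS E => q ->.
Qed.

Lemma Cd_expi c i (b : L -> R) p d : cdom c p -> pder c i b p d ->
  Cd c i (fun q => expi (b q)) p (Complex 0 d * expi (b p)).
Proof.
move=> cp db; split => /=.
- by apply: (pder_val (pder_cos cp db)); ring.
- by apply: (pder_val (pder_sin cp db)); ring.
Qed.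

Lemma norm_complex1 (a b : R) : a * a + b * b = 1 -> `|Complex a b| = 1.
Proof. by move=> E; rewrite normc_def /= !expr2 E sqrtr1. Qed.

Lemma norm_expi (b : R) : `|expi b| = 1.
Proof. by apply: norm_complex1; rewrite -!expr2 cos2Dsin2. Qed.

Lemma expi_neq0 (b : R) : expi b != 0.
Proof. by rewrite -normr_eq0 norm_expi oner_eq0. Qed.

End ComplexFunctions.

(** * The trace form and the Lagrangian angle *)

Section AngleForm.
Variables (R : realType) (N : nat) (S : sym_data R N).
Hypothesis hS : hermitian_symmetric S.
Variables (L : riemann_surface R) (alpha : oneform L 'M[R]_N).
Hypothesis hal : smooth_oneform (lg S) alpha.
Implicit Types (X Y : 'M[R]_N) (c : chart R L) (p q : L).
Let lgS := lg_subspace hS.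
Let lhS := lh_subspace hS.
Let al c i p ac cp : lg S (alpha c i p) := alpha_lg hal i ac cp.

(** By [theta_fixed] the trace of the h-part only depends on the part in [g_2]; by
    [theta_sY] it determines that part. *)
Definition gtheta X : R := theta S (gpart2 S X).

Lemma gtheta_lin : lin_on (lg S) (gtheta : 'M[R]_N -> R^o).
Proof.
move=> a X Y lX lY; rewrite /gtheta (gpart2_lin hS)//.
by rewrite (theta_lin hS)//; exact: gpart2_lh.
Qed.

Lemma theta_hpart X : lg S X -> theta S (hpart S X) = gtheta X.
Proof.
move=> lX; have -> : hpart S X = gpart2 S X + gpart0 S X.
  by apply/matrixP => i j; rewrite /gpart2 /gpart0 !mxE; field.
rewrite (lin_onD (theta_lin hS) (gpart2_lh hS lX) (gpart0_lh hS lX)).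
by rewrite (theta_fixed hS (gpart0_lh hS lX) (dtau_gpart0 hS lX)) addr0.
Qed.

Lemma gpart2_eq0 X : lg S X -> gpart2 S X = 0 <-> gtheta X = 0.
Proof.
move=> lX; split=> [E|]; first by rewrite /gtheta E (lin_on0 lhS (theta_lin hS)).
rewrite /gtheta; have [t ->] := gpart2_sY hS lX.
rewrite (lin_onZ lhS _ (theta_lin hS)); last exact: (hs_Yh hS).
move/eqP; rewrite mulf_eq0 (negPf (theta_sY hS)) orbF => /eqP ->.
by rewrite scale0r.
Qed.

Definition angle_form c i p : R := gtheta (alpha c i p).

(** The angle form is coclosed; for its primitives, the Lagrangian angles, this is
    harmonicity. *)
Definition coclosed := forall c p, atlas c -> cdom c p ->
  gtheta (mx_pd c ix (alpha c ix) p + mx_pd c iy (alpha c iy) p) = 0.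

Lemma pder_angle c k i p : atlas c -> cdom c p ->
  pder c k (angle_form c i) p (gtheta (mx_pd c k (alpha c i) p)).
Proof.
move=> ac cp; apply: (pder_lin_on lgS gtheta_lin cp _ (form_pder _ _ hal ac cp)).
by apply: filterS (near_cdom cp) => q cq; exact: al.
Qed.

Lemma gtheta_pdD c p : atlas c -> cdom c p ->
  gtheta (mx_pd c ix (alpha c ix) p + mx_pd c iy (alpha c iy) p) =
  gtheta (mx_pd c ix (alpha c ix) p) + gtheta (mx_pd c iy (alpha c iy) p).
Proof.
move=> ac cp; have l k i := mx_pd_lg hS hal k i ac cp.
exact: (lin_onD gtheta_lin (l ix ix) (l iy iy)).
Qed.

Variables (f : L -> set 'M[R]_N) (F : L -> 'M[R]_N).
Hypotheses (lF : lift_on S setT f F) (mc : maurer_cartan F alpha).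

Lemma lift_mem p : f p (F p).
Proof.
by have [_ _ H] := lF; have [_ <-] := H p I; exists 1%:M; [exact: sH1|rewrite mulmx1].
Qed.

(** A parallel section is differentiated along the lift by the h-part of the form,
    which acts on alternating forms by its trace. *)
Lemma angle_derivative s c i p : canonical_section S f s -> parallel_section S f s ->
  atlas c -> cdom c p ->
  C_pd c i (exp_i_angle S s F) p = Complex 0 (angle_form c i p) * exp_i_angle S s F p.
Proof.
move=> cs ps ac cp.
have [_ _ /(_ c i p ac I cp)/= E] := ps _ _ lF _ _ (lm_eps hS ix) (lm_eps hS iy).
rewrite /exp_i_angle E; have [_ wL wA] := cs p (F p) (lift_mem p).
have EM : MC F c i p = alpha c i p by rewrite mc.
rewrite EM (alternating_trace hS wL wA (lh_hpart hS (al i ac cp)) (lm_eps hS ix) (lm_eps hS iy)).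
by rewrite (theta_hpart (al i ac cp)).
Qed.

(** Thus every local determination of the angle is a primitive of the angle form. *)
Lemma angle_of_expi s c i p (b : L -> R) d : canonical_section S f s -> parallel_section S f s ->
  atlas c -> cdom c p -> (\forall q \near p, exp_i_angle S s F q = expi (b q)) ->
  pder c i b p d -> d = angle_form c i p.
Proof.
move=> cs ps ac cp E db; have up := nbhs_singleton E.
have E' : \forall q \near p, expi (b q) = exp_i_angle S s F q by apply: filterS E => q ->.
have := Cd_pd (Cd_near cp E' (Cd_expi cp db)).
rewrite (angle_derivative i cs ps ac cp) up => /(mulIf (expi_neq0 _)) [].
by [].
Qed.

Lemma stationary_coclosed : hamiltonian_stationary S f F -> coclosed.
Proof.
move=> [s [cs _ ps] har] c p ac cp; have [U [b [oU Up [sb hb] E]]] := har p.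
have nU q : U q -> \forall q' \near q, exp_i_angle S s F q' = expi (b q').
  by move=> Uq; apply: filterS (open_nbhs_nbhs (conj oU Uq)) => q'; exact: E.
have dE i q : U q -> cdom c q -> pd c i b q = angle_form c i q.
  move=> Uq cq; apply: (angle_of_expi cs ps ac cq (nU q Uq)).
  exact: smooth_on_pder sb ac Uq cq.
have ncp := near_cdom cp.
have dd i : pd c i (pd c i b) p = gtheta (mx_pd c i (alpha c i) p).
  apply: pder_pd; apply: pder_near cp _ (pder_angle i i ac cp).
  by apply: filterS (filterI (open_nbhs_nbhs (conj oU Up)) ncp) => q [Uq cq]; rewrite dE.
by rewrite gtheta_pdD// -!dd; exact: hb.
Qed.

Lemma minimal_angle_form : minimal S f F ->
  forall c i p, atlas c -> cdom c p -> angle_form c i p = 0.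
Proof.
move=> [s [cs _ ps] [b E]] c i p ac cp; apply/esym.
apply: (angle_of_expi (b := fun=> b) cs ps ac cp); last exact: pder_cst.
by apply: filterE => q; exact: E.
Qed.

Lemma smooth_gtheta c i (a : R) : atlas c -> smooth_in c (cdom c) (fun p => angle_form c i p * a).
Proof.
move=> ac; have [g gE] := lin_on_extend lgS gtheta_lin.
have oD : open (ccoord c @` (cdom c `&` cdom c)).
  by apply: chart_image_open; exact: cdom_open.
rewrite /smooth_in; apply: (Cinfty_ext oD (f := fun w => \sum_m \sum_n
   (g (delta_mx m n) * a) * alpha c i (cinv c w) m n)).
  move=> _ [q [_ cq] <-] /=; rewrite ccoordK// /angle_form -gE; last exact: al.
  rewrite (linear_mx_sum g) mulr_suml; apply: eq_bigr => m _; rewrite mulr_suml.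
  by apply: eq_bigr => n _; rewrite -[_ *: _]/(_ * _); ring.
apply: Cinfty_sum => // m; apply: Cinfty_sum => // n; apply: CinftyZ => //.
by have [_ _ sal] := hal; exact: sal.
Qed.

Hypotheses (fl : rflat alpha) (prim : primitive_form S alpha) (hL : simply_connected L).

Lemma angle_form_closed c p : atlas c -> cdom c p ->
  gtheta (mx_pd c ix (alpha c iy) p) = gtheta (mx_pd c iy (alpha c ix) p).
Proof.
move=> ac cp; have [_ E _ _] := flat_components hS hal fl prim ac cp.
have l k i := mx_pd_lg hS hal k i ac cp.
have : gtheta (mx_pd c ix (alpha c iy) p - mx_pd c iy (alpha c ix) p) = 0.
  by rewrite /gtheta E (lin_on0 lhS (theta_lin hS)).
by rewrite (lin_onB lgS gtheta_lin (l ix iy) (l iy ix)) => /subr0_eq.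
Qed.

(** The angle form is closed, so it is an entry of a flat nilpotent matrix form.  The
    solution of that system is unipotent, and its entry is a primitive. *)
Lemma exists_angle : exists beta : L -> R, smooth_on setT beta /\
  forall c i p, atlas c -> cdom c p -> pder c i beta p (angle_form c i p).
Proof.
have [[p0 _]|no] := pselect (exists p : L, True); last first.
  exists (fun=> 0); split; first exact: smooth_on_cst openT.
  by move=> c i p; case: no; exists p.
pose E : 'M[R]_2 := delta_mx ix iy.
pose eta : oneform L 'M[R]_2 := fun c i p => angle_form c i p *: E.
have EE : E *m E = 0 by rewrite /E mul_delta_mx_cond.
have seta : smooth_oneform setT eta.
  split=> //.
  - move=> c c' i p ac ac' cp c'p; have [_ compat _] := hal.
    have lx := al ix ac' c'p; have ly := al iy ac' c'p.
    rewrite /eta /angle_form (compat c c' i p ac ac' cp c'p).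
    set u := pd c i _ p; set v := pd c i _ p.
    rewrite (gtheta_lin u lx (subspaceZ lgS v ly)) (lin_onZ lgS v gtheta_lin ly).
    by rewrite scalerDl !scalerA.
  - move=> c i a b ac; have := smooth_gtheta i (E a b) ac.
    rewrite (_ : (fun p => angle_form c i p * E a b) = (fun p => eta c i p a b))//.
    by apply/funext => p; rewrite [RHS]mxE.
have feta : rflat eta.
  move=> c p ac cp.
  have dE k i := pder_mx_pd (pder_scalev E (pder_angle k i ac cp)).
  rewrite !dE angle_form_closed// subrr add0r /eta lbrZl lbrZr.
  by rewrite /lbr EE subrr !scaler0.
have [V [V0 sV]] := global_solution seta feta hL p0.
have dV c i p : atlas c -> cdom c p -> pder c i V p (V p *m eta c i p).
  by move=> ac cp; have [_ _ H] := sV p; exact: H.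
have Vxx p : V p ix ix = 1.
  have c0 : V p *m delta_mx ix ix = V p0 *m delta_mx ix ix.
    apply: (@pder0_const R L 2 (fun q => V q *m delta_mx ix ix)) => c i q ac cq.
    apply: is_derive_val (pder_mulmx cq (dV c i q ac cq) (pder_cst c i q _)) _.
    by rewrite mulmx0 addr0 /eta -mulmxA -scalemxAl mul_delta_mx_cond scaler0 mulmx0.
  have := congr1 (fun M : 'M[R]_2 => M ix ix) c0.
  by rewrite V0 mul1mx mxE sum2E !mxE !eqxx/= mulr1 mulr0 addr0.
exists (fun p => V p ix iy); split.
  by apply: (sol_smooth seta openT (fun p _ => sV p)).
move=> c i p ac cp; have := (is_derive_mxP _ _ _ _).1 (dV c i p ac cp) ix iy.
move=> H; apply: (is_derive_val H).
by rewrite mxE sum2E !mxE !eqxx/= Vxx !mulr1 !mulr0 mul1r addr0.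
Qed.

End AngleForm.

(** * Parallel sections of the canonical bundle *)

Section ParallelSection.
Variables (R : realType) (N : nat) (S : sym_data R N).
Hypothesis hS : hermitian_symmetric S.
Variables (L : riemann_surface R) (alpha : oneform L 'M[R]_N).
Hypothesis hal : smooth_oneform (lg S) alpha.
Implicit Types (X Y g : 'M[R]_N) (c : chart R L) (p q : L).
Let lmS := lm_subspace hS.
Let lgS := lg_subspace hS.
Let al c i p ac cp : lg S (alpha c i p) := alpha_lg hal i ac cp.

(** The complex determinant in the reference frame. *)
Definition cross X Y : R[i] := crd S ix X * crd S iy Y - crd S iy X * crd S ix Y.

Lemma cross_linear k X X' Y : lm S X -> lm S X' -> lm S Y ->
  cross (jscale S k X + X') Y = k * cross X Y + cross X' Y.
Proof.
move=> lX lX' lY; have lk := lm_jscale hS k lX.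
by rewrite /cross !(crdD hS _ lk lX') !(crd_jscale hS _ _ lX); ring.
Qed.

Lemma cross_alt X Y : lm S X -> lm S Y -> cross Y X = - cross X Y.
Proof. by move=> _ _; rewrite /cross; ring. Qed.

Lemma crossD X X' Y : lm S X -> lm S X' -> lm S Y ->
  cross (X + X') Y = cross X Y + cross X' Y.
Proof. by move=> lX lX' lY; rewrite /cross !(crdD hS)//; ring. Qed.

Lemma crossDr X Y Y' : lm S X -> lm S Y -> lm S Y' ->
  cross X (Y + Y') = cross X Y + cross X Y'.
Proof. by move=> lX lY lY'; rewrite /cross !(crdD hS)//; ring. Qed.

(** Lagrange's identity: the squared modulus of the determinant is the Gram determinant
    of the two vectors. *)
Lemma cross_unitary (k : 'M[R]_N -> 'M[R]_N) : unitary_m S k ->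
  `|cross (k (eps S ix)) (k (eps S iy))| = 1.
Proof.
move=> [_ km kJ kip]; have lk a := km _ (lm_eps hS a).
have [i11 i22 i12 [i21 j1 j2 j12 j21]] := ip_eps hS.
have lJe a := lm_J hS (lm_eps hS a).
have E a b : ip S (k (eps S a)) (k (eps S b)) = ip S (eps S a) (eps S b).
  by apply: kip; exact: lm_eps.
have EJ a b : ip S (k (eps S a)) (cJ S (k (eps S b))) = ip S (eps S a) (cJ S (eps S b)).
  by rewrite -kJ ?kip//; exact: lm_eps.
have crdJ a b : crd S a (cJ S (k (eps S b))) = imu R * crd S a (k (eps S b)).
  by rewrite -(jscale_J S (k (eps S b))) (crd_jscale hS).
have := E ix ix; have := E iy iy; have := E ix iy; have := EJ ix iy.
rewrite i11 i22 i12 j12 !(ip_crd hS)//; try exact: lm_J.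
rewrite !crdJ /cross.
case: (crd S ix (k (eps S ix))) => a1 a2; case: (crd S iy (k (eps S ix))) => a3 a4.
case: (crd S ix (k (eps S iy))) => b1 b2; case: (crd S iy (k (eps S iy))) => b3 b4 /=.
move=> e4 e3 e2 e1; apply: norm_complex1.
have {}e1 : a1 * a1 + a2 * a2 + a3 * a3 + a4 * a4 = 1 by rewrite -e1; ring.
have {}e2 : b1 * b1 + b2 * b2 + b3 * b3 + b4 * b4 = 1 by rewrite -e2; ring.
have {}e3 : a1 * b1 + a2 * b2 + a3 * b3 + a4 * b4 = 0 by rewrite -e3; ring.
have {}e4 : a2 * b1 - a1 * b2 + a4 * b3 - a3 * b4 = 0 by rewrite -e4; ring.
transitivity ((a1 * a1 + a2 * a2 + a3 * a3 + a4 * a4) * (b1 * b1 + b2 * b2 + b3 * b3 + b4 * b4)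
  - (a1 * b1 + a2 * b2 + a3 * b3 + a4 * b4) ^+ 2 - (a2 * b1 - a1 * b2 + a4 * b3 - a3 * b4) ^+ 2).
  by ring.
by rewrite e1 e2 e3 e4 expr0n/= !subr0 mulr1.
Qed.

Variables (f : L -> set 'M[R]_N) (F : L -> 'M[R]_N).
Hypotheses (lF : lift_on S setT f F) (mc : maurer_cartan F alpha).
Variable beta : L -> R.
Hypothesis sbeta : smooth_on setT beta.
Hypothesis dbeta : forall c i p, atlas c -> cdom c p -> pder c i beta p (angle_form S alpha c i p).

(** The determinant, read through the lift [F] and rotated by a primitive [beta] of the
    angle form; the rotation compensates the trace of the connection. *)
Definition rotated_section p g X Y : R[i] :=
  expi (beta p) * cross (Ad (invmx (F p) *m g) X) (Ad (invmx (F p) *m g) Y).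

Let ratio p g : f p g -> sH S (invmx (F p) *m g).
Proof.
have [_ _ H] := lF; have [Gp <-] := H p I => -[h Hh <-].
by rewrite mulKmx// (sG_unit hS).
Qed.

Lemma rotated_canonical : canonical_section S f rotated_section.
Proof.
move=> p g fg; have Hh := ratio fg; split.
- move=> h X Y Hk lX lY; rewrite /rotated_section mulmxA.
  by rewrite !(AdM _ (sH_unit hS Hh) (sH_unit hS Hk)).
- move=> k X X' Y lX lX' lY; rewrite /rotated_section.
  have AdL X1 X2 : lm S X1 -> lm S X2 -> Ad (invmx (F p) *m g) (X1 + X2) =
      Ad (invmx (F p) *m g) X1 + Ad (invmx (F p) *m g) X2.
    by rewrite /Ad mulmxDr mulmxDl.
  have lk := lm_jscale hS k lX.
  have AdZ (a : R) X1 : Ad (invmx (F p) *m g) (a *: X1) = a *: Ad (invmx (F p) *m g) X1.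
    by rewrite /Ad -scalemxAr -scalemxAl.
  have Adk : Ad (invmx (F p) *m g) (jscale S k X) = jscale S k (Ad (invmx (F p) *m g) X).
    rewrite /jscale AdL; [|exact: (subspaceZ lmS)|by apply: (subspaceZ lmS); exact: lm_J].
    by rewrite !AdZ (J_Ad hS Hh lX).
  rewrite AdL// Adk cross_linear; [by ring|exact: lm_Ad|exact: lm_Ad|exact: lm_Ad].
- move=> X Y lX lY; rewrite /rotated_section cross_alt ?mulrN//; exact: lm_Ad.
Qed.

Lemma rotated_unit : unit_section S f rotated_section.
Proof.
move=> p g fg; rewrite /rotated_section normrM norm_expi mul1r.
by apply: cross_unitary; apply: (hs_H_unitary hS); exact: ratio.
Qed.

Lemma rotated_angle p : exp_i_angle S rotated_section F p = expi (beta p).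
Proof.
have [_ _ H] := lF; have [Gp _] := H p I.
have Ad1 X : Ad 1%:M X = X by rewrite /Ad mul1mx invmx1 mulmx1.
rewrite /exp_i_angle /rotated_section mulVmx ?(sG_unit hS)// !Ad1 /cross !(crd_eps hS) /=.
by rewrite !mulr1 mulr0 subr0 mulr1.
Qed.

Section ParallelInLift.
Variables (U : set L) (F' : L -> 'M[R]_N).
Hypothesis lF' : lift_on S U f F'.
Let h q := invmx (F q) *m F' q.

Lemma smooth_Ad_ratio X : mx_smooth_on U (fun q => Ad (h q) X).
Proof.
have [_ sF HF] := lF; have [oU sF' HF'] := lF'.
have sFU : mx_smooth_on U F.
  move=> a b c ac; apply: CinftyW (sF a b c ac) => _ [q [_ cq] <-]; by exists q.
have uF q : U q -> F q \in unitmx by move=> _; apply: (sG_unit hS); have [] := HF q I.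
have uF' q : U q -> F' q \in unitmx by move=> Uq; apply: (sG_unit hS); have [] := HF' q Uq.
have sh : mx_smooth_on U h.
  by apply: mx_smooth_mulmx => //; exact: mx_smooth_invmx.
have uh q : U q -> h q \in unitmx by move=> Uq; rewrite unitmx_mul unitmx_inv uF ?uF'.
apply: (@mx_smooth_mulmx _ _ _ U (fun q => h q *m X)) => //; last exact: mx_smooth_invmx.
by apply: mx_smooth_mulmx => //; exact: mx_smooth_cst.
Qed.

Let lAd q X : U q -> lm S X -> lm S (Ad (h q) X).
Proof. by move=> Uq; apply: (lm_Ad hS); exact: (lift_ratio hS lF lF' Uq). Qed.

Lemma smooth_crd_ratio a X : lm S X ->
  smooth_on U (fun q => complex.Re (crd S a (Ad (h q) X))) /\
  smooth_on U (fun q => complex.Im (crd S a (Ad (h q) X))).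
Proof.
move=> lX; have [oU _ _] := lF'; have sA := smooth_Ad_ratio X; have le := lm_eps hS a.
split.
- apply: (smooth_on_lin_on lmS (ip_lin hS le) oU sA) => q Uq; exact: lAd.
- apply: (smooth_on_lin_on lmS (ip_lin hS (lm_J hS le)) oU sA) => q Uq; exact: lAd.
Qed.

Lemma rotated_smooth X Y : lm S X -> lm S Y ->
  smooth_on U (fun q => complex.Re (rotated_section q (F' q) X Y)) /\
  smooth_on U (fun q => complex.Im (rotated_section q (F' q) X Y)).
Proof.
move=> lX lY; have [oU _ _] := lF'.
have sb : smooth_on U beta.
  move=> c ac; apply: CinftyW (sbeta ac) => _ [q [_ cq] <-]; by exists q.
have [sc ss] := smooth_on_cos_sin oU sb.
have [x1 x2] := smooth_crd_ratio ix lX; have [x3 x4] := smooth_crd_ratio iy lX.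
have [y1 y2] := smooth_crd_ratio ix lY; have [y3 y4] := smooth_crd_ratio iy lY.
pose re (z : R[i]) := complex.Re z; pose im (z : R[i]) := complex.Im z.
pose k a Z q := crd S a (Ad (h q) Z).
pose re2 q := re (k ix X q) * re (k iy Y q) + - (im (k ix X q) * im (k iy Y q))
  + - (re (k iy X q) * re (k ix Y q) + - (im (k iy X q) * im (k ix Y q))).
pose im2 q := re (k ix X q) * im (k iy Y q) + im (k ix X q) * re (k iy Y q)
  + - (re (k iy X q) * im (k ix Y q) + im (k iy X q) * re (k ix Y q)).
have s1 : smooth_on U re2.
  apply: (smooth_onD oU); first by apply: (smooth_onD oU); [exact: (smooth_onM oU)|apply: (smooth_onN oU); exact: (smooth_onM oU)].
  by apply: (smooth_onN oU); apply: (smooth_onD oU); [exact: (smooth_onM oU)|apply: (smooth_onN oU); exact: (smooth_onM oU)].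
have s2 : smooth_on U im2.
  apply: (smooth_onD oU); first by apply: (smooth_onD oU); exact: (smooth_onM oU).
  by apply: (smooth_onN oU); apply: (smooth_onD oU); exact: (smooth_onM oU).
have Er q : complex.Re (rotated_section q (F' q) X Y)
    = cos (beta q) * re2 q + - (sin (beta q) * im2 q).
  rewrite /rotated_section /cross /re2 /im2 /k /re /im -/(h q).
  case: (crd _ _ _) => ? ?; case: (crd _ _ _) => ? ?.
  by case: (crd _ _ _) => ? ?; case: (crd _ _ _) => ? ? /=; ring.
have Ei q : complex.Im (rotated_section q (F' q) X Y)
    = cos (beta q) * im2 q + sin (beta q) * re2 q.
  rewrite /rotated_section /cross /re2 /im2 /k /re /im -/(h q).
  case: (crd _ _ _) => ? ?; case: (crd _ _ _) => ? ?.
  by case: (crd _ _ _) => ? ?; case: (crd _ _ _) => ? ? /=; ring.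
split.
- apply: (smooth_on_ext oU (fun q _ => esym (Er q))).
  by apply: (smooth_onD oU); [exact: (smooth_onM oU)|apply: (smooth_onN oU); exact: (smooth_onM oU)].
- apply: (smooth_on_ext oU (fun q _ => esym (Ei q))).
  by apply: (smooth_onD oU); exact: (smooth_onM oU).
Qed.

Lemma pder_Ad_ratio c i p B X : atlas c -> U p -> cdom c p ->
  pder c i h p (h p *m B) -> pder c i (fun q => Ad (h q) X) p (Ad (h p) (lbr B X)).
Proof.
move=> ac Up cp dh; have [oU _ _] := lF'.
have uh q : U q -> h q \in unitmx.
  by move=> Uq; apply: (sH_unit hS); exact: (lift_ratio hS lF lF' Uq).
have nuh : \forall q \near p, h q \in unitmx.
  by apply: filterS (open_nbhs_nbhs (conj oU Up)) => q; exact: uh.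
have := pder_mulmx cp (pder_mulmx cp dh (pder_cst c i p X)) (pder_invmx cp nuh dh).
move=> H; apply: (is_derive_val H).
rewrite mulmx0 addr0 mulKmx ?uh// /Ad /lbr mulmxBr mulmxBl mulmxN.
by rewrite !mulmxA.
Qed.

Lemma Cd_crd_ratio a c i p B X : atlas c -> U p -> cdom c p -> lm S X -> lh S B ->
  pder c i h p (h p *m B) ->
  Cd c i (fun q => crd S a (Ad (h q) X)) p (crd S a (Ad (h p) (lbr B X))).
Proof.
move=> ac Up cp lX hB dh; have [oU _ _] := lF'; have le := lm_eps hS a.
have dA := pder_Ad_ratio X ac Up cp dh.
have nA : \forall q \near p, lm S (Ad (h q) X).
  by apply: filterS (open_nbhs_nbhs (conj oU Up)) => q Uq; exact: lAd.
split.
- exact: (pder_lin_on lmS (ip_lin hS le) cp nA dA).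
- exact: (pder_lin_on lmS (ip_lin hS (lm_J hS le)) cp nA dA).
Qed.

(** In another lift [F h], the derivative of [Ad h] accounts for the change of the
    connection, and the trace of the remaining h-part of the form for the derivative
    of [beta]. *)
Lemma rotated_derivative X Y c i p : lm S X -> lm S Y -> atlas c -> U p -> cdom c p ->
  let A := hpart S (MC F' c i p) in
  C_pd c i (fun q => rotated_section q (F' q) X Y) p
  = rotated_section p (F' p) (lbr A X) Y + rotated_section p (F' p) X (lbr A Y).
Proof.
move=> lX lY ac Up cp A.
have [B hB [dh EM]] := lift_change hS i lF lF' ac Up cp.
rewrite -/h in dh; rewrite -/(h p) in EM.
have Hh : sH S (h p) := lift_ratio hS lF lF' Up.
have uh := sH_unit hS Hh.
have MCa : MC F c i p = alpha c i p by rewrite mc.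
have la := al i ac cp; have hA0 := lh_hpart hS la.
set A0 := hpart S (alpha c i p) in hA0.
have Hi : sH S (invmx (h p)) by exact: sHV.
have EA : A = Ad (invmx (h p)) A0 + B.
  rewrite /A EM MCa; have lA : lg S (Ad (invmx (h p)) (alpha c i p)).
    by apply: (lie_Ad (hs_G hS)) => //; exact: (sH_sG hS).
  rewrite (lin_onD (hpart_lin hS) lA (lh_lg hB)) (hpart_lh hB).
  by rewrite (hpart_Ad hS Hi la).
have lXh := lAd Up lX; have lYh := lAd Up lY.
have lbm Z W : lh S Z -> lm S W -> lm S (lbr Z W) by exact: lbr_hm.
have EAd Z : lm S Z -> Ad (h p) (lbr A Z) = lbr A0 (Ad (h p) Z) + Ad (h p) (lbr B Z).
  move=> lZ; rewrite EA lbrDl.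
  have -> : Ad (h p) (lbr (Ad (invmx (h p)) A0) Z + lbr B Z) =
      Ad (h p) (lbr (Ad (invmx (h p)) A0) Z) + Ad (h p) (lbr B Z).
    by rewrite /Ad mulmxDr mulmxDl.
  by rewrite (Ad_lbr _ _ uh) Ad_invK.
have dE := Cd_expi cp (dbeta i ac cp).
have dX a := Cd_crd_ratio a ac Up cp lX hB dh.
have dY a := Cd_crd_ratio a ac Up cp lY hB dh.
(* the product rule; the trace term and the derivative of [beta] cancel below *)
have D := CdM cp dE (CdB (CdM cp (dX ix) (dY iy)) (CdM cp (dX iy) (dY ix))).
rewrite (Cd_pd D) /rotated_section -/(h p) !EAd//.
have lBX : lm S (Ad (h p) (lbr B X)) by apply: lAd => //; exact: lbm.
have lBY : lm S (Ad (h p) (lbr B Y)) by apply: lAd => //; exact: lbm.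
have l1 := lbm _ _ hA0 lXh; have l2 := lbm _ _ hA0 lYh.
rewrite (crossD l1 lBX lYh) (crossDr lXh l2 lBY).
have tr := alternating_trace hS cross_linear cross_alt hA0 lXh lYh.
rewrite (theta_hpart hS la) in tr.
rewrite -/(cross (Ad (h p) X) (Ad (h p) Y)).
transitivity (expi (beta p) * ((cross (lbr A0 (Ad (h p) X)) (Ad (h p) Y) +
     cross (Ad (h p) X) (lbr A0 (Ad (h p) Y)))
   + (cross (Ad (h p) (lbr B X)) (Ad (h p) Y) + cross (Ad (h p) X) (Ad (h p) (lbr B Y))))).
  by rewrite tr /angle_form /cross; ring.
by ring.
Qed.

End ParallelInLift.

Lemma rotated_parallel : parallel_unit_section S f rotated_section.
Proof.
split; [exact: rotated_canonical|exact: rotated_unit|].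
move=> U F' lF' X Y lX lY; have [s1 s2] := rotated_smooth lF' lX lY.
by split=> // c i p ac Up cp; exact: (rotated_derivative lF' i lX lY ac Up cp).
Qed.

End ParallelSection.

(** * The characterizations *)

Section Conclusion.
Variables (R : realType) (N : nat) (S : sym_data R N).
Hypothesis hS : hermitian_symmetric S.
Variables (L : riemann_surface R) (alpha : oneform L 'M[R]_N).
Hypothesis hal : smooth_oneform (lg S) alpha.
Hypotheses (fl : rflat alpha) (prim : primitive_form S alpha) (hL : simply_connected L).
Variables (f : L -> set 'M[R]_N) (F : L -> 'M[R]_N).
Hypotheses (lF : lift_on S setT f F) (mc : maurer_cartan F alpha).

Lemma coclosed_stationary : coclosed S alpha -> hamiltonian_stationary S f F.
Proof.
move=> cocl; have [beta [sb db]] := exists_angle hS hal fl prim hL.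
exists (rotated_section S F beta); first exact: (rotated_parallel hS hal lF mc sb db).
move=> p; exists setT, beta; split=> //; first exact: openT.
  split=> // c q ac _ cq.
  have dd i : pd c i (pd c i beta) q = gtheta S (mx_pd c i (alpha c i) q).
    apply: pder_pd; apply: pder_cdom cq _ (pder_angle hS hal i i ac cq) => q' cq'.
    by rewrite (pder_pd (db c i q' ac cq')).
  by rewrite !dd -(gtheta_pdD hS hal ac cq); exact: cocl.
by move=> q _; exact: (rotated_angle hS lF).
Qed.

Lemma angle_form0_minimal :
  (forall c i p, atlas c -> cdom c p -> angle_form S alpha c i p = 0) -> minimal S f F.
Proof.
move=> z; have s0 : smooth_on setT (fun _ : L => 0 : R) by exact: smooth_on_cst openT.
have d0 c i p : atlas c -> cdom c p -> pder c i (fun _ : L => 0 : R) p (angle_form S alpha c i p).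
  by move=> ac cp; rewrite z//; exact: pder_cst.
exists (rotated_section S F (fun=> 0)); first exact: (rotated_parallel hS hal lF mc s0 d0).
by exists 0 => p; exact: (rotated_angle hS lF).
Qed.

Variables a2 a0 am1 a1 : oneform L 'M[R[i]]_N.
Hypotheses (h2 : forall c i p, atlas c -> cdom c p -> lgC_ S 2 (a2 c i p))
  (h0 : forall c i p, atlas c -> cdom c p -> lgC_ S 0 (a0 c i p))
  (hm1 : forall c i p, atlas c -> cdom c p -> lgC_ S (-1) (am1 c i p))
  (h1 : forall c i p, atlas c -> cdom c p -> lgC_ S 1 (a1 c i p))
  (hdec : forall c i p, atlas c -> cdom c p ->
     toC (alpha c i p) = a2 c i p + a0 c i p + am1 c i p + a1 c i p).

Let pdD_lg c p : atlas c -> cdom c p ->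
  lg S (mx_pd c ix (alpha c ix) p + mx_pd c iy (alpha c iy) p).
Proof.
by move=> ac cp; apply: (subspaceD (lg_subspace hS)); exact: (mx_pd_lg hS hal).
Qed.

Lemma coclosed_flat lam : lam != 0 -> coclosed S alpha ->
  flat (extended_form a2 a0 am1 a1 lam).
Proof.
move=> l0 cocl c p ac cp.
rewrite (extended_curvature hS hal h2 h0 hm1 h1 hdec fl prim l0 ac cp).
by rewrite (gpart2_eq0 hS (pdD_lg ac cp)).2 ?cocl// toC0 scaler0.
Qed.

Lemma flat_coclosed lam : lam != 0 -> lcos lam * lsin lam != 0 ->
  flat (extended_form a2 a0 am1 a1 lam) -> coclosed S alpha.
Proof.
move=> l0 cs flam c p ac cp; apply: (gpart2_eq0 hS (pdD_lg ac cp)).1.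
have := flam c p ac cp; rewrite (extended_curvature hS hal h2 h0 hm1 h1 hdec fl prim l0 ac cp).
move/eqP; rewrite scaler_eq0 -mulrA mulf_eq0 pnatr_eq0 (negPf cs)/= => /eqP E.
by apply: toC_inj; rewrite E toC0.
Qed.

Lemma a2_zero : zero_form a2 <->
  forall c i p, atlas c -> cdom c p -> angle_form S alpha c i p = 0.
Proof.
have E c i p (ac : atlas c) (cp : cdom c p) : a2 c i p = toC (gpart2 S (alpha c i p)).
  by have [] := form_components hS hal h2 h0 hm1 h1 hdec i ac cp.
split=> z c i p ac cp.
- apply: (gpart2_eq0 hS (alpha_lg hal i ac cp)).1; apply: toC_inj.
  by rewrite toC0 -E// z.
- rewrite E// (gpart2_eq0 hS (alpha_lg hal i ac cp)).2 ?toC0//.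
  exact: z.
Qed.

End Conclusion.

(** The product vanishes exactly at the fourth roots of unity.  The triangle with sides
    3, 4 and 5 provides another rational point of the circle. *)
Lemma unit_not_fourth_root (R : realType) : exists lam : R[i],
  [/\ `|lam| = 1, lam != 0 & lcos lam * lsin lam != 0].
Proof.
pose lam : R[i] := Complex (3 / 5) (4 / 5).
have n1 : `|lam| = 1 by apply: norm_complex1; field.
have l0 : lam != 0 by rewrite -normr_eq0 n1 oner_eq0.
have li : lam^-1 = Complex (3 / 5) (- (4 / 5)).
  by apply: (mulfI l0); rewrite mulfV// /lam; cplx; field.
exists lam; split=> //.
have -> : lcos lam * lsin lam = Complex (12 / 25) 0.
  by rewrite /lcos /lsin li -halfC /lam /imu; cplx; field.
by rewrite eq_complex /= negb_and mulf_neq0// ?invr_eq0 ?pnatr_eq0.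
Qed.

Theorem proposition2p1 (R : realType) (N : nat) (S : sym_data R N)
  (hS : hermitian_symmetric S)
  (L : riemann_surface R) (hL : simply_connected L)
  (alpha : oneform L 'M[R]_N) (halpha : smooth_oneform (lg S) alpha)
  (a2 a0 am1 a1 : oneform L 'M[R[i]]_N)
  (h2 : forall c i p, atlas c -> cdom c p -> lgC_ S 2 (a2 c i p))
  (h0 : forall c i p, atlas c -> cdom c p -> lgC_ S 0 (a0 c i p))
  (hm1 : forall c i p, atlas c -> cdom c p -> lgC_ S (-1) (am1 c i p))
  (h1 : forall c i p, atlas c -> cdom c p -> lgC_ S 1 (a1 c i p))
  (hdec : forall c i p, atlas c -> cdom c p ->
     toC (alpha c i p) = a2 c i p + a0 c i p + am1 c i p + a1 c i p) :
  ((exists (f : L -> set 'M[R]_N) (F : L -> 'M[R]_N),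
      [/\ weakly_conformal_lagrangian S f, lagrangian_lift S f F
        & maurer_cartan F alpha])
   <-> (flat (toC_form alpha) /\
        (zero_form (part01 am1) /\ zero_form (part10 a1))))
  /\
  (forall (f : L -> set 'M[R]_N) (F : L -> 'M[R]_N),
     weakly_conformal_lagrangian S f -> lagrangian_lift S f F ->
     maurer_cartan F alpha ->
     [/\ hamiltonian_stationary S f F <->
           (forall lam : R[i], lam != 0 -> flat (extended_form a2 a0 am1 a1 lam)),
         hamiltonian_stationary S f F <->
           (forall lam : R[i], `|lam| = 1 -> flat (extended_form a2 a0 am1 a1 lam))
       & minimal S f F <-> zero_form a2]).
Proof.
have pp := partially_primitiveP hS halpha h2 h0 hm1 h1 hdec.
split.
  split=> [[f [F [wc ll mc]]]|[fl /pp prim]].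
    have [fl prim] := lagrangian_lift_primitive hS halpha wc ll mc.
    by split; [apply/(flat_toC halpha)|apply/pp].
  by apply: exists_lagrangian_lift => //; apply/(flat_toC halpha).
move=> f F wc ll mc; have [fl prim] := lagrangian_lift_primitive hS halpha wc ll mc.
have [lF _] := ll.
have [lam0 [n1 l0 cs]] := unit_not_fourth_root R.
have st : hamiltonian_stationary S f F <-> coclosed S alpha.
  split; first exact: (stationary_coclosed hS halpha lF mc).
  exact: coclosed_stationary.
have fc lam : lam != 0 -> coclosed S alpha -> flat (extended_form a2 a0 am1 a1 lam).
  move=> ln0 cocl; apply: (coclosed_flat hS halpha fl prim h2 h0 hm1 h1 hdec ln0 cocl).
have cf : flat (extended_form a2 a0 am1 a1 lam0) -> coclosed S alpha.
  exact: (flat_coclosed hS halpha fl prim h2 h0 hm1 h1 hdec l0 cs).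
split.
- split=> [/st cocl lam ln0|H]; first exact: fc.
  by apply/st/cf; exact: H.
- split=> [/st cocl lam ln1|H]; last by apply/st/cf; exact: H.
  by apply: fc => //; rewrite -normr_eq0 ln1 oner_eq0.
- rewrite (a2_zero hS halpha h2 h0 hm1 h1 hdec); split.
    exact: (minimal_angle_form hS halpha lF mc).
  exact: angle_form0_minimal.
Qed.
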